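(* For arbitrary real matrices $\mathbb K^{00},\mathbb K^{01},\mathbb K^{10},\mathbb K^{11}$, the operator $\mathbf A^0_\Phi$ generates an analytic semigroup in $\mathbf L_1(I)$.
   Context: Let $I=[0,1]$ and $m\in\mathbb N$. $\mathbf L_1(I)$ and $\mathbf W^2_1(I)$ denote the $m$-fold products of $L_1(I)$ and of the Sobolev space $W^2_1(I)$ (functions with derivatives up to order $2$ in $L_1(I)$), i.e. spaces of vector functions $\mathbf u=(u_1,\dots,u_m)$. Let $\mathbb D=\mathrm{diag}\{\sigma_i\}_{1\le i\le m}$ with constants $\sigma_i>0$, and let $\mathbb K^{00},\mathbb K^{01},\mathbb K^{10},\mathbb K^{11}$ be real $m\times m$ matrices. Put $L\mathbf u=(\partial_x\mathbf u(0),\partial_x\mathbf u(1))$ and $$\Phi\mathbf u=\big(\mathbb K^{00}\mathbf u(0)+\mathbb K^{01}\mathbf u(1),\ \mathbb K^{10}\mathbf u(0)+\mathbb K^{11}\mathbf u(1)\big)$$ (values at the endpoints are traces). The operator $\mathbf A^0_\Phi$ in $\mathbf L_1(I)$ is $\mathbf u\mapsto\mathbb D\,\partial_{xx}\mathbf u$ on the domain $$D(\mathbf A^0_\Phi)=\{\mathbf u\in\mathbf W^2_1(I);\ L\mathbf u=\Phi\mathbf u\}.$$ *)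

(* Defs.v *)
From HB Require Import structures.
From mathcomp Require Import all_boot all_order all_algebra.
From mathcomp Require Import generic_quotient ring_quotient.
From mathcomp Require Import all_classical all_reals all_analysis.
From mathcomp Require Import measurable_realfun.
From mathcomp.real_closed Require Import complex.

Set Implicit Arguments.
Unset Strict Implicit.
Unset Printing Implicit Defensive.
Import Order.TTheory GRing.Theory Num.Theory numFieldNormedType.Exports.
Import Normc.

Local Open Scope classical_set_scope.
Local Open Scope ring_scope.
Local Open Scope complex_scope.
Local Open Scope quotient_scope.

(** * Analytic semigroups on a complex normed space *)

Section AnalyticSemigroup.
Variables (R : realType) (X : normedModType R[i]).
Implicit Types (T : R[i] -> {linear X -> X}) (z : R[i]) (delta : R).

(* { z != 0 : |arg z| < delta } in polar coordinates *)
Definition sector delta : set R[i] :=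
  [set z | exists r t : R,
    [/\ 0 < r, `|t| < delta & z = (r * cos t) +i* (r * sin t)]].

(* complex differentiability at z of z |-> T z for the operator norm;
   [e : R[i]] with [0 < e] is automatically a positive real number *)
Definition op_holomorphic_at T z : Prop :=
  exists2 T' : {linear X -> X}, continuous T' &
    forall e : R[i], 0 < e ->
      \forall h \near (0 : R[i]^o),
        forall x : X, `|T (z + h) x - T z x - h *: T' x| <= e * `|h| * `|x|.

(* (T z), z in sector delta or z = 0, is an analytic semigroup of angle delta *)
Definition analytic_semigroup delta T : Prop :=
  [/\ forall z, sector delta z -> continuous (T z),
      forall x, T 0 x = x,
      forall z w, sector delta z -> sector delta w ->
        forall x, T (z + w) x = T z (T w x),
      forall z, sector delta z -> op_holomorphic_at T z &
      forall delta' : R, 0 < delta' < delta ->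
        forall x, T z x @[z --> within (sector delta') (nbhs (0 : R[i]^o))]
                  --> x].

(* the graph of the generator of the semigroup t |-> T t, t >= 0:
   (u, f) with lim_{h -> 0+} (T h u - u) / h = f *)
Definition generator T : set (X * X) :=
  [set uf | (h%:C)^-1 *: (T h%:C uf.1 - uf.1) @[h --> (0 : R)^'+] --> uf.2].

(* Unbounded operators are represented by their graphs. *)
Definition generates_analytic_semigroup (A : set (X * X)) : Prop :=
  exists delta T,
    [/\ 0 < delta, delta <= pi / 2, analytic_semigroup delta T &
        generator T = A].

End AnalyticSemigroup.

(** * The space L_1(I), I = [0, 1], of complex-valued functions

   The scalars are complex since analytic semigroups live on complex spaces.
   [L1fun] is the space of integrable functions R -> R[i] on I (values outside
   I are irrelevant) and [L1] its quotient by almost everywhere equality on I,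
   with the norm [\int_I |u|]. *)

Section L1.
Variable R : realType.

Definition unitI : set R := `[0, 1].

Local Notation mu := (@lebesgue_measure R).
Local Notation I := unitI.

Lemma measurable_unitI : measurable (I : set (measurableTypeR R)).
Proof. exact: measurable_itv. Qed.
Local Notation mI := measurable_unitI.

#[local] Instance ae_filter : Filter (nbhs (almost_everywhere mu)).
Proof. exact: (ae_filter_ringOfSetsType mu). Qed.

Definition cintegrable (f : R -> R[i]) : Prop :=
  mu.-integrable I (fun x => (complex.Re (f x))%:E) /\
  mu.-integrable I (fun x => (complex.Im (f x))%:E).

Definition cintegral (f : R -> R[i]) : R[i] :=
  (\int[mu]_(x in I) complex.Re (f x)) +i* (\int[mu]_(x in I) complex.Im (f x)).

Lemma cintegrable_normc (f : R -> R[i]) : cintegrable f ->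
  mu.-integrable I (fun x => (normc (f x))%:E).
Proof.
move=> [fr fi].
have mr := measurable_int mu fr.
have mi := measurable_int mu fi.
have intD := integrableD mI (integrable_abse fr) (integrable_abse fi).
apply: le_integrable intD => //; first exact: mI.
  apply/measurable_EFinP.
  have -> : (fun x => normc (f x)) =
     Num.sqrt \o (fun x => complex.Re (f x) ^+ 2 + complex.Im (f x) ^+ 2).
    by apply/funext => x /=; case: (f x).
  apply: measurableT_comp.
    by apply: continuous_measurable_fun; exact: sqrt_continuous.
  by apply: measurable_funD; apply: measurable_funX; exact/measurable_EFinP.
move=> x _ /=; rewrite lee_fin.
case: (f x) => a b /=.
rewrite ger0_norm ?sqrtr_ge0// ger0_norm ?addr_ge0//.
rewrite -(@ler_pXn2r _ 2)// ?nnegrE ?sqrtr_ge0 ?addr_ge0//.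
rewrite sqr_sqrtr ?addr_ge0 ?sqr_ge0// sqrrD !real_normK ?num_real//.
by rewrite -addrA (addrC (_ *+ 2)) addrA lerDl mulrn_wge0// mulr_ge0.
Qed.

Definition L1_pred : {pred R -> R[i]} := mem [set f | cintegrable f].

Lemma L1_submod_closed : submod_closed L1_pred.
Proof.
split.
  by apply/mem_set; split; apply: (eq_integrable mI (cst 0%E));
    rewrite ?integrable0// => x _.
move=> a f g /set_mem[fr fi] /set_mem[gr gi]; apply/mem_set; split.
- apply: (eq_integrable mI (fun x => ((complex.Re a)%:E * (complex.Re (f x))%:E
    - (complex.Im a)%:E * (complex.Im (f x))%:E) + (complex.Re (g x))%:E)%E).
    move=> x _; rewrite -!EFinM -EFinB -EFinD; congr EFin.
    have -> : (a *: f + g) x = a * f x + g x by [].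
    by case: a (f x) (g x) => [? ?] [? ?] [? ?].
  exact: (integrableD mI (integrableB mI (integrableZl mI (complex.Re a) fr)
    (integrableZl mI (complex.Im a) fi)) gr).
- apply: (eq_integrable mI (fun x => ((complex.Re a)%:E * (complex.Im (f x))%:E
    + (complex.Im a)%:E * (complex.Re (f x))%:E) + (complex.Im (g x))%:E)%E).
    move=> x _; rewrite -!EFinM -!EFinD; congr EFin.
    have -> : (a *: f + g) x = a * f x + g x by [].
    by case: a (f x) (g x) => [? ?] [? ?] [? ?].
  exact: (integrableD mI (integrableD mI (integrableZl mI (complex.Re a) fi)
    (integrableZl mI (complex.Im a) fr)) gi).
Qed.

HB.instance Definition _ :=
  GRing.isSubmodClosed.Build R[i] (R -> R[i]) L1_pred L1_submod_closed.

Record L1fun := MkL1fun { L1fun_val :> R -> R[i]; _ : L1fun_val \in L1_pred }.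

HB.instance Definition _ := [isSub for L1fun_val].
HB.instance Definition _ := gen_eqMixin L1fun.
HB.instance Definition _ := gen_choiceMixin L1fun.
HB.instance Definition _ := [SubChoice_isSubLmodule of L1fun by <:].

Lemma L1fun_cintegrable (f : L1fun) : cintegrable f.
Proof. by case: f => f /= /set_mem. Qed.

Definition L1_null : {pred L1fun} :=
  mem [set f : L1fun | {ae mu, forall x, I x -> f x = 0}].

Lemma L1_null_submod_closed : submod_closed L1_null.
Proof.
split; first by apply/mem_set; exact: aeW.
move=> a f g /set_mem f0 /set_mem g0; apply/mem_set.
apply: filterS2 f0 g0 => x fx gx Ix.
have -> : (a *: f + g) x = a * f x + g x by [].
by rewrite fx// gx// mulr0 addr0.
Qed.

HB.instance Definition _ :=
  GRing.isSubmodClosed.Build R[i] L1fun L1_null L1_null_submod_closed.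

Definition L1 : Type := Quotient.quot L1_null.

HB.instance Definition _ := Choice.on L1.
HB.instance Definition _ := EqQuotient.on L1.
HB.instance Definition _ := GRing.Zmodule.on L1.

Lemma L1_eqP (f g : L1fun) :
  (\pi_L1 f = \pi_L1 g) <-> {ae mu, forall x, I x -> f x = g x}.
Proof.
have -> : (\pi_L1 f = \pi_L1 g) <-> (f - g) \in L1_null.
  by rewrite Quotient.idealrBE; split => [fg|/eqP//]; apply/eqP.
split=> [/set_mem|fg]; last apply/mem_set.
  apply: filterS => x /[apply] /eqP.
  have -> : (f - g) x = f x - g x by [].
  by rewrite subr_eq0 => /eqP.
move: fg; apply: filterS => x /[apply] fg.
have -> : (f - g) x = f x - g x by [].
by rewrite fg subrr.
Qed.

Lemma repr_piL1 (f : L1fun) :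
  {ae mu, forall x, I x -> repr (\pi_L1 f) x = f x}.
Proof. by apply/L1_eqP; rewrite reprK. Qed.

Lemma L1_piD (f g : L1fun) : \pi_L1 (f + g) = \pi_L1 f + \pi_L1 g.
Proof. by rewrite [LHS]pi_addr. Qed.

Definition L1_scale (a : R[i]) (u : L1) : L1 := \pi_L1 (a *: repr u).

Lemma L1_piZ (a : R[i]) (f : L1fun) : \pi_L1 (a *: f) = L1_scale a (\pi_L1 f).
Proof.
apply/L1_eqP; have := repr_piL1 f; apply: filterS => x /[apply] fx.
have E (h : L1fun) : (a *: h) x = a * h x by [].
by rewrite !E fx.
Qed.

Lemma L1_scaleA a b u : L1_scale a (L1_scale b u) = L1_scale (a * b) u.
Proof. by rewrite -[u]reprK -(L1_piZ b) -!L1_piZ scalerA. Qed.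

Lemma L1_scale1 : left_id 1 L1_scale.
Proof. by move=> u; rewrite -[u]reprK -L1_piZ scale1r. Qed.

Lemma L1_scaleDr : right_distributive L1_scale +%R.
Proof.
move=> a u v; rewrite -[u]reprK -[v]reprK.
by rewrite -L1_piD -!L1_piZ scalerDr L1_piD.
Qed.

Lemma L1_scaleDl u : {morph L1_scale^~ u : a b / a + b}.
Proof.
by move=> a b; rewrite -[u]reprK -!L1_piZ scalerDl L1_piD.
Qed.

HB.instance Definition _ := GRing.Zmodule_isLmodule.Build R[i] L1
  L1_scaleA L1_scale1 L1_scaleDr L1_scaleDl.

Definition L1_norm (u : L1) : R[i] :=
  (\int[mu]_(x in I) normc (repr u x))%:C.

Lemma L1_norm_pi (f : L1fun) :
  L1_norm (\pi_L1 f) = (\int[mu]_(x in I) normc (f x))%:C.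
Proof.
congr (_%:C); rewrite /Rintegral; congr fine.
apply: ae_eq_integral; first exact: mI.
- exact: measurable_int (cintegrable_normc (L1fun_cintegrable _)).
- exact: measurable_int (cintegrable_normc (L1fun_cintegrable _)).
- by have := repr_piL1 f; apply: filterS => x /[apply] ->.
Qed.

Lemma L1_ler_normD u v : L1_norm (u + v) <= L1_norm u + L1_norm v.
Proof.
rewrite -[u]reprK -[v]reprK -L1_piD !L1_norm_pi -rmorphD lecR.
have inu := cintegrable_normc (L1fun_cintegrable (repr u)).
have inv := cintegrable_normc (L1fun_cintegrable (repr v)).
rewrite -RintegralD//; last exact: mI.
apply: le_Rintegral; first exact: mI.
- exact: cintegrable_normc (L1fun_cintegrable _).
- by have := integrableD mI inu inv; apply: eq_integrable; first exact: mI.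
- move=> x _; have -> : (repr u + repr v) x = repr u x + repr v x by [].
  by rewrite -lecR rmorphD; exact: (ler_normD (repr u x) (repr v x)).
Qed.

Lemma L1_normZ a u : L1_norm (a *: u) = `|a| * L1_norm u.
Proof.
rewrite -[u]reprK -[a *: _]/(L1_scale a _) -L1_piZ !L1_norm_pi.
have -> : `|a| = (normc a)%:C by case: a.
rewrite -rmorphM; congr (_%:C).
rewrite -RintegralZl; last 2 first.
- exact: mI.
- exact: cintegrable_normc (L1fun_cintegrable _).
by apply: eq_Rintegral => x _; rewrite -normcM.
Qed.

Lemma L1_normr0_eq0 u : L1_norm u = 0 -> u = 0.
Proof.
rewrite -[u]reprK; set f := repr u; rewrite L1_norm_pi => /complexI.
have inf := cintegrable_normc (L1fun_cintegrable f).
rewrite /Rintegral => /eqP; rewrite fine_eq0; last first.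
  by apply: integrable_fin_num => //; exact: mI.
move=> /eqP f0.
have : (\int[mu]_(x in I) `|(normc (f x))%:E| = 0)%E.
  rewrite -[RHS]f0; apply: eq_integral => x _; rewrite gee0_abs// lee_fin.
  by case: (f x) => a b /=; rewrite sqrtr_ge0.
move/(ae_eq_integral_abs mu mI (measurable_int mu inf)) => fae.
have -> : 0 = \pi_L1 0 :> L1 by rewrite [RHS]pi_zeror.
apply/L1_eqP; move: fae; apply: filterS => x /[apply] /= -[].
by move/eq0_normc.
Qed.

HB.instance Definition _ := @Lmodule_isNormed.Build R[i] L1
  L1_norm L1_ler_normD L1_normZ L1_normr0_eq0.

End L1.

(** * The m-fold product of L_1(I), with the sum norm *)

Section L1vec.
Variables (R : realType) (m : nat).

Definition L1vec : Type := {ffun 'I_m -> L1 R}.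

HB.instance Definition _ := GRing.Lmodule.on L1vec.

Definition L1vec_comp (u : L1vec) (i : 'I_m) : L1 R :=
  (u : {ffun 'I_m -> L1 R}) i.
Coercion L1vec_comp : L1vec >-> Funclass.

Definition L1vec_norm (u : L1vec) : R[i] := \sum_i `|u i|.

Lemma L1vec_ler_normD u v : L1vec_norm (u + v) <= L1vec_norm u + L1vec_norm v.
Proof.
rewrite -big_split; apply: ler_sum => i _.
by rewrite /L1vec_comp ffunE ler_normD.
Qed.

Lemma L1vec_normZ (a : R[i]) u : L1vec_norm (a *: u) = `|a| * L1vec_norm u.
Proof.
rewrite mulr_sumr; apply: eq_bigr => i _.
by rewrite /L1vec_comp ffunE normrZ.
Qed.

Lemma L1vec_normr0_eq0 u : L1vec_norm u = 0 -> u = 0.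
Proof.
move=> u0; apply/ffunP => i; rewrite [RHS]ffunE; apply/normr0_eq0.
move/eqP: u0; rewrite psumr_eq0; last by move=> j _; exact: normr_ge0.
by move=> /allP/(_ i); rewrite mem_index_enum => /(_ isT) /eqP.
Qed.

HB.instance Definition _ := @Lmodule_isNormed.Build R[i] L1vec
  L1vec_norm L1vec_ler_normD L1vec_normZ L1vec_normr0_eq0.

End L1vec.

(** * Weak derivatives, traces and the operator A^0_Phi *)

Section Operator.
Variable R : realType.

Local Notation mu := (@lebesgue_measure R).
Local Notation I := (@unitI R).

(* C^1 functions with compact support in ]0, 1[; together with
   [weak_derivative] this is the textbook definition of the one-dimensional
   Sobolev spaces (e.g. Brezis, chapter 8) *)
Definition test_function (phi : R -> R) : Prop :=
  [/\ forall x, derivable phi x 1,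
      continuous (derive1 phi) &
      exists a b : R, [/\ 0 < a, b < 1 &
        forall x, ~~ (a <= x <= b) -> phi x = 0]].

(* v is the weak derivative of u on the interval ]0, 1[ *)
Definition weak_derivative (u v : L1 R) : Prop :=
  forall phi, test_function phi ->
    cintegral (fun x => repr u x * (derive1 phi x)%:C) =
    - cintegral (fun x => repr v x * (phi x)%:C).

(* the value at x of the representative of u that is continuous on [0, 1] *)
Definition trace (u : L1 R) (x : R) (c : R[i]) : Prop :=
  exists g : R -> R[i]^o,
    [/\ {within I, continuous g},
        {ae mu, forall y, I y -> repr u y = g y} &
        g x = c].

Variable m : nat.
Implicit Types (u v : L1vec R m).

Definition vweak_derivative u v : Prop :=
  forall i, weak_derivative (u i) (v i).

Definition vtrace u (x : R) (c : 'cV[R[i]]_m) : Prop :=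
  forall i, trace (u i) x (c i 0).

(* u belongs to W^2_1(I), with weak derivatives u' and u'' in L_1(I) *)
Definition W21 u u' u'' : Prop :=
  vweak_derivative u u' /\ vweak_derivative u' u''.

Definition complex_mx (K : 'M[R]_m) : 'M[R[i]]_m := map_mx (real_complex R) K.

Definition Phi (K00 K01 K10 K11 : 'M[R]_m) (u0 u1 : 'cV[R[i]]_m) :
    'cV[R[i]]_m * 'cV[R[i]]_m :=
  (complex_mx K00 *m u0 + complex_mx K01 *m u1,
   complex_mx K10 *m u0 + complex_mx K11 *m u1).

Definition diagD (sigma : 'I_m -> R) u : L1vec R m :=
  [ffun i => (sigma i)%:C *: u i].

(* the graph of D d^2/dx^2 on { u in W^2_1(I) : L u = Phi u }, where
   L u = (u'(0), u'(1)) *)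
Definition A0_Phi (sigma : 'I_m -> R) (K00 K01 K10 K11 : 'M[R]_m) :
    set (L1vec R m * L1vec R m) :=
  [set uf | exists u' u'', [/\ W21 uf.1 u' u'',
     exists u0 u1 du0 du1 : 'cV[R[i]]_m,
       [/\ vtrace uf.1 0 u0, vtrace uf.1 1 u1,
           vtrace u' 0 du0, vtrace u' 1 du1 &
           (du0, du1) = Phi K00 K01 K10 K11 u0 u1] &
     uf.2 = diagD sigma u'']].

End Operator.

(* Main.v *)
(* Put the i-th component on an edge of length 1/sqrt sigma_i parametrised at speed
   sqrt sigma_i, so that the operator becomes u |-> u'' on a finite network, seen from
   each of the 2m edge ends, with the boundary conditions u_e'(0) = sum_f kap_ef u_f(0).
   Such data extend uniquely to functions V_e on the whole line that are consistent
   under the reversal of edges and satisfy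
     V_e(s) - V_e(-s) = sum_f kap_ef int_0^s (V_f(r) + V_f(-r)) dr;
   the extension grows at most exponentially and is bounded, in a weighted L1 norm, by
   the L1 norm of the data.  Both relations survive convolution with an even kernel, so
   the semigroup is T(z) u = (G_z * V) restricted to the network, G_z being the Gaussian
   kernel, and the semigroup law, analyticity on |arg z| < pi/4, boundedness on smaller
   sectors and strong continuity are inherited from G_z.

   If u'' = F in the domain of the operator, the extension of u has the extension of F
   as second derivative, and (G_h * V - V)/h is the convolution of F with a kernel of
   mass 1 concentrating at 0, so u lies in the domain of the generator.  Conversely,
   convolution with exp(-l|r|)/(2l) inverts l^2 - d^2/dx^2 and commutes with T(z), so
   every element of the domain of the generator is of this form. *)

Require Import Defs.
From HB Require Import structures.
From mathcomp Require Import all_boot all_order all_algebra.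
From mathcomp Require Import generic_quotient ring_quotient.
From mathcomp Require Import all_classical all_reals all_analysis.
From mathcomp Require Import measurable_realfun.
From mathcomp Require Import ring lra.
From mathcomp.real_closed Require Import complex.
Set Implicit Arguments.
Unset Strict Implicit.
Unset Printing Implicit Defensive.
Import Order.TTheory GRing.Theory Num.Theory numFieldNormedType.Exports.
Local Open Scope classical_set_scope.
Local Open Scope ring_scope.

(** * Integration on the line *)

(** The matrices carry no sign or symmetry, so there is no dissipativity or form argument, and the
    boundary terms are point evaluations, unbounded on L1. Extending the data absorbs them instead
    of treating them as a perturbation. The price is exponential growth of the extension: hence the
    weights, and kernels that must decay strictly faster than the weight. Each integration costs an
    arbitrarily small part of the weight, so many statements carry two weights [w < l]. What is
    inherited from the line is inherited through uniqueness: a convolved extension satisfies both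
    relations again, so it is almost everywhere the extension of its own restriction, and operators
    on the network compose like convolutions. The angle pi/4 comes from the algebraic condition
    [|im z| < re z]. The root of [1 / (4 z)] then lies in a cone so narrow that complex Gaussian
    integrals reduce to the real one by a straight-line homotopy, and that a product of three such
    roots or inverse roots stays in the right half plane, which decides the branch in the semigroup
    law. Since the matrices are real, the network analysis is done over the reals and complex data
    and kernels are split into parts. *)

Section IntegralOnTheLine.
Variable R : realType.
Local Notation mu := (@lebesgue_measure R).
Implicit Types f g h : R -> R.

Definition mf f := measurable_fun [set: measurableTypeR R] (f : _ -> measurableTypeR R).
Definition ig f := mu.-integrable [set: R] (EFin \o f).
Definition Int f : R := \int[mu]_x f x.

Lemma ig_mf f : ig f -> mf f.
Proof. by move=> /(measurable_int mu) /measurable_EFinP. Qed.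

Lemma ig_dom f g : mf f -> (forall x, `|f x| <= g x) -> ig g -> ig f.
Proof.
move=> mff fg igg; apply: (le_integrable _ _ _ igg) => //.
  exact/measurable_EFinP.
move=> x _ /=; rewrite lee_fin; apply: le_trans (fg x) _; exact: ler_norm.
Qed.

Lemma igZ (c : R) f : ig f -> ig (fun x => c * f x).
Proof.
move=> fi; have := integrableZl (@measurableT _ _) c fi.
by apply: eq_integrable.
Qed.

Lemma igD f g : ig f -> ig g -> ig (fun x => f x + g x).
Proof.
move=> fi gi; have := integrableD (@measurableT _ _) fi gi.
by apply: eq_integrable.
Qed.

Lemma igN f : ig f -> ig (fun x => - f x).
Proof.
by move=> fi; have := integrableN fi; apply: eq_integrable.
Qed.

Lemma igB f g : ig f -> ig g -> ig (fun x => f x - g x).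
Proof. by move=> fi gi; apply: igD => //; exact: igN. Qed.

Lemma ig_abs f : ig f -> ig (fun x => `|f x|).
Proof. by move=> fi; have := integrable_abse fi; apply: eq_integrable. Qed.

Lemma ig0 : ig (fun=> 0).
Proof. by have := integrable0 mu [set: R]; apply: eq_integrable. Qed.

Lemma ig_sum (I : Type) (s : seq I) (P : pred I) (F : I -> R -> R) :
  (forall i, ig (F i)) -> ig (fun x => \sum_(i <- s | P i) F i x).
Proof.
move=> Fi; elim: s => [|i s IH].
  rewrite (_ : (fun _ => _) = fun=> 0); first exact: ig0.
  by apply/funext => x; rewrite big_nil.
rewrite (_ : (fun _ => _) = fun x =>
  (if P i then F i x else 0) + \sum_(j <- s | P j) F j x).
  apply: igD => //; case: (P i) => //; exact: ig0.
by apply/funext => x; rewrite big_cons; case: (P i); rewrite ?add0r.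
Qed.

Lemma IntD f g : ig f -> ig g -> Int (fun x => f x + g x) = Int f + Int g.
Proof. by move=> fi gi; rewrite /Int RintegralD. Qed.

Lemma IntZ (c : R) f : ig f -> Int (fun x => c * f x) = c * Int f.
Proof. by move=> fi; rewrite /Int RintegralZl. Qed.

Lemma IntN f : ig f -> Int (fun x => - f x) = - Int f.
Proof.
move=> fi; rewrite -mulN1r -IntZ//; congr Int; apply/funext => x.
by rewrite mulN1r.
Qed.

Lemma IntB f g : ig f -> ig g -> Int (fun x => f x - g x) = Int f - Int g.
Proof. by move=> fi gi; rewrite IntD ?IntN//; exact: igN. Qed.

Lemma Int0 : Int (fun=> 0) = 0.
Proof.
have -> : Int (fun=> 0) = 0 * Int (fun=> 0).
  by rewrite -IntZ; [congr Int; apply/funext => x; rewrite mul0r|exact: ig0].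
by rewrite mul0r.
Qed.

Lemma Int_sum (I : Type) (s : seq I) (P : pred I) (F : I -> R -> R) :
  (forall i, ig (F i)) ->
  Int (fun x => \sum_(i <- s | P i) F i x) = \sum_(i <- s | P i) Int (F i).
Proof.
move=> Fi; elim: s => [|i s IH].
  rewrite (_ : (fun _ => _) = fun=> 0) ?big_nil ?Int0//.
  by apply/funext => x; rewrite big_nil.
rewrite big_cons (_ : (fun _ => _) = fun x =>
  (if P i then F i x else 0) + \sum_(j <- s | P j) F j x).
  rewrite IntD ?IH; last exact: ig_sum.
    by case: (P i); rewrite ?Int0 ?add0r.
  by case: (P i) => //; exact: ig0.
by apply/funext => x; rewrite big_cons; case: (P i); rewrite ?add0r.
Qed.

Lemma Int_le f g : ig f -> ig g -> (forall x, f x <= g x) -> Int f <= Int g.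
Proof. by move=> fi gi fg; rewrite /Int; apply: le_Rintegral. Qed.

Lemma Int_ge0 f : (forall x, 0 <= f x) -> 0 <= Int f.
Proof. by move=> f0; apply: Rintegral_ge0. Qed.

Lemma Int_abs f : ig f -> `|Int f| <= Int (fun x => `|f x|).
Proof. by move=> fi; apply: le_normr_Rintegral. Qed.

Lemma Int_ext f g : f =1 g -> Int f = Int g.
Proof. by move=> /funext ->. Qed.

Lemma ig_ext f g : f =1 g -> ig f -> ig g.
Proof. by move=> /funext ->. Qed.

Lemma EFin_Int f : ig f -> (Int f)%:E = (\int[mu]_x (f x)%:E)%E.
Proof.
move=> fi; rewrite /Int /Rintegral fineK//.
by apply: integrable_fin_num.
Qed.

Definition aeq f g := \forall x \ae mu, f x = g x.

#[global] Instance ae_filterT : Filter (nbhs (almost_everywhere mu)).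
Proof. exact: (ae_filter_ringOfSetsType mu). Qed.

Lemma Int_aeq f g : mf f -> mf g -> aeq f g -> Int f = Int g.
Proof.
move=> mff mg fg; rewrite /Int /Rintegral; congr fine.
apply: ae_eq_integral => //; try exact/measurable_EFinP.
by apply: filterS fg => x /= -> _.
Qed.

Lemma ig_aeq f g : mf g -> aeq f g -> ig f -> ig g.
Proof.
move=> mg fg fi; have mff := ig_mf fi.
apply/integrableP; split; first exact/measurable_EFinP.
have [_] := integrableP _ _ _ fi; apply: le_lt_trans.
rewrite le_eqVlt; apply/orP; left; apply/eqP.
apply: ge0_ae_eq_integral => //.
- by apply: measurableT_comp => //; apply/measurable_EFinP => //; exact: ig_mf.
- by apply: measurableT_comp => //; apply/measurable_EFinP => //; exact: ig_mf.
- by apply: filterS fg => x /= -> _.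
Qed.

Lemma Int_abs0 f : ig f -> Int (fun x => `|f x|) = 0 -> aeq f (fun=> 0).
Proof.
move=> fi f0.
have : (\int[mu]_x `|(f x)%:E| = 0)%E.
  rewrite -[RHS](congr1 EFin f0) EFin_Int; last exact: ig_abs.
  by apply: eq_integral.
move/(ae_eq_integral_abs mu measurableT (measurable_int mu fi)).
by apply: filterS => x /= /(_ Logic.I) -[].
Qed.

Lemma Int_aeq0 f : mf f -> aeq f (fun=> 0) -> Int f = 0.
Proof.
move=> mff f0; rewrite (Int_aeq mff _ f0) ?Int0//.
exact: measurable_cst.
Qed.

Lemma mfM f g : mf f -> mf g -> mf (fun x => f x * g x).
Proof. by move=> mff mg; apply: measurable_funM. Qed.

Lemma mfD f g : mf f -> mf g -> mf (fun x => f x + g x).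
Proof. by move=> mff mg; apply: measurable_funD. Qed.

Lemma mfB f g : mf f -> mf g -> mf (fun x => f x - g x).
Proof. by move=> mff mg; apply: measurable_funB. Qed.

Lemma mf_cst (c : R) : mf (fun=> c).
Proof. exact: measurable_cst. Qed.

Lemma mf_cont f : continuous f -> mf f.
Proof. exact: continuous_measurable_fun. Qed.

Lemma mf_comp f g : mf f -> mf g -> mf (fun x => f (g x)).
Proof. by move=> mff mg; apply: (measurableT_comp mff mg). Qed.

Lemma mf_affine (a b : R) : mf (fun x => a * x + b).
Proof.
apply: mf_cont => x; apply: cvgD; last exact: cvg_cst.
by apply: cvgM; [exact: cvg_cst|exact: cvg_id].
Qed.

Lemma mf_abs f : mf f -> mf (fun x => `|f x|).
Proof. by move=> mff; apply: measurableT_comp. Qed.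

(** Lebesgue measure is determined by its values on half-open intervals, so it suffices to measure
    the preimage of []u, v]]. For [a < 0] the reflection exchanges the closed end, hence the two
    cases. *)
Lemma pushforward_affine (a b : R) (A : set R) : a != 0 -> measurable A ->
  (`|a|%:E * pushforward mu (fun x : R => (a * x + b)%R : measurableTypeR R) A =
  mu A)%E.
Proof.
move=> a0 mA.
have mphi : measurable_fun [set: measurableTypeR R]
    (fun x : R => a * x + b : measurableTypeR R) by exact: mf_affine.
pose phi : {mfun measurableTypeR R >-> measurableTypeR R} :=
  HB.pack (fun x : R => a * x + b : measurableTypeR R)
    (isMeasurableFun.Build _ _ _ _ _ mphi).
pose nu : {measure set (measurableTypeR R) -> \bar R} :=
  mscale (NngNum (normr_ge0 a)) (pushforward mu phi).
suff /esym : mu A = nu mphi A by [].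
apply: lebesgue_measure_unique => //= _ [[u v]] _ <- /=.
set pre : set R := (fun x : R => a * x + b) @^-1` `]u, v].
rewrite -[RHS]/(`|a|%:E * mu pre)%E.
have [a1|a1] : 0 < a \/ a < 0 by move: a0; rewrite neq_lt => /orP[]; auto.
- rewrite (_ : pre = `](u - b) / a, (v - b) / a]%classic); last first.
    rewrite /pre; apply/seteqP; split => x /=; rewrite !in_itv/=.
      move=> /andP[h1 h2]; rewrite ltr_pdivrMr// ler_pdivlMr//.
      by apply/andP; split; lra.
    rewrite ltr_pdivrMr// ler_pdivlMr// => /andP[h1 h2].
    by apply/andP; split; lra.
  rewrite !lebesgue_measure_itv/= !lte_fin ltr_pM2r ?invr_gt0// ltrD2r.
  case: ifPn => // _; last by rewrite mule0.
  rewrite -!EFinD -EFinM gtr0_norm//; congr EFin; field; exact: lt0r_neq0.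
- rewrite (_ : pre = `[(v - b) / a, (u - b) / a[%classic); last first.
    rewrite /pre; apply/seteqP; split => x /=; rewrite !in_itv/=.
      move=> /andP[h1 h2]; rewrite ltr_ndivlMr// ler_ndivrMr//.
      by apply/andP; split; lra.
    rewrite ltr_ndivlMr// ler_ndivrMr// => /andP[h1 h2].
    by apply/andP; split; lra.
  rewrite !lebesgue_measure_itv/= !lte_fin ltr_nM2r ?invr_lt0// ltrD2r.
  case: ifPn => // _; last by rewrite mule0.
  rewrite -!EFinD -EFinM ltr0_norm//; congr EFin; field; exact: ltr0_neq0.
Qed.

Lemma ge0_integral_affine (a b : R) f : a != 0 -> mf f -> (forall x, 0 <= f x) ->
  (\int[mu]_x (f x)%:E = `|a|%:E * \int[mu]_x (f (a * x + b)%R)%:E)%E.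
Proof.
move=> a0 mff f0.
have mphi : measurable_fun [set: measurableTypeR R]
    (fun x : R => a * x + b : measurableTypeR R) by exact: mf_affine.
pose phi : {mfun measurableTypeR R >-> measurableTypeR R} :=
  HB.pack (fun x : R => a * x + b : measurableTypeR R)
    (isMeasurableFun.Build _ _ _ _ _ mphi).
have mE : measurable_fun setT (EFin \o f) by exact/measurable_EFinP.
have H := @ge0_integral_pushforward _ _ _ _ R phi mphi mu setT
  (EFin \o f) measurableT mE (fun y _ => f0 y).
rewrite preimage_setT in H.
rewrite -[X in (_ * X)%E]H.
pose nu : {measure set (measurableTypeR R) -> \bar R} := pushforward mu phi.
rewrite -(@ge0_integral_mscale _ _ R (nu mphi) setT measurableT
   (NngNum (normr_ge0 a)) (EFin \o f)) //=.
  apply: eq_measure_integral => A mA _ /=.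
  exact/esym/pushforward_affine.
by move=> x _; rewrite lee_fin.
Qed.

Lemma ig_affine (a b : R) f : a != 0 -> ig f -> ig (fun x => f (a * x + b)).
Proof.
move=> a0 fi; have mff := ig_mf fi; apply/integrableP; split.
  by apply/measurable_EFinP; apply: mf_comp => //; exact: mf_affine.
have [_] := integrableP _ _ _ fi.
have -> : (\int[mu]_x `|(EFin \o f) x| = \int[mu]_x (`|f x|%R)%:E)%E by [].
rewrite (ge0_integral_affine b a0 (mf_abs mff))//.
have : (\int[mu]_x (`|f (a * x + b)%R|%R)%:E >= 0)%E.
  by apply: integral_ge0 => x _; rewrite lee_fin.
have -> : (\int[mu]_x `|(EFin \o (fun x => f (a * x + b)%R)) x| = \int[mu]_x (`|f (a * x + b)|)%:E)%E by [].
case: (\int[mu]_x (`|f (a * x + b)%R|%R)%:E)%E => [r| |] // _.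
  by move=> _; exact: ltry.
by rewrite gt0_muley// lte_fin normr_gt0.
Qed.

Lemma Int_affine (a b : R) f : a != 0 -> ig f ->
  Int (fun x => f (a * x + b)) = `|a|^-1 * Int f.
Proof.
move=> a0 fi.
(* The change of variables is available for nonnegative integrands; in general [f] is split into
   positive and negative part. *)
wlog f0 : f fi / forall x, 0 <= f x => [H|].
  have E : f = fun x => ((`|f x| + f x) / 2) - ((`|f x| - f x) / 2).
    by apply/funext => x; field.
  pose p x := 2^-1 * (`|f x| + f x); pose n x := 2^-1 * (`|f x| - f x).
  have pi : ig p by apply: igZ; apply: igD => //; exact: ig_abs.
  have ni : ig n by apply: igZ; apply: igB => //; exact: ig_abs.
  have -> : f = fun x => p x - n x by apply/funext => x; rewrite /p /n; field.
  rewrite IntB//; last 2 first.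
  - exact: (ig_affine b a0 pi).
  - exact: (ig_affine b a0 ni).
  rewrite (IntB pi ni) mulrBr; congr (_ - _); apply: H => //.
  - by move=> x; rewrite /p mulr_ge0//; have := ler_norm (- f x); rewrite normrN; lra.
  - by move=> x; rewrite /n mulr_ge0// subr_ge0 ler_norm.
have := ge0_integral_affine b a0 (ig_mf fi) f0.
rewrite -EFin_Int// -EFin_Int; last exact: ig_affine.
rewrite -EFinM => -[->]; rewrite mulrA mulVf ?mul1r//.
by rewrite normr_eq0.
Qed.

Lemma ig_shift (b : R) f : ig f -> ig (fun x => f (x + b)).
Proof.
move=> fi; have := ig_affine b (oner_neq0 R) fi; apply: ig_ext => x.
by rewrite mul1r.
Qed.

Lemma Int_shift (b : R) f : ig f -> Int (fun x => f (x + b)) = Int f.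
Proof.
move=> fi; have := Int_affine b (oner_neq0 R) fi.
rewrite normr1 invr1 mul1r => <-; apply: Int_ext => x.
by rewrite mul1r.
Qed.

Lemma ig_refl (b : R) f : ig f -> ig (fun x => f (b - x)).
Proof.
have n1 : (-1 : R) != 0 by rewrite oppr_eq0 oner_neq0.
move=> fi; have := ig_affine b n1 fi; apply: ig_ext => x.
by rewrite mulN1r addrC.
Qed.

Lemma Int_refl (b : R) f : ig f -> Int (fun x => f (b - x)) = Int f.
Proof.
have n1 : (-1 : R) != 0 by rewrite oppr_eq0 oner_neq0.
move=> fi; have := Int_affine b n1 fi.
rewrite normrN normr1 invr1 mul1r => <-; apply: Int_ext => x.
by rewrite mulN1r addrC.
Qed.

Definition mf2 (F : R -> R -> R) :=
  measurable_fun [set: measurableTypeR R * measurableTypeR R]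
    (fun p => F p.1 p.2 : measurableTypeR R).
Definition ig2 (F : R -> R -> R) :=
  (mu \x mu)%E.-integrable [set: measurableTypeR R * measurableTypeR R]
    (fun p => (F p.1 p.2)%:E).

Lemma ig2_mf F : ig2 F -> mf2 F.
Proof. by move=> /(measurable_int _) /measurable_EFinP. Qed.

Lemma mf2M F G : mf2 F -> mf2 G -> mf2 (fun x y => F x y * G x y).
Proof. by move=> mF mG; exact: measurable_funM. Qed.

Lemma mf2D F G : mf2 F -> mf2 G -> mf2 (fun x y => F x y + G x y).
Proof. by move=> mF mG; exact: measurable_funD. Qed.

Lemma mf2B F G : mf2 F -> mf2 G -> mf2 (fun x y => F x y - G x y).
Proof. by move=> mF mG; exact: measurable_funB. Qed.

Lemma mf2_comp f F : mf f -> mf2 F -> mf2 (fun x y => f (F x y)).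
Proof. by move=> mff mF; exact: (measurableT_comp mff mF). Qed.

Lemma mf2_fst : mf2 (fun x _ => x).
Proof. exact: measurable_fst. Qed.

Lemma mf2_snd : mf2 (fun _ y => y).
Proof. exact: measurable_snd. Qed.

Lemma mf2_1 f : mf f -> mf2 (fun x _ => f x).
Proof. by move=> mff; exact: mf2_comp mff mf2_fst. Qed.

Lemma mf2_2 f : mf f -> mf2 (fun _ y => f y).
Proof. by move=> mff; exact: mf2_comp mff mf2_snd. Qed.

Lemma mf2_le F G : mf2 F -> mf2 G -> mf2 (fun x y => (F x y <= G x y)%R%:R).
Proof.
move=> mF mG.
rewrite /mf2 (_ : (fun _ => _) = fun p => if F p.1 p.2 <= G p.1 p.2 then 1 else 0); last first.
  by apply/funext => p; case: ifP.
apply: measurable_fun_ifT => //; exact: measurable_fun_ler.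
Qed.

Lemma mf_le f g : mf f -> mf g -> mf (fun x => (f x <= g x)%R%:R).
Proof.
move=> mF mG.
rewrite /mf (_ : (fun _ => _) = fun p => if f p <= g p then 1 else 0); last first.
  by apply/funext => p; case: ifP.
apply: measurable_fun_ifT => //; exact: measurable_fun_ler.
Qed.

Lemma mf_lt f g : mf f -> mf g -> mf (fun x => (f x < g x)%R%:R).
Proof.
move=> mF mG.
rewrite /mf (_ : (fun _ => _) = fun p => if f p < g p then 1 else 0); last first.
  by apply/funext => p; case: ifP.
apply: measurable_fun_ifT => //; exact: measurable_fun_ltr.
Qed.

Lemma mf_id : mf id.
Proof. exact: measurable_id. Qed.

Lemma ig2_dom F G : mf2 F -> (forall x y, `|F x y| <= G x y) -> ig2 G -> ig2 F.
Proof.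
move=> mF FG iG; apply: (le_integrable _ _ _ iG) => //.
  exact/measurable_EFinP.
move=> x _ /=; rewrite lee_fin; apply: le_trans (FG _ _) _; exact: ler_norm.
Qed.

Lemma ig2_sym F : ig2 F -> ig2 (fun x y => F y x).
Proof.
move=> Fi; have mF := ig2_mf Fi.
have ms : measurable_fun [set: measurableTypeR R * measurableTypeR R]
  (fun p => (p.2, p.1) : measurableTypeR R * measurableTypeR R).
  exact: measurable_fun_pair.
apply/(integrable21ltyP _ _ _).2; last first.
  exact: ((integrable12ltyP _ _ (measurable_int _ Fi)).1 Fi).
by apply/measurable_EFinP; exact: (measurableT_comp mF ms).
Qed.

Lemma ig2_swap F : ig2 F ->
  Int (fun x => Int (F x)) = Int (fun y => Int (fun x => F x y)).
Proof.
move=> Fi; have := Fubini Fi.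
(* The inner integrals in Fubini's theorem are extended reals, finite only almost everywhere;
   passing to [fine] inside changes them on a null set. *)
have aux (G : R -> \bar R) : measurable_fun setT G -> 
   mu.-integrable setT G -> fine (\int[mu]_x G x)%E = Int (fun x => fine (G x)).
  move=> mG Gi; rewrite /Int /Rintegral; congr fine.
  apply: ae_eq_integral => //.
    by apply/measurable_EFinP; apply: measurableT_comp mG => //; exact: measurable_fine.
  by apply: filterS (integrable_ae measurableT Gi) => x /= h /h /fineK.
move=> /(congr1 fine).
rewrite aux; last 2 first.
- exact: (measurable_fubini_F Fi).
- exact: (integrable_fubini_F Fi).
rewrite aux.
- by [].
- exact: (measurable_fubini_G Fi).
- exact: (integrable_fubini_F (ig2_sym Fi)).
Qed.

Lemma ig2_Int F : ig2 F -> ig (fun x => Int (F x)).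
Proof.
move=> Fi.
have iF := integrable_fubini_F Fi.
apply/integrableP; split.
  apply/measurable_EFinP; apply: measurableT_comp (measurable_fubini_F Fi) => //.
have [_] := integrableP _ _ _ iF; apply: le_lt_trans.
rewrite le_eqVlt; apply/orP; left; apply/eqP.
apply: ge0_ae_eq_integral => //.
- apply: measurableT_comp => //; apply/measurable_EFinP.
  by apply: measurableT_comp (measurable_fubini_F Fi).
- by apply: measurableT_comp (measurable_fubini_F Fi).
- by apply: filterS (integrable_ae measurableT iF) => x /= h /h /fineK <-.
Qed.

Lemma ig2_abs F : ig2 F -> ig2 (fun x y => `|F x y|).
Proof. by move=> Fi; have := integrable_abse Fi; apply: eq_integrable. Qed.

Lemma ig2_sufficient F : mf2 F -> (forall x, ig (F x)) ->
  ig (fun x => Int (fun y => `|F x y|)) -> ig2 F.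
Proof.
move=> mF Fi Fii.
apply/(integrable12ltyP _ _ _).2; first exact/measurable_EFinP.
rewrite (_ : (fun _ => _) = (fun x => (Int (fun y => `|F x y|))%:E)).
  by rewrite -EFin_Int// ltry.
by apply/funext => x; rewrite EFin_Int//; exact: ig_abs.
Qed.

Lemma ig2_tensor f g : ig f -> ig g -> ig2 (fun x y => f x * g y).
Proof.
move=> fi gi; apply: ig2_sufficient.
- by apply: mf2M; [apply: mf2_1|apply: mf2_2]; exact: ig_mf.
- by move=> x; exact: igZ.
- rewrite (_ : (fun _ => _) = fun x => Int (fun y => `|g y|) * `|f x|).
    by apply: igZ; exact: ig_abs.
  apply/funext => x; rewrite mulrC -IntZ; last exact: ig_abs.
  by apply: Int_ext => y; rewrite normrM.
Qed.

(** Integrated in [s] for fixed [r], the absolute value gives [|f r|] times the norm of [g] by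
    translation invariance; hence the transposition at the start. *)
Lemma ig2_conv f g : ig f -> ig g -> ig2 (fun s r => f r * g (s - r)).
Proof.
move=> fi gi; apply: ig2_sym; apply: ig2_sufficient.
- apply: mf2M; first by apply: mf2_1; exact: ig_mf.
  apply: mf2_comp; first exact: ig_mf.
  by apply: mf2B; [exact: mf2_snd|exact: mf2_fst].
- by move=> x; apply: igZ; exact: ig_shift.
- rewrite (_ : (fun _ => _) = fun x => Int (fun y => `|g y|) * `|f x|).
    by apply: igZ; exact: ig_abs.
  apply/funext => x; rewrite mulrC -(Int_shift (- x) (ig_abs gi)) -IntZ.
    by apply: Int_ext => y; rewrite normrM.
  exact: (ig_shift (- x) (ig_abs gi)).
Qed.

End IntegralOnTheLine.

(** * Exponential weights and primitives vanishing at 0 *)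

Section Weights.
Variable R : realType.
Local Notation mu := (@lebesgue_measure R).
Implicit Types (f g h : R -> R) (w l s t : R).

(** The parameter may be negative: [ew (- w)] is the growing inverse of [ew w]. For [w > 0], [wi w]
    admits exponential growth while [wi (- w)] demands decay. *)
Definition ew (w s : R) : R := expR (- (w * `|s|)).
Definition wi w f := ig (fun s => f s * ew w s).
Definition wnorm w f := Int (fun s => `|f s| * ew w s).

Lemma ew_gt0 w s : 0 < ew w s. Proof. exact: expR_gt0. Qed.
Lemma ew_ge0 w s : 0 <= ew w s. Proof. exact: expR_ge0. Qed.
Hint Resolve ew_gt0 ew_ge0 : core.

Lemma ewN w s : ew w (- s) = ew w s. Proof. by rewrite /ew normrN. Qed.

Lemma ew_inv w s : ew w s * ew (- w) s = 1.
Proof. by rewrite /ew -expRD mulNr opprK addNr expR0. Qed.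

Lemma ewDw w l s : ew (w + l) s = ew w s * ew l s.
Proof. by rewrite /ew -expRD; congr expR; lra. Qed.

Lemma ew_le w l s : w <= l -> ew l s <= ew w s.
Proof. by move=> wl; rewrite /ew ler_expR lerN2 ler_wpM2r. Qed.

Lemma ew_le1 w s : 0 <= w -> ew w s <= 1.
Proof. by move=> w0; rewrite /ew -expR0 ler_expR oppr_le0 mulr_ge0. Qed.

Lemma ew_sub w s t : 0 <= w -> ew w s * ew w t <= ew w (s + t).
Proof.
move=> w0; rewrite /ew -expRD ler_expR.
have := ler_wpM2l w0 (ler_normD s t); lra.
Qed.

(** The triangle inequality read as a translation estimate: moving a point by [r] costs at most the
    growing factor [ew (- w) r]. The weighted convolution bounds rest on it. *)
Lemma ew_sub' w s r : 0 <= w -> ew w s <= ew (- w) r * ew w (s - r).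
Proof.
move=> w0; have := ew_sub s (- r) w0.
rewrite ewN => /(ler_wpM2l (ew_ge0 (- w) r)); apply: le_trans.
by rewrite mulrCA [X in _ * X]mulrC ew_inv mulr1.
Qed.

Lemma mf_ew w : mf (ew w).
Proof.
apply: mf_comp; first exact: measurable_expR.
have -> : (fun s : R => - (w * `|s|)) = fun s => (- w) * `|s|.
  by apply/funext => s; rewrite mulNr.
by apply: mfM; [exact: mf_cst|exact: mf_abs (@mf_id R)].
Qed.

(** Up to the factor [l], the two-sided exponential is a sum of two one-sided exponential densities;
    at [x = 0] both contribute, so only an inequality holds everywhere. *)
Lemma ew_exponential l x : 0 < l ->
  ew l x <= l^-1 * (exponential_pdf l x + exponential_pdf l (0 - x)).
Proof.
move=> l0; have l0' := ltW l0.
have [x0|x0] := leP 0 x.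
  rewrite (exponential_pdfE l x0) /ew ger0_norm// mulrDr mulrA mulVf ?gt_eqF//.
  rewrite mul1r -mulNr lerDl mulr_ge0 ?invr_ge0//.
  exact: exponential_pdf_ge0.
have x0' : 0 <= 0 - x by lra.
rewrite (exponential_pdfE l x0') /ew ltr0_norm// mulrDr addrC mulrA mulVf ?gt_eqF//.
rewrite mul1r -mulNr sub0r lerDl mulr_ge0 ?invr_ge0//.
exact: exponential_pdf_ge0.
Qed.

Lemma ig_exponential l : 0 < l -> ig (exponential_pdf l).
Proof. exact: integrable_exponential_pdf. Qed.

Lemma Int_exponential l : 0 < l -> Int (exponential_pdf l) = 1.
Proof. by move=> l0; rewrite /Int /Rintegral integral_exponential_pdf. Qed.

Lemma ig_ew l : 0 < l -> ig (ew l).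
Proof.
move=> l0; apply: (ig_dom (mf_ew l)); last first.
  apply: (igZ l^-1); apply: (igD (ig_exponential l0)).
  exact: (ig_refl 0 (ig_exponential l0)).
by move=> x; rewrite ger0_norm//; exact: ew_exponential.
Qed.

Lemma Int_ew l : 0 < l -> Int (ew l) <= 2 / l.
Proof.
move=> l0.
have i1 := ig_exponential l0.
have i2 := ig_refl 0 (ig_exponential l0).
have := Int_le (ig_ew l0) (igZ l^-1 (igD i1 i2)) (fun x => ew_exponential x l0).
rewrite (IntZ _ (igD i1 i2)) (IntD i1 i2) (Int_refl 0 (ig_exponential l0)).
rewrite Int_exponential//; lra.
Qed.

Lemma wi_mf w f : wi w f -> mf f.
Proof.
move=> /ig_mf fm.
have -> : f = fun s => f s * ew w s * ew (- w) s.
  by apply/funext => s; rewrite -mulrA ew_inv mulr1.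
by apply: mfM => //; exact: mf_ew.
Qed.

Lemma wi_abs w f : wi w f -> ig (fun s => `|f s| * ew w s).
Proof.
move=> /ig_abs; apply: ig_ext => s; by rewrite normrM [X in _ * X]ger0_norm.
Qed.

Lemma wiD w f g : wi w f -> wi w g -> wi w (fun s => f s + g s).
Proof. by move=> fi gi; apply: ig_ext (igD fi gi) => s; rewrite mulrDl. Qed.

Lemma wiB w f g : wi w f -> wi w g -> wi w (fun s => f s - g s).
Proof. by move=> fi gi; apply: ig_ext (igB fi gi) => s; rewrite mulrBl. Qed.

Lemma wiZ w (c : R) f : wi w f -> wi w (fun s => c * f s).
Proof. by move=> fi; apply: ig_ext (igZ c fi) => s; rewrite mulrA. Qed.

Lemma wi_sum w (I : Type) (r : seq I) (P : pred I) (F : I -> R -> R) :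
  (forall i, wi w (F i)) -> wi w (fun x => \sum_(i <- r | P i) F i x).
Proof.
move=> Fi; rewrite /wi; apply: ig_ext (ig_sum r P Fi) => s.
by rewrite mulr_suml.
Qed.

Lemma wi_neg w f : wi w f -> wi w (fun s => f (- s)).
Proof.
move=> /(ig_refl 0); apply: ig_ext => s; by rewrite sub0r ewN.
Qed.

Lemma wi_dom w f g : mf f -> (forall x, `|f x| <= g x) -> wi w g -> wi w f.
Proof.
move=> fm fg; apply: ig_dom; first by apply: mfM => //; exact: mf_ew.
by move=> x; rewrite normrM [X in _ * X]ger0_norm// ler_wpM2r.
Qed.

Lemma wi_le w l f : w <= l -> wi w f -> wi l f.
Proof.
move=> wl fi; apply: (ig_dom _ _ (wi_abs fi)).
  apply: mfM; [exact: wi_mf fi|exact: mf_ew].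
by move=> x; rewrite normrM [X in _ * X]ger0_norm// ler_wpM2l// ew_le.
Qed.

Lemma wi_refl w f t : 0 <= w -> wi w f -> wi w (fun s => f (t - s)).
Proof.
move=> w0 fi; have := ig_refl t (wi_abs fi) => /(igZ (ew (- w) t)).
apply: ig_dom.
  apply: mfM; last exact: mf_ew.
  have -> : (fun s => f (t - s)) = (fun s => f ((-1) * s + t)).
    by apply/funext => s; congr f; lra.
  by apply: mf_comp; [exact: wi_mf fi|exact: mf_affine].
move=> x; rewrite normrM [X in _ * X]ger0_norm// mulrCA ler_wpM2l//.
have -> : t - x = - (x - t) by lra.
by rewrite ewN; exact: ew_sub'.
Qed.

Lemma wi_shift w f t : 0 <= w -> wi w f -> wi w (fun s => f (s + t)).
Proof.
move=> w0 fi; have := wi_refl t w0 fi.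
move=> /wi_neg; apply: ig_ext => s; congr (f _ * _); ring.
Qed.

Lemma wnorm_ge0 w f : 0 <= wnorm w f.
Proof. by apply: Int_ge0 => s; rewrite mulr_ge0. Qed.

Lemma wi_cst w (c : R) : 0 < w -> wi w (fun=> c).
Proof. by move=> w0; exact: igZ (ig_ew w0). Qed.

(* Signed indicator of the segment from 0 to s, so that prim h is the primitive of h vanishing at 0, on both half lines. *)
Definition chi s r : R := (r <= s)%R%:R - (r <= 0)%R%:R.
Definition prim h s := Int (fun r => h r * chi s r).

Lemma chi_abs s r : `|chi s r| <= (`|r| <= `|s|)%R%:R.
Proof.
rewrite /chi.
have [rs|rs] := leP r s; have [r0|r0] := leP r 0; rewrite ?subrr ?normr0 ?ler0n//.
  have -> : `|r| <= `|s| by rewrite !ger0_norm//; lra.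
  by rewrite subr0 normr1.
have -> : `|r| <= `|s| by rewrite !ler0_norm//; lra.
by rewrite sub0r normrN normr1.
Qed.

(** On the support [|r| <= |s|] the product of the two weights is at least 1. In this form a
    primitive is estimated by the weighted norm of its integrand. *)
Lemma chi_ew w s r : 0 <= w -> `|chi s r| <= ew (- w) s * ew w r.
Proof.
move=> w0; apply: le_trans (chi_abs s r) _.
case: (leP `|r| `|s|) => [rs|_]; last by rewrite /= mulr_ge0.
rewrite /ew -expRD -[X in X <= _]expR0 ler_expR.
have := ler_wpM2l w0 rs; lra.
Qed.

Lemma mf_chi s : mf (chi s).
Proof.
by apply: mfB; apply: mf_le; [exact: mf_id|exact: mf_cst|exact: mf_id|exact: mf_cst].
Qed.

Lemma mf2_chi : mf2 chi.
Proof.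
have h1 : mf2 (fun s r : R => (r <= s)%R%:R) := mf2_le (@mf2_snd R) (@mf2_fst R).
have h2 : mf2 (fun _ r : R => (r <= 0)%R%:R).
  apply: (mf2_2 (f := fun r => (r <= 0)%R%:R)).
  by apply: mf_le; [exact: mf_id|exact: mf_cst].
exact: mf2B h1 h2.
Qed.

Lemma ig_prim w h s : 0 <= w -> wi w h -> ig (fun r => h r * chi s r).
Proof.
move=> w0 hi; apply: (ig_dom _ _ (igZ (ew (- w) s) (wi_abs hi))).
  by apply: mfM; [exact: wi_mf hi|exact: mf_chi].
move=> r; rewrite normrM mulrCA ler_wpM2l//; exact: chi_ew.
Qed.

Lemma prim_bound w h s : 0 <= w -> wi w h -> `|prim h s| <= ew (- w) s * wnorm w h.
Proof.
move=> w0 hi; have ip := ig_prim s w0 hi.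
apply: le_trans (Int_abs ip) _.
rewrite /wnorm -IntZ; last exact: wi_abs.
apply: Int_le => [||r]; first exact: ig_abs.
  exact: igZ (wi_abs hi).
rewrite normrM mulrCA ler_wpM2l//; exact: chi_ew.
Qed.

(** A primitive of a function of weight [w] grows at most like [ew (- w)], which any strictly larger
    weight [l] makes integrable. *)
Lemma wi_prim w l h : 0 <= w -> w < l -> wi w h -> wi l (prim h).
Proof.
move=> w0 wl hi.
have lw0 : 0 < l - w by lra.
have H : ig2 (fun s r => (h r * chi s r) * ew l s).
  apply: (ig2_dom _ _ (ig2_tensor (ig_ew lw0) (wi_abs hi))).
    apply: mf2M; last exact: mf2_1 (mf_ew l).
    by apply: mf2M; [exact: mf2_2 (wi_mf hi)|exact: mf2_chi].
  move=> s r; rewrite !normrM [`|ew l s|]ger0_norm// -mulrA [leRHS]mulrCA.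
  rewrite ler_wpM2l//.
  have -> : ew l s = ew (l - w) s * ew w s by rewrite -ewDw subrK.
  rewrite mulrCA ler_wpM2l//.
  apply: le_trans (ler_wpM2r (ew_ge0 w s) (chi_ew s r w0)) _.
  by rewrite mulrAC [ew _ s * _]mulrC ew_inv mul1r.
apply: ig_ext (ig2_Int H) => s.
by rewrite mulrC -IntZ ?(ig_prim s w0 hi)//; apply: Int_ext => r; rewrite mulrC.
Qed.

Lemma prim0 h : prim h 0 = 0.
Proof.
by rewrite /prim -[RHS](Int0 R); apply: Int_ext => r; rewrite /chi subrr mulr0.
Qed.

Lemma primD w h g s : 0 <= w -> wi w h -> wi w g ->
  prim (fun r => h r + g r) s = prim h s + prim g s.
Proof.
move=> w0 hi gi; rewrite /prim -IntD; last 2 first.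
- exact: ig_prim hi.
- exact: ig_prim gi.
by apply: Int_ext => r; rewrite mulrDl.
Qed.

Lemma primZ w (c : R) h s : 0 <= w -> wi w h ->
  prim (fun r => c * h r) s = c * prim h s.
Proof.
move=> w0 hi; rewrite /prim -IntZ; last exact: ig_prim hi.
by apply: Int_ext => r; rewrite mulrA.
Qed.

Lemma primB w h g s : 0 <= w -> wi w h -> wi w g ->
  prim (fun r => h r - g r) s = prim h s - prim g s.
Proof.
move=> w0 hi gi; rewrite /prim -IntB; last 2 first.
- exact: ig_prim hi.
- exact: ig_prim gi.
by apply: Int_ext => r; rewrite mulrBl.
Qed.

Lemma prim_sum w (I : Type) (r : seq I) (P : pred I) (F : I -> R -> R) s :
  0 <= w -> (forall i, wi w (F i)) ->
  prim (fun x => \sum_(i <- r | P i) F i x) s = \sum_(i <- r | P i) prim (F i) s.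
Proof.
move=> w0 Fi; rewrite /prim -Int_sum; last by move=> i; exact: ig_prim (Fi i).
by apply: Int_ext => x; rewrite mulr_suml.
Qed.

Lemma aeneq (c : R) : \forall x \ae mu, x != c.
Proof.
exists [set c]; split => //=; first exact: lebesgue_measure_set1.
by move=> x /= /negP; rewrite negbK => /eqP.
Qed.

Lemma prim_aeq h g s : mf h -> mf g -> aeq h g -> prim h s = prim g s.
Proof.
move=> hm gm hg; apply: Int_aeq.
- by apply: mfM => //; exact: mf_chi.
- by apply: mfM => //; exact: mf_chi.
- by apply: filterS hg => x ->.
Qed.

Lemma prim_refl w h t s : 0 <= w -> wi w h ->
  prim (fun r => h (t - r)) s = prim h t - prim h (t - s).
Proof.
move=> w0 hi.
rewrite /prim -IntB; last 2 first.
- exact: ig_prim hi.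
- exact: ig_prim hi.
rewrite -[RHS](Int_refl t); last first.
  by apply: igB; exact: ig_prim hi.
have mh : mf (fun r => h (t - r)) := wi_mf (wi_refl t w0 hi).
have mch (c : R) : mf (fun x => chi c (t - x)).
  have -> : (fun x => chi c (t - x)) = (fun x => chi c ((-1) * x + t)).
    by apply/funext => x; congr chi; lra.
  by apply: mf_comp; [exact: mf_chi|exact: mf_affine].
apply: Int_aeq.
- by apply: mfM => //; exact: mf_chi.
- by apply: mfB; apply: mfM.
(* Reflection moves the closed end of the half-open indicators in [chi]; the two sides differ only
   at [s] and [0]. *)
apply: filterS2 (aeneq s) (aeneq 0) => x xs x0.
rewrite -mulrBr; congr (_ * _); rewrite /chi.
have -> : (t - x <= t) = (0 <= x) by apply/idP/idP; lra.
have -> : (t - x <= t - s) = (s <= x) by apply/idP/idP; lra.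
move: xs x0; case: ltgtP => // _ _; case: ltgtP => // _ _ /=; lra.
Qed.

Lemma prim_neg w h s : 0 <= w -> wi w h -> prim h (- s) = - prim (fun r => h (- r)) s.
Proof.
move=> w0 hi; have := prim_refl 0 s w0 hi.
rewrite prim0 !sub0r => /eqP; rewrite -eqr_oppLR => /eqP <-.
by congr (- _); apply: Int_ext => r; rewrite sub0r.
Qed.

End Weights.
#[global] Hint Extern 0 (is_true (0 < ew _ _)) => (exact: ew_gt0) : core.
#[global] Hint Extern 0 (is_true (0 <= ew _ _)) => (exact: ew_ge0) : core.

(** * Convolution with exponentially decaying kernels *)

Section Convolution.
Variable R : realType.
Local Notation mu := (@lebesgue_measure R).
Implicit Types (f g h a : R -> R) (w l s t : R).

Lemma mf_refl f t : mf f -> mf (fun s => f (t - s)).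
Proof.
move=> fm; have -> : (fun s => f (t - s)) = (fun s => f ((-1) * s + t)).
  by apply/funext => s; congr f; ring.
by apply: mf_comp => //; exact: mf_affine.
Qed.

Lemma mf_shift f t : mf f -> mf (fun s => f (s + t)).
Proof.
move=> fm; have -> : (fun s => f (s + t)) = (fun s => f (1 * s + t)).
  by apply/funext => s; congr f; ring.
by apply: mf_comp => //; exact: mf_affine.
Qed.

(** By [pushforward_affine] the preimage of a null set under a nonconstant affine map is null. *)
Lemma ae_affine (p b : R) (P : R -> Prop) : p != 0 ->
  (\forall x \ae mu, P x) -> \forall x \ae mu, P (p * x + b).
Proof.
move=> p0 [A [mA A0 PA]].
exists ((fun x : R => p * x + b) @^-1` A); split.
- have := @mf_affine R p b measurableT _ mA.
  by rewrite setTI.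
- have := pushforward_affine b p0 mA.
  rewrite A0 => /eqP; rewrite mule_eq0 => /orP[|/eqP//].
  by rewrite eqe normr_eq0 (negPf p0).
- by move=> x /= Px; exact: PA.
Qed.

Lemma aeq_refl f g t : aeq f g -> aeq (fun s => f (t - s)) (fun s => g (t - s)).
Proof.
have n1 : (-1 : R) != 0 by rewrite oppr_eq0 oner_neq0.
move=> /(ae_affine t n1); apply: filterS => x.
by rewrite mulN1r addrC.
Qed.

(** Decay is required pointwise rather than in the mean: [conv g f s] is then absolutely convergent
    at every [s] when [f] has a weight at most [l], and convolution identities hold at every
    point. *)
Definition kern l g := mf g /\ exists C, forall r, `|g r| <= C * ew l r.

Lemma kernP l g : kern l g -> exists2 C, 0 <= C & forall r, `|g r| <= C * ew l r.
Proof.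
move=> [gm [C gC]]; exists C => //.
have := le_trans (normr_ge0 _) (gC 0); rewrite pmulr_lge0//.
Qed.

Lemma kern_mf l g : kern l g -> mf g. Proof. by case. Qed.

Lemma kernD l g h : kern l g -> kern l h -> kern l (fun r => g r + h r).
Proof.
move=> [gm [C gC]] [hm [D hD]]; split; first exact: mfD.
exists (C + D) => r; rewrite mulrDl; apply: le_trans (ler_normD _ _) _.
exact: lerD.
Qed.

Lemma kernZ l (c : R) g : kern l g -> kern l (fun r => c * g r).
Proof.
move=> [gm [C gC]]; split; first by apply: mfM => //; exact: mf_cst.
by exists (`|c| * C) => r; rewrite normrM -mulrA ler_wpM2l.
Qed.

Lemma kern_wi w l g : w < l -> kern l g -> wi (- w) g.
Proof.
move=> wl kg; have [C C0 gC] := kernP kg.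
have lw : 0 < l - w by lra.
apply: (ig_dom _ _ (igZ C (ig_ew lw))).
  by apply: mfM; [exact: kern_mf kg|exact: mf_ew].
move=> r; rewrite normrM [X in _ * X]ger0_norm//.
by rewrite ewDw mulrA ler_wpM2r.
Qed.

Lemma kern_ig l g : 0 < l -> kern l g -> ig g.
Proof.
move=> l0 /(kern_wi l0); apply: ig_ext => s.
by rewrite /ew oppr0 mul0r oppr0 expR0 mulr1.
Qed.

Definition conv g f s := Int (fun r => g r * f (s - r)).

Lemma conv_dom w l (C : R) g f s r : 0 <= w -> w <= l -> 0 <= C ->
  (forall r, `|g r| <= C * ew l r) ->
  `|g r * f (s - r)| <= C * ew (- w) s * (`|f (s - r)| * ew w (s - r)).
Proof.
move=> w0 wl C0 gC; rewrite normrM.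
rewrite (_ : C * ew (- w) s * _ = C * (ew (- w) s * ew w (s - r)) * `|f (s - r)|);
  last by ring.
apply: ler_wpM2r => //; apply: le_trans (gC r) _; rewrite ler_wpM2l//.
apply: le_trans (ew_le r wl) _.
have := ew_sub' r s w0; rewrite (_ : r - s = - (s - r)) ?ewN//; ring.
Qed.

Lemma conv_ig w l g f s : 0 <= w -> w <= l -> kern l g -> wi w f ->
  ig (fun r => g r * f (s - r)).
Proof.
move=> w0 wl kg fi; have [C C0 gC] := kernP kg.
apply: (ig_dom _ _ (igZ (C * ew (- w) s) (ig_refl s (wi_abs fi)))).
  by apply: mfM; [exact: kern_mf kg|exact: mf_refl (wi_mf fi)].
by move=> r; exact: (conv_dom f s r w0 wl C0 gC).
Qed.

Lemma ig2_conv_kern w l g f : 0 <= w -> w < l -> kern l g -> wi w f ->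
  ig2 (fun s r => g r * f (s - r) * ew w s).
Proof.
move=> w0 wl kg fi.
apply: (ig2_dom _ _ (ig2_conv (wi_abs (kern_wi wl kg)) (wi_abs fi))).
  apply: mf2M; last exact: mf2_1 (mf_ew w).
  apply: mf2M; first exact: mf2_2 (kern_mf kg).
  apply: mf2_comp (wi_mf fi) _; exact: (mf2B (@mf2_fst R) (@mf2_snd R)).
move=> s r; rewrite !normrM [`|ew w s|]ger0_norm//.
rewrite -!mulrA ler_wpM2l// mulrCA ler_wpM2l//; exact: ew_sub'.
Qed.

Lemma conv_wi w l g f : 0 <= w -> w < l -> kern l g -> wi w f -> wi w (conv g f).
Proof.
move=> w0 wl kg fi; have := ig2_Int (ig2_conv_kern w0 wl kg fi).
apply: ig_ext => s; rewrite mulrC -IntZ; last exact: conv_ig (ltW wl) kg fi.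
by apply: Int_ext => r; rewrite mulrC.
Qed.

(** Young's inequality: the weight at [s] is split between [r] and [s - r], and the kernel is
    measured in the inverse weight. *)
Lemma conv_wnorm w l g f : 0 <= w -> w < l -> kern l g -> wi w f ->
  wnorm w (conv g f) <= wnorm (- w) g * wnorm w f.
Proof.
move=> w0 wl kg fi.
have H1 := ig2_conv (wi_abs (kern_wi wl kg)) (wi_abs fi).
have H0 := ig2_conv_kern w0 wl kg fi.
have -> : wnorm (- w) g * wnorm w f = Int (fun s => Int (fun r =>
   `|g r| * ew (- w) r * (`|f (s - r)| * ew w (s - r)))).
  rewrite (ig2_swap H1) mulrC /wnorm -IntZ; last exact: wi_abs (kern_wi wl kg).
  apply: Int_ext => r; rewrite mulrC -(Int_shift (- r) (wi_abs fi)) -IntZ//.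
  exact: (ig_shift (- r) (wi_abs fi)).
have -> : wnorm w (conv g f) =
    Int (fun s => `|Int (fun r => g r * f (s - r) * ew w s)|).
  apply: Int_ext => s; rewrite -[X in _ * X]ger0_norm// -normrM mulrC -IntZ.
    by congr `|_|; apply: Int_ext => r; rewrite mulrC.
  exact: conv_ig (ltW wl) kg fi.
apply: Int_le.
- exact/ig_abs/ig2_Int.
- exact: ig2_Int.
- move=> s.
  have i1 : ig (fun r => g r * f (s - r) * ew w s).
    apply: ig_ext (igZ (ew w s) (conv_ig s w0 (ltW wl) kg fi)) => r.
    by rewrite mulrC.
  apply: le_trans (Int_abs i1) _.
  have [C C0 gC] := kernP kg.
  have gC' r : `|(`|g r| * ew (- w) r)| <= C * ew (l - w) r.
    rewrite normrM normr_id [X in _ * X]ger0_norm// ewDw mulrA.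
    by apply: ler_wpM2r.
  have kg' : kern (l - w) (fun r => `|g r| * ew (- w) r).
    split; last by exists C.
    by apply: mfM; [apply: mf_abs; exact: kern_mf kg|exact: mf_ew].
  have fi0 : wi 0 (fun r => `|f r| * ew w r).
    apply: ig_ext (wi_abs fi) => r.
    by rewrite /ew mul0r oppr0 expR0 mulr1.
  apply: Int_le; first exact: ig_abs.
    apply: (conv_ig s (lexx 0) _ kg' fi0); lra.
  move=> r; rewrite !normrM [`|ew w s|]ger0_norm//.
  rewrite -!mulrA ler_wpM2l// mulrCA ler_wpM2l//; exact: ew_sub'.
Qed.

(** The decay [ew l r * ew l q] is shared out: [ew (l - w) r] is kept for the integration over [r],
    and [ew w (r + q)] is carried to the argument of [f] at the cost of a factor depending on
    [s]. *)
Lemma conv2_dom w l (C D : R) g h f s r q : 0 <= w -> w <= l -> 0 <= C -> 0 <= D ->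
  (forall r, `|g r| <= C * ew l r) -> (forall r, `|h r| <= D * ew l r) ->
  `|g r * (h q * f (s - r - q))| <=
    (C * D * ew (- w) s) * (ew (l - w) r * (`|f (s - r - q)| * ew w (s - r - q))).
Proof.
move=> w0 wl C0 D0 gC hD; rewrite !normrM.
have E1 : `|g r| * `|h q| <= C * D * (ew l r * ew l q).
  by rewrite mulrACA; apply: ler_pM.
have E2 : ew l r * ew l q <= ew (- w) s * (ew (l - w) r * ew w (s - r - q)).
  have -> : ew l r = ew (l - w) r * ew w r by rewrite -ewDw subrK.
  rewrite -mulrA [leRHS]mulrCA ler_wpM2l//.
  apply: (@le_trans _ _ (ew w (r + q))).
    apply: le_trans (ew_sub r q w0).
    by rewrite ler_wpM2l// ew_le.
  have := ew_sub' (r + q) s w0.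
  by rewrite (_ : r + q - s = - (s - r - q)) ?ewN//; ring.
have CD : 0 <= C * D by rewrite mulr_ge0.
have := ler_wpM2r (normr_ge0 (f (s - r - q))) (le_trans E1 (ler_wpM2l CD E2)).
move=> H; rewrite mulrA; apply: le_trans H _.
by rewrite le_eqVlt; apply/orP; left; apply/eqP; ring.
Qed.

Lemma ig2_conv2 w l g h f s : 0 <= w -> w < l -> kern l g -> kern l h -> wi w f ->
  ig2 (fun r q => g r * (h q * f (s - r - q))).
Proof.
move=> w0 wl kg kh fi; have [C C0 gC] := kernP kg; have [D D0 hD] := kernP kh.
have lw : 0 < l - w by lra.
have fm := wi_mf fi.
have mfsrq : mf2 (fun r q => f (s - r - q)).
  apply: mf2_comp fm _; apply: mf2B (@mf2_snd R).
  apply: (mf2B _ (@mf2_fst R)); apply: mf2_1; exact: mf_cst.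
have ifw r : ig (fun q => `|f (s - r - q)| * ew w (s - r - q)).
  exact: (ig_refl (s - r) (wi_abs fi)).
have H : ig2 (fun r q => (C * D * ew (- w) s) *
    (ew (l - w) r * (`|f (s - r - q)| * ew w (s - r - q)))).
  apply: ig2_sufficient.
  - apply: mf2M; first by apply: mf2_1; exact: mf_cst.
    apply: mf2M; first by apply: mf2_1; exact: mf_ew.
    apply: mf2M; first by exact: mf2_comp (mf_abs (@mf_id R)) mfsrq.
    apply: mf2_comp (mf_ew w) _; apply: mf2B (@mf2_snd R).
    by apply: (mf2B _ (@mf2_fst R)); apply: mf2_1; exact: mf_cst.
  - by move=> r; do 2 apply: igZ.
  - apply: ig_ext (igZ (C * D * ew (- w) s * wnorm w f) (ig_ew lw)) => r.
    rewrite /wnorm -(Int_refl (s - r) (wi_abs fi)) mulrAC -IntZ//.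
    apply: Int_ext => q; rewrite [RHS]ger0_norm; first by rewrite !mulrA.
    by do ![apply: mulr_ge0 => //].
apply: (ig2_dom _ _ H).
  apply: mf2M; first exact: mf2_1 (kern_mf kg).
  by apply: mf2M => //; exact: mf2_2 (kern_mf kh).
by move=> r q; apply: conv2_dom => //; exact: ltW.
Qed.

Lemma convC w l g h f s : 0 <= w -> w < l -> kern l g -> kern l h -> wi w f ->
  conv g (conv h f) s = conv h (conv g f) s.
Proof.
move=> w0 wl kg kh fi.
have H := ig2_conv2 s w0 wl kg kh fi.
transitivity (Int (fun r => Int (fun q => g r * (h q * f (s - r - q))))).
  apply: Int_ext => r; rewrite IntZ//; exact: conv_ig (ltW wl) kh fi.
rewrite (ig2_swap H).
apply: Int_ext => q; rewrite -IntZ.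
  by apply: Int_ext => r; rewrite mulrCA; congr (_ * (_ * f _)); ring.
exact: conv_ig (ltW wl) kg fi.
Qed.

Lemma convA w l g h f s : 0 <= w -> w < l -> kern l g -> kern l h -> wi w f ->
  conv g (conv h f) s = conv (conv g h) f s.
Proof.
move=> w0 wl kg kh fi.
have H := ig2_conv2 s w0 wl kg kh fi.
have [C C0 gC] := kernP kg; have [D D0 hD] := kernP kh.
have lw : 0 < l - w by lra.
have H2 : ig2 (fun r t => g r * (h (t - r) * f (s - t))).
  apply: (ig2_dom _ _ (ig2_tensor (ig_ew lw)
     (igZ (C * D * ew (- w) s) (ig_refl s (wi_abs fi))))).
    apply: mf2M; first exact: mf2_1 (kern_mf kg).
    apply: mf2M; last exact: mf2_2 (mf_refl s (wi_mf fi)).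
    apply: mf2_comp (kern_mf kh) _; exact: (mf2B (@mf2_snd R) (@mf2_fst R)).
  move=> r t; have := conv2_dom f s r (t - r) w0 (ltW wl) C0 D0 gC hD.
  have -> : s - r - (t - r) = s - t by ring.
  by move=> /le_trans -> //; rewrite [X in X <= _]mulrCA lexx.
transitivity (Int (fun r => Int (fun q => g r * (h q * f (s - r - q))))).
  apply: Int_ext => r; rewrite IntZ//; exact: conv_ig (ltW wl) kh fi.
transitivity (Int (fun r => Int (fun t => g r * (h (t - r) * f (s - t))))).
  apply: Int_ext => r.
  have i1 : ig (fun q => g r * (h q * f (s - r - q))).
    by apply: igZ; exact: conv_ig (ltW wl) kh fi.
  rewrite -(Int_shift (- r) i1); apply: Int_ext => t.
  by congr (_ * (_ * f _)); ring.
rewrite (ig2_swap H2); apply: Int_ext => t.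
rewrite mulrC -IntZ; last first.
  apply: (conv_ig t (lexx 0) _ kg); first by apply: le_trans w0 (ltW wl).
  apply: ig_ext (kern_ig _ kh) => [q|]; last exact: le_lt_trans w0 wl.
  by rewrite /ew mul0r oppr0 expR0 mulr1.
by apply: Int_ext => r; rewrite mulrCA mulrA; ring.
Qed.

Lemma convDr w l g f h s : 0 <= w -> w <= l -> kern l g -> wi w f -> wi w h ->
  conv g (fun r => f r + h r) s = conv g f s + conv g h s.
Proof.
move=> w0 wl kg fi hi; rewrite /conv -IntD.
- by apply: Int_ext => r; rewrite mulrDr.
- exact: conv_ig wl kg fi.
- exact: conv_ig wl kg hi.
Qed.

Lemma convZr w l (c : R) g f s : 0 <= w -> w <= l -> kern l g -> wi w f ->
  conv g (fun r => c * f r) s = c * conv g f s.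
Proof.
move=> w0 wl kg fi; rewrite /conv -IntZ.
  by apply: Int_ext => r; rewrite mulrCA.
exact: conv_ig wl kg fi.
Qed.

Lemma conv_sumr w l g (I : Type) (r : seq I) (P : pred I) (F : I -> R -> R) s :
  0 <= w -> w <= l -> kern l g -> (forall i, wi w (F i)) ->
  conv g (fun x => \sum_(i <- r | P i) F i x) s = \sum_(i <- r | P i) conv g (F i) s.
Proof.
move=> w0 wl kg Fi; rewrite /conv -Int_sum; last by move=> i; exact: conv_ig wl kg (Fi i).
by apply: Int_ext => x; rewrite mulr_sumr.
Qed.

Lemma convBr w l g f h s : 0 <= w -> w <= l -> kern l g -> wi w f -> wi w h ->
  conv g (fun r => f r - h r) s = conv g f s - conv g h s.
Proof.
move=> w0 wl kg fi hi; rewrite /conv -IntB.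
- by apply: Int_ext => r; rewrite mulrBr.
- exact: conv_ig wl kg fi.
- exact: conv_ig wl kg hi.
Qed.

Lemma convDl w l g h f s : 0 <= w -> w <= l -> kern l g -> kern l h -> wi w f ->
  conv (fun r => g r + h r) f s = conv g f s + conv h f s.
Proof.
move=> w0 wl kg kh fi; rewrite /conv -IntD.
- by apply: Int_ext => r; rewrite mulrDl.
- exact: conv_ig wl kg fi.
- exact: conv_ig wl kh fi.
Qed.

Lemma convZl w l (c : R) g f s : 0 <= w -> w <= l -> kern l g -> wi w f ->
  conv (fun r => c * g r) f s = c * conv g f s.
Proof.
move=> w0 wl kg fi; rewrite /conv -IntZ.
  by apply: Int_ext => r; rewrite mulrA.
exact: conv_ig wl kg fi.
Qed.

Lemma conv_aeq g f h s : mf g -> mf f -> mf h -> aeq f h -> conv g f s = conv g h s.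
Proof.
move=> gm fm hm fh; apply: Int_aeq.
- by apply: mfM => //; exact: mf_refl.
- by apply: mfM => //; exact: mf_refl.
- by apply: filterS (aeq_refl s fh) => r ->.
Qed.

(** Evenness of [g] enters here: substituting [- r] turns the reflected argument [t - (s - r)] into
    [(t - s) - r]. *)
Lemma conv_refl w l g f t s : 0 <= w -> w <= l -> kern l g -> wi w f ->
  (forall r, g (- r) = g r) ->
  conv g (fun r => f (t - r)) s = conv g f (t - s).
Proof.
move=> w0 wl kg fi ge; rewrite /conv -(Int_refl 0).
  by apply: Int_ext => r; rewrite sub0r ge; congr (_ * f _); ring.
exact: (conv_ig s w0 wl kg (wi_refl t w0 fi)).
Qed.

Lemma prim_shift w h t s : 0 <= w -> wi w h ->
  prim (fun r => h (r + t)) s = prim h (s + t) - prim h t.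
Proof.
move=> w0 hi; rewrite /prim -IntB; last 2 first.
- exact: ig_prim hi.
- exact: ig_prim hi.
rewrite -[RHS](Int_shift t); last by apply: igB; exact: ig_prim hi.
apply: Int_ext => r; rewrite -mulrBr /chi lerD2r; congr (_ * _).
have -> : (r + t <= t) = (r <= 0) by apply/idP/idP; lra.
ring.
Qed.

(** Fubini against [chi s]. The value at 0 is subtracted because primitives are normalised to vanish
    there and their convolutions need not be. *)
Lemma conv_prim w l g a s : 0 <= w -> w < l -> kern l g -> wi w a ->
  conv g (prim a) s - conv g (prim a) 0 = prim (conv g a) s.
Proof.
move=> w0 wl kg ai; have [C C0 gC] := kernP kg.
have l0 : 0 <= l by exact: le_trans w0 (ltW wl).
have pai := wi_prim w0 wl ai.
have lw : 0 < l - w by lra.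
rewrite -IntB; last 2 first.
- exact: conv_ig (lexx l) kg pai.
- exact: conv_ig (lexx l) kg pai.
have H : ig2 (fun t r => g r * (a (t - r) * chi s t)).
  apply: (ig2_dom _ _ (ig2_conv (igZ (C * ew (- w) s) (ig_ew lw)) (wi_abs ai))).
    apply: mf2M; first exact: mf2_2 (kern_mf kg).
    apply: mf2M; last exact: mf2_1 (mf_chi s).
    apply: mf2_comp (wi_mf ai) _; exact: (mf2B (@mf2_fst R) (@mf2_snd R)).
  move=> t r; rewrite !normrM.
  have E1 : `|g r| * `|chi s t| <= C * ew l r * (ew (- w) s * ew w t).
    by apply: ler_pM => //; exact: chi_ew.
  have E2 : ew l r * ew w t <= ew (l - w) r * ew w (t - r).
    have -> : ew l r = ew (l - w) r * ew w r by rewrite -ewDw subrK.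
    rewrite -mulrA ler_wpM2l// mulrC -(ewN w r); exact: ew_sub.
  have CD : 0 <= C * ew (- w) s by rewrite mulr_ge0.
  have := ler_wpM2l CD E2.
  have -> : C * ew (- w) s * (ew l r * ew w t) = C * ew l r * (ew (- w) s * ew w t) by ring.
  move=> /(le_trans E1) /(ler_wpM2r (normr_ge0 (a (t - r)))) E3.
  rewrite mulrCA mulrC; apply: le_trans E3 _.
  by rewrite le_eqVlt; apply/orP; left; apply/eqP; ring.
transitivity (Int (fun r => Int (fun t => g r * (a (t - r) * chi s t)))).
  apply: Int_ext => r.
  have hi := wi_shift (- r) w0 ai.
  rewrite IntZ; last exact: (ig_prim s w0 hi).
  by rewrite -[Int _]/(prim (fun t => a (t - r)) s) (prim_shift (- r) s w0 ai) sub0r mulrBr.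
rewrite -(ig2_swap H); apply: Int_ext => t.
rewrite mulrC -IntZ; last exact: (conv_ig t w0 (ltW wl) kg ai).
by apply: Int_ext => r; rewrite mulrA mulrC.
Qed.

End Convolution.

(** * The fundamental theorem of calculus for primitives *)

Section FTC.
Variable R : realType.
Local Notation mu := (@lebesgue_measure R).
Implicit Types (f F h : R -> R) (s : R).

Lemma prim_itv h s : 0 <= s -> mf h -> prim h s = \int[mu]_(x in `[0, s]) h x.
Proof.
move=> s0 hm; rewrite Rintegral_mkcond; apply: Int_aeq.
- by apply: mfM => //; exact: mf_chi.
- by apply: (measurable_restrictT _ _).1 => //; exact: measurable_funTS.
apply: filterS (aeneq (0:R)) => x x0; rewrite patchE /chi.
case: ifPn => [|] xs; rewrite mem_setE in_itv/= in xs.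
  case/andP: xs => xs ->; rewrite leNgt lt_neqAle eq_sym x0 xs/=.
  by rewrite subr0 mulr1.
have [x0'|x0'] := leP x 0; have [xs'|xs'] := leP x s; rewrite ?subrr ?mulr0//=.
- by exfalso; lra.
- by exfalso; move: xs; rewrite (ltW x0') xs'.
Qed.

Lemma ig_continuous f (a b : R) : continuous f ->
  ig (fun x => f x * ((a <= x) && (x <= b))%R%:R).
Proof.
move=> cf.
have : mu.-integrable `[a, b] (EFin \o f).
  apply: continuous_compact_integrable; first exact: segment_compact.
  exact: continuous_subspaceT.
have mI : measurable (`[a, b]%classic : set (measurableTypeR R)) by exact: measurable_itv.
move=> H; have := (integrable_mkcond _ mI).1 H.
apply: eq_integrable => // x _.
rewrite patchE mem_setE in_itv /=; case: ifP => _; first by rewrite mulr1.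
by rewrite mulr0.
Qed.

Lemma ig_prim_continuous f s : continuous f -> ig (fun r => f r * chi s r).
Proof.
move=> cf; apply: (ig_dom _ _ (ig_abs (ig_continuous (- `|s|) `|s| cf))).
  by apply: mfM; [exact: mf_cont|exact: mf_chi].
move=> r; rewrite !normrM ler_wpM2l// -ler_norml.
by rewrite [leRHS]ger0_norm ?ler0n//; exact: chi_abs.
Qed.

Definition dv F (x d : R) := is_derive (x : R) (1 : R) F d.

Lemma dv_cst (c x : R) : dv (fun=> c) x 0.
Proof. exact: is_derive_cst. Qed.

Lemma dv_id (x : R) : dv (fun y => y) x 1.
Proof. exact: is_derive_id. Qed.

Lemma dvD F G (x a b : R) : dv F x a -> dv G x b -> dv (fun y => F y + G y) x (a + b).
Proof. by move=> dF dG; exact: (@is_deriveD R R R F G x 1 a b). Qed.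

Lemma dvN F (x a : R) : dv F x a -> dv (fun y => - F y) x (- a).
Proof. by move=> dF; exact: (@is_deriveN R R R F x 1 a). Qed.

Lemma dvB F G (x a b : R) : dv F x a -> dv G x b -> dv (fun y => F y - G y) x (a - b).
Proof. by move=> dF dG; apply: dvD => //; exact: dvN. Qed.

Lemma dvM F G (x a b : R) : dv F x a -> dv G x b ->
  dv (fun y => F y * G y) x (F x * b + G x * a).
Proof. by move=> dF dG; exact: (@is_deriveM R R F G x 1 a b). Qed.

Lemma dv_comp F G (x a b : R) : dv F (G x) a -> dv G x b ->
  dv (fun y => F (G y)) x (a * b).
Proof. exact: is_derive1_comp. Qed.

Lemma dv_exp F (x a : R) : dv F x a -> dv (fun y => expR (F y)) x (expR (F x) * a).
Proof. by move=> dF; apply: (dv_comp (is_derive_expR _) dF). Qed.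

Lemma dv_cos F (x a : R) : dv F x a -> dv (fun y => cos (F y)) x (- sin (F x) * a).
Proof. by move=> dF; apply: (dv_comp (is_derive_cos _) dF). Qed.

Lemma dv_sin F (x a : R) : dv F x a -> dv (fun y => sin (F y)) x (cos (F x) * a).
Proof. by move=> dF; apply: (dv_comp (is_derive_sin _) dF). Qed.

Lemma dv_eq F (x a b : R) : dv F x a -> a = b -> dv F x b.
Proof. by move=> dF <-. Qed.

Lemma dv_cont F f : (forall x, dv F x (f x)) -> continuous F.
Proof.
move=> dF x; apply: differentiable_continuous; apply/derivable1_diffP.
exact: (@ex_derive _ _ _ _ _ _ _ (dF x)).
Qed.

(** Counterpart of [prim_neg] for integrands without a growth bound, as needed for arbitrary
    continuous functions. *)
Lemma prim_neg_ig h s : mf h -> ig (fun r => h r * chi (- s) r) ->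
  prim h (- s) = - prim (fun r => h (- r)) s.
Proof.
move=> hm hi; rewrite /prim -[RHS]mulN1r.
transitivity (Int (fun x => h (0 - x) * chi (- s) (0 - x))).
  exact: (esym (Int_refl 0 hi)).
have mch (c : R) : mf (fun x => chi c (0 - x)) := mf_refl 0 (mf_chi c).
have mh : mf (fun x => h (0 - x)) := mf_refl 0 hm.
have E : aeq (fun x => h (0 - x) * chi (- s) (0 - x))
    (fun x => -1 * (h (- x) * chi s x)).
  apply: filterS2 (aeneq s) (aeneq 0) => x xs x0.
  rewrite sub0r mulrCA; congr (_ * _); rewrite /chi lerN2 oppr_le0.
  by move: xs x0; case: ltgtP => // _ _; case: ltgtP => // _ _ /=; ring.
have mhn : mf (fun x => h (- x)).
  by move: mh; congr mf; apply/funext => x; rewrite sub0r.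
rewrite (Int_aeq _ _ E) ?IntZ//.
- apply: (ig_aeq (f := fun x => -1 * (h (0 - x) * chi (- s) (0 - x)))).
  + by apply: mfM => //; exact: mf_chi.
  + by apply: filterS E => x ->; ring.
  + by apply: igZ; exact: (ig_refl 0 hi).
- by apply: mfM.
- by apply: mfM; [exact: mf_cst|apply: mfM => //; exact: mf_chi].
Qed.

Lemma prim_FTC f F s : (forall x : R, dv F x (f x)) -> continuous f ->
  prim f s = F s - F 0.
Proof.
have pos f' F' s' : 0 < s' -> (forall x : R, dv F' x (f' x)) ->
    continuous f' -> prim f' s' = F' s' - F' 0.
  move=> s0 dF cf.
  have cF : continuous F' := dv_cont dF.
  rewrite prim_itv ?ltW//; last exact: mf_cont.
  rewrite /Rintegral (@continuous_FTC2 _ f' F' 0 s')//.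
  - exact: continuous_subspaceT.
  - split.
    + by move=> x _; exact: (@ex_derive _ _ _ _ _ _ _ (dF x)).
    + exact: cvg_at_right_filter (cF 0).
    + exact: cvg_at_left_filter (cF s').
  - by move=> x _; rewrite derive1E (@derive_val _ _ _ _ _ _ _ (dF x)).
have [s0 dF cf|s0 dF cf|<- _ _] := ltgtP 0 s.
- exact: pos.
- have dN : forall x : R, dv (fun x => F (- x)) x (- f (- x)).
    by move=> x; apply: dv_eq (dv_comp (dF (- x)) (dvN (dv_id x))) _; ring.
  have cN : continuous (fun x => - f (- x)).
    move=> x; apply: cvgN; apply: continuous_comp; first exact: oppr_continuous.
    exact: cf.
  have s0' : 0 < - s by lra.
  have := pos _ _ _ s0' dN cN; rewrite opprK oppr0 => <-.
  have -> : prim f s = - prim (fun r => f (- r)) (- s).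
    rewrite -{1}(opprK s); apply: prim_neg_ig; first exact: mf_cont.
    exact: ig_prim_continuous.
  rewrite -[LHS]mulN1r /prim -IntZ; first by apply: Int_ext => r; ring.
  apply: (ig_prim_continuous (f := fun r => f (- r))) => x.
  by apply: continuous_comp; [exact: oppr_continuous|exact: cf].
- by rewrite prim0 subrr.
Qed.

End FTC.

Lemma cvg_sumR (R : realType) (T : Type) (F : set_system T) {FF : Filter F}
    (I : Type) (r : seq I) (f : I -> T -> R) (l : I -> R) :
  (forall i, f i x @[x --> F] --> l i) ->
  (\sum_(i <- r) f i x) @[x --> F] --> \sum_(i <- r) l i.
Proof.
move=> fl; elim: r => [|i r IH].
  by rewrite big_nil; under eq_fun do rewrite big_nil; exact: cvg_cst.
by rewrite big_cons; under eq_fun do rewrite big_cons; exact: cvgD.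
Qed.

(** * Power series of exponential type *)

Section ExponentialSeries.
Variable R : realType.
Variables (a : nat -> R) (A B : R).
Hypotheses (A0 : 0 <= A) (B0 : 0 <= B) (aAB : forall k, `|a k| <= A * B ^+ k).

Let c k : R := a k / k`!%:R.

Lemma pseries_exp_term (x : R) k :
  `|c k * x ^+ k| <= A * exp_coeff (B * `|x|) k.
Proof.
rewrite /c /exp_coeff /= normrM normrM normfV exprMn (normr_nat R) normrX.
have -> : A * (B ^+ k * `|x| ^+ k / k`!%:R) = A * B ^+ k / k`!%:R * `|x| ^+ k.
  by rewrite mulrAC -!mulrA.
by rewrite ler_wpM2r ?exprn_ge0// ler_wpM2r ?invr_ge0.
Qed.

Lemma cvg_pseries_exp (x : R) : cvgn (pseries c x).
Proof.
apply: normed_cvg => /=.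
apply: (@series_le_cvg R _ (fun k => A * exp_coeff (B * `|x|) k)).
- by move=> k; exact: normr_ge0.
- by move=> k; rewrite mulr_ge0// exp_coeff_ge0// mulr_ge0.
- by move=> k; exact: pseries_exp_term.
- have -> : (fun k => A * exp_coeff (B * `|x|) k) = A *: exp_coeff (B * `|x|).
    by apply/funext => k.
  apply: is_cvg_seriesZ; exact: is_cvg_series_exp_coeff.
Qed.

Lemma pseries_exp_bound (x : R) : `|limn (pseries c x)| <= A * expR (B * `|x|).
Proof.
have Bx : 0 <= B * `|x| by rewrite mulr_ge0.
have H n : `|pseries c x n| <= A * expR (B * `|x|).
  apply: (@le_trans _ _ (A * series (exp_coeff (B * `|x|)) n)); last first.
    rewrite ler_wpM2l//; apply: nondecreasing_cvgn_le; last exact: is_cvg_series_exp_coeff.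
    by apply: nondecreasing_series => k _ _; exact: exp_coeff_ge0.
  rewrite /pseries /series /= mulr_sumr; apply: le_trans (ler_norm_sum _ _ _) _.
  by apply: ler_sum => k _; exact: pseries_exp_term.
have cv : cvgn (pseries c x) by exact: cvg_pseries_exp.
rewrite ler_norml; apply/andP; split.
  apply: limr_ge => //; apply: nearW => n.
  by have := H n; rewrite ler_norml => /andP[].
apply: limr_le => //; apply: nearW => n.
by have := H n; rewrite ler_norml => /andP[].
Qed.

End ExponentialSeries.

Lemma dv_pseries_exp (R : realType) (a : nat -> R) (A B : R) (x : R) :
  0 <= A -> 0 <= B -> (forall k, `|a k| <= A * B ^+ k) ->
  dv (fun x => limn (pseries (fun k => a k / k`!%:R) x)) x
     (limn (pseries (fun k => a k.+1 / k`!%:R) x)).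
Proof.
move=> A0 B0 aAB.
(* With the factorial split off, formal differentiation is a shift of the coefficients, and shifts
   keep the geometric bound up to powers of [B]. Termwise differentiation asks for convergence of
   the series and of its first two formal derivatives. *)
have D (b : nat -> R) : pseries_diffs (fun k => b k / k`!%:R) = (fun k => b k.+1 / k`!%:R).
  apply/funext => k; rewrite /pseries_diffs factS natrM invfM.
  by rewrite mulrCA mulVKf.
have a1 k : `|a k.+1| <= (A * B) * B ^+ k by rewrite -mulrA -exprS.
have a2 k : `|a k.+2| <= (A * B * B) * B ^+ k by rewrite -!mulrA -!exprS.
have := @pseries_snd_diffs R (fun k => a k / k`!%:R) (`|x| + 1) x.
rewrite !D; apply.
- exact: (cvg_pseries_exp A0 B0 aAB).
- by apply: (cvg_pseries_exp _ B0 a1); rewrite mulr_ge0.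
- by apply: (cvg_pseries_exp _ B0 a2); rewrite !mulr_ge0.
- by rewrite [ltRHS]ger0_norm ?addr_ge0// ltrDl.
Qed.

Lemma pseries0 (R : realType) (c : nat -> R) : limn (pseries c 0) = c 0%N.
Proof.
apply/cvg_lim => //; apply: (@cvg_near_cst) => //=.
exists 1%N => // -[//|n] _; rewrite /pseries /series /= big_nat_recl//= expr0 mulr1.
by rewrite big1 ?addr0// => i _; rewrite exprS mul0r mulr0.
Qed.

(** * The Volterra resolvent kernel *)

Section ResolventKernel.
Variables (R : realType) (n : nat) (kap : 'M[R]_n).

(* Taylor coefficients of t |-> 2 kap exp(- t kap). *)
Fixpoint Ncoef (k : nat) : 'M[R]_n :=
  if k is k'.+1 then - (kap *m Ncoef k') else 2 *: kap.

(** The sum of all entries dominates row sums and column sums alike; both are used. *)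
Definition knorm : R := \sum_e \sum_f `|kap e f|.

Definition Nser (e g : 'I_n) (t : R) : R :=
  limn (pseries (fun k => Ncoef k e g / k`!%:R) t).

Lemma knorm_ge0 : 0 <= knorm.
Proof. by apply: sumr_ge0 => e _; apply: sumr_ge0. Qed.

Lemma knorm_row e : \sum_f `|kap e f| <= knorm.
Proof.
rewrite /knorm [leRHS](bigD1 e)//= lerDl; apply: sumr_ge0 => i _; exact: sumr_ge0.
Qed.

Lemma knorm_col f : \sum_e `|kap e f| <= knorm.
Proof.
rewrite /knorm; apply: ler_sum => e _.
by rewrite (bigD1 f)//= lerDl; apply: sumr_ge0.
Qed.

Lemma Ncoef_bound k e g : `|Ncoef k e g| <= 2 * knorm * knorm ^+ k.
Proof.
elim: k e g => [|k IH] e g /=.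
  rewrite mxE normrM expr0 mulr1 ger0_norm// ler_wpM2l//.
  apply: le_trans (knorm_row e).
  by rewrite (bigD1 g)//= lerDl; apply: sumr_ge0.
rewrite !mxE normrN; apply: le_trans (ler_norm_sum _ _ _) _.
apply: (@le_trans _ _ (\sum_f `|kap e f| * (2 * knorm * knorm ^+ k))).
  by apply: ler_sum => f _; rewrite normrM ler_wpM2l.
rewrite -mulr_suml exprS [leRHS]mulrCA ler_wpM2r ?knorm_row//.
by rewrite !mulr_ge0 ?exprn_ge0 ?knorm_ge0.
Qed.

Let K2 : 0 <= 2 * knorm. Proof. by rewrite mulr_ge0 ?knorm_ge0. Qed.

Lemma Nser_bound e g t : `|Nser e g t| <= 2 * knorm * expR (knorm * `|t|).
Proof.
by apply: pseries_exp_bound => //; [exact: knorm_ge0|move=> k; exact: Ncoef_bound].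
Qed.

Lemma dv_Nser e g t : dv (Nser e g) t (- \sum_f kap e f * Nser f g t).
Proof.
apply: dv_eq (dv_pseries_exp t K2 knorm_ge0 (fun k => Ncoef_bound k e g)) _.
apply/cvg_lim => //.
have -> : pseries (fun k => Ncoef k.+1 e g / k`!%:R) t =
    (fun N => - (\sum_f (kap e f * pseries (fun k => Ncoef k f g / k`!%:R) t N))).
  apply/funext => N; rewrite /pseries /series /=.
  under [in RHS]eq_bigr do rewrite mulr_sumr.
  rewrite exchange_big/= -sumrN; apply: eq_bigr => k _.
  rewrite !mxE mulNr mulNr; congr (- _); rewrite !mulr_suml.
  by apply: eq_bigr => f _; ring.
apply: cvgN.
apply: cvg_sumR => f; apply: cvgM; first exact: cvg_cst.
exact: (cvg_pseries_exp K2 knorm_ge0 (fun k => Ncoef_bound k f g)).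
Qed.

Lemma Nser_cont e g : continuous (Nser e g).
Proof. by apply: dv_cont => x; exact: dv_Nser. Qed.

(** Cut off to [t >= 0], so that convolution with it involves past values only. *)
Definition Nker e g t : R := if 0 <= t then Nser e g t else 0.

Lemma mf_Nker e g : mf (Nker e g).
Proof.
rewrite /Nker; apply: measurable_fun_ifT => //.
  by apply: measurable_fun_ler; [exact: measurable_cst|exact: measurable_id].
by apply: mf_cont; exact: Nser_cont.
Qed.

Lemma Nker_bound e g t : `|Nker e g t| <= 2 * knorm * ew (- knorm) t.
Proof.
rewrite /Nker /ew mulNr opprK; case: ifP => _; first exact: Nser_bound.
by rewrite normr0 mulr_ge0// expR_ge0.
Qed.

(** The differential equation [N' = - kap N] with [N(0) = 2 kap], integrated from 0; this is the
    resolvent equation on which [ext_symS] relies. *)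
Lemma Nker_eq e g t : 0 <= t ->
  Nker e g t = 2 * kap e g - \sum_f kap e f * prim (Nker f g) t.
Proof.
move=> t0; rewrite /Nker t0.
have P f : prim (Nker f g) t = prim (Nser f g) t.
  rewrite (prim_itv t0 (mf_Nker f g)) (prim_itv t0 (mf_cont (@Nser_cont f g))).
  apply: eq_Rintegral => x; rewrite inE /= in_itv /= => /andP[x0 _].
  by rewrite /Nker x0.
under eq_bigr do rewrite P.
have := @prim_FTC R (fun t => - \sum_f kap e f * Nser f g t) (Nser e g) t
  (dv_Nser e g) _.
have cN (f : 'I_n) : ig (fun r => Nser f g r * chi t r).
  by apply: ig_prim_continuous; exact: Nser_cont.
have -> : prim (fun t => - \sum_f kap e f * Nser f g t) t =
   - \sum_f kap e f * prim (Nser f g) t.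
  rewrite /prim.
  under [in RHS]eq_bigr do rewrite -IntZ//.
  rewrite -Int_sum => [|f]; last exact: igZ.
  rewrite -IntN; last by apply: ig_sum => f; exact: igZ.
  apply: Int_ext => r; rewrite mulNr mulr_suml; congr (- _).
  by apply: eq_bigr => f _; rewrite mulrA.
have -> : Nser e g 0 = 2 * kap e g by rewrite /Nser pseries0 /= fact0 divr1 mxE.
move=> H.
rewrite -[Nser e g t](subrK (2 * kap e g)) -H; first by rewrite addrC.
move=> x; apply: cvgN; apply: cvg_sumR => f; apply: cvgM; first exact: cvg_cst.
exact: Nser_cont.
Qed.

End ResolventKernel.

(** * Half-line norms and one-sided convolutions *)

Section HalfLine.
Variable R : realType.
Local Notation mu := (@lebesgue_measure R).
Implicit Types (f g a N : R -> R) (w l b c s : R).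

Definition hnorm w f := Int (fun s => `|f s| * ew w s * (0 < s)%R%:R).

Lemma mf_ind_gt (c : R) : mf (fun s => (c < s)%R%:R).
Proof. by apply: mf_lt; [exact: mf_cst|exact: mf_id]. Qed.

Lemma ig_ind f P : mf P -> (forall s, 0 <= P s <= 1) -> ig f ->
  ig (fun s => f s * P s).
Proof.
move=> mP P01 fi; apply: (ig_dom _ _ (ig_abs fi)).
  by apply: mfM => //; exact: ig_mf.
move=> s; have /andP[P0 P1] := P01 s.
by rewrite normrM (ger0_norm P0) ler_piMr.
Qed.

Lemma ind01 (b : bool) : 0 <= (b%:R : R) <= 1.
Proof. by case: b; rewrite /= ?lexx ?ler01. Qed.

Lemma hnorm_ig w f : wi w f -> ig (fun s => `|f s| * ew w s * (0 < s)%R%:R).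
Proof.
move=> fi; apply: ig_ind; [exact: mf_ind_gt|by move=> s; exact: ind01|exact: wi_abs].
Qed.

Lemma hnorm_ge0 w f : 0 <= hnorm w f.
Proof. by apply: Int_ge0 => s; rewrite !mulr_ge0. Qed.

Lemma wnorm_hnorm w f : wi w f -> wnorm w f = hnorm w f + hnorm w (fun s => f (- s)).
Proof.
move=> fi; have fni := wi_neg fi.
have i2 := ig_refl 0 (hnorm_ig fni).
rewrite {2}/hnorm -(Int_refl 0 (hnorm_ig fni)) -IntD //; last exact: hnorm_ig.
apply: Int_aeq.
- exact: ig_mf (wi_abs fi).
- by apply: mfD; apply: ig_mf => //; exact: hnorm_ig.
apply: filterS (aeneq (0:R)) => x x0.
rewrite sub0r opprK ewN oppr_gt0 -mulrDr.
by move: x0; case: ltgtP => // _ _ /=; rewrite ?addr0 ?add0r mulr1.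
Qed.

Lemma hnormD w f g : wi w f -> wi w g ->
  hnorm w (fun s => f s + g s) <= hnorm w f + hnorm w g.
Proof.
move=> fi gi; rewrite -IntD; try exact: hnorm_ig.
apply: Int_le => [||s].
- exact: hnorm_ig (wiD fi gi).
- by apply: igD; exact: hnorm_ig.
- by rewrite -!mulrDl -!mulrA ler_wpM2r ?mulr_ge0// ler_normD.
Qed.

Lemma hnorm_sum w (I : finType) (F : I -> R -> R) : (forall i, wi w (F i)) ->
  hnorm w (fun s => \sum_i F i s) <= \sum_i hnorm w (F i).
Proof.
move=> Fi; rewrite -Int_sum; last by move=> i; exact: hnorm_ig.
apply: Int_le => [||s].
- by apply: hnorm_ig; exact: wi_sum.
- by apply: ig_sum => i; exact: hnorm_ig.
- rewrite -mulr_suml -mulr_suml -!mulrA ler_wpM2r ?mulr_ge0//.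
  exact: ler_norm_sum.
Qed.

Lemma hnormZ w c f : wi w f -> hnorm w (fun s => c * f s) = `|c| * hnorm w f.
Proof.
move=> fi; rewrite -IntZ; last exact: hnorm_ig.
by apply: Int_ext => s; rewrite normrM !mulrA.
Qed.

Lemma hnormN w f : hnorm w (fun s => - f s) = hnorm w f.
Proof. by apply: Int_ext => s; rewrite normrN. Qed.

Lemma chi_pos s r : 0 < s -> chi s r = ((0 < r) && (r <= s))%R%:R.
Proof.
move=> s0; rewrite /chi; have [r0|r0] := leP r 0.
  by rewrite (le_trans r0 (ltW s0)) subrr.
by case: (r <= s); rewrite subr0.
Qed.

Lemma exponential_pdf_le (l x : R) : 0 < l -> exponential_pdf l x <= l.
Proof.
move=> l0; have [x0|x0] := leP 0 x; last by rewrite lt0_exponential_pdf// ltW.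
rewrite (exponential_pdfE l x0) -[leRHS]mulr1 ler_wpM2l ?(ltW l0)// -expR0 ler_expR.
by rewrite mulNr oppr_le0 mulr_ge0// ltW.
Qed.

(** Interchanging the integrals leaves the tail of the weight beyond [r], which is [l^-1] times its
    value at [r]. This factor is the source of smallness in the a priori estimate; the weight
    [w < l] guarantees that the primitive is integrable for the weight [l]. *)
Lemma hnorm_prim w l a : 0 < w -> w < l -> wi w a ->
  hnorm l (prim a) <= l^-1 * hnorm l a.
Proof.
move=> w0 wl ai; have l0 : 0 < l by lra.
have ali := wi_le (ltW wl) ai.
have pi : wi l (prim a) := wi_prim (ltW w0) wl ai.
have Ei := ig_exponential l0.
have Ai := hnorm_ig ali.
have H := ig2_conv Ai Ei.
(* An exponential density of mass 1 in [s] is inserted, so that both sides are integrals over [s]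
   and can be compared pointwise. *)
have -> : l^-1 * hnorm l a = Int (fun s => l^-1 * Int (fun r =>
    `|a r| * ew l r * (0 < r)%R%:R * exponential_pdf l (s - r))).
  rewrite IntZ; last exact: (ig2_Int H).
  rewrite (ig2_swap H); congr (_ * _); apply: Int_ext => r.
  rewrite IntZ; last exact: (ig_shift (- r) Ei).
  by rewrite (Int_shift (- r) Ei) Int_exponential// mulr1.
apply: Int_le.
- exact: hnorm_ig.
- by apply: igZ; exact: (ig2_Int H).
move=> s; have [s0|s0] := ltP 0 s; last first.
  rewrite mulr0 mulr_ge0 ?invr_ge0 ?(ltW l0)//; apply: Int_ge0 => r.
  by rewrite !mulr_ge0// exponential_pdf_ge0// ltW.
rewrite mulr1.
have ip := ig_prim s (ltW w0) ai.
apply: le_trans (ler_wpM2r (ew_ge0 l s) (Int_abs ip)) _.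
rewrite mulrC -IntZ; last exact: ig_abs.
have iE : ig (fun r => `|a r| * ew l r * (0 < r)%R%:R * exponential_pdf l (s - r)).
  apply: (ig_dom _ _ (igZ l Ai)).
    apply: mfM; first exact: ig_mf.
    by apply: mf_refl; exact: ig_mf.
  move=> r; rewrite normrM (ger0_norm (_ : 0 <= `|a r| * _ * _)) ?mulr_ge0//.
  rewrite mulrC ler_wpM2r ?mulr_ge0//.
  by rewrite ger0_norm ?exponential_pdf_ge0 ?(ltW l0)//; exact: exponential_pdf_le.
rewrite -IntZ//; apply: Int_le => [||r].
- by apply: igZ; exact: ig_abs.
- exact: igZ.
rewrite normrM chi_pos//; have [r0|r0] /= := ltP 0 r; last first.
  by rewrite normr0 !mulr0 mul0r mulr0.
have [rs|rs] /= := leP r s; last first.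
  rewrite normr0 !mulr0 mulr_ge0 ?invr_ge0 ?(ltW l0)//.
  by rewrite !mulr_ge0// exponential_pdf_ge0// ltW.
rewrite normr1 !mulr1.
have sr : 0 <= s - r by lra.
rewrite (exponential_pdfE l sr).
have -> : ew l s = ew l r * expR (- l * (s - r)).
  by rewrite /ew !ger0_norm ?(ltW s0) ?(ltW r0)// -expRD; congr expR; ring.
rewrite le_eqVlt; apply/orP; left; apply/eqP; field.
by rewrite gt_eqF.
Qed.

Definition posf f := forall s, s < 0 -> f s = 0.

(** The kernel [N] may grow, but for causal [f] and [N] only [0 <= r <= s] contributes, where the
    growth of [N (s - r)] is bounded by that at [s]. *)
Lemma pconv_dom b w (C : R) f N s r : 0 <= b -> 0 <= w -> posf f -> posf N ->
  (forall t, `|N t| <= C * ew (- b) t) ->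
  `|f r * N (s - r)| <= C * ew (- b) s * ew (- w) s * (`|f r| * ew w r).
Proof.
move=> b0 w0 pf pN NC.
have C0 : 0 <= C.
  by have := le_trans (normr_ge0 _) (NC 0); rewrite pmulr_lge0.
have [r0|r0] := ltP r 0; first by rewrite pf// mul0r normr0 mul0r mulr0.
have [rs|rs] := ltP (s - r) 0.
  by rewrite pN// mulr0 normr0 !mulr_ge0.
rewrite normrM mulrC.
have s0 : 0 <= s by lra.
have E1 : `|N (s - r)| <= C * ew (- b) s.
  apply: le_trans (NC _) _; rewrite ler_wpM2l// /ew ler_expR !ger0_norm//.
  by have := mulr_ge0 b0 r0; lra.
have E2 : 1 <= ew (- w) s * ew w r.
  rewrite /ew -expRD -expR0 ler_expR !ger0_norm//.
  by have := mulr_ge0 w0 rs; lra.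
have -> : C * ew (- b) s * ew (- w) s * (`|f r| * ew w r) =
  (C * ew (- b) s) * `|f r| * (ew (- w) s * ew w r) by ring.
rewrite -[leLHS]mulr1; apply: ler_pM => //.
by rewrite ler_wpM2r.
Qed.

Lemma pconv_ig b w (C : R) f N s : 0 <= b -> 0 <= w -> posf f -> posf N -> mf N ->
  (forall t, `|N t| <= C * ew (- b) t) -> wi w f ->
  ig (fun r => f r * N (s - r)).
Proof.
move=> b0 w0 pf pN mN NC fi.
apply: (ig_dom _ _ (igZ (C * ew (- b) s * ew (- w) s) (wi_abs fi))).
  by apply: mfM; [exact: wi_mf fi|exact: mf_refl].
by move=> r; exact: (pconv_dom s r b0 w0 pf pN NC).
Qed.

(** Young's inequality for causal functions, where the weight is exactly multiplicative. The growth
    [b] of the kernel leaves the effective decay [w - b], so the operator norm tends to 0 as [w]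
    grows. *)
Lemma pconv_wi b w (C : R) f N : 0 <= b -> b < w -> posf f -> posf N -> mf N ->
  (forall t, `|N t| <= C * ew (- b) t) -> wi w f ->
  wi w (conv f N) /\ wnorm w (conv f N) <= C * (2 / (w - b)) * wnorm w f.
Proof.
move=> b0 bw pf pN mN NC fi; have w0 : 0 <= w by lra.
have wb0 : 0 < w - b by lra.
have ki := igZ C (ig_ew wb0).
have H := ig2_conv (wi_abs fi) ki.
have C0 : 0 <= C.
  by have := le_trans (normr_ge0 _) (NC 0); rewrite pmulr_lge0.
have D s r : `|f r * N (s - r) * ew w s| <= `|f r| * ew w r * (C * ew (w - b) (s - r)).
  have RHS0 : 0 <= `|f r| * ew w r * (C * ew (w - b) (s - r)) by rewrite !mulr_ge0.
  have [r0|r0] := ltP r 0; first by rewrite pf// !mul0r normr0 !mul0r.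
  have [rs|rs] := ltP (s - r) 0; first by rewrite pN// mulr0 mul0r normr0.
  rewrite !normrM [`|ew w s|]ger0_norm//.
  have -> : ew w s = ew w r * ew w (s - r).
    have s0 : 0 <= s by lra.
    by rewrite /ew !ger0_norm// -expRD; congr expR; ring.
  rewrite -!mulrA ler_wpM2l// mulrCA ler_wpM2l//.
  have -> : ew (w - b) (s - r) = ew (- b) (s - r) * ew w (s - r).
    by rewrite -ewDw addrC.
  by rewrite mulrA ler_wpM2r.
have H0 : ig2 (fun s r => f r * N (s - r) * ew w s).
  apply: (ig2_dom _ D H); apply: mf2M; last exact: mf2_1 (mf_ew w).
  apply: mf2M; first exact: mf2_2 (wi_mf fi).
  by apply: mf2_comp mN _; exact: (mf2B (@mf2_fst R) (@mf2_snd R)).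
have E s : Int (fun r => f r * N (s - r) * ew w s) = conv f N s * ew w s.
  rewrite mulrC -IntZ; last exact: (pconv_ig s b0 w0 pf pN mN NC fi).
  by apply: Int_ext => r; rewrite mulrC.
split; first exact: ig_ext E (ig2_Int H0).
have -> : wnorm w (conv f N) = Int (fun s => `|Int (fun r => f r * N (s - r) * ew w s)|).
  by apply: Int_ext => s; rewrite E normrM [`|ew w s|]ger0_norm.
apply: (@le_trans _ _ (C * Int (ew (w - b)) * wnorm w f)); last first.
  rewrite ler_wpM2r ?wnorm_ge0// ler_wpM2l//; exact: Int_ew.
have -> : C * Int (ew (w - b)) * wnorm w f = Int (fun s => Int (fun r =>
   `|f r| * ew w r * (C * ew (w - b) (s - r)))).
  rewrite (ig2_swap H) -(IntZ _ (ig_ew wb0)) /wnorm -(IntZ _ (wi_abs fi)).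
  apply: Int_ext => r; rewrite mulrC -(Int_shift (- r) ki) -IntZ//.
  exact: (ig_shift (- r) ki).
apply: Int_le.
- exact/ig_abs/ig2_Int.
- exact: ig2_Int.
move=> s.
have i1 : ig (fun r => f r * N (s - r) * ew w s).
  apply: ig_ext (igZ (ew w s) (pconv_ig s b0 w0 pf pN mN NC fi)) => r.
  by rewrite mulrC.
apply: le_trans (Int_abs i1) _; apply: Int_le => [||r]; first exact: ig_abs.
  apply: (ig_dom _ _ (igZ C (wi_abs fi))).
    apply: mfM; first exact: ig_mf (wi_abs fi).
    apply: mfM; first exact: mf_cst.
    exact: mf_refl (mf_ew _).
  move=> r; rewrite ger0_norm ?mulr_ge0// ?mulr_ge0// mulrC ler_wpM2r ?mulr_ge0//.
  by rewrite ler_piMr// ew_le1// ltW.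
exact: D.
Qed.

(** Fubini moves the primitive onto the kernel. The base-point term produced by the shift vanishes
    because [N] is causal and [r >= 0] on the support of [f]. *)
Lemma prim_pconv b w (C : R) f N s : 0 <= b -> 0 <= w -> posf f -> posf N -> mf N ->
  (forall t, `|N t| <= C * ew (- b) t) -> wi w f ->
  prim (conv f N) s = conv f (prim N) s.
Proof.
move=> b0 w0 pf pN mN NC fi.
have C0 : 0 <= C.
  by have := le_trans (normr_ge0 _) (NC 0); rewrite pmulr_lge0.
have b1 : 0 <= b + 1 by lra.
have Nw : wi (b + 1) N.
  apply: (ig_dom _ _ (igZ C (ig_ew (@ltr01 R)))).
    by apply: mfM => //; exact: mf_ew.
  move=> t; rewrite normrM [`|ew _ t|]ger0_norm//.
  have -> : ew 1 t = ew (- b) t * ew (b + 1) t :> R by rewrite -ewDw addKr.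
  by rewrite mulrA ler_wpM2r.
have H : ig2 (fun t r => f r * N (t - r) * chi s t).
  apply: (ig2_dom _ _ (ig2_tensor (igZ (C * ew (- b) s * ew (- w) s * ew (- 1) s)
     (ig_ew (@ltr01 R))) (wi_abs fi))).
    apply: mf2M; last exact: mf2_1 (mf_chi s).
    apply: mf2M; first exact: mf2_2 (wi_mf fi).
    by apply: mf2_comp mN _; exact: (mf2B (@mf2_fst R) (@mf2_snd R)).
  move=> t r; rewrite normrM.
  have E := pconv_dom t r b0 w0 pf pN NC.
  have E' := chi_abs s t.
  have [ts|ts] := leP `|t| `|s|; last first.
    have -> : `|chi s t| = 0.
      have tsF : (`|t| <= `|s|) = false by rewrite leNgt ts.
      by apply/eqP; rewrite eq_le normr_ge0 andbT; move: E'; rewrite tsF.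
    by rewrite mulr0 !mulr_ge0.
  have E1 : `|chi s t| <= ew (- 1) s * ew 1 t by exact: chi_ew.
  have E2 : C * ew (- b) t * ew (- w) t <= C * ew (- b) s * ew (- w) s.
    apply: ler_pM; rewrite ?mulr_ge0//.
      by rewrite ler_wpM2l// /ew ler_expR !mulNr !opprK ler_wpM2l.
    by rewrite /ew ler_expR !mulNr !opprK ler_wpM2l.
  have -> : C * ew (- b) s * ew (- w) s * ew (-1) s * ew 1 t * (`|f r| * ew w r) =
    (C * ew (- b) s * ew (- w) s * (`|f r| * ew w r)) * (ew (-1) s * ew 1 t) by ring.
  apply: ler_pM => //; apply: le_trans E _.
  by rewrite ler_wpM2r ?mulr_ge0.
transitivity (Int (fun t => Int (fun r => f r * N (t - r) * chi s t))).
  apply: Int_ext => t; rewrite mulrC -IntZ; last exact: (pconv_ig t b0 w0 pf pN mN NC fi).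
  by apply: Int_ext => r; rewrite mulrC.
rewrite (ig2_swap H); apply: Int_ext => r.
have Ns := wi_shift (- r) b1 Nw.
transitivity (f r * prim (fun t => N (t - r)) s).
  rewrite -IntZ; last exact: (ig_prim s b1 Ns).
  by apply: Int_ext => t; rewrite mulrA.
rewrite (prim_shift (- r) s b1 Nw).
have [r0|r0] := ltP r 0; first by rewrite pf// !mul0r.
rewrite [X in _ - X](_ : _ = 0) ?subr0//.
transitivity (Int (fun t => N t * 0)).
  apply: Int_aeq.
  - by apply: mfM => //; exact: mf_chi.
  - by apply: mfM => //; exact: mf_cst.
  apply: filterS (aeneq (0 : R)) => t t0.
  have [t0'|t0'] := ltP t 0; first by rewrite pN// !mul0r.
  congr (_ * _); rewrite /chi.
  have t1 : 0 < t by rewrite lt_neqAle eq_sym t0.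
  by rewrite leNgt (le_lt_trans _ t1) ?oppr_le0// leNgt t1/= subrr.
by rewrite -[RHS](Int0 R); apply: Int_ext => t; rewrite mulr0.
Qed.

(** Fatou's lemma. Convergence is eventual equality at each point, which is how the iterates of the
    extension converge. *)
Lemma wi_limit w (S : nat -> R -> R) f (M : R) : (forall k, wi w (S k)) ->
  (forall k, wnorm w (S k) <= M) ->
  (forall s, \forall k \near \oo, S k s = f s) -> wi w f.
Proof.
move=> Si SM Sf.
have cS s : S k s @[k --> \oo] --> f s.
  by apply: cvg_near_cst.
have fm : mf f.
  apply: (measurable_fun_cvg (h := S)) => // k.
  exact: wi_mf (Si k).
apply/integrableP; split.
  by apply/measurable_EFinP; apply: mfM => //; exact: mf_ew.
apply: (@le_lt_trans _ _ M%:E); last exact: ltry.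
have F := @fatou _ _ R mu setT measurableT (fun k s => (`|S k s| * ew w s)%:E).
apply: (@le_trans _ _ (\int[mu]_x limn_einf (fun k => (`|S k x| * ew w x)%:E))%E).
  rewrite le_eqVlt; apply/orP; left; apply/eqP; apply: eq_integral => x _.
  rewrite /= normrM [`|ew w x|]ger0_norm//; apply/esym.
  have cv : (`|S k x| * ew w x)%:E @[k --> \oo] --> (`|f x| * ew w x)%:E.
    apply: cvg_near_cst; near do apply: (congr1 (fun y => (`|y| * ew w x)%:E)).
    exact: Sf.
  rewrite -(cvg_lim _ cv)//; apply: is_cvg_limn_einfE.
  by apply/cvg_ex; eexists; exact: cv.
apply: le_trans (F _ _) _.
- by move=> k; apply/measurable_EFinP; exact: ig_mf (wi_abs (Si k)).
- by move=> k x _; rewrite lee_fin mulr_ge0.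
rewrite limn_einf_lim; apply: lime_le; first exact: is_cvg_einfs.
apply: nearW => k; rewrite /einfs/=; apply: (@le_trans _ _ (wnorm w (S k))%:E).
  apply: ereal_inf_lbound; exists k => //=.
  by rewrite /wnorm EFin_Int//; exact: wi_abs.
by rewrite lee_fin.
Unshelve. all: by end_near.
Qed.

End HalfLine.

(** * Extension of network data to the line *)

Section Network.
Variables (R : realType) (n : nat).
Variables (bar : 'I_n -> 'I_n) (tau : 'I_n -> R) (kap : 'M[R]_n).
Hypotheses (barK : involutive bar) (tau_gt0 : forall e, 0 < tau e).
Hypothesis tau_bar : forall e, tau (bar e) = tau e.
Implicit Types (V F u v : 'I_n -> R -> R) (w s : R) (e f g : 'I_n).

(* symS is the integrated form of V e' + V e' o opp = \sum_f kap e f (V f + V f o opp),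
   which at 0 reads V e' 0 = \sum_f kap e f V f 0; unlike this boundary condition it
   is preserved by convolution with even kernels. *)
Definition symC V := forall e s, V (bar e) s = V e (tau e - s).
Definition symS V := forall e s,
  V e s - V e (- s) = \sum_f kap e f * prim (fun r => V f r + V f (- r)) s.
Definition wiV w V := forall e, wi w (V e).
Definition cut v e s : R := v e s * ((0 <= s) && (s <= tau e))%R%:R.
Definition cutnorm v : R := \sum_e Int (fun s => `|cut v e s|).

(** A positive lower bound of all lengths; the harmonic form with the summand 1 avoids a minimum
    over a possibly empty index set. *)
Definition tmin : R := (1 + \sum_e (tau e)^-1)^-1.

Lemma tmin_gt0 : 0 < tmin.
Proof.
rewrite invr_gt0 ltr_pwDl//; apply: sumr_ge0 => e _.
by rewrite invr_ge0 ltW.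
Qed.

Lemma tmin_le e : tmin <= tau e.
Proof.
rewrite -[leRHS]invrK lef_pV2 ?posrE ?invr_gt0//.
  rewrite (bigD1 e)//= addrCA lerDl addr_ge0//; apply: sumr_ge0 => f _.
  by rewrite invr_ge0 ltW.
by rewrite -invr_gt0; exact: tmin_gt0.
Qed.

(** The summands serve the estimates of [om_facts]: the multiples of [knorm kap] bring the Volterra
    correction in [Hop] to norm at most 1, and [5 / tmin] gives [expR (w * tmin) >= 1 + 5], so that
    a delay by [tmin] gains the factor 1/6. *)
Definition om : R := 1 + 3 * knorm kap + 4 * n%:R * knorm kap + 5 / tmin.

Lemma om_facts w : om <= w -> [/\ 0 < w, 2 * knorm kap <= w,
  knorm kap < w, expR (- (w * tmin)) <= 6^-1 &
  n%:R * (2 * knorm kap * (2 / (w - knorm kap))) <= 1].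
Proof.
have K0 := knorm_ge0 kap; have t0 := tmin_gt0.
have nK : 0 <= n%:R * knorm kap by rewrite mulr_ge0.
have T0 : 0 < 5 / tmin by rewrite divr_gt0.
rewrite /om => ow; have w0 : 0 < w by nra.
have wK : knorm kap < w by nra.
split => //; first nra.
- rewrite expRN lef_pV2 ?posrE ?expR_gt0//.
  have : 5 / tmin <= w by nra.
  rewrite ler_pdivrMr// => h.
  have := expR_ge1Dx (w * tmin); lra.
- have wK0 : 0 < w - knorm kap by lra.
  have -> : n%:R * (2 * knorm kap * (2 / (w - knorm kap))) =
     (4 * (n%:R * knorm kap)) / (w - knorm kap) by field; rewrite gt_eqF.
  rewrite ler_pdivrMr// mul1r; nra.
Qed.

Lemma sum_bar (G : 'I_n -> R) : \sum_e G (bar e) = \sum_e G e.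
Proof. by rewrite [RHS](reindex bar)//; exists bar => e _; exact: barK. Qed.

(** Beyond [tau e] consistency reads [V e s = V (bar e) (- (s - tau e))]: that part is a copy of the
    negative half of the reversed edge, delayed by [tau e] and hence damped by the weight. *)
Lemma symC_hnorm w V e : 0 <= w -> wiV w V -> symC V ->
  hnorm w (V e) <= Int (fun s => `|cut V e s|) +
    expR (- (w * tau e)) * hnorm w (fun s => V (bar e) (- s)).
Proof.
move=> w0 Vi VC; set c := expR _.
have c0 : 0 <= c by exact: expR_ge0.
pose G t := `|V (bar e) (- t)| * ew w t * (0 < t)%R%:R.
have Gi : ig G by exact: hnorm_ig (wi_neg (Vi _)).
have Vim := wi_mf (Vi e).
have mcut : mf (fun s => ((0 <= s) && (s <= tau e))%R%:R : R).
  have -> : (fun s : R => ((0 <= s) && (s <= tau e))%R%:R : R) =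
    (fun s => (0 <= s)%R%:R * (s <= tau e)%R%:R).
    by apply/funext => s; case: (0 <= s); case: (s <= _); rewrite /= ?mulr1 ?mulr0.
  by apply: mfM; apply: mf_le; [exact: mf_cst|exact: mf_id|exact: mf_id|exact: mf_cst].
have cuti : ig (fun s => `|cut V e s|).
  apply/ig_abs/(ig_dom _ _ (igZ (ew (- w) (tau e)) (wi_abs (Vi e)))).
    exact: mfM.
  move=> s; rewrite /cut; case: (boolP (_ && _)) => [/andP[s0 st]|_] /=; last first.
    by rewrite mulr0 normr0 !mulr_ge0.
  rewrite mulr1 mulrCA ler_peMr// /ew -expRD -expR0 ler_expR !ger0_norm ?(ltW (tau_gt0 _))//.
  by have := ler_wpM2l w0 st; lra.
have -> : hnorm w (fun s => V (bar e) (- s)) = Int (fun s => G (s + - tau e)).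
  by rewrite (Int_shift (- tau e) Gi).
rewrite -IntZ; last exact: (ig_shift (- tau e) Gi).
rewrite -IntD//; last first.
  exact: igZ (ig_shift (- tau e) Gi).
apply: Int_le => [||s].
- exact: hnorm_ig.
- by apply: igD => //; exact: igZ (ig_shift (- tau e) Gi).
rewrite /G; have [s0|s0] := ltP 0 s; last first.
  by rewrite mulr0 addr_ge0// !mulr_ge0.
have [st|st] := leP s (tau e).
  rewrite /cut st (ltW s0) /= !mulr1 -[leLHS]addr0 lerD//.
    by rewrite ler_piMr// ew_le1.
  by rewrite !mulr_ge0.
have stF : (s <= tau e) = false by apply/negbTE; rewrite -ltNge.
rewrite /cut (ltW s0) stF /= mulr0 normr0 add0r mulr1 subr_gt0 st mulr1.
have -> : V e s = V (bar e) (- (s - tau e)).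
  by rewrite VC; congr (V e _); ring.
rewrite mulrCA ler_wpM2l// /c /ew -expRD ler_expR !ger0_norm ?(ltW s0)//; lra.
Qed.

(** The relation [symS] expresses the negative half through the positive half and primitives, on
    which [hnorm_prim] gains [w^-1]. *)
Lemma symS_hnorm w1 w V e : 0 < w1 -> w1 < w -> wiV w1 V -> symS V ->
  hnorm w (fun s => V e (- s)) <= hnorm w (V e) +
    \sum_f `|kap e f| * (w^-1 * (hnorm w (V f) + hnorm w (fun s => V f (- s)))).
Proof.
move=> w10 w1w Vi VS; have w0 : 0 < w by lra.
have Viw f : wi w (V f) := wi_le (ltW w1w) (Vi f).
have ai f : wi w1 (fun r => V f r + V f (- r)).
  by apply: wiD => //; exact: wi_neg.
have aiw f : wi w (fun r => V f r + V f (- r)).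
  by apply: wiD => //; exact: wi_neg.
have pi f : wi w (prim (fun r => V f r + V f (- r))) := wi_prim (ltW w10) w1w (ai f).
have si : wi w (fun s => \sum_f kap e f * prim (fun r => V f r + V f (- r)) s).
  by apply: wi_sum => f; exact: wiZ.
have -> : (fun s => V e (- s)) =
   (fun s => V e s + - \sum_f kap e f * prim (fun r => V f r + V f (- r)) s).
  by apply/funext => s; rewrite -VS; ring.
have sni : wi w (fun s => - \sum_f kap e f * prim (fun r => V f r + V f (- r)) s).
  by move: (igN si); apply: ig_ext => s; rewrite mulNr.
apply: le_trans (hnormD (Viw e) sni) _.
rewrite hnormN lerD2l; apply: le_trans (hnorm_sum _) _ => [f|]; first exact: wiZ.
apply: ler_sum => f _; rewrite hnormZ// ler_wpM2l//.
apply: le_trans (hnorm_prim w10 w1w (ai f)) _.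
rewrite ler_wpM2l ?invr_ge0 ?(ltW w0)//; apply: hnormD => //; exact: wi_neg.
Qed.

(* The reflection symmetries make the part of V beyond the interval decay:
   this a priori estimate yields both uniqueness and boundedness of the extension. *)
Lemma apriori w1 w V : 0 < w1 -> w1 < w -> om <= w -> wiV w1 V -> symC V -> symS V ->
  \sum_e wnorm w (V e) <= 8 * cutnorm V.
Proof.
move=> w10 w1w omw Vi VC VS.
have [w0 wK _ wt _] := om_facts omw; have K0 := knorm_ge0 kap.
have Viw f : wi w (V f) := wi_le (ltW w1w) (Vi f).
set P := \sum_e hnorm w (V e); set M := \sum_e hnorm w (fun s => V e (- s)).
have P0 : 0 <= P by apply: sumr_ge0 => e _; exact: hnorm_ge0.
have M0 : 0 <= M by apply: sumr_ge0 => e _; exact: hnorm_ge0.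
have -> : \sum_e wnorm w (V e) = P + M.
  by rewrite -big_split; apply: eq_bigr => e _; rewrite wnorm_hnorm.
have H1 : P <= cutnorm V + 6^-1 * M.
  rewrite /M -sum_bar mulr_sumr -big_split /=; apply: ler_sum => e _.
  apply: le_trans (symC_hnorm _ (ltW w0) Viw VC) _.
  rewrite lerD2l ler_wpM2r ?hnorm_ge0//; apply: le_trans wt.
  by rewrite ler_expR lerN2 ler_wpM2l ?tmin_le// ltW.
have H2 : M <= P + 2^-1 * (P + M).
  apply: (@le_trans _ _ (P + \sum_e \sum_f `|kap e f| *
     (w^-1 * (hnorm w (V f) + hnorm w (fun s => V f (- s)))))).
    rewrite -big_split; apply: ler_sum => e _; exact: symS_hnorm w10 w1w Vi VS.
  rewrite lerD2l exchange_big /= -big_split mulr_sumr; apply: ler_sum => f _.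
  rewrite -mulr_suml mulrA ler_wpM2r ?addr_ge0 ?hnorm_ge0//.
  rewrite ler_pdivrMr// mulrC; apply: le_trans (knorm_col kap f) _; lra.
(* [H2] gives [M <= 3 * P]; inserted in [H1] this yields [P <= 2 * cutnorm V] and
   [M <= 6 * cutnorm V], whence the constant 8. *)
lra.
Qed.

Lemma apriori_eq w1 V : 0 < w1 -> wiV w1 V -> symC V -> symS V ->
  cutnorm V = 0 -> forall e, aeq (V e) (fun=> 0).
Proof.
move=> w10 Vi VC VS V0 e; pose w := Num.max om (w1 + 1).
have w1w : w1 < w by rewrite /w lt_max (_ : w1 < w1 + 1) ?orbT// ltrDl.
have omw : om <= w by rewrite /w le_max lexx.
have := apriori w10 w1w omw Vi VC VS.
rewrite V0 mulr0 => H.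
have : wnorm w (V e) = 0.
  apply/eqP; rewrite eq_le wnorm_ge0 andbT; apply: le_trans H.
  rewrite (bigD1 e)//= lerDl; apply: sumr_ge0 => f _; exact: wnorm_ge0.
have Vw := wi_le (ltW w1w) (Vi e).
move=> H0; have := Int_abs0 Vw _.
have -> : Int (fun x => `|V e x * ew w x|) = 0.
  by rewrite -[RHS]H0; apply: Int_ext => s; rewrite normrM [X in _ * X]ger0_norm.
move=> /(_ erefl); apply: filterS => s /eqP.
by rewrite mulf_eq0 (gt_eqF (ew_gt0 _ _)) orbF => /eqP.
Qed.

(* Hop solves symS for the values h s = V (- s): F - h = kap prim (F + h) gives
   h = F - N * F with N t = 2 kap exp(- t kap).  Psi continues beyond tau e through
   symC; each iteration gains at least tmin, which bounds all lengths from below. *)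
Definition Hop F e s : R := F e s - \sum_f conv (F f) (Nker kap e f) s.
Definition Psi v F e s : R :=
  cut v e s + (tau e < s)%R%:R * Hop F (bar e) (s - tau e).
Definition Siter v k : 'I_n -> R -> R := iter k (Psi v) (fun _ _ => 0).
(** At the point [s] the iterates are stationary as soon as [s < k * tmin]; stopping there yields
    the fixed point of [Psi] without a limit process. *)
Definition Fext v e s : R := Siter v (Num.truncn (`|s| / tmin)).+1 e s.
Definition ext v e s : R := if 0 <= s then Fext v e s else Hop (Fext v) e (- s).

Definition posV F := forall e, posf (F e).

Lemma Nker_pos e f : posf (Nker kap e f).
Proof. by move=> s s0; rewrite /Nker leNgt s0. Qed.

Let K0 := knorm_ge0 kap.

Lemma Hop_wi w F : om <= w -> posV F -> wiV w F -> wiV w (Hop F).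
Proof.
move=> omw Fp Fi e; have [_ _ Kw _ _] := om_facts omw.
apply: wiB => //; apply: wi_sum => f.
by case: (pconv_wi K0 Kw (Fp f) (@Nker_pos e f) (mf_Nker _ _ _) (Nker_bound _ _ _) (Fi f)).
Qed.

(** Identity plus a Volterra operator whose norm is at most 1 by the choice of [om]. *)
Lemma Hop_wnorm w F : om <= w -> posV F -> wiV w F ->
  \sum_e wnorm w (Hop F e) <= 2 * \sum_e wnorm w (F e).
Proof.
move=> omw Fp Fi; have [w0 _ Kw _ nK] := om_facts omw.
have ci e f : wi w (conv (F f) (Nker kap e f)).
  by case: (pconv_wi K0 Kw (Fp f) (@Nker_pos e f) (mf_Nker _ _ _) (Nker_bound _ _ _) (Fi f)).
apply: (@le_trans _ _ (\sum_e (wnorm w (F e) +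
    \sum_f (2 * knorm kap * (2 / (w - knorm kap))) * wnorm w (F f)))).
  apply: ler_sum => e _.
  have Hi := Hop_wi omw Fp Fi e.
  apply: (@le_trans _ _ (wnorm w (F e) + \sum_f wnorm w (conv (F f) (Nker kap e f)))).
    rewrite /wnorm -Int_sum; last by move=> f; exact: wi_abs.
    rewrite -IntD; last 2 first.
    - exact: wi_abs.
    - by apply: ig_sum => f; exact: wi_abs.
    apply: Int_le => [||s]; first exact: wi_abs.
      by apply: igD; [exact: wi_abs|apply: ig_sum => f; exact: wi_abs].
    rewrite -mulr_suml -mulrDl ler_wpM2r//; apply: le_trans (ler_normB _ _) _.
    by rewrite lerD2l ler_norm_sum.
  rewrite lerD2l; apply: ler_sum => f _.
  by case: (pconv_wi K0 Kw (Fp f) (@Nker_pos e f) (mf_Nker _ _ _) (Nker_bound _ _ _) (Fi f)).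
rewrite big_split/= -mulr_sumr sumr_const card_ord -mulrnAl -mulr_natl.
have X0 : 0 <= \sum_e wnorm w (F e) by apply: sumr_ge0 => e _; exact: wnorm_ge0.
have := ler_wpM2r X0 nK; lra.
Qed.

Definition data v := forall e, ig (cut v e).

Lemma cut_wi w v : 0 <= w -> data v -> wiV w (cut v).
Proof.
move=> w0 dv e; apply: (ig_dom _ _ (ig_abs (dv e))).
  by apply: mfM; [exact: ig_mf (dv e)|exact: mf_ew].
by move=> s; rewrite normrM [X in _ * X]ger0_norm// ler_piMr// ew_le1.
Qed.

Lemma cut_wnorm w v e : 0 <= w -> data v -> wnorm w (cut v e) <= Int (fun s => `|cut v e s|).
Proof.
move=> w0 dv; apply: Int_le => [||s].
- exact: wi_abs (cut_wi w0 dv e).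
- exact: ig_abs (dv e).
- by rewrite ler_piMr// ew_le1.
Qed.

Lemma cut0 v e s : s < 0 -> cut v e s = 0.
Proof. by move=> s0; rewrite /cut [0 <= s]leNgt s0 mulr0. Qed.

Lemma cut_tau v e s : tau e < s -> cut v e s = 0.
Proof. by move=> s0; rewrite /cut [s <= _]leNgt s0 andbF mulr0. Qed.

Lemma cut_in v e s : 0 <= s -> s <= tau e -> cut v e s = v e s.
Proof. by move=> s0 st; rewrite /cut s0 st mulr1. Qed.

Lemma cutnorm_ge0 v : 0 <= cutnorm v.
Proof. by apply: sumr_ge0 => e _; apply: Int_ge0. Qed.

Lemma Psi_pos v F : posV (Psi v F).
Proof.
move=> e s s0; rewrite /Psi cut0// add0r ltNge (ltW (lt_trans s0 _)) ?mul0r//.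
Qed.

Lemma delay_wi w G e : 0 <= w -> wi w G ->
  wi w (fun s => (tau e < s)%R%:R * G (s - tau e)) /\
  wnorm w (fun s => (tau e < s)%R%:R * G (s - tau e)) <= expR (- (w * tau e)) * wnorm w G.
Proof.
move=> w0 Gi; have Gs := wi_shift (- tau e) w0 Gi.
have i1 : wi w (fun s => (tau e < s)%R%:R * G (s - tau e)).
  apply: (wi_dom (g := fun s => `|G (s - tau e)|)).
  - by apply: mfM; [exact: mf_ind_gt|exact: wi_mf Gs].
  - by move=> s; rewrite normrM; case: (_ < _); rewrite /= ?normr0 ?normr1 ?mul0r ?mul1r.
  - exact: wi_abs.
split => //; rewrite /wnorm -(Int_shift (- tau e) (wi_abs Gi)) -IntZ; last first.
  exact: (ig_shift (- tau e) (wi_abs Gi)).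
apply: Int_le => [||s]; first exact: wi_abs.
  exact: igZ (ig_shift (- tau e) (wi_abs Gi)).
have [st|st] := ltP (tau e) s; last first.
  by rewrite /= mul0r normr0 mul0r !mulr_ge0// expR_ge0.
rewrite /= mul1r mulrCA ler_wpM2l// /ew -expRD ler_expR.
have s0 : 0 < s by apply: lt_trans st.
rewrite !ger0_norm ?(ltW s0)//; lra.
Qed.

Lemma Psi_wi w v F : om <= w -> data v -> posV F -> wiV w F -> wiV w (Psi v F).
Proof.
move=> omw dv Fp Fi e; have [/ltW w0 _ _ _ _] := om_facts omw.
apply: wiD; first exact: cut_wi.
by case: (delay_wi e w0 (Hop_wi omw Fp Fi (bar e))).
Qed.

(** The factor 1/3 is the bound 2 for [Hop] times the damping 1/6 of the delay; being below 1, it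
    keeps the iterates bounded by a multiple of the data. *)
Lemma Psi_wnorm w v F : om <= w -> data v -> posV F -> wiV w F ->
  \sum_e wnorm w (Psi v F e) <= cutnorm v + 3^-1 * \sum_e wnorm w (F e).
Proof.
move=> omw dv Fp Fi; have [/ltW w0 _ _ wt _] := om_facts omw.
have Hi := Hop_wi omw Fp Fi.
apply: (@le_trans _ _ (cutnorm v + 6^-1 * \sum_e wnorm w (Hop F (bar e)))).
  rewrite mulr_sumr -big_split /=; apply: ler_sum => e _.
  have [i1 n1] := delay_wi e w0 (Hi (bar e)).
  have ci := cut_wi w0 dv e.
  apply: (@le_trans _ _ (wnorm w (cut v e) +
     wnorm w (fun s => (tau e < s)%R%:R * Hop F (bar e) (s - tau e)))).
    rewrite /wnorm -IntD; last 2 first.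
    - exact: wi_abs.
    - exact: wi_abs.
    apply: Int_le => [||s]; first exact: wi_abs (Psi_wi omw dv Fp Fi e).
      by apply: igD; exact: wi_abs.
    by rewrite -mulrDl ler_wpM2r// ler_normD.
  apply: lerD; first exact: cut_wnorm.
  apply: le_trans n1 _; rewrite ler_wpM2r ?wnorm_ge0//; apply: le_trans wt.
  by rewrite ler_expR lerN2 ler_wpM2l ?tmin_le.
rewrite (sum_bar (fun e => wnorm w (Hop F e))).
have := Hop_wnorm omw Fp Fi; lra.
Qed.

Lemma Siter_pos v k : posV (Siter v k).
Proof. by case: k => [|k] e s s0 //; exact: Psi_pos. Qed.

Lemma Siter_wi w v k : om <= w -> data v -> wiV w (Siter v k).
Proof.
move=> omw dv; elim: k => [|k IH].
  by move=> e; apply: ig_ext (ig0 R) => s; rewrite mul0r.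
by apply: Psi_wi => //; exact: Siter_pos.
Qed.

Lemma Siter_wnorm w v k : om <= w -> data v ->
  \sum_e wnorm w (Siter v k e) <= 2 * cutnorm v.
Proof.
move=> omw dv; have c0 := cutnorm_ge0 v; elim: k => [|k IH].
  rewrite big1 ?mulr_ge0// => e _; rewrite -[RHS](Int0 R); apply: Int_ext => s.
  by rewrite /= normr0 mul0r.
have := Psi_wnorm omw dv (@Siter_pos v k) (Siter_wi k omw dv).
rewrite -[Psi v (Siter v k)]/(Siter v k.+1); lra.
Qed.

Definition agree (a : R) F G := forall e s, s < a -> F e s = G e s.

Lemma Hop_causal a F G : agree a F G -> agree a (Hop F) (Hop G).
Proof.
move=> FG e s sa; rewrite /Hop FG//; congr (_ - _); apply: eq_bigr => f _.
apply: Int_ext => r; have [ra|ra] := ltP r a; first by rewrite FG.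
by rewrite Nker_pos ?mulr0//; lra.
Qed.

(** [Hop] uses past values only, and the delay [tau e >= tmin] moves the horizon of agreement
    forward by [tmin]. *)
Lemma Psi_causal v a F G : agree a F G -> agree (a + tmin) (Psi v F) (Psi v G).
Proof.
move=> FG e s sa; rewrite /Psi (Hop_causal FG)//.
by have := tmin_le e; lra.
Qed.

Lemma Siter_agreeS v k : agree (k%:R * tmin) (Siter v k.+1) (Siter v k).
Proof.
elim: k => [|k IH].
  by move=> e s; rewrite mul0r => s0; rewrite !Siter_pos.
by rewrite mulrSr mulrDl mul1r; exact: Psi_causal.
Qed.

Lemma Siter_agree v k j : (k <= j)%N -> agree (k%:R * tmin) (Siter v j) (Siter v k).
Proof.
move=> kj; rewrite -(subnK kj); elim: (j - k)%N => [//|i IH] e s sk.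
rewrite addSn Siter_agreeS ?IH//.
apply: lt_le_trans sk _; rewrite ler_wpM2r ?(ltW tmin_gt0)// ler_nat.
exact: leq_addl.
Qed.

Lemma Fext_Siter v k e s : s < k%:R * tmin -> Fext v e s = Siter v k e s.
Proof.
move=> sk; rewrite /Fext; set j := (_.+1).
have sj : s < j%:R * tmin.
  rewrite -ltr_pdivrMr ?tmin_gt0//; apply: le_lt_trans (truncnS_gt _).
  by rewrite ler_wpM2r ?ler_norm// invr_ge0 ltW// tmin_gt0.
have [kj|jk] := leqP k j; first by rewrite (Siter_agree v kj).
by rewrite (Siter_agree v (ltnW jk)).
Qed.

Lemma exists_tmin s : exists k : nat, s < k%:R * tmin.
Proof.
exists (Num.truncn (`|s| / tmin)).+1.
rewrite -ltr_pdivrMr ?tmin_gt0//; apply: le_lt_trans (truncnS_gt _).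
by rewrite ler_wpM2r ?ler_norm// invr_ge0 ltW// tmin_gt0.
Qed.

Lemma Fext_fix v e s : Fext v e s = Psi v (Fext v) e s.
Proof.
have [k sk] := exists_tmin s.
have A : agree (k%:R * tmin) (Fext v) (Siter v k) by move=> f t; exact: Fext_Siter.
have sk1 : s < k%:R * tmin + tmin by apply: lt_trans sk _; rewrite ltrDl tmin_gt0.
rewrite (Psi_causal v A e sk1) (@Fext_Siter v k.+1)//.
by rewrite mulrSr mulrDl mul1r.
Qed.

Lemma Fext_pos v : posV (Fext v).
Proof. by move=> e s s0; rewrite Fext_fix Psi_pos. Qed.

Lemma Fext_wi w v : om <= w -> data v -> wiV w (Fext v).
Proof.
move=> omw dv e.
apply: (@wi_limit _ _ (fun k => Siter v k e) _ (2 * cutnorm v)) => [k|k|s].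
- exact: Siter_wi.
- apply: le_trans (Siter_wnorm k omw dv).
  rewrite (bigD1 e)//= lerDl; apply: sumr_ge0 => f _; exact: wnorm_ge0.
- have [k sk] := exists_tmin s; exists k => // j /= kj.
  rewrite (Siter_agree v kj)//; apply/esym; exact: Fext_Siter.
Qed.

Lemma ext_wi w v : om <= w -> data v -> wiV w (ext v).
Proof.
move=> omw dv e.
have Fi := Fext_wi omw dv; have Hi := Hop_wi omw (@Fext_pos v) Fi.
have m1 : mf (ext v e).
  rewrite /ext; apply: measurable_fun_ifT.
  - by apply: measurable_fun_ler; [exact: measurable_cst|exact: measurable_id].
  - exact: wi_mf (Fi e).
  - exact: wi_mf (wi_neg (Hi e)).
apply: (wi_dom m1 _ (wiD (wi_abs (Fi e)) (wi_abs (wi_neg (Hi e))))).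
move=> s; rewrite /ext; case: ifP => _; first by rewrite lerDl.
by rewrite lerDr.
Qed.

Definition compat v := forall e s, 0 <= s -> s <= tau e -> v (bar e) s = v e (tau e - s).

Lemma cut_ext v e s : cut (ext v) e s = cut v e s.
Proof.
have [s0|s0] := ltP s 0; first by rewrite !cut0.
have [st|st] := ltP (tau e) s; first by rewrite !cut_tau.
by rewrite !cut_in// /ext s0 Fext_fix /Psi ltNge st mul0r addr0 cut_in.
Qed.

(** Outside the edge both sides are the same value of [Hop]: [ext] uses it on the negative half
    line, and the fixed-point equation of [Psi] uses it beyond the end of the reversed edge. Within
    the edge the claim is the compatibility of the data. *)
Lemma ext_symC v : compat v -> symC (ext v).
Proof.
move=> vc e s; have t0 := tau_gt0 e.
have [s0|s0] := ltP s 0.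
  rewrite /ext leNgt s0 /= (_ : 0 <= tau e - s); last by lra.
  rewrite Fext_fix /Psi cut_tau; last by lra.
  rewrite add0r (_ : tau e < tau e - s) ?mul1r; last by lra.
  by congr Hop; ring.
have [st|st] := ltP (tau e) s; last first.
  have E (f : 'I_n) t : 0 <= t -> t <= tau f -> ext v f t = v f t.
    by move=> h1 h2; rewrite -(cut_in (ext v) h1 h2) cut_ext cut_in.
  have h1 : 0 <= tau e - s by lra.
  have h2 : tau e - s <= tau e by lra.
  have h3 : s <= tau (bar e) by rewrite tau_bar.
  by rewrite (E _ _ h1 h2) (E _ _ s0 h3); exact: vc.
rewrite /ext s0 (_ : (0 <= tau e - s) = false); last by apply/negbTE; rewrite -ltNge; lra.
rewrite Fext_fix /Psi cut_tau ?tau_bar// add0r st mul1r barK.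
by congr Hop; ring.
Qed.

Lemma prim_pos0 (N : R -> R) t : mf N -> posf N -> t <= 0 -> prim N t = 0.
Proof.
move=> mN pN t0; transitivity (Int (fun r => N r * 0)).
  apply: Int_aeq.
  - by apply: mfM => //; exact: mf_chi.
  - by apply: mfM => //; exact: mf_cst.
  apply: filterS (aeneq (0 : R)) => r r0.
  have [r0'|r0'] := ltP r 0; first by rewrite pN// !mul0r.
  congr (_ * _); rewrite /chi.
  have r1 : 0 < r by rewrite lt_neqAle eq_sym r0.
  by rewrite leNgt (le_lt_trans t0 r1) leNgt r1 subrr.
by rewrite -[RHS](Int0 R); apply: Int_ext => r; rewrite mulr0.
Qed.

Lemma Nker_wi e f : wi (knorm kap + 1) (Nker kap e f).
Proof.
apply: (ig_dom _ _ (igZ (2 * knorm kap) (ig_ew (@ltr01 R)))).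
  by apply: mfM; [exact: mf_Nker|exact: mf_ew].
move=> t; rewrite normrM [X in _ * X]ger0_norm//.
have -> : ew 1 t = ew (- knorm kap) t * ew (knorm kap + 1) t :> R.
  by rewrite -ewDw addKr.
by rewrite mulrA ler_wpM2r// Nker_bound.
Qed.

Lemma sum_rearrange e (X : 'I_n -> R) (Y : 'I_n -> 'I_n -> R) :
  \sum_g (2 * kap e g * X g - \sum_f kap e f * Y f g) =
  \sum_f kap e f * (2 * X f - \sum_g Y f g).
Proof.
transitivity (\sum_g 2 * kap e g * X g - \sum_g \sum_f kap e f * Y f g).
  by rewrite -sumrB.
rewrite exchange_big /= -sumrB; apply: eq_bigr => f _.
by rewrite mulrBr mulr_sumr; congr (_ - _); ring.
Qed.

Lemma prim_even w (V : R -> R) s : 0 <= w -> wi w V ->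
  prim (fun r => V r + V (- r)) (- s) = - prim (fun r => V r + V (- r)) s.
Proof.
move=> w0 Vi; rewrite (prim_neg s w0 (wiD Vi (wi_neg Vi))); congr (- _).
by apply: Int_ext => r; rewrite opprK addrC.
Qed.

Lemma sum_odd w V e s x : 0 <= w -> wiV w V ->
  x = \sum_f kap e f * prim (fun r => V f r + V f (- r)) (- s) ->
  - x = \sum_f kap e f * prim (fun r => V f r + V f (- r)) s.
Proof.
move=> w0 Vi ->; rewrite -sumrN; apply: eq_bigr => f _.
by rewrite (prim_even s w0 (Vi f)) -mulrN opprK.
Qed.

Lemma symS0 V e : V e 0 - V e (- 0) =
  \sum_f kap e f * prim (fun r => V f r + V f (- r)) 0.
Proof. by rewrite oppr0 subrr big1// => f _; rewrite prim0 mulr0. Qed.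

(** For [s > 0] and [F = Fext v], the left side is [N * F] by the definition of [Hop]. On the right
    the integrand is [2 F - N * F] on the positive half line; its primitive moves onto the kernel,
    and [Nker_eq] gives [N * F] again. Negative [s] follow because both sides are odd. *)
Lemma ext_symS v : data v -> symS (ext v).
Proof.
move=> dv.
have [w0 _ Kw _ _] := om_facts (lexx om); have w0' := ltW w0.
have Fi := Fext_wi (lexx om) dv; have Fp := @Fext_pos v.
have Ei := ext_wi (lexx om) dv.
have K1 : 0 <= knorm kap + 1 by rewrite addr_ge0 ?K0.
have ci e f : wi om (conv (Fext v f) (Nker kap e f)).
  by case: (pconv_wi K0 Kw (Fp f) (@Nker_pos e f) (mf_Nker _ _ _) (Nker_bound _ _ _) (Fi f)).
have Npw e f : mf (prim (Nker kap e f)).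
  have lt : knorm kap + 1 < knorm kap + 2 by lra.
  exact: wi_mf (wi_prim K1 lt (Nker_wi e f)).
have Npi e f s : ig (fun r => Fext v f r * prim (Nker kap e f) (s - r)).
  apply: (@pconv_ig _ (knorm kap + 1) om (wnorm (knorm kap + 1) (Nker kap e f))) => //.
  - move=> t t0; exact: prim_pos0 (mf_Nker _ _ _) (@Nker_pos e f) (ltW t0).
  - by move=> t; rewrite mulrC; exact: prim_bound (Nker_wi e f).
have Npi' e f g s : ig (fun r => Fext v g r * prim (Nker kap e f) (s - r)).
  apply: (@pconv_ig _ (knorm kap + 1) om (wnorm (knorm kap + 1) (Nker kap e f))) => //.
  - move=> t t0; exact: prim_pos0 (mf_Nker _ _ _) (@Nker_pos e f) (ltW t0).
  - by move=> t; rewrite mulrC; exact: prim_bound (Nker_wi e f).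
have pos e s : 0 < s -> ext v e s - ext v e (- s) =
    \sum_f kap e f * prim (fun r => ext v f r + ext v f (- r)) s.
  move=> s0.
  have sN : (0 <= - s) = false by apply/negbTE; rewrite -ltNge; lra.
  have -> : ext v e s - ext v e (- s) = \sum_f conv (Fext v f) (Nker kap e f) s.
    rewrite /ext (ltW s0) sN (opprK s) /Hop.
    by move: (Fext v e s) (\sum_f _) => x y; rewrite subKr.
  have E f : prim (fun r => ext v f r + ext v f (- r)) s =
     Int (fun r => 2 * (Fext v f r * (r <= s)%R%:R)) -
     \sum_g Int (fun r => Fext v g r * prim (Nker kap f g) (s - r)).
    transitivity (prim (fun r => 2 * Fext v f r -
        \sum_g conv (Fext v g) (Nker kap f g) r) s).
      apply: Int_ext => r; rewrite chi_pos//.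
      have [r0|r0] /= := ltP 0 r; last by rewrite !mulr0.
      have rN : (0 <= - r) = false by apply/negbTE; rewrite -ltNge; lra.
      by rewrite /ext (ltW r0) rN opprK /Hop; congr (_ * _); ring.
    have i2 : wi om (fun r => 2 * Fext v f r) by exact: wiZ.
    have i3 : wi om (fun r => \sum_g conv (Fext v g) (Nker kap f g) r) by exact: wi_sum.
    rewrite (primB s w0' i2 i3); congr (_ - _); last first.
      rewrite (prim_sum _ _ s w0' (ci f)); apply: eq_bigr => g _.
      exact: (prim_pconv s K0 w0' (Fp g) (@Nker_pos f g) (mf_Nker _ _ _) (Nker_bound _ _ _) (Fi g)).
    apply: Int_aeq.
    - by apply: mfM; [exact: wi_mf i2|exact: mf_chi].
    - apply: mfM; first exact: mf_cst.
      by apply: mfM; [exact: wi_mf (Fi f)|apply: mf_le; [exact: mf_id|exact: mf_cst]].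
    apply: filterS (aeneq (0:R)) => r r0; rewrite -mulrA; congr (_ * _).
    rewrite chi_pos//; have [r0'|r0'] := ltP r 0; first by rewrite Fp// !mul0r.
    by rewrite (_ : 0 < r)//= lt_neqAle eq_sym r0.
  under [RHS]eq_bigr do rewrite E.
  have i4 f : ig (fun r => Fext v f r * (r <= s)%R%:R).
    apply: (ig_dom _ _ (igZ (ew (- om) s) (wi_abs (Fi f)))).
      by apply: mfM; [exact: wi_mf (Fi f)|apply: mf_le; [exact: mf_id|exact: mf_cst]].
    move=> r; have [r0|r0] := ltP r 0; first by rewrite Fp// mul0r normr0 mul0r mulr0.
    have [rs|rs] := leP r s; last by rewrite mulr0 normr0 !mulr_ge0.
    rewrite mulr1 mulrCA ler_peMr// /ew -expRD -expR0 ler_expR !ger0_norm//; last exact: ltW.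
    have := ler_wpM2l w0' rs; lra.
  have i5 e' f' g' : ig (fun r => kap e' f' * (Fext v g' r * prim (Nker kap f' g') (s - r))).
    exact: igZ.
  transitivity (\sum_g Int (fun r => 2 * kap e g * (Fext v g r * (r <= s)%R%:R) -
      \sum_f kap e f * (Fext v g r * prim (Nker kap f g) (s - r)))).
    apply: eq_bigr => g _; apply: Int_ext => r.
    have [rs|rs] := leP r s; last first.
      rewrite Nker_pos; last by lra.
      rewrite mulr0 big1 ?subr0 ?mulr0// => f _.
      rewrite prim_pos0 ?mulr0//; [exact: mf_Nker|exact: Nker_pos|lra].
    rewrite Nker_eq; last by lra.
    rewrite mulrBr mulr1; congr (_ - _); first by ring.
    by rewrite mulr_sumr; apply: eq_bigr => f _; rewrite mulrCA.
  transitivity (\sum_g (2 * kap e g * Int (fun r => Fext v g r * (r <= s)%R%:R) -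
      \sum_f kap e f * Int (fun r => Fext v g r * prim (Nker kap f g) (s - r)))).
    apply: eq_bigr => g _.
    rewrite IntB; [|exact: igZ|by apply: ig_sum => f; exact: i5].
    rewrite (IntZ _ (i4 g)) Int_sum; last by move=> f; exact: i5.
    by congr (_ - _); apply: eq_bigr => f _; rewrite IntZ.
  rewrite sum_rearrange; apply: eq_bigr => f _; congr (_ * (_ - _)).
  by rewrite (IntZ _ (i4 f)).
move=> e s; have [s0|s0|<-] := ltgtP 0 s.
- exact: pos.
- have s0' : 0 < - s by lra.
  have H := pos e _ s0'; rewrite (opprK s) in H.
  transitivity (- (ext v e (- s) - ext v e s)).
    by move: (ext v e s) (ext v e (- s)) => x y; rewrite opprB.
  exact: (@sum_odd om (ext v) e s _ w0' Ei H).
- exact: symS0.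
Qed.

End Network.

(* The sections below rebind cut, cutnorm, etc. with their parameters fixed. *)
Local Notation raw_cut := cut.
Local Notation raw_cutnorm := cutnorm.

(** * Convolution operators acting on network data *)

Section ExtensionOperator.
Variables (R : realType) (n : nat).
Variables (bar : 'I_n -> 'I_n) (tau : 'I_n -> R) (kap : 'M[R]_n).
Hypotheses (barK : involutive bar) (tau_gt0 : forall e, 0 < tau e).
Hypothesis tau_bar : forall e, tau (bar e) = tau e.
Implicit Types (V F u v : 'I_n -> R -> R) (w s a b : R) (e f : 'I_n) (g h : R -> R).

Local Notation symC := (symC bar tau).
Local Notation symS := (symS kap).
Local Notation data := (data tau).
Local Notation compat := (compat bar tau).
Local Notation ext := (ext bar tau kap).
Local Notation om := (om tau kap).
Local Notation cut := (cut tau).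
Local Notation cutnorm := (cutnorm tau).
Local Notation lin a u b v := (fun e s => a * u e s + b * v e s).

Lemma cut_lin a u b v e s : cut (lin a u b v) e s = a * cut u e s + b * cut v e s.
Proof. by rewrite /cut mulrDl !mulrA. Qed.

Lemma data_lin a u b v : data u -> data v -> data (lin a u b v).
Proof.
move=> du dv e; apply: ig_ext (igD (igZ a (du e)) (igZ b (dv e))) => s.
by rewrite cut_lin.
Qed.

Lemma compat_lin a u b v : compat u -> compat v -> compat (lin a u b v).
Proof. by move=> cu cv e s s0 st; rewrite cu// cv. Qed.

Lemma wiV_lin w a u b v : wiV w u -> wiV w v -> wiV w (lin a u b v).
Proof. by move=> iu iv e; apply: wiD; apply: wiZ. Qed.

Lemma symC_lin a u b v : symC u -> symC v -> symC (lin a u b v).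
Proof. by move=> cu cv e s; rewrite cu cv. Qed.

Lemma symS_lin w a u b v : 0 <= w -> wiV w u -> wiV w v -> symS u -> symS v ->
  symS (lin a u b v).
Proof.
move=> w0 iu iv su sv e s.
have -> : a * u e s + b * v e s - (a * u e (- s) + b * v e (- s)) =
  a * (u e s - u e (- s)) + b * (v e s - v e (- s)) by ring.
rewrite su sv !mulr_sumr -big_split /=; apply: eq_bigr => f _.
have i1 := wiD (iu f) (wi_neg (iu f)); have i2 := wiD (iv f) (wi_neg (iv f)).
rewrite -[X in _ = _ * X](_ : a * prim (fun r => u f r + u f (- r)) s +
   b * prim (fun r => v f r + v f (- r)) s = _); first by ring.
rewrite -(primZ a s w0 i1) -(primZ b s w0 i2).
rewrite -(primD s w0 (wiZ a i1) (wiZ b i2)); apply: Int_ext => r.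
by congr (_ * _); ring.
Qed.

Lemma ig_cut w V e : 0 <= w -> wi w (V e) -> ig (cut V e).
Proof.
move=> w0 Vi; apply: (ig_dom _ _ (igZ (ew (- w) (tau e)) (wi_abs Vi))).
  apply: mfM; first exact: wi_mf Vi.
  have -> : (fun s : R => ((0 <= s) && (s <= tau e))%R%:R : R) =
    (fun s => (0 <= s)%R%:R * (s <= tau e)%R%:R).
    by apply/funext => s; case: (0 <= s); case: (s <= _); rewrite /= ?mulr1 ?mulr0.
  by apply: mfM; apply: mf_le; [exact: mf_cst|exact: mf_id|exact: mf_id|exact: mf_cst].
move=> s; rewrite /raw_cut; case: (boolP (_ && _)) => [/andP[s0 st]|_] /=; last first.
  by rewrite mulr0 normr0 !mulr_ge0.
rewrite mulr1 mulrCA ler_peMr// /ew -expRD -expR0 ler_expR !ger0_norm ?(ltW (tau_gt0 _))//.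
by have := ler_wpM2l w0 st; lra.
Qed.

Lemma Int_cut_le w V e : 0 <= w -> wi w (V e) ->
  Int (fun s => `|cut V e s|) <= ew (- w) (tau e) * wnorm w (V e).
Proof.
move=> w0 Vi; rewrite /wnorm -IntZ; last exact: wi_abs.
apply: Int_le => [||s]; first exact: ig_abs (ig_cut w0 Vi).
  exact: igZ (wi_abs Vi).
rewrite /raw_cut; case: (boolP (_ && _)) => [/andP[s0 st]|_] /=; last first.
  by rewrite mulr0 normr0 !mulr_ge0.
rewrite mulr1 mulrCA ler_peMr// /ew -expRD -expR0 ler_expR !ger0_norm ?(ltW (tau_gt0 _))//.
by have := ler_wpM2l w0 st; lra.
Qed.

Lemma data_wi w V : 0 <= w -> wiV w V -> data V.
Proof. by move=> w0 Vi e; exact: ig_cut w0 (Vi e). Qed.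

Lemma symC_compat V : symC V -> compat V.
Proof. by move=> VC e s _ _; exact: VC. Qed.

Lemma aeq_sub (f g : R -> R) : aeq (fun s => 1 * f s + -1 * g s) (fun=> 0) -> aeq f g.
Proof.
apply: filterS => s; rewrite mul1r mulN1r => /eqP; rewrite subr_eq0 => /eqP //.
Qed.

Lemma sym_unique w U V : 0 < w -> wiV w U -> wiV w V -> symC U -> symC V ->
  symS U -> symS V -> (forall e, aeq (cut U e) (cut V e)) -> forall e, aeq (U e) (V e).
Proof.
move=> w0 Ui Vi UC VC US VS UV e; apply: aeq_sub.
have i0 := wiV_lin 1 (-1) Ui Vi.
apply: (@apriori_eq R n bar tau kap barK tau_gt0 w (lin 1 U (-1) V) w0 i0).
- exact: symC_lin.
- exact: symS_lin (ltW w0) Ui Vi US VS.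
rewrite /raw_cutnorm big1// => f _.
rewrite (@Int_aeq0 R)//; first exact: ig_mf (ig_abs (ig_cut (ltW w0) (i0 f))).
apply: filterS (UV f) => s; rewrite cut_lin => ->.
by rewrite mul1r mulN1r subrr normr0.
Qed.

Lemma om_gt0 : 0 < om.
Proof. by case: (om_facts tau_gt0 (lexx om)). Qed.
Local Hint Resolve om_gt0 : core.

Lemma ext_wiom v : data v -> wiV om (ext v).
Proof. exact: ext_wi. Qed.

Lemma ext_unique w V v : 0 < w -> wiV w V -> symC V -> symS V -> data v -> compat v ->
  (forall e, aeq (cut V e) (cut v e)) -> forall e, aeq (V e) (ext v e).
Proof.
move=> w0 Vi VC VS dv cv Vv.
pose w1 := Num.max w om.
have w1w : w <= w1 by rewrite le_max lexx.
have w1om : om <= w1 by rewrite le_max lexx orbT.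
have w10 : 0 < w1 by apply: lt_le_trans w1w.
have Vi1 : wiV w1 V by move=> e; exact: wi_le (Vi e).
have Ei : wiV w1 (ext v) by exact: ext_wi.
apply: (sym_unique w10 Vi1 Ei VC _ VS).
- exact: ext_symC.
- exact: ext_symS.
move=> e; apply: filterS (Vv e) => s ->.
exact/esym/(cut_ext bar kap tau_gt0).
Qed.

Lemma ext_aeq u v : data u -> compat u -> data v -> compat v ->
  (forall e, aeq (cut u e) (cut v e)) -> forall e, aeq (ext u e) (ext v e).
Proof.
move=> du cu dv cv uv; apply: (ext_unique om_gt0 (ext_wiom du) _ _ dv cv).
- exact: ext_symC.
- exact: ext_symS.
- move=> e; apply: filterS (uv e) => s <-.
  exact: (cut_ext bar kap tau_gt0).
Qed.

Lemma ext_lin a u b v : data u -> compat u -> data v -> compat v ->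
  forall e, aeq (ext (lin a u b v) e) (fun s => a * ext u e s + b * ext v e s).
Proof.
move=> du cu dv cv e.
have H : aeq (fun s => a * ext u e s + b * ext v e s) (ext (lin a u b v) e).
  apply: (@ext_unique om (lin a (ext u) b (ext v)) _ om_gt0 _ _ _
    (data_lin a b du dv) (compat_lin a b cu cv)).
  - by apply: wiV_lin; exact: ext_wiom.
  - by apply: symC_lin; exact: ext_symC.
  - apply: (symS_lin _ _ (ltW om_gt0) (ext_wiom du) (ext_wiom dv)); exact: ext_symS.
  - move=> f; apply: nearW => s; rewrite !cut_lin.
    by congr (_ * _ + _ * _); exact: (cut_ext bar kap tau_gt0).
by apply: filterS H => s ->.
Qed.

(** The a priori estimate needs a weight strictly above one in which the functions are already known
    to be integrable, here [om]. *)
Definition wt : R := om + 1.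

Lemma wt_gt0 : 0 < wt. Proof. by rewrite /wt ltr_wpDl// ltW. Qed.
Lemma om_wt : om < wt. Proof. by rewrite /wt ltrDl. Qed.

Lemma ext_wiwt v : data v -> wiV wt (ext v).
Proof. by move=> dv e; exact: wi_le (ltW om_wt) (ext_wiom dv e). Qed.

Lemma cutnorm_ext v : cutnorm (ext v) = cutnorm v.
Proof.
apply: eq_bigr => e _; apply: Int_ext => s; congr `|_|.
exact: (cut_ext bar kap tau_gt0).
Qed.

Lemma ext_bound v : data v -> compat v -> \sum_e wnorm wt (ext v e) <= 8 * cutnorm v.
Proof.
move=> dv cv; rewrite -cutnorm_ext.
apply: (apriori barK tau_gt0 om_gt0 om_wt (ltW om_wt)).
- exact: ext_wiom.
- exact: ext_symC.
- exact: ext_symS.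
Qed.

Lemma conv_symC w l g V : 0 <= w -> w <= l -> kern l g -> (forall r, g (- r) = g r) ->
  wiV w V -> symC V -> symC (fun e => conv g (V e)).
Proof.
move=> w0 wl kg ge Vi VC e s; rewrite -(conv_refl (tau e) s w0 wl kg (Vi e) ge).
by congr conv; apply/funext => r; rewrite VC.
Qed.

Lemma conv_neg w l g (f : R -> R) s : 0 <= w -> w <= l -> kern l g -> wi w f ->
  (forall r, g (- r) = g r) -> conv g (fun r => f (- r)) s = conv g f (- s).
Proof.
move=> w0 wl kg fi ge; rewrite -(sub0r s) -(conv_refl 0 s w0 wl kg fi ge).
by congr conv; apply/funext => r; rewrite sub0r.
Qed.

(** Convolution commutes with [prim] up to a value at 0. That value vanishes: the primitive of an
    even function is odd, and [g] is even. *)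
Lemma conv_symS w l g V : 0 <= w -> w < l -> kern l g -> (forall r, g (- r) = g r) ->
  wiV w V -> symS V -> symS (fun e => conv g (V e)).
Proof.
move=> w0 wl kg ge Vi VS e s; have wl' := ltW wl.
have l0 : 0 <= l := le_trans w0 wl'.
pose a f r := V f r + V f (- r).
have ai f : wi w (a f) by apply: wiD => //; exact: wi_neg.
have pai f : wi l (prim (a f)) := wi_prim w0 wl (ai f).
have E f s' : conv g (a f) s' = conv g (V f) s' + conv g (V f) (- s').
  rewrite /a (convDr s' w0 wl' kg (Vi f) (wi_neg (Vi f))).
  by rewrite (conv_neg s' w0 wl' kg (Vi f) ge).
have P f : conv g (prim (a f)) 0 = 0.
  have := conv_neg 0 l0 (lexx l) kg (pai f) ge; rewrite oppr0.
  have -> : (fun r => prim (a f) (- r)) = (fun r => (-1) * prim (a f) r).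
    by apply/funext => r; rewrite /a (prim_even r w0 (Vi f)) mulN1r.
  rewrite (convZr (-1) 0 l0 (lexx l) kg (pai f)); lra.
rewrite -(conv_neg s w0 wl' kg (Vi e) ge) -(convBr s w0 wl' kg (Vi e) (wi_neg (Vi e))).
have -> : (fun r => V e r - V e (- r)) = (fun r => \sum_f kap e f * prim (a f) r).
  by apply/funext => r; rewrite VS.
rewrite (conv_sumr _ _ s l0 (lexx l) kg); last by move=> f; exact: wiZ.
apply: eq_bigr => f _; rewrite (convZr _ s l0 (lexx l) kg (pai f)); congr (_ * _).
rewrite -[LHS]subr0 -[X in _ - X](P f) (conv_prim s w0 wl kg (ai f)).
by congr prim; apply/funext => r; exact: E.
Qed.

Definition rop g v e s : R := conv g (ext v e) s.
(** The rate [wt + 1] lies strictly above the weight [wt] of the extensions, so that such kernels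
    act boundedly; evenness preserves both relations. *)
Definition ekern g := kern (wt + 1) g /\ forall r, g (- r) = g r.

Lemma wt1 : wt < wt + 1. Proof. by rewrite ltrDl. Qed.
Local Hint Resolve wt1 : core.
Let wt0 := ltW wt_gt0.

Lemma rop_wi g v : ekern g -> data v -> wiV wt (rop g v).
Proof. by move=> [kg _] dv e; exact: conv_wi wt0 wt1 kg (ext_wiwt dv e). Qed.

Lemma rop_symC g v : ekern g -> data v -> compat v -> symC (rop g v).
Proof.
move=> [kg ge] dv cv; apply: (conv_symC wt0 (ltW wt1) kg ge (ext_wiwt dv)).
exact: ext_symC.
Qed.

Lemma rop_symS g v : ekern g -> data v -> symS (rop g v).
Proof.
move=> [kg ge] dv; apply: (conv_symS wt0 wt1 kg ge (ext_wiwt dv)).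
exact: ext_symS.
Qed.

Lemma rop_data g v : ekern g -> data v -> data (rop g v).
Proof. by move=> kg dv; exact: data_wi wt0 (rop_wi kg dv). Qed.

Lemma rop_compat g v : ekern g -> data v -> compat v -> compat (rop g v).
Proof. by move=> kg dv cv; apply: symC_compat; exact: rop_symC. Qed.

(** The convolved extension satisfies both relations and restricts to its own data, so uniqueness
    identifies it with the extension of that data. This makes the operators [rop] compose like
    convolutions. *)
Lemma ext_rop g v e : ekern g -> data v -> compat v -> aeq (ext (rop g v) e) (rop g v e).
Proof.
move=> kg dv cv.
have H : aeq (rop g v e) (ext (rop g v) e).
  apply: (ext_unique wt_gt0 (rop_wi kg dv) (rop_symC kg dv cv) (rop_symS kg dv)
    (rop_data kg dv) (rop_compat kg dv cv)).
  by move=> f; apply: nearW.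
by apply: filterS H => s ->.
Qed.

Lemma rop_rop g h v e s : ekern g -> ekern h -> data v -> compat v ->
  rop g (rop h v) e s = conv g (conv h (ext v e)) s.
Proof.
move=> kg kh dv cv; apply: conv_aeq.
- exact: kern_mf kg.1.
- exact: wi_mf (ext_wiwt (rop_data kh dv) e).
- exact: wi_mf (rop_wi kh dv e).
- exact: ext_rop.
Qed.

Lemma ropC g h v e s : ekern g -> ekern h -> data v -> compat v ->
  rop g (rop h v) e s = rop h (rop g v) e s.
Proof.
move=> kg kh dv cv; rewrite (rop_rop e s kg kh dv cv) (rop_rop e s kh kg dv cv).
exact: (convC s wt0 wt1 kg.1 kh.1 (ext_wiwt dv e)).
Qed.

Lemma ropA g h v e s : ekern g -> ekern h -> data v -> compat v ->
  rop g (rop h v) e s = rop (conv g h) v e s.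
Proof.
move=> kg kh dv cv; rewrite (rop_rop e s kg kh dv cv).
exact: (convA s wt0 wt1 kg.1 kh.1 (ext_wiwt dv e)).
Qed.

Lemma rop_aeq g u v e s : ekern g -> data u -> compat u -> data v -> compat v ->
  (forall e, aeq (cut u e) (cut v e)) -> rop g u e s = rop g v e s.
Proof.
move=> kg du cu dv cv uv; apply: conv_aeq; first exact: kern_mf kg.1.
- exact: wi_mf (ext_wiwt du e).
- exact: wi_mf (ext_wiwt dv e).
- exact: ext_aeq.
Qed.

Lemma rop_lin g a u b v e s : ekern g -> data u -> compat u -> data v -> compat v ->
  rop g (lin a u b v) e s = a * rop g u e s + b * rop g v e s.
Proof.
move=> kg du cu dv cv.
have iu := ext_wiwt du e; have iv := ext_wiwt dv e.
transitivity (conv g (fun s => a * ext u e s + b * ext v e s) s).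
  apply: conv_aeq; first exact: kern_mf kg.1.
  - exact: wi_mf (ext_wiwt (data_lin a b du dv) e).
  - by apply: mfD; apply: mfM (mf_cst _) _; [exact: wi_mf iu|exact: wi_mf iv].
  - exact: ext_lin.
rewrite (convDr s wt0 (ltW wt1) kg.1 (wiZ a iu) (wiZ b iv)).
exact: (f_equal2 +%R (convZr a s wt0 (ltW wt1) kg.1 iu)
                     (convZr b s wt0 (ltW wt1) kg.1 iv)).
Qed.

Lemma rop_kerD a g b h v e s : ekern g -> ekern h -> data v ->
  rop (fun r => a * g r + b * h r) v e s = a * rop g v e s + b * rop h v e s.
Proof.
move=> [kg _] [kh _] dv; have iv := ext_wiwt dv e.
rewrite /rop (convDl s wt0 (ltW wt1) (kernZ a kg) (kernZ b kh) iv).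
by rewrite (convZl a s wt0 (ltW wt1) kg iv) (convZl b s wt0 (ltW wt1) kh iv).
Qed.

Lemma ekern_lin a g b h : ekern g -> ekern h -> ekern (fun r => a * g r + b * h r).
Proof.
move=> [kg ge] [kh he]; split; first by apply: kernD; exact: kernZ.
by move=> r; rewrite ge he.
Qed.

(** The factor 8 is that of the a priori estimate; the sum is the cost of passing from the weighted
    norm on the line to the edges. *)
Definition Cop : R := (\sum_e ew (- wt) (tau e)) * 8.

Lemma Cop_ge0 : 0 <= Cop.
Proof. by rewrite /Cop mulr_ge0//; apply: sumr_ge0. Qed.

Lemma cutnorm_wnorm V : wiV wt V ->
  cutnorm V <= (\sum_e ew (- wt) (tau e)) * \sum_e wnorm wt (V e).
Proof.
move=> Vi; rewrite /raw_cutnorm mulr_suml; apply: ler_sum => e _.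
apply: le_trans (Int_cut_le wt0 (Vi e)) _; rewrite ler_wpM2l//.
rewrite (bigD1 e)//= lerDl; apply: sumr_ge0 => f _; exact: wnorm_ge0.
Qed.

Lemma rop_bound g v : ekern g -> data v -> compat v ->
  cutnorm (rop g v) <= Cop * wnorm (- wt) g * cutnorm v.
Proof.
move=> kg dv cv; apply: le_trans (cutnorm_wnorm (rop_wi kg dv)) _.
rewrite /Cop -!mulrA ler_wpM2l ?sumr_ge0//.
apply: (@le_trans _ _ (wnorm (- wt) g * \sum_e wnorm wt (ext v e))).
  rewrite mulr_sumr; apply: ler_sum => e _.
  exact: (conv_wnorm wt0 wt1 kg.1 (ext_wiwt dv e)).
rewrite mulrCA ler_wpM2l ?wnorm_ge0//; exact: ext_bound.
Qed.

End ExtensionOperator.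

Local Notation raw_ekern := ekern.

(** * The generator on the network *)

Section ApproximateIdentity.
Variable R : realType.
Local Notation mu := (@lebesgue_measure R).
Implicit Types (f g h : R -> R) (w l s r eta eps d : R).

Lemma Int_dominated (F : nat -> R -> R) f g : (forall k, mf (F k)) -> mf f ->
  (forall s, F k s @[k --> \oo] --> f s) -> ig g -> (forall k s, `|F k s| <= g s) ->
  Int (F k) @[k --> \oo] --> Int f.
Proof.
move=> Fm fm Ff gi Fg.
have [| | | | |fi _ cv] := @dominated_convergence _ _ R mu setT measurableT
  (fun k => EFin \o F k) (EFin \o f) (EFin \o g).
- by move=> k; apply/measurable_EFinP; exact: Fm.
- exact/measurable_EFinP.
- apply: aeW => s _; apply: cvg_EFin; first exact: nearW.
  exact: Ff.
- exact: gi.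
- by apply: aeW => s k _; rewrite /= lee_fin.
apply: fine_cvg; have := EFin_Int fi; rewrite /= => ->; exact: cv.
Qed.

Lemma ig_tail f eta : ig f -> 0 < eta ->
  exists k : nat, Int (fun s => `|f s| * (k%:R < `|s|)%R%:R) <= eta.
Proof.
move=> fi eta0.
have cv : Int (fun s => `|f s| * (k%:R < `|s|)%R%:R) @[k --> \oo] --> Int (fun=> (0 : R)).
  apply: (@Int_dominated (fun (k : nat) s => `|f s| * (k%:R < `|s|)%R%:R)
    (fun=> 0) (fun s => `|f s|)).
  - move=> k; apply: mfM; first exact: mf_abs (ig_mf fi).
    by apply: mf_lt; [exact: mf_cst|exact: mf_abs (@mf_id R)].
  - exact: mf_cst.
  - move=> s; apply: cvg_near_cst; exists (Num.truncn `|s|).+1 => //= k /= sk.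
    have : `|s| < k%:R.
      by apply: lt_le_trans (truncnS_gt _) _; rewrite ler_nat.
    by move=> /ltW; rewrite leNgt => /negPf ->; rewrite mulr0.
  - exact: ig_abs.
  - move=> k s; rewrite normrM normr_id ler_piMr//.
    by rewrite ger0_norm//; case: (_ < _).
rewrite Int0 in cv.
have /cvgrPdist_le/(_ _ eta0) [k _ /(_ k (leqnn k))] := cv.
rewrite sub0r normrN => H; exists k; exact: le_trans (ler_norm _) H.
Qed.

(** Continuous approximation is available on a set of finite measure, without control outside it; so
    [f] is truncated to [|s| <= k] and the approximant multiplied by a continuous cut-off. *)
Lemma ig_approx_continuous f eta : ig f -> 0 < eta ->
  exists2 h, continuous h & exists A M, [/\ forall s, `|h s| <= M,
    forall s, A < `|s| -> h s = 0 & Int (fun s => `|f s - h s|) <= eta].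
Proof.
move=> fi eta0; have e2 : 0 < eta / 2 by rewrite divr_gt0.
have [k kP] := ig_tail fi e2.
set f1 := fun s => f s * (`|s| <= k%:R)%R%:R.
have f1i : ig f1.
  apply: ig_ind fi; last by move=> s; exact: ind01.
  by apply: mf_le; [exact: mf_abs (@mf_id R)|exact: mf_cst].
set a := (k%:R + 1 : R).
set E := `[- a, a]%classic.
have mE : measurable (E : set (measurableTypeR R)) by exact: measurable_itv.
have muE : (mu E < +oo)%E.
  by rewrite lebesgue_measure_itv /=; case: ifP => // _; rewrite ltry.
have f1E : mu.-integrable E (EFin \o f1) by exact: integrableS f1i.
have [G [Gc Gi Gcv]] := approximation_continuous_integrable mE muE f1E.
have [n nP] : exists n, (\int[mu]_(z in E) `|(f1 z - G n z)%:E| <= (eta / 2)%:E)%E.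
  have /fine_cvgP[Gfin /cvgrPdist_le/(_ _ e2)Gd] := Gcv.
  near \oo => n; exists n.
  have fin : (\int[mu]_(z in E) `|(f1 z - G n z)%:E|)%E \is a fin_num by near: n.
  rewrite -(fineK fin) lee_fin.
  apply: le_trans (ler_norm _) _; rewrite -normrN -sub0r; near: n; exact: Gd.
set g := G n in nP.
(* Trapezoidal cut-off, equal to 1 for [|s| <= k] and to 0 for [|s| >= a]. On the ramp in between
   [f1] vanishes, and [g] is close to 0 there in L1. *)
pose th s := Num.max 0 (Num.min 1 (a - `|s|)).
have thc : continuous th.
  move=> s; apply: (@continuous_max R R (fun=> 0) (fun s => Num.min 1 (a - `|s|))).
    exact: cvg_cst.
  apply: (@continuous_min R R (fun=> 1) (fun s => a - `|s|)); first exact: cvg_cst.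
  by apply: cvgB; [exact: cvg_cst|exact: norm_continuous].
have th0 s : 0 <= th s by rewrite le_max lexx.
have th1 s : th s <= 1 by rewrite ge_max ler01 ge_min lexx.
have tha s : a <= `|s| -> th s = 0.
  move=> sa; apply/max_idPl; rewrite ge_min; apply/orP; right; lra.
have thk s : `|s| <= k%:R -> th s = 1.
  move=> sk; rewrite /th (_ : Num.min _ _ = 1).
    by apply/max_idPr.
  by apply/min_idPl; rewrite /a; lra.
exists (fun s => th s * g s).
  by move=> s; apply: cvgM; [exact: thc|exact: Gc].
have [M HM] : exists M, forall s, `|s| <= a -> `|g s| <= M.
  have a0 : - a <= a by rewrite ge0_cp// addr_ge0.
  have cg : {within `[- a, a], continuous (fun s => `|g s|)}.
    apply: continuous_subspaceT => s; apply: (@continuous_comp _ _ _ g Num.norm); first exact: Gc.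
    exact: norm_continuous.
  have [c _ cM] := EVT_max a0 cg; exists `|g c| => s; rewrite ler_norml => sa.
  by apply: cM; rewrite in_itv.
exists a, M; split.
- move=> s; rewrite normrM ger0_norm//.
  have [sa|sa] := leP a `|s|.
    rewrite tha// mul0r; apply: le_trans (HM 0 _) => //.
    by rewrite normr0 addr_ge0.
  rewrite -[leRHS]mul1r; apply: ler_pM => //; exact/HM/ltW.
- by move=> s sa; rewrite tha ?mul0r ?ltW.
have gm : mf g by apply: mf_cont; exact: Gc.
have fm := ig_mf fi.
set Q := fun s => `|f1 s - g s| * (`|s| <= a)%R%:R.
have Qm : mf Q.
  apply: mfM; first by apply: mf_abs; apply: mfB (ig_mf f1i) gm.
  by apply: mf_le; [exact: mf_abs (@mf_id R)|exact: mf_cst].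
have QE : (\int[mu]_x (Q x)%:E = \int[mu]_(z in E) `|(f1 z - g z)%:E|)%E.
  rewrite [RHS]integral_mkcond; apply: eq_integral => x _.
  rewrite /patch /Q mem_setE /E/= in_itv/= -ler_norml.
  by case: ifP => _; rewrite ?mulr1 ?mulr0.
have Q0 x : 0 <= Q x by rewrite mulr_ge0.
have Qi : ig Q.
  apply/integrableP; split; first exact/measurable_EFinP.
  apply: (@le_lt_trans _ _ (eta / 2)%:E); last exact: ltry.
  apply: le_trans nP; rewrite -QE le_eqVlt; apply/orP; left; apply/eqP.
  by apply: eq_integral => x _ /=; rewrite ger0_norm.
have Qe : Int Q <= eta / 2 by rewrite -lee_fin EFin_Int// QE.
set T := fun s => `|f s| * (k%:R < `|s|)%R%:R in kP.
have Ti : ig T.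
  apply: ig_ind (ig_abs fi); last by move=> s; exact: ind01.
  by apply: mf_lt; [exact: mf_cst|exact: mf_abs (@mf_id R)].
have pt s : `|f s - th s * g s| <= T s + Q s.
  rewrite /T /Q /f1; case: (leP `|s| k%:R) => sk.
    by rewrite thk// mul1r !mulr1 mulr0 add0r (_ : `|s| <= a) ?mulr1// /a; lra.
  rewrite mulr1 mulr0 sub0r normrN; have [sa|sa] := leP `|s| a.
    rewrite mulr1; apply: le_trans (ler_normB _ _) _.
    by rewrite lerD2l normrM (ger0_norm (th0 s)) ler_piMl.
  by rewrite (tha _ (ltW sa)) mul0r subr0 mulr0 addr0.
have : Int (fun s => `|f s - th s * g s|) <= Int T + Int Q.
  rewrite -IntD//; apply: (Int_le _ (igD Ti Qi) pt).
  apply: ig_dom (igD Ti Qi); first exact: mf_abs (mfB fm (mfM (mf_cont thc) gm)).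
  by move=> s; rewrite normr_id; exact: pt.
lra.
Unshelve. all: by end_near.
Qed.

Lemma ew_continuous w : continuous (ew w).
Proof.
move=> s; apply: continuous_comp; last exact: continuous_expR.
apply: cvgN; apply: cvgM; first exact: cvg_cst.
exact: norm_continuous.
Qed.

(** The weighted L1 modulus of continuity under translation. *)
Definition omega w f r := wnorm w (fun s => f (s - r) - f s).

Lemma wnormD w f g : wi w f -> wi w g ->
  wnorm w (fun s => f s + g s) <= wnorm w f + wnorm w g.
Proof.
move=> fi gi; rewrite -IntD; [|exact: wi_abs|exact: wi_abs].
apply: Int_le; first exact: wi_abs (wiD fi gi).
  by apply: igD; exact: wi_abs.
by move=> s; rewrite -mulrDl ler_wpM2r// ler_normD.
Qed.

Lemma wnormN w f : wnorm w (fun s => - f s) = wnorm w f.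
Proof. by apply: Int_ext => s; rewrite normrN. Qed.

Lemma wnormZ w (c : R) f : wi w f -> wnorm w (fun s => c * f s) = `|c| * wnorm w f.
Proof.
move=> fi; rewrite /wnorm -IntZ; last exact: wi_abs.
by apply: Int_ext => s; rewrite normrM mulrA.
Qed.

Lemma wnorm_shift w f r : 0 <= w -> wi w f ->
  wnorm w (fun s => f (s - r)) <= ew (- w) r * wnorm w f.
Proof.
move=> w0 fi; rewrite -[wnorm w f]/(Int (fun s => `|f s| * ew w s)).
rewrite -(Int_shift (- r) (wi_abs fi)) -IntZ; last exact: ig_shift (wi_abs fi).
apply: Int_le; first exact: wi_abs (wi_shift (- r) w0 fi).
  by apply: igZ; exact: ig_shift (wi_abs fi).
by move=> s; rewrite mulrCA ler_wpM2l//; exact: ew_sub'.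
Qed.

Lemma omega_le w f r : 0 <= w -> wi w f -> omega w f r <= 2 * wnorm w f * ew (- w) r.
Proof.
move=> w0 fi; have fr := wi_shift (- r) w0 fi.
have fN : wi w (fun s => - f s).
  by have := wiZ (-1) fi; apply: ig_ext => s; rewrite mulN1r.
apply: le_trans (wnormD fr fN) _; rewrite wnormN.
have h1 := wnorm_shift r w0 fi.
have h2 : 1 <= ew (- w) r by rewrite -expR0 ler_expR mulNr opprK mulr_ge0.
have := ler_wpM2r (wnorm_ge0 w f) h2; lra.
Qed.

(** The contradiction supplies a sequence of shifts tending to 0, to which dominated convergence
    applies. *)
Lemma omega_continuous w h (A M : R) eta : continuous h -> (forall s, `|h s| <= M) ->
  (forall s, A < `|s| -> h s = 0) -> 0 < eta ->
  exists2 d, 0 < d & forall r, `|r| < d -> omega w h r <= eta.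
Proof.
move=> hc hM hA eta0; apply: contrapT => H.
have {}H k : exists r, `|r| < k.+1%:R^-1 /\ eta < omega w h r.
  apply: contrapT => N; apply: H; exists k.+1%:R^-1; first by rewrite invr_gt0.
  move=> r rk; rewrite leNgt; apply/negP => er; apply: N; by exists r.
have [r rP] := choice H.
have M0 : 0 <= M by apply: le_trans (hM 0).
(* All shifts have modulus at most 1, so both terms vanish outside [|s| <= A + 1]. *)
pose D s := 2 * M * (((- (A + 1) <= s) && (s <= A + 1))%R%:R * ew w s).
have r1 k : `|r k| <= 1.
  by have [/ltW rk _] := rP k; apply: le_trans rk _; rewrite invf_le1// ler1n.
have r0 : r k @[k --> \oo] --> (0 : R).
  apply/cvgrPdist_lt => e e0; have := near_infty_natSinv_lt (PosNum e0).
  apply: filterS => k /= ke; rewrite sub0r normrN; have [rk _] := rP k; exact: lt_trans rk ke.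
have cv : omega w h (r k) @[k --> \oo] --> Int (fun=> (0 : R)).
  apply: (@Int_dominated _ _ D).
  - move=> k; apply: mfM; last exact: mf_ew.
    exact: mf_abs (mfB (mf_shift (- r k) (mf_cont hc)) (mf_cont hc)).
  - exact: mf_cst.
  - move=> s; have <- : `|h s - h s| * ew w s = 0 by rewrite subrr normr0 mul0r.
    apply: cvgM; last exact: cvg_cst.
    apply: cvg_norm; apply: cvgB; last exact: cvg_cst.
    apply: (@cvg_comp _ _ _ (fun k => s - r k) h); last exact: hc.
    suff : (s - r k) @[k --> \oo] --> s - 0 by rewrite subr0.
    by apply: cvgB => //; exact: cvg_cst.
  - apply: igZ; have := @ig_continuous R (ew w) (- (A + 1)) (A + 1) (@ew_continuous w).
    by apply: ig_ext => s; rewrite mulrC.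
  - move=> k s; rewrite normrM normr_id [`|ew w s|]ger0_norm// /D mulrA ler_wpM2r//.
    have := r1 k; rewrite ler_norml => /andP[r1a r1b].
    case: (boolP (_ && _)) => [_|]; rewrite ?mulr1 ?mulr0.
      apply: le_trans (ler_normB _ _) _; have := hM s; have := hM (s - r k); lra.
    rewrite -ler_norml -ltNge => sA.
    have sA2 : A < `|s - r k|.
      have := ler_normB (s - r k) (- r k); rewrite normrN; have := r1 k.
      have -> : s - r k - - r k = s by ring.
      lra.
    by rewrite (hA _ sA2) (hA s) ?subrr ?normr0//; lra.
rewrite Int0 in cv; have /cvgrPdist_lt/(_ _ eta0)[k _ /(_ k (leqnn k))] := cv.
rewrite sub0r normrN => /(le_lt_trans (ler_norm _)); have [_ /ltW] := rP k.
by move=> /le_lt_trans/[apply]; rewrite ltxx.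
Qed.

Lemma omega_small w f eta : 0 <= w -> wi w f -> 0 < eta ->
  exists2 d, 0 < d & forall r, `|r| < d -> omega w f r <= eta.
Proof.
move=> w0 fi eta0.
(* A shift by [|r| < 1] multiplies the weighted norm by at most [expR w]; the approximation error
   enters once shifted and once unshifted. *)
set c := 3 + expR w; have c0 : 0 < c by rewrite addr_gt0// expR_gt0.
have ec : 0 < eta / c by rewrite divr_gt0.
have [h0 h0c [A [M [h0M h0A h0f]]]] := ig_approx_continuous fi ec.
(* [h0] approximates [f] times the weight in plain L1, so dividing by the weight approximates [f] in
   the weighted norm. *)
pose h s := h0 s * ew (- w) s.
have hc : continuous h by move=> s; apply: cvgM; [exact: h0c|exact: ew_continuous].
have hA s : A < `|s| -> h s = 0 by move=> sA; rewrite /h h0A ?mul0r.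
have M0 : 0 <= M by apply: le_trans (h0M 0).
have hM s : `|h s| <= M * expR (w * `|A|).
  have [sA|sA] := ltP A `|s|; first by rewrite hA// normr0 mulr_ge0// expR_ge0.
  rewrite normrM; apply: ler_pM => //; rewrite ger0_norm// ler_expR mulNr opprK ler_wpM2l//.
  exact: le_trans sA (ler_norm _).
have hi : wi w h.
  have h0i : ig h0.
    have := @ig_continuous R h0 (- A) A h0c; apply: ig_ext => s.
    rewrite -ler_norml; have [_|sA] := leP `|s| A; rewrite ?mulr1 ?mulr0//.
    by rewrite h0A.
  by apply: ig_ext h0i => s; rewrite /h -mulrA (mulrC (ew _ _)) ew_inv mulr1.
have fh : wnorm w (fun s => f s - h s) <= eta / c.
  apply: le_trans h0f; rewrite le_eqVlt; apply/orP; left; apply/eqP; apply: Int_ext => s.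
  rewrite -[X in _ * X]ger0_norm// -normrM mulrBl /h -mulrA (mulrC (ew (- w) s)) ew_inv mulr1//.
have [d d0 dP] := omega_continuous w hc hM hA ec.
exists (Num.min d 1); first by rewrite lt_min d0 ltr01.
move=> r; rewrite lt_min => /andP[/dP rd r1].
have i1 := wiB fi hi.
have i2 := wi_shift (- r) w0 i1.
have i3 : wi w (fun s => h (s - r) - h s) by exact: wiB (wi_shift (- r) w0 hi) hi.
have i1N : wi w (fun s => -1 * (f s - h s)) by exact: wiZ.
have -> : omega w f r = wnorm w (fun s => ((f (s - r) - h (s - r)) + (h (s - r) - h s)) + -1 * (f s - h s)).
  by apply: Int_ext => s; congr (`|_| * _); ring.
apply: le_trans (wnormD (wiD i2 i3) i1N) _.
have e1 := wnormD i2 i3.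
have e2 := wnorm_shift r w0 i1; rewrite wnormZ// normrN1 mul1r.
have e3 : ew (- w) r <= expR w.
  by rewrite ler_expR mulNr opprK ler_piMr// ltW.
have e4 : ew (- w) r * wnorm w (fun s => f s - h s) <= expR w * (eta / c).
  by apply: ler_pM => //; exact: wnorm_ge0.
apply: le_trans (lerD (le_trans e1 (lerD (le_trans e2 e4) rd)) fh) _.
have E : eta = (3 + expR w) * (eta / c) by rewrite mulrC divfK// gt_eqF.
rewrite [leRHS]E mulrDl -addrA addrC lerD2r.
by have := ltW ec; move: (eta / c) (expR w) => x y x0; clear -x0; lra.
Qed.

Lemma ig2D (F G : R -> R -> R) : ig2 F -> ig2 G -> ig2 (fun s r => F s r + G s r).
Proof.
move=> Fi Gi; have := integrableD measurableT Fi Gi.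
by apply: eq_integrable => // p _.
Qed.

(** The difference is the integral of [f (s - r) - f s] against [g r], so Fubini bounds it by an
    average of moduli of continuity. *)
Lemma conv_id_omega w l g f : 0 <= w -> w < l -> kern l g -> wi w f ->
  ig (fun r => `|g r| * omega w f r) /\
  wnorm w (fun s => conv g f s - Int g * f s) <= Int (fun r => `|g r| * omega w f r).
Proof.
move=> w0 wl kg fi; have gi := kern_ig (le_lt_trans w0 wl) kg.
pose F s r := g r * (f (s - r) - f s) * ew w s.
have Fi : ig2 F.
  have i1 := ig2_conv_kern w0 wl kg fi.
  have i2 := ig2_sym (ig2_tensor gi fi).
  have i3 := ig2D (ig2_abs i1) (ig2_abs i2).
  apply: (ig2_dom _ _ i3).
    have -> : F = (fun s r => g r * f (s - r) * ew w s - g r * (f s * ew w s)).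
      by apply/funext => s; apply/funext => r; rewrite /F; ring.
    by apply: mf2B; [exact: ig2_mf i1|exact: ig2_mf i2].
  move=> s r; rewrite (_ : F s r = g r * f (s - r) * ew w s - g r * (f s * ew w s)).
    exact: ler_normB.
  by rewrite /F; ring.
have E r : Int (fun s => `|F s r|) = `|g r| * omega w f r.
  rewrite -IntZ; last exact: wi_abs (wiB (wi_shift (- r) w0 fi) fi).
  by apply: Int_ext => s; rewrite !normrM [`|ew w s|]ger0_norm// mulrA.
have Fa := ig2_abs Fi.
split.
  by have := ig2_Int (ig2_sym Fa); apply: ig_ext => r; exact: E.
rewrite -(Int_ext E) -(ig2_swap Fa).
have Fs s : ig (F s).
  have := igB (conv_ig s w0 (ltW wl) kg fi) (igZ (f s) gi) => /(igZ (ew w s)).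
  by apply: ig_ext => r; rewrite /F; ring.
have E2 s : (conv g f s - Int g * f s) * ew w s = Int (F s).
  have i1 := conv_ig s w0 (ltW wl) kg fi; have i2 := igZ (f s) gi.
  rewrite [Int g * _]mulrC -IntZ// -IntB// mulrC -IntZ; last exact: igB.
  by apply: Int_ext => r; rewrite /F; ring.
apply: Int_le.
- have := ig2_Int Fi => /ig_abs; apply: ig_ext => s; rewrite -E2 normrM [`|ew w s|]ger0_norm//.
- exact: ig2_Int Fa.
- by move=> s; rewrite -[X in _ * X]ger0_norm// -normrM E2 Int_abs.
Qed.

Lemma abs_le_ew l r : 0 < l -> `|r| <= l^-1 * ew (- l) r.
Proof.
move=> l0; rewrite mulrC ler_pdivlMr// mulrC /ew mulNr opprK.
by have := expR_ge1Dx (l * `|r|); lra.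
Qed.

(** The threshold [e0] depends on [w], [f], [eta] and [B] alone, which makes the estimate uniform
    over kernels of scale [eps]: complex times may approach 0 in any manner inside the cone. The
    mass of [g] is left free because the imaginary parts of the Gaussian kernels have mass 0. *)
Lemma approx_identity w f eta (B : R) : 0 <= w -> wi w f -> 0 < eta -> 0 <= B ->
  exists2 e0, 0 < e0 & forall eps g, 0 < eps -> eps < e0 -> mf g ->
    (forall r, `|g r| <= B / eps * ew eps^-1 r) ->
    wnorm w (fun s => conv g f s - Int g * f s) <= eta.
Proof.
move=> w0 fi eta0 B0.
have b0 : 0 < 4 * B + 1 by rewrite ltr_wpDl// mulr_ge0.
have [d d0 dP] := omega_small w0 fi (divr_gt0 eta0 b0).
set et := eta / (4 * B + 1) in dP.
set N := wnorm w f; have N0 : 0 <= N by exact: wnorm_ge0.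
have c0 : 0 < 64 * N * B / d + 1.
  by rewrite ltr_wpDl// divr_ge0 ?mulr_ge0// ltW.
have w10 : 0 < w + 1 by rewrite ltr_wpDl.
(* The first bound gives [w < eps^-1 / 4], so the kernel absorbs the growth of the modulus; the
   second brings the part of order [eps] below [eta / 2]. *)
exists (Num.min (4 * (w + 1))^-1 (eta / 2 / (64 * N * B / d + 1))).
  by rewrite lt_min invr_gt0 mulr_gt0 ?divr_gt0.
move=> eps g eps0; rewrite lt_min => /andP[ew1 ee] gm gB.
have ei0 : 0 < eps^-1 by rewrite invr_gt0.
have wl : w < eps^-1 / 4.
  rewrite -(ltf_pV2 (y := eps)) ?posrE ?invr_gt0 ?mulr_gt0// in ew1; rewrite ?posrE ?invr_gt0 ?mulr_gt0//.
  by rewrite invrK in ew1; lra.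
have kg : kern eps^-1 g by split => //; exists (B / eps).
have wl' : w < eps^-1 by lra.
have [gi ub] := conv_id_omega w0 wl' kg fi.
apply: le_trans ub _.
have Be : 0 <= B / eps by rewrite divr_ge0// ltW.
(* Away from 0 the crude bound on the modulus is multiplied by [|r| / d >= 1]; the factor [|r|] is
   what produces the order [eps]. *)
have om r : omega w f r <= et + 2 * N / d * (`|r| * ew (- w) r).
  have Nd : 0 <= 2 * N / d by rewrite divr_ge0 ?mulr_ge0// ltW.
  have et0 : 0 < et by rewrite divr_gt0.
  have [/dP rd|dr] := ltP `|r| d; first by apply: le_trans rd _; rewrite lerDl mulr_ge0// mulr_ge0.
  apply: le_trans (omega_le r w0 fi) _; rewrite -/N.
  apply: (@le_trans _ _ (2 * N / d * (d * ew (- w) r))).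
    by rewrite mulrA divfK// gt_eqF.
  apply: (@le_trans _ _ (2 * N / d * (`|r| * ew (- w) r))); last by rewrite lerDr ltW.
  by rewrite ler_wpM2l// ler_wpM2r.
have pt r : `|g r| * omega w f r <=
    et * (B / eps) * ew eps^-1 r + 2 * N / d * (B / eps) * (4 * eps) * ew (eps^-1 / 2) r.
  have e1 : `|r| * ew (- w) r <= 4 * eps * ew (- (eps^-1 / 2)) r.
    have q0 : 0 < eps^-1 / 4 by rewrite divr_gt0.
    have := abs_le_ew r q0; rewrite invfM !invrK (mulrC eps) => h1.
    apply: (@le_trans _ _ (4 * eps * ew (- (eps^-1 / 4)) r * ew (- (eps^-1 / 4)) r)).
      apply: ler_pM => //; apply: ew_le; lra.
    by rewrite -mulrA -ewDw ler_wpM2l ?mulr_ge0 ?(ltW eps0)//; apply: ew_le; lra.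
  apply: (@le_trans _ _ (B / eps * ew eps^-1 r * (et + 2 * N / d * (`|r| * ew (- w) r)))).
    apply: ler_pM => //; exact: wnorm_ge0.
  rewrite mulrDr; apply: lerD; first by rewrite le_eqVlt; apply/orP; left; apply/eqP; ring.
  have -> : ew (eps^-1 / 2) r = ew eps^-1 r * ew (- (eps^-1 / 2)) r.
    transitivity (ew (eps^-1 + - (eps^-1 / 2)) r); last exact: ewDw.
    congr (ew _ r); field.
    by rewrite gt_eqF.
  have -> : B / eps * ew eps^-1 r * (2 * N / d * (`|r| * ew (- w) r)) =
     (2 * N / d * (B / eps) * ew eps^-1 r) * (`|r| * ew (- w) r) by ring.
  have -> : 2 * N / d * (B / eps) * (4 * eps) * (ew eps^-1 r * ew (- (eps^-1 / 2)) r) =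
     (2 * N / d * (B / eps) * ew eps^-1 r) * (4 * eps * ew (- (eps^-1 / 2)) r) by ring.
  rewrite ler_wpM2l//; apply: mulr_ge0 => //; apply: mulr_ge0 => //.
  by apply: divr_ge0; [exact: mulr_ge0|exact: ltW].
have e20 : 0 < eps^-1 / 2 by rewrite divr_gt0.
have i1 := igZ (et * (B / eps)) (ig_ew ei0).
have i2 := igZ (2 * N / d * (B / eps) * (4 * eps)) (ig_ew e20).
apply: le_trans (Int_le gi (igD i1 i2) pt) _.
rewrite IntD// !IntZ; [|exact: ig_ew..].
have j1 := Int_ew ei0; have j2 := Int_ew e20.
have t1 : et * (B / eps) * Int (ew eps^-1) <= et * (2 * B).
  have -> : et * (2 * B) = et * (B / eps) * (2 / eps^-1) by field; rewrite gt_eqF.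
  by rewrite ler_wpM2l// mulr_ge0// divr_ge0 ?ltW.
have t2 : 2 * N / d * (B / eps) * (4 * eps) * Int (ew (eps^-1 / 2)) <= (64 * N * B / d + 1) * eps.
  apply: (@le_trans _ _ (2 * N / d * (B / eps) * (4 * eps) * (2 / (eps^-1 / 2)))).
    rewrite ler_wpM2l//; apply: mulr_ge0; last by rewrite mulr_ge0// ltW.
    by apply: mulr_ge0 => //; apply: divr_ge0; [exact: mulr_ge0|exact: ltW].
  have -> : 2 * N / d * (B / eps) * (4 * eps) * (2 / (eps^-1 / 2)) = 32 * N * B / d * eps.
    by field; rewrite !gt_eqF.
  rewrite ler_wpM2r ?(ltW eps0)//.
  have : 0 <= N * B / d by rewrite divr_ge0 ?mulr_ge0// ltW.
  lra.
have t3 : et * (2 * B) <= eta / 2.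
  rewrite /et mulrAC ler_pdivrMr//; have := mulr_ge0 (ltW eta0) B0; lra.
have t4 : (64 * N * B / d + 1) * eps <= eta / 2.
  by rewrite mulrC -ler_pdivlMr// ltW.
lra.
Qed.

End ApproximateIdentity.

(** * Second differences and twofold primitives *)

Section SecondDifference.
Variable R : realType.
Implicit Types (f g h F G : R -> R) (w l s r a rho : R).

Lemma prim_cst (c : R) s : prim (fun=> c) s = c * s.
Proof.
rewrite (@prim_FTC R (fun=> c) (fun x => c * x)); last first.
- exact: cst_continuous.
- by move=> x; apply: dv_eq (dvM (dv_cst c x) (dv_id x)) _; ring.
by rewrite mulr0 subr0.
Qed.

Lemma prim_id s : prim id s = s ^+ 2 / 2.
Proof.
rewrite (@prim_FTC R id (fun x => x * x * 2^-1)).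
- by rewrite mul0r mul0r subr0 expr2.
- move=> x; apply: dv_eq (dvM (dvM (dv_id x) (dv_id x)) (dv_cst 2^-1 x)) _.
  by field.
- by move=> x; exact: cvg_id.
Qed.

Lemma prim_step s : prim (fun x => (0 <= x)%R%:R) s = Num.max 0 s.
Proof.
have [s0|s0] := leP 0 s.
  transitivity (prim (fun=> 1) s); last by rewrite prim_cst mul1r.
  apply: Int_ext => r; rewrite /chi; have [r0|r0] := leP 0 r => //.
  rewrite (ltW r0) (_ : r <= s) ?subrr ?mulr0//.
  exact: le_trans (ltW r0) s0.
apply: Int_aeq0.
  apply: mfM; last exact: mf_chi.
  by apply: mf_le; [exact: mf_cst|exact: mf_id].
apply: filterS (aeneq 0) => r r0; rewrite /chi; have [r1|r1] := leP 0 r; last by rewrite mul0r.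
have {}r1 : 0 < r by rewrite lt_neqAle eq_sym r0.
have -> : (r <= s) = false by apply/negbTE; rewrite -ltNge; exact: lt_trans s0 r1.
have -> : (r <= 0) = false by apply/negbTE; rewrite -ltNge.
by rewrite subrr mulr0.
Qed.

Lemma prim_chi rho r : prim (fun x => chi x rho) r = (r - rho) * chi r rho.
Proof.
pose u (x : R) : R := (0 <= x)%R%:R.
have um : mf u by apply: mf_le; [exact: mf_cst|exact: mf_id].
have w1 : (0 : R) < 1 by [].
have ui : wi 1 u.
  apply: (wi_dom um _ (wi_cst 1 w1)) => x; rewrite /u ger0_norm//.
  by case: (0 <= x).
have ci (c : R) : wi 1 (fun=> c) := wi_cst c w1.
have -> : prim (fun x => chi x rho) r =
    prim (fun x => u (x + - rho)) r - prim (fun=> (rho <= 0)%R%:R) r.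
  rewrite -(primB r ler01)//; last exact: wi_shift.
  by apply: Int_ext => x; rewrite /chi /u subr_ge0.
rewrite (prim_shift (- rho) r ler01 ui) !prim_step prim_cst /chi.
by case: (leP 0 (r - rho)); case: (leP 0 (- rho)); case: (leP rho r);
  case: (leP rho 0) => /= *; rewrite ?mul1r ?mul0r; lra.
Qed.

(** Cauchy's formula for repeated integration, on both half lines at once; [chi] supplies the
    sign. *)
Lemma prim_prim w h r : 0 <= w -> wi w h ->
  prim (prim h) r = Int (fun rho => h rho * ((r - rho) * chi r rho)).
Proof.
move=> w0 hi.
have H : ig2 (fun x rho => h rho * chi x rho * chi r x).
  have i1 : ig (fun x : R => ((- `|r| <= x) && (x <= `|r|))%R%:R : R).
    have := @ig_continuous R (fun=> 1) (- `|r|) `|r| (@cst_continuous _ _ _).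
    by apply: ig_ext => x; rewrite mul1r.
  apply: (ig2_dom _ _ (ig2_tensor (igZ (ew (- w) r) i1) (wi_abs hi))).
    apply: mf2M; last exact: mf2_1 (mf_chi r).
    by apply: mf2M; [exact: mf2_2 (wi_mf hi)|exact: mf2_chi].
  move=> x rho; rewrite !normrM -ler_norml.
  have c1 := chi_abs r x; have c2 := chi_ew x rho w0.
  case: (leP `|x| `|r|) c1 => [xr c1|_ c1]; last first.
    by rewrite (le_anti (x := `|chi r x|) (y := 0)) ?c1 ?normr_ge0// !mulr0 mul0r.
  rewrite mulr1 -mulrA.
  have -> : ew (- w) r * (`|h rho| * ew w rho) = `|h rho| * (ew (- w) r * ew w rho) by ring.
  apply: ler_wpM2l => //; rewrite -[leRHS]mulr1; apply: ler_pM => //.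
  apply: le_trans c2 _; rewrite ler_wpM2r// ler_expR !mulNr !opprK ler_wpM2l//.
transitivity (Int (fun x => Int (fun rho => h rho * chi x rho * chi r x))).
  apply: Int_ext => x; rewrite mulrC -IntZ; last exact: ig_prim hi.
  by apply: Int_ext => rho; rewrite mulrC.
rewrite (ig2_swap H); apply: Int_ext => rho.
rewrite -prim_chi -IntZ; first by apply: Int_ext => x; rewrite mulrA.
have c1 : 0 < (1 : R) by [].
have := @ig_prim R 1 (fun x => chi x rho) r ler01; apply.
have um : mf (fun x => chi x rho).
  by apply: mfB; [apply: mf_le; [exact: mf_cst|exact: mf_id]|exact: mf_cst].
apply: (wi_dom um _ (wi_cst 1 c1)) => x; apply: le_trans (chi_abs _ _) _.
by case: (`|rho| <= `|x|).
Qed.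

Definition tri a rho := Num.max 0 (a - `|rho|).

Lemma tri_ge0 a rho : 0 <= tri a rho.
Proof. by rewrite le_max lexx. Qed.

Lemma triN a rho : tri a (- rho) = tri a rho.
Proof. by rewrite /tri normrN. Qed.

Lemma mf_max f g : mf f -> mf g -> mf (fun x => Num.max (f x) (g x)).
Proof. exact: measurable_maxr. Qed.

Lemma mf_tri a : mf (tri a).
Proof.
apply: mf_max; first exact: mf_cst.
by apply: mfB; [exact: mf_cst|exact: mf_abs (@mf_id R)].
Qed.

Lemma tri_exp l a rho : 0 < l -> 0 <= a -> tri a rho <= l^-1 * (ew (- l) a * ew l rho).
Proof.
move=> l0 a0; rewrite /ew mulNr opprK -expRD (ger0_norm a0) -mulrBr.
rewrite ge_max mulr_ge0 ?invr_ge0 ?expR_ge0 ?(ltW l0)//=.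
rewrite mulrC ler_pdivlMr// mulrC.
by have := expR_ge1Dx (l * (a - `|rho|)); lra.
Qed.

(** The tent [tri] is the Peano kernel of the second difference. The difference is the primitive of
    [P (x + s) - P (s - x)], itself a primitive of the symmetrised [F], which reduces the claim to
    [prim_prim]. *)
Lemma second_difference w F s r : 0 <= w -> wi w F ->
  prim (prim F) (s + r) + prim (prim F) (s - r) - 2 * prim (prim F) s =
  Int (fun rho => F (s - rho) * tri `|r| rho).
Proof.
move=> w0 Fi; wlog r0 : r / 0 <= r => [H|].
  have [|r0] := leP 0 r; first exact: H.
  have := H (- r); rewrite oppr_ge0 (ltW r0) normrN opprK => /(_ isT) <-.
  by rewrite (addrC (prim _ (s + r))).
have w1 : w < w + 1 by rewrite ltrDl.
have w10 : 0 <= w + 1 by rewrite addr_ge0.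
set P := prim F; have Pi : wi (w + 1) P := wi_prim w0 w1 Fi.
have Fp : wi w (fun x => F (x + s)) := wi_shift s w0 Fi.
have Fm : wi w (fun x => F (s - x)) := wi_refl s w0 Fi.
have Pp : wi (w + 1) (fun x => P (x + s)) := wi_shift s w10 Pi.
have Pm : wi (w + 1) (fun x => P (s - x)) := wi_refl s w10 Pi.
have e1 : prim P (s + r) - prim P s = prim (fun x => P (x + s)) r.
  by rewrite (prim_shift s r w10 Pi) (addrC r).
have e2 : prim P s - prim P (s - r) = prim (fun x => P (s - x)) r.
  by rewrite (prim_refl s r w10 Pi).
have e3 : prim P (s + r) + prim P (s - r) - 2 * prim P s =
    prim (fun x => P (x + s) - P (s - x)) r.
  by rewrite (primB r w10 Pp Pm) -e1 -e2; ring.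
have e4 x : P (x + s) - P (s - x) = prim (fun y => F (y + s) + F (s - y)) x.
  by rewrite (primD x w0 Fp Fm) (prim_shift s x w0 Fi) (prim_refl s x w0 Fi) -/P; ring.
rewrite e3 (_ : (fun x => P (x + s) - P (s - x)) = prim (fun y => F (y + s) + F (s - y)));
  last by apply/funext.
rewrite (prim_prim r w0 (wiD Fp Fm)).
pose T rho := (r - rho) * chi r rho.
have Ti f : wi w f -> ig (fun rho => f rho * T rho).
  move=> fi; have h := ig_prim r w0 fi.
  apply: (ig_dom _ _ (igZ (2 * `|r|) (ig_abs h))).
    apply: mfM; first exact: wi_mf fi.
    by apply: mfM; [apply: mfB; [exact: mf_cst|exact: mf_id]|exact: mf_chi].
  move=> x; rewrite /T !normrM.
  have -> : `|f x| * (`|r - x| * `|chi r x|) = `|r - x| * `|chi r x| * `|f x| by ring.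
  rewrite mulrCA [_ * (2 * _ * _)]mulrC ler_wpM2r//.
  have := chi_abs r x; case: (leP `|x| `|r|) => [xr _|_].
    by rewrite ler_wpM2r//; have := ler_normB r x; clear -xr; lra.
  by move=> c0; rewrite (le_anti (x := `|chi r x|) (y := 0)) ?c0 ?normr_ge0// !mulr0.
transitivity (Int (fun rho => F (s - rho) * (T (- rho) + T rho))).
  have i1 := Ti _ Fp; have i2 := Ti _ Fm.
  have -> : Int (fun rho => (F (rho + s) + F (s - rho)) * T rho) =
     Int (fun rho => F (rho + s) * T rho) + Int (fun rho => F (s - rho) * T rho).
    by rewrite -IntD//; apply: Int_ext => x; rewrite mulrDl.
  rewrite -(Int_refl 0 i1) -IntD//; last exact: ig_refl i1.
  by apply: Int_ext => x; rewrite sub0r mulrDr addrC (addrC (- x)) addrC.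
have Tm : mf T.
  by apply: mfM; [apply: mfB; [exact: mf_cst|exact: mf_id]|exact: mf_chi].
apply: Int_aeq.
- apply: mfM; first exact: wi_mf Fm.
  apply: mfD => //; have := mf_refl 0 Tm; congr mf; apply/funext => x; by rewrite sub0r.
- by apply: mfM; [exact: wi_mf Fm|exact: mf_tri].
apply: filterS (aeneq 0) => x x0; congr (_ * _).
rewrite /T /tri /chi (ger0_norm r0).
have [x1|x1] := ltP 0 x.
  have -> : (- x <= 0) = true by apply/idP; clear -x1; lra.
  have -> : (- x <= r) = true by apply/idP; clear -x1 r0; lra.
  rewrite gtr0_norm//; clear -x1 r0.
  by case: (leP x r); case: (leP 0 (r - x)) => /= *; lra.
have {}x1 : x < 0 by rewrite lt_neqAle x0.
have -> : (x <= r) = true by apply/idP; clear -x1 r0; lra.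
have -> : (- x <= 0) = false by apply/negbTE; rewrite -ltNge; clear -x1; lra.
rewrite ltr0_norm//; clear -x1 r0.
by case: (leP (- x) r); case: (leP 0 (r - - x)) => /= *; lra.
Qed.

(* For an even G, G * Y - (Int G) Y is the convolution of Y'' with Km G. *)
Definition Km G rho := 2^-1 * Int (fun r => G r * tri `|r| rho).

Lemma mf2_tri : mf2 (fun rho r : R => tri `|r| rho).
Proof.
apply: measurable_maxr; first exact: measurable_cst.
by apply: measurable_funB; [exact: (mf2_2 (mf_abs (@mf_id R)))|exact: (mf2_1 (mf_abs (@mf_id R)))].
Qed.

(** The tent is at most [2 / l] times [expR (l / 2 * (|r| - |rho|))], so half of the decay in [r] is
    traded for decay in [rho]. *)
Lemma Km_dom (B l : R) G rho r : 0 < l -> (forall r, `|G r| <= B * ew l r) -> 0 <= B ->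
  `|G r * tri `|r| rho| <= B * (2 / l) * ew (l / 2) r * ew (l / 2) rho.
Proof.
move=> l0 GB B0; rewrite normrM (ger0_norm (tri_ge0 _ _)).
have l2 : 0 < l / 2 by rewrite divr_gt0.
have := tri_exp rho l2 (normr_ge0 r).
have -> : ew (- (l / 2)) `|r| = ew (- (l / 2)) r by rewrite /ew normr_id.
move=> t; apply: le_trans (ler_pM (normr_ge0 _) (tri_ge0 _ _) (GB r) t) _.
have -> : ew (l / 2) r = ew l r * ew (- (l / 2)) r.
  by rewrite -ewDw; congr (ew _ r); field.
rewrite invf_div le_eqVlt; apply/orP; left; apply/eqP; ring.
Qed.

Lemma Km_bound (B l : R) G : 0 < l -> mf G -> (forall r, `|G r| <= B * ew l r) -> 0 <= B ->
  mf (Km G) /\ forall rho, `|Km G rho| <= 4 * B / l ^+ 2 * ew (l / 2) rho.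
Proof.
move=> l0 Gm GB B0.
have l2 : 0 < l / 2 by rewrite divr_gt0.
have dom rho r := Km_dom rho r l0 GB B0.
have H : ig2 (fun rho r => G r * tri `|r| rho).
  apply: (ig2_dom _ _ (ig2_tensor (ig_ew l2) (igZ (B * (2 / l)) (ig_ew l2)))).
    by apply: mf2M; [exact: mf2_2|exact: mf2_tri].
  by move=> rho r; apply: le_trans (dom rho r) _; rewrite mulrC.
split; first by apply: mfM; [exact: mf_cst|exact: ig_mf (ig2_Int H)].
move=> rho; rewrite normrM ger0_norm ?invr_ge0//.
have c0 : 0 <= B * (2 / l) * ew (l / 2) rho by rewrite !mulr_ge0// invr_ge0 ltW.
have di : ig (fun r => B * (2 / l) * ew (l / 2) rho * ew (l / 2) r) by exact: igZ (ig_ew l2).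
have dom' r : `|G r * tri `|r| rho| <= B * (2 / l) * ew (l / 2) rho * ew (l / 2) r.
  by apply: le_trans (dom rho r) _; rewrite mulrAC.
have i1 : ig (fun r => G r * tri `|r| rho).
  apply: (ig_dom _ dom' di); apply: mfM => //.
  apply: mf_max; first exact: mf_cst.
  by apply: mfB; [exact: mf_abs (@mf_id R)|exact: mf_cst].
have := le_trans (Int_abs i1) (Int_le (ig_abs i1) di dom').
rewrite IntZ; last exact: ig_ew.
move=> h; have := le_trans h (ler_wpM2l c0 (Int_ew l2)).
have -> : 4 * B / l ^+ 2 * ew (l / 2) rho = 2^-1 * (B * (2 / l) * ew (l / 2) rho * (2 / (l / 2))).
  by field; rewrite gt_eqF.
by move=> h2; rewrite ler_wpM2l// invr_ge0.
Qed.

Lemma Km_kern l G : 0 < l -> kern l G -> kern (l / 2) (Km G).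
Proof.
move=> l0 kG; have [C C0 GC] := kernP kG.
by have [Km1 Km2] := Km_bound l0 (kern_mf kG) GC C0; split => //; eexists; exact: Km2.
Qed.

Lemma wi_prim2 w F l : 0 <= w -> w < l -> wi w F -> wi l (prim (prim F)).
Proof.
move=> w0 wl Fi; have a : w < (w + l) / 2 by lra.
have b : (w + l) / 2 < l by lra.
have c : 0 <= (w + l) / 2 by lra.
exact: wi_prim c b (wi_prim w0 a Fi).
Qed.

(** Averaging over [r] and [- r], allowed by evenness of [G], turns the left side into half the
    [G]-average of second differences, to which the Peano formula and Fubini apply. *)
Lemma conv_second w l G F s : 0 <= w -> w < l / 2 -> kern l G -> (forall r, G (- r) = G r) ->
  wi w F ->
  conv G (prim (prim F)) s - Int G * prim (prim F) s = conv (Km G) F s.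
Proof.
move=> w0 wl2 kG Ge Fi; have l0 : 0 < l by lra.
have l2 : 0 < l / 2 by lra.
have wl : w < l by lra.
have [C C0 GC] := kernP kG.
set Y := prim (prim F).
have Yi : wi (l / 2) Y := wi_prim2 w0 wl2 Fi.
have l20 := ltW l2.
have l2l : l / 2 <= l by lra.
have Gi : ig G := kern_ig l0 kG.
have i1 : ig (fun r => G r * Y (s - r)) := conv_ig s l20 l2l kG Yi.
have i2 : ig (fun r => G r * Y (s + r)).
  have := ig_refl 0 i1; apply: ig_ext => r; rewrite sub0r Ge; congr (_ * Y _); ring.
have e1 : conv G Y s = Int (fun r => G r * Y (s + r)).
  rewrite /conv -(Int_refl 0 i1); apply: Int_ext => r; rewrite sub0r Ge; congr (_ * Y _); ring.
have e2 : conv G Y s - Int G * Y s =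
    2^-1 * Int (fun r => G r * (Y (s + r) + Y (s - r) - 2 * Y s)).
  have -> : Int (fun r => G r * (Y (s + r) + Y (s - r) - 2 * Y s)) =
      Int (fun r => (G r * Y (s + r) + G r * Y (s - r)) - 2 * Y s * G r).
    by apply: Int_ext => r; ring.
  rewrite (IntB (igD i2 i1) (igZ (2 * Y s) Gi)) (IntD i2 i1) (IntZ (2 * Y s) Gi) -e1.
  by rewrite -/(conv G Y s); field.
rewrite e2.
have H : ig2 (fun rho r => F (s - rho) * (G r * tri `|r| rho)).
  have Fm : ig (fun rho => `|F (s - rho)| * ew w rho) := wi_abs (wi_refl s w0 Fi).
  apply: (ig2_dom _ _ (ig2_tensor Fm (igZ (C * (2 / l)) (ig_ew l2)))).
    apply: mf2M; first exact: mf2_1 (mf_refl s (wi_mf Fi)).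
    by apply: mf2M; [exact: mf2_2 (kern_mf kG)|exact: mf2_tri].
  move=> rho r.
  have h : `|G r * tri `|r| rho| <= C * (2 / l) * ew (l / 2) r * ew w rho.
    apply: le_trans (Km_dom rho r l0 GC C0) _; apply: ler_wpM2l (ew_le rho (ltW wl2)).
    by rewrite !mulr_ge0// invr_ge0 ltW.
  rewrite normrM; apply: le_trans (ler_wpM2l (normr_ge0 _) h) _.
  by rewrite le_eqVlt; apply/orP; left; apply/eqP; ring.
transitivity (2^-1 * Int (fun rho => Int (fun r => F (s - rho) * (G r * tri `|r| rho)))).
  rewrite (ig2_swap H); congr (_ * _); apply: Int_ext => r.
  rewrite (second_difference s r w0 Fi) -IntZ.
    by apply: Int_ext => rho; ring.
  have [t0 t1] : mf (tri `|r|) /\ forall rho, `|tri `|r| rho| <= l^-1 * ew (- l) r * ew w rho.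
    split; first exact: mf_tri.
    move=> rho; rewrite ger0_norm ?tri_ge0//; apply: le_trans (tri_exp rho l0 (normr_ge0 r)) _.
    rewrite /ew normr_id -/(ew (- l) r) -/(ew l rho) -mulrA !ler_wpM2l ?invr_ge0 ?expR_ge0 ?(ltW l0)//.
    exact: ew_le (ltW wl).
  apply: (ig_dom _ _ (igZ (l^-1 * ew (- l) r) (wi_abs (wi_refl s w0 Fi)))).
    by apply: mfM => //; exact: mf_refl (wi_mf Fi).
  by move=> rho; rewrite normrM mulrC [leRHS]mulrCA mulrC ler_wpM2l// mulrC.
rewrite -IntZ; last exact: ig2_Int H.
apply: Int_ext => rho; rewrite IntZ; first by rewrite /Km; ring.
apply: (ig_dom _ _ (igZ (C * (2 / l) * ew (l / 2) rho) (ig_ew l2))).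
  apply: mfM (kern_mf kG) _; apply: mf_max; first exact: mf_cst.
  by apply: mfB; [exact: mf_abs (@mf_id R)|exact: mf_cst].
by move=> r; apply: le_trans (Km_dom rho r l0 GC C0) _; rewrite mulrAC.
Qed.

(** Read off from [conv_second] at 0 for [F = 1], whose twofold primitive is [s ^+ 2 / 2]. *)
Lemma Km_mass l G : 0 < l -> kern l G -> (forall r, G (- r) = G r) ->
  Int (Km G) = 2^-1 * Int (fun r => r ^+ 2 * G r).
Proof.
move=> l0 kG Ge; have l4 : 0 < l / 4 by lra.
have l42 : l / 4 < l / 2 by lra.
have := @conv_second (l / 4) l G (fun=> 1) 0 (ltW l4) l42 kG Ge (wi_cst 1 l4).
have pp : prim (prim (fun=> (1 : R))) = fun s => s ^+ 2 / 2.
  rewrite (_ : prim (fun=> 1) = id); first by apply/funext => s; rewrite prim_id.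
  by apply/funext => s; rewrite prim_cst mul1r.
rewrite pp expr0n mul0r mulr0 subr0 => h.
transitivity (conv (Km G) (fun=> 1) 0); first by apply: Int_ext => r; rewrite mulr1.
rewrite -h /conv -IntZ; first by apply: Int_ext => r; rewrite sub0r sqrrN; ring.
have l20 : 0 <= l / 2 by lra.
have l2l : l / 2 <= l by lra.
have := conv_ig 0 l20 l2l kG (wi_prim2 (ltW l4) l42 (wi_cst 1 l4)).
by rewrite pp => /(igZ 2); apply: ig_ext => r; rewrite sub0r sqrrN; field.
Qed.

End SecondDifference.

(** * The exponential kernel *)

Section ExponentialKernel.
Variable R : realType.
Implicit Types (f g h F G : R -> R) (w l s r a rho : R).

Lemma Int_half_line (phi Phi : R -> R) : (forall x, dv Phi x (phi x)) -> continuous phi ->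
  ig (fun x => phi x * (0 < x)%R%:R) -> Phi (k%:R) @[k --> \oo] --> (0 : R) ->
  Int (fun x => phi x * (0 < x)%R%:R) = - Phi 0.
Proof.
move=> dP pc pi P0.
have pm := mf_cont pc.
have c1 : prim phi k%:R @[k --> \oo] --> Int (fun x => phi x * (0 < x)%R%:R).
  apply: (@Int_dominated R (fun k x => phi x * chi k%:R x) _ (fun x => `|phi x * (0 < x)%R%:R|)).
  - by move=> k; apply: mfM => //; exact: mf_chi.
  - exact: ig_mf pi.
  - move=> x; apply: cvg_near_cst; exists (Num.truncn `|x|).+1 => //= k /= xk.
    have xk' : x <= k%:R.
      apply: le_trans (ler_norm _) (le_trans (ltW (truncnS_gt _)) _); by rewrite ler_nat.
    by rewrite /chi xk'; case: (leP x 0) => /= _; rewrite ?subrr ?subr0.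
  - exact: ig_abs.
  - move=> k x; rewrite !normrM ler_wpM2l// /chi.
    case: (leP x 0) => [x0|x0]; last first.
      by case: (x <= k%:R); rewrite /= subr0 normr1 ?normr0.
    by rewrite (le_trans x0 (ler0n R k)) /= subrr.
have c2 : prim phi k%:R @[k --> \oo] --> 0 - Phi 0.
  rewrite (_ : (fun k => _) = (fun k : nat => Phi k%:R - Phi 0)).
    by apply: cvgB => //; exact: cvg_cst.
  by apply/funext => k; rewrite (prim_FTC _ dP pc).
by rewrite -[RHS]sub0r; exact: (cvg_unique (@norm_hausdorff _ R^o) c1 c2).
Qed.

Lemma pos_xexp l r : 0 < l -> 0 <= r * (0 < r)%R%:R * expR (- (l * r)) /\
  r * (0 < r)%R%:R * expR (- (l * r)) <= 2 / l * ew (l / 2) r.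
Proof.
move=> l0; have l2 : 0 < l / 2 by rewrite divr_gt0.
case: (ltP 0 r) => [r0|_]; last first.
  by rewrite mulr0 mul0r; split => //; rewrite mulr_ge0// divr_ge0// ltW.
rewrite mulr1; split; first by rewrite mulr_ge0 ?expR_ge0// ltW.
have := abs_le_ew r l2; rewrite invf_div (gtr0_norm r0) => h.
have -> : expR (- (l * r)) = ew (l / 2) r * ew (l / 2) r.
  by rewrite /ew (gtr0_norm r0) -expRD; congr expR; field.
rewrite mulrA; apply: ler_wpM2r => //.
have := ler_wpM2r (ew_ge0 (l / 2) r) h.
by rewrite -[leRHS]mulrA (mulrC (ew (- (l / 2)) r)) ew_inv mulr1.
Qed.

Lemma Int_xexp l : 0 < l -> let f := fun x : R => x * (0 < x)%R%:R * expR (- (l * x)) in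
  ig f /\ Int f = l^-2.
Proof.
move=> l0 f; have l2 : 0 < l / 2 by rewrite divr_gt0.
have ln0 : l != 0 by rewrite gt_eqF.
pose phi x := x * expR (- (l * x)).
pose Phi x := - ((x / l + l^-2) * expR (- (l * x))).
have dE x : dv (fun x => expR (- (l * x))) x (expR (- (l * x)) * - l).
  apply: dv_exp; apply: dvN.
  by apply: dv_eq (dvM (dv_cst l x) (dv_id x)) _; ring.
have dP x : dv Phi x (phi x).
  apply: dv_eq (dvN (dvM (dvD (dvM (dv_id x) (dv_cst l^-1 x)) (dv_cst (l^-2) x)) (dE x))) _.
  by rewrite /phi; field.
have pc : continuous phi.
  by apply: (dv_cont (f := fun x => _)) => x; exact: dvM (dv_id x) (dE x).
have ff : f = fun x => phi x * (0 < x)%R%:R by apply/funext => x; rewrite /f /phi mulrAC.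
have fi : ig f.
  apply: (ig_dom _ _ (igZ (2 / l) (ig_ew l2))).
    rewrite ff; apply: mfM; [exact: mf_cont|exact: mf_ind_gt].
  by move=> x; have [p0 p1] := pos_xexp x l0; rewrite ger0_norm.
split => //.
have := @Int_half_line phi Phi dP pc; rewrite -ff => /(_ fi) ->.
  by rewrite /Phi mul0r add0r mulr0 oppr0 expR0 mulr1 opprK.
have b (k : nat) : `|Phi k.+1%:R| <= 6 * l^-1 ^+ 3 * k.+1%:R^-1.
  have k0 : 0 < k.+1%:R :> R by [].
  set x := k.+1%:R in k0 *.
  have i0 : expR (- (l * x)) = ew (l / 2) x * ew (l / 2) x.
    by rewrite /ew (gtr0_norm k0) -expRD; congr expR; field.
  have i1 : x * ew (l / 2) x <= 2 / l.
    have := abs_le_ew x l2; rewrite invf_div (gtr0_norm k0) => /(ler_wpM2r (ew_ge0 (l / 2) x)).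
    by rewrite -mulrA (mulrC (ew _ _)) ew_inv mulr1.
  have i2 : ew (l / 2) x <= 1 by apply: ew_le1; exact: ltW.
  have e0 := ew_ge0 (l / 2) x.
  rewrite normrN ger0_norm; last first.
    by rewrite mulr_ge0 ?expR_ge0// addr_ge0 ?invr_ge0 ?exprn_ge0 ?divr_ge0// ltW.
  rewrite ler_pdivlMr// i0.
  have -> : (x / l + l ^- 2) * (ew (l / 2) x * ew (l / 2) x) * x =
     l^-1 * (x * ew (l / 2) x) * (x * ew (l / 2) x) + l ^- 2 * ((x * ew (l / 2) x) * ew (l / 2) x) by ring.
  have li : 0 <= l^-1 by rewrite invr_ge0 ltW.
  have xe : 0 <= x * ew (l / 2) x by rewrite mulr_ge0// ltW.
  have l2i : 0 <= l ^- 2 by rewrite invr_ge0 exprn_ge0// ltW.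
  have -> : 6 * l^-1 ^+ 3 = l^-1 * (2 / l) * (2 / l) + l ^- 2 * (2 / l) by field.
  apply: lerD.
    by apply: ler_pM => //; [exact: mulr_ge0|apply: ler_wpM2l].
  by apply: ler_wpM2l => //; rewrite -[leRHS]mulr1; apply: ler_pM.
rewrite -(cvg_shiftS (fun k : nat => Phi k%:R)); apply/cvgrPdist_le => e e0.
have c0 : 0 < 6 * l^-1 ^+ 3 by rewrite mulr_gt0// exprn_gt0// invr_gt0.
have := near_infty_natSinv_lt (PosNum (divr_gt0 e0 c0)).
apply: filterS => k /= /ltW ke; rewrite sub0r normrN; apply: le_trans (b k) _.
by rewrite mulrC -ler_pdivlMr.
Qed.

Lemma Int_ew_eq l : 0 < l -> Int (ew l) = 2 / l.
Proof.
move=> l0; have li : l^-1 * l = 1 by rewrite mulVf// gt_eqF.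
have e1 := ig_exponential l0; have e2 := ig_refl 0 e1.
have -> : 2 / l = Int (fun x => l^-1 * (exponential_pdf l x + exponential_pdf l (0 - x))).
  by rewrite IntZ ?IntD ?(Int_refl 0 e1) ?Int_exponential//; [ring|exact: igD].
apply: Int_aeq; first exact: mf_ew.
  by apply: mfM; [exact: mf_cst|apply: mfD; exact: ig_mf].
apply: filterS (aeneq 0) => x x0.
have [x1|x1] := ltP 0 x.
  rewrite (exponential_pdfE l (ltW x1)) (@lt0_exponential_pdf _ l (0 - x)) ?addr0.
    by rewrite /ew (gtr0_norm x1) mulrA li mul1r mulNr.
  by clear -x1; lra.
have {}x1 : x < 0 by rewrite lt_neqAle x0.
rewrite (@lt0_exponential_pdf _ l x)// add0r exponential_pdfE; last by clear -x1; lra.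
by rewrite /ew (ltr0_norm x1) sub0r mulrA li mul1r mulNr.
Qed.

(** The exponential is an eigenfunction of [Km], the integral form of its being a multiple of the
    fundamental solution of [l^2 - d^2/dx^2]; this turns [conv_second] into the resolvent identity.
    The tent restricts to [|r| > |rho|], which leaves two copies of the integral of
    [x expR (- l x)]. *)
Lemma Km_exp l rho : 0 < l -> Km (ew l) rho = l^-2 * ew l rho.
Proof.
move=> l0; have [fi fI] := Int_xexp l0; set f := fun x : R => _ in fi fI.
have a0 := normr_ge0 rho; set a := `|rho| in a0.
have i1 := ig_shift (- a) fi.
have E r : ew l r * tri `|r| rho = ew l rho * (f (r + - a) + f (0 - r + - a)).
  have ea x : ew l x = expR (- (l * `|x|)) by [].
  rewrite mulrDr /f /tri -/a !ea -/a.
  have X y : 0 < y - a -> expR (- (l * a)) * ((y - a) * 1 * expR (- (l * (y - a)))) = expR (- (l * y)) * (y - a).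
    by move=> _; rewrite mulr1 mulrCA -expRD mulrC; congr (expR _ * _); ring.
  case: (ltP 0 r) => r0.
    have -> : (0 < 0 - r - a) = false by apply/negbTE; rewrite -leNgt; clear -r0 a0; lra.
    rewrite (gtr0_norm r0) /= !(mulr0n, mulr0, mul0r, addr0).
    case: (ltP 0 (r - a)) => ra; last by rewrite /= !(mulr0n, mulr0, mul0r).
    by rewrite X.
  have -> : (0 < r - a) = false by apply/negbTE; rewrite -leNgt; clear -r0 a0; lra.
  rewrite (ler0_norm r0) /= !(mulr0n, mulr0, mul0r, add0r).
  case: (ltP 0 (- r - a)) => ra; last by rewrite /= !(mulr0n, mulr0, mul0r).
  by rewrite X.
have i2 := ig_refl 0 i1.
rewrite /Km (Int_ext E) (IntZ _ (igD i1 i2)) (IntD i1 i2) (Int_refl 0 i1) (Int_shift (- a) fi) fI.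
by field; rewrite gt_eqF.
Qed.

End ExponentialKernel.

(** * Even kernels and affine functions *)

Section EvenConvolution.
Variable R : realType.
Implicit Types (G V F : R -> R) (w l s b d : R).

(** The first moment of an even kernel vanishes, so only its mass acts on an affine function. *)
Lemma conv_affine l G b d s : 0 < l -> kern l G -> (forall r, G (- r) = G r) ->
  conv G (fun x => b + d * x) s = Int G * (b + d * s).
Proof.
move=> l0 kG Ge; have [C C0 GC] := kernP kG.
have Gi := kern_ig l0 kG.
have rGi : ig (fun r => r * G r).
  have l2 : 0 < l / 2 by rewrite divr_gt0.
  apply: (ig_dom _ _ (igZ (2 / l * C) (ig_ew l2))).
    by apply: mfM; [exact: mf_id|exact: kern_mf kG].
  move=> r; rewrite normrM; have := abs_le_ew r l2; rewrite invf_div => h.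
  apply: le_trans (ler_pM (normr_ge0 _) (normr_ge0 _) h (GC r)) _.
  have -> : ew (l / 2) r = ew l r * ew (- (l / 2)) r.
    by rewrite -ewDw; congr (ew _ r); field.
  by rewrite le_eqVlt; apply/orP; left; apply/eqP; ring.
have odd0 : Int (fun r => r * G r) = 0.
  have := Int_refl 0 rGi.
  have -> : Int (fun x => (0 - x) * G (0 - x)) = Int (fun r => (-1) * (r * G r)).
    by apply: Int_ext => r; rewrite sub0r Ge; ring.
  by rewrite (IntZ _ rGi); lra.
transitivity (Int (fun r => (b + d * s) * G r - d * (r * G r))).
  by apply: Int_ext => r; ring.
by rewrite (IntB (igZ _ Gi) (igZ _ rGi)) !IntZ// odd0; ring.
Qed.

Lemma conv_second_affine w l G F b d s : 0 <= w -> w < l / 2 -> kern l G ->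
  (forall r, G (- r) = G r) -> wi w F ->
  conv G (fun x => b + d * x + prim (prim F) x) s - Int G * (b + d * s + prim (prim F) s) =
  conv (Km G) F s.
Proof.
move=> w0 wl kG Ge Fi; rewrite -(conv_second s w0 wl kG Ge Fi).
have l2 : 0 < l / 2 by exact: le_lt_trans w0 wl.
have l0 : 0 < l by move: l2; rewrite pmulr_lgt0// invr_gt0.
have l2l : l / 2 <= l by rewrite ler_piMr ?(ltW l0)// invf_le1// ler1n.
have ai : wi (l / 2) (fun x => b + d * x).
  apply: wiD; first exact: wi_cst.
  have := wi_prim (lexx 0) l2 _; rewrite /wi.
  have l4 : 0 < l / 4 by rewrite divr_gt0.
  have l42 : l / 4 < l / 2 by clear -l0; lra.
  have := wi_prim (ltW l4) l42 (wi_cst d l4).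
  by rewrite (_ : prim (fun=> d) = *%R d)//; apply/funext => x; rewrite prim_cst.
rewrite (convDr s (ltW l2) l2l kG ai (wi_prim2 w0 wl Fi)).
by rewrite (conv_affine b d s l0 kG Ge); ring.
Qed.

End EvenConvolution.

Lemma resolvent_ring1 (R : comPzRingType) (a x y z : R) :
  a * x + -1 * y = z - (1 * y + -1 * (a * x + -1 * z)).
Proof. by ring. Qed.

Lemma resolvent_ring2 (R : comPzRingType) (a x y : R) : a * x + -1 * (a * x + -1 * y) = y.
Proof. by ring. Qed.

(** * The generator in terms of twofold primitives *)

Section NetworkGenerator.
Variables (R : realType) (n : nat).
Variables (bar : 'I_n -> 'I_n) (tau : 'I_n -> R) (kap : 'M[R]_n).
Hypotheses (barK : involutive bar) (tau_gt0 : forall e, 0 < tau e).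
Hypothesis tau_bar : forall e, tau (bar e) = tau e.
Implicit Types (V F u v : 'I_n -> R -> R) (w s a h : R) (e f : 'I_n) (g : R -> R).
Implicit Types (b d : 'I_n -> R).

Local Notation symC := (symC bar tau).
Local Notation symS := (symS kap).
Local Notation data := (data tau).
Local Notation compat := (compat bar tau).
Local Notation ext := (ext bar tau kap).
Local Notation cut := (cut tau).
Local Notation cutnorm := (cutnorm tau).
Local Notation wt := (wt tau kap).
Local Notation rop := (rop bar tau kap).
Local Notation ekern := (ekern tau kap).
Local Notation lin a u b v := (fun e s => a * u e s + b * v e s).

(** The general function with second derivative [F e]; [b e] and [d e] are its value and slope at
    0. *)
Definition affp b d F e s := b e + d e * s + prim (prim (F e)) s.

Lemma affp_wi w l b d F : 0 <= w -> w < l -> wiV w F -> wiV l (affp b d F).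
Proof.
move=> w0 wl Fi e; have l0 := le_lt_trans w0 wl.
apply: wiD; last exact: wi_prim2 (Fi e).
apply: wiD; first exact: wi_cst.
have l2 : 0 < l / 2 by rewrite divr_gt0.
have l2l : l / 2 < l by rewrite ltr_pdivrMr// ltr_pMr// ltr1n.
have := wi_prim (ltW l2) l2l (wi_cst (d e) l2).
by rewrite (_ : prim (fun=> d e) = *%R (d e))//; apply/funext => x; rewrite prim_cst.
Qed.

Lemma prim2_symC w F e s : 0 <= w -> wiV w F -> symC F ->
  prim (prim (F (bar e))) s = prim (F e) (tau e) * s -
    prim (prim (F e)) (tau e) + prim (prim (F e)) (tau e - s).
Proof.
move=> w0 Fi cF; have w1 : w < w + 1 by rewrite ltrDl.
have w10 : 0 < w + 1 by exact: le_lt_trans w0 w1.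
have Pi := wi_prim w0 w1 (Fi e).
have -> : prim (F (bar e)) = fun x => prim (F e) (tau e) - prim (F e) (tau e - x).
  apply/funext => x; rewrite -(prim_refl _ _ w0 (Fi e)); congr (prim _ x).
  by apply/funext => r; exact: cF.
rewrite (primB s (ltW w10) (wi_cst _ w10) (wi_refl (tau e) (ltW w10) Pi)).
by rewrite (prim_refl _ _ (ltW w10) Pi) prim_cst; ring.
Qed.

(** For consistent [F], reversal changes the twofold primitive by an affine term ([prim2_symC]), so
    the relation compares affine functions of [s]; their values at 0 and 1 give the matching
    conditions at the far end. *)
Lemma affp_symC w b d F : 0 <= w -> wiV w F -> symC F ->
  symC (affp b d F) <->
  (forall e, b (bar e) = b e + d e * tau e + prim (prim (F e)) (tau e)) /\
  (forall e, d (bar e) = - d e - prim (F e) (tau e)).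
Proof.
move=> w0 Fi cF; split => [H|[H1 H2] e s]; last first.
  by rewrite /affp (prim2_symC e s w0 Fi cF) H1 H2; ring.
have E e s : b (bar e) + d (bar e) * s + prim (F e) (tau e) * s - prim (prim (F e)) (tau e) =
    b e + d e * (tau e - s).
  have := H e s; rewrite /affp (prim2_symC e s w0 Fi cF) => h.
  by apply: (addIr (prim (prim (F e)) (tau e - s))); rewrite -[RHS]h; ring.
have E0 e := E e 0; have E1 e := E e 1.
have E2 e : b (bar e) = b e + d e * tau e + prim (prim (F e)) (tau e).
  apply: (addIr (- prim (prim (F e)) (tau e))).
  by have := E0 e; rewrite !mulr0 !addr0 subr0 => ->; ring.
split => e; first exact: E2.
apply: (addrI (b (bar e) + prim (F e) (tau e) - prim (prim (F e)) (tau e))).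
have := E1 e; rewrite !mulr1 E2 => h.
by transitivity (b e + d e * (tau e - 1)); [rewrite -h; ring|ring].
Qed.

Lemma prim_sym w (V : R -> R) s : 0 <= w -> wi w V ->
  prim V s - prim V (- s) = prim (fun r => V r + V (- r)) s.
Proof.
move=> w0 Vi; rewrite (primD s w0 Vi (wi_neg Vi)) (prim_neg s w0 Vi); ring.
Qed.

Lemma prim_asym w (V : R -> R) s : 0 <= w -> wi w V ->
  prim V s + prim V (- s) = prim (fun r => V r - V (- r)) s.
Proof.
move=> w0 Vi; rewrite (primB s w0 Vi (wi_neg Vi)) (prim_neg s w0 Vi); ring.
Qed.

(** Integrating [symS] for [F] twice cancels every contribution of [F]. What remains is linear in
    [s], and its coefficients agree exactly when the boundary condition at 0 holds. *)
Lemma affp_symS w b d F : 0 <= w -> wiV w F -> symS F ->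
  symS (affp b d F) <-> (forall e, d e = \sum_f kap e f * b f).
Proof.
move=> w0 Fi sF; have w1 : w < w + 1 by rewrite ltrDl.
have w10 : 0 < w + 1 by exact: le_lt_trans w0 w1.
have w2 : w + 1 < w + 2 by rewrite ltrD2l ltr1n.
have w20 : 0 < w + 2 by exact: lt_trans w10 w2.
have w02 : w < w + 2 by exact: lt_trans w1 w2.
have Ps e := wi_prim w0 w1 (Fi e).
have Se e : wi w (fun r => F e r + F e (- r)) := wiD (Fi e) (wi_neg (Fi e)).
have D2 e s : affp b d F e s - affp b d F e (- s) = 2 * d e * s +
    prim (prim (fun r => F e r - F e (- r))) s.
  have -> : affp b d F e s - affp b d F e (- s) =
    2 * d e * s + (prim (prim (F e)) s - prim (prim (F e)) (- s)) by rewrite /affp; ring.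
  rewrite (prim_sym s (ltW w10) (Ps e)); congr (_ + prim _ s).
  by apply/funext => r; exact: prim_asym (Fi e).
have S2 f : prim (fun r => affp b d F f r + affp b d F f (- r)) =
   fun s => 2 * b f * s + prim (prim (prim (fun r => F f r + F f (- r)))) s.
  have -> : (fun r => affp b d F f r + affp b d F f (- r)) =
      (fun r => 2 * b f + prim (prim (fun r => F f r + F f (- r))) r).
    apply/funext => r; rewrite -(_ : prim (fun r => prim (F f) r - prim (F f) (- r)) r =
       prim (prim (fun r => F f r + F f (- r))) r).
      by rewrite -(prim_asym r (ltW w10) (Ps f)) /affp; ring.
    by congr (prim _ r); apply/funext => x; exact: prim_sym (Fi f).
  apply/funext => s; rewrite (primD s (ltW w20) (wi_cst _ w20)) ?prim_cst//.
  exact: wi_prim2 (Se f).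
have Q e s : prim (prim (fun r => F e r - F e (- r))) s =
    \sum_f kap e f * prim (prim (prim (fun r => F f r + F f (- r)))) s.
  have -> : (fun r => F e r - F e (- r)) =
      (fun s => \sum_f kap e f * prim (fun r => F f r + F f (- r)) s).
    by apply/funext => r; exact: sF.
  have -> : prim (fun s => \sum_f kap e f * prim (fun r => F f r + F f (- r)) s) =
      (fun s => \sum_f kap e f * prim (prim (fun r => F f r + F f (- r))) s).
    apply/funext => r; rewrite (prim_sum _ _ _ (ltW w10)).
      apply: eq_bigr => f _; exact: (primZ _ _ (ltW w10) (wi_prim w0 w1 (Se f))).
    by move=> f; apply: wiZ; exact: wi_prim w0 w1 (Se f).
  rewrite (prim_sum _ _ _ (ltW w20)).
    apply: eq_bigr => f _; exact: (primZ _ _ (ltW w20) (wi_prim2 w0 w02 (Se f))).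
  by move=> f; apply: wiZ; exact: wi_prim2 w0 w02 (Se f).
have RHS e s : \sum_f kap e f * prim (fun r => affp b d F f r + affp b d F f (- r)) s =
    2 * (\sum_f kap e f * b f) * s + prim (prim (fun r => F e r - F e (- r))) s.
  rewrite Q mulr_sumr mulr_suml -big_split; apply: eq_bigr => f _ /=.
  by rewrite S2; ring.
split => [H e|H e s]; last by rewrite D2 RHS H.
have := H e 1; rewrite D2 RHS !mulr1 => /addIr h.
by apply: (mulfI _ h); rewrite pnatr_eq0.
Qed.

Lemma cutnorm_lin a u c v : data u -> data v ->
  cutnorm (lin a u c v) <= `|a| * cutnorm u + `|c| * cutnorm v.
Proof.
move=> du dv; rewrite /raw_cutnorm !mulr_sumr -big_split; apply: ler_sum => e _ /=.
rewrite -!IntZ; [|exact: ig_abs (dv e)|exact: ig_abs (du e)].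
have i1 := igZ `|a| (ig_abs (du e)); have i2 := igZ `|c| (ig_abs (dv e)).
rewrite -(IntD i1 i2); apply: Int_le; last first.
- by move=> s; rewrite cut_lin -!normrM ler_normD.
- exact: igD i1 i2.
- have := ig_abs (igD (igZ a (du e)) (igZ c (dv e))).
  by apply: ig_ext => s; rewrite cut_lin.
Qed.

Lemma cutnorm_aeq u v : data u -> data v -> (forall e, aeq (cut u e) (cut v e)) ->
  cutnorm u = cutnorm v.
Proof.
move=> du dv uv; apply: eq_bigr => e _; apply: Int_aeq.
- exact: mf_abs (ig_mf (du e)).
- exact: mf_abs (ig_mf (dv e)).
- by apply: filterS (uv e) => s ->.
Qed.

Lemma cutnorm_eq0 u : data u -> cutnorm u = 0 -> forall e, aeq (cut u e) (fun=> 0).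
Proof.
move=> du u0 e; apply: Int_abs0 (du e) _.
have := u0; rewrite /raw_cutnorm => /eqP; rewrite psumr_eq0; last first.
  by move=> f _; apply: Int_ge0 => x; exact: normr_ge0.
by move=> /allP/(_ e (mem_index_enum e))/eqP.
Qed.

Let wt0 : 0 < wt := wt_gt0 kap tau_gt0.
Let Vwi v (dv : data v) : wiV wt (ext v) := ext_wiwt kap barK tau_gt0 dv.

Lemma pos_lower_bound (E : 'I_n -> R) : (forall e, 0 < E e) ->
  exists2 e0, 0 < e0 & forall e, e0 <= E e.
Proof. by move=> E0; exists (tmin E); [exact: tmin_gt0|exact: tmin_le]. Qed.

Lemma cut_sub_scale (a : R) V v e s :
  cut (fun e s => V e s - a * v e s) e s = cut V e s - a * cut v e s.
Proof. by rewrite /raw_cut mulrBl mulrA. Qed.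

Lemma rop_approx v (eta B : R) : data v -> 0 < eta -> 0 <= B ->
  exists2 e0, 0 < e0 & forall eps g, 0 < eps -> eps < e0 -> mf g ->
    (forall r, `|g r| <= B / eps * ew eps^-1 r) ->
    cutnorm (fun e s => rop g v e s - Int g * v e s) <= eta.
Proof.
move=> dv eta0 B0; have Vi := Vwi dv.
set S := \sum_e ew (- wt) (tau e).
have S0 : 0 <= S by apply: sumr_ge0 => e _; exact: ew_ge0.
have n0 : 0 < n%:R + 1 :> R by exact: ltr_wpDl.
have S1 : 0 < S + 1 by exact: ltr_wpDl.
(* [S] is the cost of restricting to the edges and [n] the number of terms; the summands 1 keep the
   divisor positive. *)
set c := eta / ((S + 1) * (n%:R + 1)).
have c0 : 0 < c by apply: divr_gt0 => //; exact: mulr_gt0.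
have H e : exists E, 0 < E /\ forall eps g, 0 < eps -> eps < E -> mf g ->
    (forall r, `|g r| <= B / eps * ew eps^-1 r) ->
    wnorm wt (fun s => conv g (ext v e) s - Int g * ext v e s) <= c.
  by have [E E0 EP] := approx_identity (ltW wt0) (Vi e) c0 B0; exists E; split.
have [E EP] := choice H.
have [e0 e00 e0E] := pos_lower_bound (fun e => (EP e).1).
have w1 : 0 < wt + 1 by exact: ltr_wpDl (ltW wt0) ltr01.
exists (Num.min e0 (wt + 1)^-1); first by rewrite lt_min e00 invr_gt0.
move=> eps g eps0; rewrite lt_min => /andP[ee ew1] gm gB.
pose V e s := conv g (ext v e) s - Int g * ext v e s.
have -> : cutnorm (fun e s => rop g v e s - Int g * v e s) = cutnorm V.
  apply: eq_bigr => e _; apply: Int_ext => s; rewrite !cut_sub_scale cut_ext//.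
have Vw : wiV wt V.
  move=> e; apply: wiB; last exact: wiZ (Vi e).
  apply: (@conv_wi R wt eps^-1) => //; first exact: ltW.
    rewrite -(ltf_pV2 (x := eps^-1)) ?posrE ?invr_gt0// invrK.
    by apply: lt_trans ew1 _; rewrite ltf_pV2 ?posrE// ltrDl.
  by split => //; exists (B / eps).
apply: le_trans (cutnorm_wnorm tau_gt0 Vw) _; rewrite -/S.
have s1 : \sum_e wnorm wt (V e) <= n%:R * c.
  apply: (@le_trans _ _ (\sum_(e < n) c)); last by rewrite sumr_const card_ord mulr_natl.
  by apply: ler_sum => e _; exact: (EP e).2 eps g eps0 (lt_le_trans ee (e0E e)) gm gB.
apply: le_trans (ler_wpM2l S0 s1) _.
have -> : eta = (S + 1) * ((n%:R + 1) * c).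
  by rewrite /c mulrA mulrC divfK// gt_eqF// mulr_gt0.
apply: ler_pM => //; first by apply: mulr_ge0 => //; exact: ltW.
  by rewrite lerDl.
by apply: ler_wpM2r; [exact: ltW|rewrite lerDl].
Qed.

(** What the generator requires of the heat kernels at real times [h]: [Num.sqrt h] is the diffusive
    scale, and the second moment fixes the coefficient 1 in front of the second derivative. *)
Definition heat_family (G : R -> R -> R) (B : R) := forall h, 0 < h ->
  [/\ forall l, kern l (G h), forall r, G h (- r) = G h r,
     forall r, `|G h r| <= B / Num.sqrt h * ew (Num.sqrt h)^-1 r,
     Int (G h) = 1 & Int (fun r => r ^+ 2 * G h r) = 2 * h].

Definition quot (G : R -> R -> R) h v F :=
  lin h^-1 (lin 1 (rop (G h) v) (-1) v) (-1) F.

Definition ngen G v F := forall eta, 0 < eta -> exists2 h0, 0 < h0 &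
  forall h, 0 < h -> h < h0 -> cutnorm (quot G h v F) <= eta.

(* The strong form of v'' = F on the network, with boundary data b and derivatives d. *)
Definition nsol v F := exists b d,
  [/\ forall e, aeq (cut v e) (cut (affp b d (ext F)) e),
      forall e, d e = \sum_f kap e f * b f,
      forall e, b (bar e) = b e + d e * tau e + prim (prim (ext F e)) (tau e) &
      forall e, d (bar e) = - d e - prim (ext F e) (tau e)].

Lemma KmN (g : R -> R) rho : Km g (- rho) = Km g rho.
Proof. by congr (_ * _); apply: Int_ext => r; rewrite triN. Qed.

Lemma quot_data G h v F : ekern (G h) -> data v -> data F -> data (quot G h v F).
Proof.
move=> eG dv dF; apply: data_lin => //; apply: data_lin => //.
exact: rop_data barK tau_gt0 _ _ eG dv.
Qed.

Lemma nsol_gen G (B : R) v F : 0 <= B -> heat_family G B ->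
  data v -> compat v -> data F -> compat F -> nsol v F -> ngen G v F.
Proof.
move=> B0 hG dv cv dF cF [b [d [vW dk bb dd]]] eta eta0.
have Fi := Vwi dF; have w0 := ltW wt0.
have w1 : wt < wt + 1 by rewrite ltrDl.
have w10 : 0 < wt + 1 := lt_trans wt0 w1.
have sW : symC (affp b d (ext F)).
  by apply/(affp_symC b d w0 Fi (ext_symC kap barK tau_gt0 tau_bar cF)); split.
have sW' : symS (affp b d (ext F)).
  by apply/(affp_symS b d w0 Fi (ext_symS kap barK tau_gt0 dF)).
have Wi := affp_wi b d w0 w1 Fi.
have Wv : forall e, aeq (affp b d (ext F) e) (ext v e).
  apply: (ext_unique barK tau_gt0 tau_bar w10 Wi sW sW' dv cv) => e.
  by apply: filterS (vW e) => s ->.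
have B8 : 0 <= 8 * B by exact: mulr_ge0.
have [e0 e00 e0P] := rop_approx dF eta0 B8.
(* The kernel [K] below lives at scale [2 * sqrt h], because [Km] halves the decay rate. *)
exists ((e0 / 2) ^+ 2); first by rewrite exprn_gt0// divr_gt0.
move=> h h0 hh; have [kG Ge Gb G1 G2] := hG h h0.
set q := Num.sqrt h in Gb *; have q0 : 0 < q by rewrite sqrtr_gt0.
have qh : q ^+ 2 = h by rewrite sqr_sqrtr// ltW.
have qe : 2 * q < e0.
  rewrite mulrC -ltr_pdivlMr// -(ltr_pXn2r (n := 2))// ?nnegrE ?divr_ge0 ?ltW//.
  by rewrite qh.
(* Doubled because [Km] halves the rate and [ekern] demands [wt + 1]. *)
pose l := 2 * (wt + 1).
have l0 : 0 < l by exact: mulr_gt0.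
have lE : l / 2 = wt + 1 by rewrite /l mulrC mulKf// pnatr_eq0.
pose K r := h^-1 * Km (G h) r.
have kK : kern (wt + 1) K by apply: kernZ; rewrite -lE; exact: Km_kern l0 (kG l).
(* By [Km_mass], the mass of [Km (G h)] is half the second moment, that is [h]. *)
have K1 : Int K = 1.
  rewrite /K IntZ; last by apply: kern_ig (Km_kern l0 (kG l)); rewrite lE.
  by rewrite (Km_mass l0 (kG l) Ge) G2; field; rewrite gt_eqF.
have eK : ekern K by split => // r; rewrite /K KmN.
have Kb r : `|K r| <= 8 * B / (2 * q) * ew (2 * q)^-1 r.
  have qi : 0 < q^-1 by rewrite invr_gt0.
  have Bq : 0 <= B / q by apply: divr_ge0 => //; exact: ltW.
  have [_ /(_ r)] := Km_bound qi (kern_mf (kG 0)) Gb Bq.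
  move=> kb; have hi : 0 <= h^-1 by rewrite invr_ge0 ltW.
  rewrite /K (normrM h^-1) (ger0_norm hi).
  apply: le_trans (ler_wpM2l hi kb) _.
  have -> : q^-1 / 2 = (2 * q)^-1 by rewrite invfM mulrC.
  rewrite le_eqVlt; apply/orP; left; apply/eqP.
  rewrite -qh; field; rewrite gt_eqF//.
have := e0P (2 * q) K (mulr_gt0 (ltr0n _ 2) q0) qe (kern_mf kK) Kb; rewrite K1.
have eG : ekern (G h) by split.
suff -> : cutnorm (fun e s => rop K F e s - 1 * F e s) = cutnorm (quot G h v F) by [].
apply: cutnorm_aeq.
- move=> e; have := data_lin 1 (-1) (rop_data barK tau_gt0 eK dF) dF e.
  by apply: ig_ext => s; rewrite /raw_cut mul1r mulN1r mul1r.
- exact: quot_data.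
move=> e; apply: filterS (vW e) => s vWs.
have wl : wt < l / 2 by rewrite lE.
have E := conv_second_affine (b e) (d e) s w0 wl (kG l) Ge (Fi e).
have rE : rop (G h) v e s = conv (G h) (affp b d (ext F) e) s.
  apply: conv_aeq; [exact: kern_mf (kG 0)|exact: wi_mf (Vwi dv e)|exact: wi_mf (Wi e)|].
  by apply: filterS (Wv e) => x ->.
have kE : rop K F e s = h^-1 * conv (Km (G h)) (ext F e) s.
  apply: convZl w0 _ _ (Fi e); first exact: ltW w1.
  by rewrite -lE; exact: Km_kern l0 (kG l).
rewrite /quot cut_sub_scale cut_lin cut_lin /raw_cut.
have := vWs; rewrite /raw_cut => vWs'.
have -> : rop (G h) v e s = conv (Km (G h)) (ext F e) s + affp b d (ext F) e s.
  by rewrite rE -E G1 /affp; ring.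
by rewrite kE mulN1r vWs'; ring.
Qed.

(** Large enough for [wt < lam / 2], as [conv_second] requires, and for [wt + 1 < lam], as [ekern]
    requires. The kernel [E] is the Green function of [lam^2 - d^2/dx^2] on the line. *)
Let lam := 2 * wt + 3.
Let E r := (2 * lam)^-1 * ew lam r.

Let lam0 : 0 < lam. Proof. by rewrite /lam addr_gt0// mulr_gt0. Qed.
Let wt1lam : wt + 1 < lam.
Proof. by rewrite /lam; move: wt wt0 => x x0; lra. Qed.
Let wtlam : wt < lam / 2.
Proof. by rewrite ltr_pdivlMr// mulrC ltrDl. Qed.

Let kE : kern lam E.
Proof. by apply: kernZ; split; [exact: mf_ew|exists 1 => r; rewrite mul1r ger0_norm]. Qed.

Let kE1 : kern (wt + 1) E.
Proof.
have [C C0 H] := kernP kE; split; first exact: kern_mf kE.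
by exists C => r; apply: le_trans (H r) _; apply: ler_wpM2l => //; apply: ew_le; exact: ltW.
Qed.

Lemma resolvent_ekern : ekern E.
Proof. by split => [|r]; [exact: kE1|rewrite /E ewN]. Qed.

(** With [Y] the twofold primitive of [V], [conv_second] and [Km_exp] give [U = lam^2 (E * Y) - Y].
    Commuting [E] past both primitives turns [E * Y] into the twofold primitive of [U] up to an
    affine function. This is [U'' = lam^2 U - V] in integrated form. *)
Lemma resolvent_affine v e : data v -> exists bd : R * R, forall s,
  rop E v e s = bd.1 + bd.2 * s +
    prim (prim (fun r => lam ^+ 2 * rop E v e r + -1 * ext v e r)) s.
Proof.
move=> dv; have Vi := Vwi dv e; have w0 := ltW wt0.
set V := ext v e in Vi *; set U := rop E v e.
have w1 : wt < wt + 1 by rewrite ltrDl.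
have w10 : 0 < wt + 1 := lt_trans wt0 w1.
have Ui : wi wt U := rop_wi barK tau_gt0 resolvent_ekern dv e.
set P := prim V; have Pi : wi (wt + 1) P := wi_prim w0 w1 Vi.
set Y := prim P.
have wlam : wt < lam := lt_trans w1 wt1lam.
have kew : kern lam (ew lam).
  by split; [exact: mf_ew|exists 1 => r; rewrite mul1r ger0_norm].
have Yi : wi (wt + 1) Y := wi_prim2 w0 w1 Vi.
have UE s : U s = (2 * lam)^-1 * conv (ew lam) V s.
  exact: convZl s w0 (ltW wlam) kew Vi.
have YE s : conv E Y s = (2 * lam)^-1 * conv (ew lam) Y s.
  exact: convZl s (ltW w10) (ltW wt1lam) kew Yi.
have ln0 : lam != 0 by rewrite gt_eqF.
have e1 s : U s = lam ^+ 2 * conv E Y s - Y s.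
  have := conv_second s w0 wtlam kew (ewN lam) Vi.
  have -> : conv (Km (ew lam)) V s = lam ^- 2 * conv (ew lam) V s.
    rewrite -(convZl (lam ^- 2) s w0 (ltW wlam) kew Vi); apply: Int_ext => r.
    by rewrite (Km_exp r lam0).
  rewrite (Int_ew_eq lam0) -/P -/Y => h.
  have -> : U s = lam ^+ 2 * (2 * lam)^-1 * (lam ^- 2 * conv (ew lam) V s).
    by rewrite UE; field.
  by rewrite -h YE; field.
have e2 s : conv E Y s = conv E Y 0 + prim (conv E P) s.
  by rewrite -(conv_prim s (ltW w10) wt1lam kE Pi) addrC subrK.
have e3 : conv E P = fun r => conv E P 0 + prim U r.
  by apply/funext => r; rewrite -(conv_prim r w0 wlam kE Vi) addrC subrK.
have e4 s : prim (conv E P) s = conv E P 0 * s + prim (prim U) s.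
  rewrite e3 (primD s (ltW w10) (wi_cst _ w10) (wi_prim w0 w1 Ui)) prim_cst.
  by rewrite -[conv E P 0 + _]/((fun r => conv E P 0 + prim U r) 0) -e3.
exists (lam ^+ 2 * conv E Y 0, lam ^+ 2 * conv E P 0) => s /=.
have -> : prim (prim (fun r => lam ^+ 2 * U r + -1 * V r)) s =
    lam ^+ 2 * prim (prim U) s + -1 * Y s.
  have -> : prim (fun r => lam ^+ 2 * U r + -1 * V r) =
      (fun x => lam ^+ 2 * prim U x + -1 * P x).
    apply/funext => x; rewrite (primD x w0 (wiZ _ Ui) (wiZ _ Vi)).
    by rewrite (primZ _ _ w0 Ui) (primZ _ _ w0 Vi).
  have Pu := wi_prim w0 w1 Ui.
  rewrite (primD s (ltW w10) (wiZ _ Pu) (wiZ _ Pi)).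
  by rewrite (primZ _ _ (ltW w10) Pu) (primZ _ _ (ltW w10) Pi).
rewrite e1 e2 e4; move: (prim (prim U) s) (conv E P 0) (conv E Y 0) (Y s) => x1 x2 x3 x4.
by ring.
Qed.

Lemma prim_aeq_fun (f g : R -> R) : mf f -> mf g -> aeq f g -> prim f = prim g.
Proof. by move=> fm gm fg; apply/funext => s; exact: prim_aeq. Qed.

Lemma nsol_aeq u v F K : data F -> compat F -> data K -> compat K ->
  (forall e, aeq (cut u e) (cut v e)) -> (forall e, aeq (cut F e) (cut K e)) ->
  nsol u F -> nsol v K.
Proof.
move=> dF cF dK cK uv FK [b [d [uW dk bb dd]]]; exists b, d.
have P : forall e, prim (ext F e) = prim (ext K e).
  move=> e; apply: prim_aeq_fun; [exact: wi_mf (Vwi dF e)|exact: wi_mf (Vwi dK e)|].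
  exact: (ext_aeq kap barK tau_gt0 tau_bar dF cF dK cK FK e).
split.
- move=> e; apply: filterS2 (uv e) (uW e) => s E1; rewrite E1 => E2.
  apply: etrans E2 _.
  exact: (congr1 (fun p => (b e + d e * s + prim p s) * ((0 <= s) && (s <= tau e))%R%:R) (P e)).
- exact: dk.
- move=> e; exact (etrans (bb e) (congr1 (fun p => b e + d e * tau e + prim p (tau e)) (P e))).
- move=> e; exact (etrans (dd e) (congr1 (fun p => - d e - p (tau e)) (P e))).
Qed.

(** The equivalences [affp_symC] and [affp_symS] are used backwards: [rop E v] is known to satisfy
    both relations, so the constants in its representation satisfy the boundary conditions. *)
Lemma resolvent_nsol v : data v -> compat v ->
  nsol (rop E v) (lin (lam ^+ 2) (rop E v) (-1) v).
Proof.
move=> dv cv; have w0 := ltW wt0; have eE := resolvent_ekern.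
have [bd bdP] := choice (fun e => resolvent_affine e dv).
have dU := rop_data barK tau_gt0 eE dv.
have cU := rop_compat barK tau_gt0 tau_bar eE dv cv.
have Ui := rop_wi barK tau_gt0 eE dv.
pose F' := lin (lam ^+ 2) (rop E v) (-1) (ext v).
have F'i : wiV wt F' := wiV_lin (lam ^+ 2) (-1) Ui (Vwi dv).
have sF' : symC F'.
  exact: symC_lin (rop_symC barK tau_gt0 tau_bar eE dv cv) (ext_symC kap barK tau_gt0 tau_bar cv).
have sF'' : symS F'.
  exact: symS_lin w0 Ui (Vwi dv) (rop_symS barK tau_gt0 eE dv) (ext_symS kap barK tau_gt0 dv).
set F := lin _ _ _ v.
have dF : data F := data_lin _ _ dU dv.
have P e : prim (ext F e) = prim (F' e).
  apply: prim_aeq_fun; [exact: wi_mf (Vwi dF e)|exact: wi_mf (F'i e)|].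
  have a1 := ext_lin kap barK tau_gt0 tau_bar (lam ^+ 2) (-1) dU cU dv cv e.
  have a2 := ext_rop barK tau_gt0 tau_bar e eE dv cv.
  by apply: filterS2 a1 a2 => s -> ->.
pose b e := (bd e).1; pose d e := (bd e).2.
have aff : affp b d F' = rop E v.
  by apply/funext => e; apply/funext => s; rewrite bdP.
have aff' : affp b d (ext F) = rop E v.
  rewrite -aff; apply/funext => e; apply/funext => s.
  exact: (congr1 (fun p => b e + d e * s + prim p s) (P e)).
have [c1 _] := affp_symC b d w0 F'i sF'.
have [c2 _] := affp_symS b d w0 F'i sF''.
rewrite aff in c1 c2.
have [h1 h2] := c1 (rop_symC barK tau_gt0 tau_bar eE dv cv).
have h3 := c2 (rop_symS barK tau_gt0 eE dv).
exists b, d; split.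
- by move=> e; rewrite aff'; apply: filterS (@aeneq R 0) => s.
- exact: h3.
- move=> e; apply: etrans (h1 e) _.
  exact: (congr1 (fun p => b e + d e * tau e + prim p (tau e)) (esym (P e))).
- move=> e; apply: etrans (h2 e) _.
  exact: (congr1 (fun p => - d e - p (tau e)) (esym (P e))).
Qed.

(** Applying the resolvent to the difference quotients of [v] gives two values for the limit: [RF]
    by continuity, and [lam^2 Rv - v] because [Rv] already solves the strong problem. Their equality
    says [v = rop E (lam^2 v - F)], a function covered by [resolvent_nsol]. *)
Lemma gen_nsol G (B : R) v F : 0 <= B -> heat_family G B ->
  data v -> compat v -> data F -> compat F -> ngen G v F -> nsol v F.
Proof.
move=> B0 hG dv cv dF cF gen; have eE := resolvent_ekern.
pose Rv := rop E v; pose RF := rop E F.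
pose A := lin (lam ^+ 2) Rv (-1) v.
have dRv : data Rv := rop_data barK tau_gt0 eE dv.
have cRv : compat Rv := rop_compat barK tau_gt0 tau_bar eE dv cv.
have dRF : data RF := rop_data barK tau_gt0 eE dF.
have dA : data A := data_lin _ _ dRv dv.
have cA : compat A := compat_lin _ _ cRv cv.
have genR : ngen G Rv A := nsol_gen B0 hG dRv cRv dA cA (resolvent_nsol dv cv).
have Z0 : cutnorm (lin 1 RF (-1) A) = 0.
  apply/le_anti/andP; split; last exact: cutnorm_ge0.
  apply/ler_addgt0Pl => eta eta0; rewrite addr0.
  set C := Cop tau kap * wnorm (- wt) E.
  have C0 : 0 <= C by apply: mulr_ge0; [exact: Cop_ge0|exact: wnorm_ge0].
  have e1 : 0 < eta / (C + 1) by apply: divr_gt0 => //; exact: ltr_wpDl.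
  have [h1 h10 H1] := gen _ (divr_gt0 e1 (ltr0n _ 2)).
  have [h2 h20 H2] := genR _ (divr_gt0 eta0 (ltr0n _ 2)).
  pose h := Num.min h1 h2 / 2.
  have m0 : 0 < Num.min h1 h2 by rewrite lt_min h10.
  have h0 : 0 < h by exact: divr_gt0.
  have hm : h < Num.min h1 h2 by rewrite ltr_pdivrMr// ltr_pMr// ltr1n.
  have [{}hm1 hm2] : h < h1 /\ h < h2 by move: hm; rewrite lt_min => /andP.
  have {}H1 := H1 h h0 hm1; have {}H2 := H2 h h0 hm2.
  have [kG Ge _ _ _] := hG h h0; have eG : ekern (G h) by split.
  have dG : data (rop (G h) v) := rop_data barK tau_gt0 eG dv.
  have cG : compat (rop (G h) v) := rop_compat barK tau_gt0 tau_bar eG dv cv.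
  have dX : data (quot G h v F) := quot_data eG dv dF.
  have dX1 := data_lin 1 (-1) dG dv; have cX1 := compat_lin 1 (-1) cG cv.
  have cX : compat (quot G h v F) := compat_lin _ _ cX1 cF.
  have b1 := rop_bound barK tau_gt0 tau_bar eE dX cX; rewrite -/C in b1.
  have dEX := rop_data barK tau_gt0 eE dX.
  have dZ : data (quot G h Rv A) := quot_data eG dRv dA.
  have := cutnorm_lin 1 (-1) dZ dEX.
  have -> : cutnorm (lin 1 (quot G h Rv A) (-1) (rop E (quot G h v F))) =
      cutnorm (lin 1 RF (-1) A).
    congr raw_cutnorm; apply/funext => e; apply/funext => s.
    rewrite /quot (rop_lin barK tau_gt0 tau_bar _ _ _ _ eE dX1 cX1 dF cF).
    rewrite (rop_lin barK tau_gt0 tau_bar _ _ _ _ eE dG cG dv cv).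
    rewrite (ropC barK tau_gt0 tau_bar e s eE eG dv cv) -/RF -/Rv.
    ring.
  rewrite normrN normr1 !mul1r => /le_trans; apply.
  have b2 := ler_wpM2l C0 H1.
  have b3 : C * (eta / (C + 1) / 2) <= eta / 2.
    rewrite mulrA ler_wpM2r ?invr_ge0// mulrCA ler_piMr ?(ltW eta0)//.
    by rewrite ler_pdivrMr ?ltr_wpDl// mul1r lerDl.
  by rewrite (splitr eta); apply: lerD => //; apply: le_trans b1 (le_trans b2 b3).
pose g := lin (lam ^+ 2) v (-1) F.
have dg : data g := data_lin _ _ dv dF.
have cg : compat g := compat_lin _ _ cv cF.
have gE e s : rop E g e s = lam ^+ 2 * Rv e s + -1 * RF e s.
  exact (rop_lin barK tau_gt0 tau_bar (lam ^+ 2) (-1) e s eE dv cv dF cF).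
have dRFA := data_lin 1 (-1) dRF dA.
have Rg e : aeq (cut (rop E g) e) (cut v e).
  apply: filterS (cutnorm_eq0 dRFA Z0 e) => s h.
  have h1 := etrans (esym (cut_lin tau 1 RF (-1) A e s)) h.
  have h2 := cut_lin tau (lam ^+ 2) Rv (-1) v e s.
  have h3 : cut (rop E g) e s = lam ^+ 2 * cut Rv e s + -1 * cut RF e s.
    apply: etrans _ (cut_lin tau (lam ^+ 2) Rv (-1) RF e s).
    exact (congr1 (fun x => x * ((0 <= s) && (s <= tau e))%R%:R) (gE e s)).
  have h4 := congr1 (fun x => 1 * cut RF e s + -1 * x) (esym h2).
  have h5 := congr1 (fun x => cut v e s - x) (etrans h4 h1).
  have h6 := etrans h3 (etrans (resolvent_ring1 (lam ^+ 2) (cut Rv e s) (cut RF e s) (cut v e s)) h5).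
  exact (etrans h6 (subr0 _)).
have dRg := rop_data barK tau_gt0 eE dg.
have cRg := rop_compat barK tau_gt0 tau_bar eE dg cg.
apply: (nsol_aeq _ _ dF cF Rg _ (resolvent_nsol dg cg)).
- exact: data_lin dRg dg.
- exact: compat_lin cRg cg.
move=> e; apply: filterS (Rg e) => s h.
have h1 := cut_lin tau (lam ^+ 2) (rop E g) (-1) g e s.
have h2 := cut_lin tau (lam ^+ 2) v (-1) F e s.
have h3 := congr2 (fun x y => lam ^+ 2 * x + -1 * y) h h2.
exact (etrans h1 (etrans h3 (resolvent_ring2 _ _ _))).
Qed.

End NetworkGenerator.

(** * Weak derivatives *)

Section WeakDerivative.
Variable R : realType.
Local Notation mu := (@lebesgue_measure R).
Implicit Types (a b f g phi psi D : R -> R) (c d s x y eps : R).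

Definition onI f x := f x * ((0 <= x) && (x <= 1))%R%:R.
Definition wderiv a b := forall phi, test_function phi ->
  Int (fun x => onI a x * derive1 phi x) = - Int (fun x => onI b x * phi x).

Lemma prim_halfline psi s : ig psi ->
  prim psi s = Int (fun r => psi r * (r <= s)%R%:R) - Int (fun r => psi r * (r <= 0)%R%:R).
Proof.
move=> pi; have i t : ig (fun r => psi r * (r <= t)%R%:R).
  by apply: ig_ind pi; [apply: mf_le; [exact: mf_id|exact: mf_cst]|move=> ?; exact: ind01].
by rewrite -(IntB (i s) (i 0)); apply: Int_ext => r; rewrite -mulrBr.
Qed.

Lemma dv_prim psi x : continuous psi -> ig psi -> dv (prim psi) x (psi x).
Proof.
move=> pc pi; have x1 : x < x + 1 by rewrite ltrDl.
have pi' : mu.-integrable [set` Interval -oo%O (BRight (x + 1))] (EFin \o psi).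
  exact: integrableS pi.
have [| |d1 d2] := @continuous_FTC1 R psi -oo%O x (x + 1) x1 pi'.
- exact: ltNyr.
- exact: pc.
set F := fun x => _ in d1 d2.
have dF : dv F x (psi x) by apply: DeriveDef; [exact: d1|rewrite -derive1E; exact: d2].
have -> : prim psi = fun s => F s - F 0.
  have E s : F s = Int (fun r => psi r * (r <= s)%R%:R).
    rewrite /F Rintegral_mkcond; apply: Int_ext => r.
    by rewrite patchE mem_setE in_itv/=; case: (r <= s); rewrite ?mulr1 ?mulr0.
  by apply/funext => s; rewrite !E; exact: prim_halfline.
by apply: dv_eq (dvB dF (dv_cst (F 0) x)) _; rewrite subr0.
Qed.

Lemma bounded_onI f : continuous f -> (forall x, (x <= 0) || (1 <= x) -> f x = 0) ->
  exists2 M, 0 <= M & forall x, `|f x| <= M.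
Proof.
move=> fc f0.
have cd : {within `[0, 1], continuous (fun s => `|f s|)}.
  apply: continuous_subspaceT => s; apply: (@continuous_comp _ _ _ f Num.norm); first exact: fc.
  exact: norm_continuous.
have [c _ cM] := EVT_max ler01 cd; exists `|f c| => // x.
have [x1|x1] := boolP (x \in `[0, 1]); first exact: cM.
have -> : f x = 0; last by rewrite normr0.
apply: f0; move: x1; rewrite in_itv/= negb_and -!ltNge.
by case/orP => /ltW ->; rewrite ?orbT.
Qed.

Lemma ig_onI f : continuous f -> (forall x, (x <= 0) || (1 <= x) -> f x = 0) -> ig f.
Proof.
move=> fc f0; apply: ig_ext (ig_continuous 0 1 fc) => x.
case: (boolP (_ && _)) => [_|]; first by rewrite mulr1.
rewrite negb_and -!ltNge => h; rewrite mulr0 f0//.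
by case/orP: h => /ltW ->; rewrite ?orbT.
Qed.

Lemma ig_bounded D f M : ig D -> mf f -> (forall x, `|f x| <= M) -> ig (fun x => D x * f x).
Proof.
move=> Di fm fM; apply: (ig_dom _ _ (igZ M (ig_abs Di))); first exact: mfM (ig_mf Di) fm.
by move=> x; rewrite normrM mulrC ler_wpM2r.
Qed.

Section TestFunction.
Variable phi : R -> R.
Hypothesis tphi : test_function phi.

Lemma test_dv x : dv phi x (derive1 phi x).
Proof. by case: tphi => dp _ _; apply: DeriveDef; [exact: dp|rewrite derive1E]. Qed.

Lemma test_cont : continuous phi.
Proof. exact: dv_cont test_dv. Qed.

Lemma test_out x : (x <= 0) || (1 <= x) -> phi x = 0 /\ derive1 phi x = 0.
Proof.
case: tphi => _ _ [a [b [a0 b1 out]]] x01.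
have xab : (x < a) || (b < x).
  case/orP: x01 => h; apply/orP; [left; exact: le_lt_trans h a0|right; exact: lt_le_trans b1 h].
split; first by apply: out; rewrite negb_and -!ltNge.
have : \near x, cst 0 x = phi x.
  case/orP: xab => h; near=> y; rewrite /= out// negb_and -!ltNge; apply/orP; [left|right].
    by near: y; exact: lt_nbhsl.
  by near: y; exact: lt_nbhsr.
move=> /near_eq_derive nd; rewrite derive1E -nd.
have := dv_cst (0 : R) x; rewrite /dv => -[_ h]; exact: h.
Unshelve. all: by end_near.
Qed.

Lemma test_onI f x : onI f x * phi x = f x * phi x /\
  onI f x * derive1 phi x = f x * derive1 phi x.
Proof.
rewrite /onI; case: (boolP (_ && _)) => [_|]; first by rewrite mulr1.
rewrite negb_and -!ltNge => h; have /test_out[-> ->] : (x <= 0) || (1 <= x).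
  by case/orP: h => /ltW ->; rewrite ?orbT.
by rewrite !mulr0.
Qed.

Lemma test_ig : ig phi /\ ig (derive1 phi).
Proof.
split; apply: ig_onI; [exact: test_cont|by move=> x /test_out[]| |by move=> x /test_out[]].
by case: tphi.
Qed.

Lemma ig_test D : ig D -> ig (fun x => D x * phi x) /\ ig (fun x => D x * derive1 phi x).
Proof.
move=> Di; have dc : continuous (derive1 phi) by case: tphi.
have [M M0 dM] := bounded_onI test_cont (fun x h => (test_out h).1).
have [M' M0' dM'] := bounded_onI dc (fun x h => (test_out h).2).
by split; apply: ig_bounded => //; apply: mf_cont => //; exact: test_cont.
Qed.

Lemma test_prim s : prim (derive1 phi) s = phi s.
Proof.
have phi0 : phi 0 = 0 by apply: (test_out _).1; rewrite lexx.
rewrite (prim_FTC _ test_dv); first by rewrite phi0 subr0.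
by case: tphi.
Qed.

Lemma test_Int : Int (derive1 phi) = 0.
Proof.
transitivity (prim (derive1 phi) 1); last by rewrite test_prim (test_out _).1// lexx orbT.
apply: Int_ext => x; rewrite /chi; case: (leP x 0) => x0.
  by rewrite (test_out _).2 ?mul0r// x0.
case: (leP x 1) => x1; first by rewrite /= subr0 mulr1.
by rewrite (test_out _).2 ?mul0r// (ltW x1) orbT.
Qed.

(** For almost every [x > 0], [chi x y] equals [1 - chi y x] minus the constant indicator of
    [y <= 0], and the derivative of [phi] has integral 0. Combined with Fubini this yields
    integration by parts. *)
Lemma test_chi y : Int (fun x => derive1 phi x * chi x y) = - phi y.
Proof.
have [_ di] := test_ig; have dm := ig_mf di.
have w1 : wi 0 (derive1 phi) by apply: ig_ext di => x; rewrite /ew mul0r oppr0 expR0 mulr1.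
have i1 := ig_prim y (lexx 0) w1.
have i2 := igZ (y <= 0)%R%:R di.
transitivity (Int (fun x => (derive1 phi x - derive1 phi x * chi y x) - (y <= 0)%R%:R * derive1 phi x)).
  apply: Int_aeq.
  - apply: mfM => //; apply: mfB; last exact: mf_cst.
    by apply: mf_le; [exact: mf_cst|exact: mf_id].
  - by apply: ig_mf; apply: igB i2; exact: igB.
  apply: filterS (aeneq y) => x xy; rewrite /chi.
  have [x0|x0] := leP x 0; first by rewrite (test_out _).2 ?x0// !(mul0r, mulr0) !subrr.
  have -> : (y <= x)%R%:R = 1 - (x <= y)%R%:R :> R.
    have [xy'|xy'] := leP x y.
      by rewrite (_ : (y <= x) = false) ?subrr//; apply/negbTE; rewrite -ltNge lt_neqAle xy.
    by rewrite (ltW xy') subr0.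
  by rewrite subr0; ring.
rewrite (IntB (igB di i1) i2) (IntB di i1) (IntZ _ di) test_Int.
by rewrite -/(prim (derive1 phi) y) test_prim mulr0 subr0 sub0r.
Qed.

Lemma test_prim_parts D : ig D ->
  Int (fun x => prim D x * derive1 phi x) = - Int (fun x => D x * phi x).
Proof.
move=> bi; have [_ di] := test_ig; have dm := ig_mf di.
have H : ig2 (fun x y => derive1 phi x * (D y * chi x y)).
  apply: (ig2_dom _ _ (ig2_tensor (ig_abs di) (ig_abs bi))).
    apply: mf2M; first exact: mf2_1 dm.
    by apply: mf2M; [exact: mf2_2 (ig_mf bi)|exact: mf2_chi].
  move=> x y; rewrite !normrM ler_wpM2l// ler_piMr//.
  by apply: le_trans (chi_abs _ _) _; case: (`|y| <= `|x|).
have w1 : wi 0 D by apply: ig_ext bi => x; rewrite /ew mul0r oppr0 expR0 mulr1.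
transitivity (Int (fun x => Int (fun y => derive1 phi x * (D y * chi x y)))).
  apply: Int_ext => x; rewrite mulrC -IntZ//; exact: (ig_prim x (lexx 0) w1).
rewrite (ig2_swap H) -(IntN (ig_test bi).1).
apply: Int_ext => y; rewrite -mulrN -test_chi -IntZ; first by apply: Int_ext => x; ring.
apply: ig_dom (ig_abs di); first by apply: mfM => //; apply: mfB; [apply: mf_le; [exact: mf_cst|exact: mf_id]|exact: mf_cst].
move=> x; rewrite normrM ler_piMr//.
by apply: le_trans (chi_abs _ _) _; case: (`|y| <= `|x|).
Qed.

End TestFunction.

Lemma wderiv_prim a b c : ig (onI a) -> ig (onI b) ->
  aeq (onI a) (onI (fun x => c + prim (onI b) x)) -> wderiv a b.
Proof.
move=> ai bi ab phi tphi; have [_ di] := test_ig tphi.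
have dm := ig_mf di.
have w1 : wi 0 (onI b) by apply: ig_ext bi => x; rewrite /ew mul0r oppr0 expR0 mulr1.
have pm : mf (prim (onI b)) := wi_mf (wi_prim (lexx 0) ltr01 w1).
have dc : continuous (derive1 phi) by case: tphi.
have Pi : ig (fun x => prim (onI b) x * derive1 phi x).
  apply: (ig_dom _ _ (igZ (wnorm 0 (onI b)) (ig_abs di))); first exact: mfM.
  move=> x; rewrite normrM ler_wpM2r//; apply: le_trans (prim_bound x (lexx 0) w1) _.
  by rewrite /ew oppr0 mul0r oppr0 expR0 mul1r.
transitivity (Int (fun x => c * derive1 phi x + prim (onI b) x * derive1 phi x)).
  apply: Int_aeq.
  - exact: mfM (ig_mf ai) dm.
  - exact: ig_mf (igD (igZ c di) Pi).
  apply: filterS ab => x ->; rewrite (test_onI tphi (fun x => c + prim (onI b) x) x).2.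
  by rewrite mulrDl.
rewrite (IntD (igZ c di) Pi) (IntZ _ di) (test_Int tphi) mulr0 add0r.
exact: test_prim_parts tphi _ bi.
Qed.

(** A mollifier of mass 1 that is merely continuous: its primitives are of class C^1, the regularity
    asked of test functions. *)
Definition tent eps r := eps ^- 2 * tri eps r.

Section Tent.
Variable eps : R.
Hypothesis eps0 : 0 < eps.

Lemma tent_cont : continuous (tent eps).
Proof.
move=> x; apply: cvgM; first exact: cvg_cst.
apply: (@continuous_max R R (fun=> 0) (fun s => eps - `|s|)); first exact: cvg_cst.
by apply: cvgB; [exact: cvg_cst|exact: norm_continuous].
Qed.

Lemma tent_out r : eps <= `|r| -> tent eps r = 0.
Proof.
move=> er; rewrite /tent /tri (_ : Num.max _ _ = 0) ?mulr0//.
by apply/max_idPl; rewrite subr_le0.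
Qed.

Lemma tent_bound r : `|tent eps r| <= expR 1 / eps * ew eps^-1 r.
Proof.
have ei : 0 < eps^-1 by rewrite invr_gt0.
rewrite normrM (ger0_norm (tri_ge0 _ _)) ger0_norm ?invr_ge0 ?exprn_ge0 ?(ltW eps0)//.
have := tri_exp r ei (ltW eps0); rewrite invrK => h.
have e2 : 0 <= eps ^- 2 by rewrite invr_ge0 exprn_ge0// ltW.
apply: le_trans (ler_wpM2l e2 h) _.
have -> : ew (- eps^-1) eps = expR 1.
  by rewrite /ew mulNr opprK (gtr0_norm eps0) mulVf// gt_eqF.
by rewrite le_eqVlt; apply/orP; left; apply/eqP; field; rewrite gt_eqF.
Qed.

Lemma tent_ig : ig (tent eps).
Proof.
apply: ig_ext (ig_continuous (- eps) eps tent_cont) => x; rewrite -ler_norml.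
by have [_|h] := leP `|x| eps; rewrite ?mulr1// mulr0 tent_out// ltW.
Qed.

Lemma Int_tent : Int (tent eps) = 1.
Proof.
have e0 := ltW eps0.
have w1 : (0 : R) < 1 by [].
have := second_difference 0 eps ler01 (wi_cst 1 w1).
have pp : prim (prim (fun=> (1 : R))) = fun s => s ^+ 2 / 2.
  rewrite (_ : prim (fun=> 1) = id); first by apply/funext => s; rewrite prim_id.
  by apply/funext => s; rewrite prim_cst mul1r.
rewrite pp add0r sub0r sqrrN expr0n/= mul0r mulr0 subr0 (ger0_norm e0) => h.
have ti : ig (tri eps).
  have := igZ (eps ^+ 2) tent_ig; apply: ig_ext => x.
  by rewrite /tent mulrA divff ?mul1r// expf_neq0// gt_eqF.
rewrite /tent (IntZ _ ti).
have -> : Int (tri eps) = eps ^+ 2.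
  transitivity (Int (fun rho => 1 * tri eps rho)); first by apply: Int_ext => x; rewrite mul1r.
  by rewrite -h; field.
by rewrite mulVf// expf_neq0// gt_eqF.
Qed.

End Tent.

(** A difference of two functions of mass 1 has integral 0, so its primitive has compact support.
    The second tent, centred at 1/2 with half-width 1/4, is a fixed reference; the margins [2 * eps]
    keep the first one away from the end points. *)
Lemma tent_test s eps : 0 < eps -> 2 * eps <= s -> s <= 1 - 2 * eps ->
  let psi := fun y => tent eps (s - y) - tent 4^-1 (2^-1 - y) in
  test_function (prim psi) /\ derive1 (prim psi) = psi.
Proof.
move=> e0 s1 s2 psi; have e4 : (0 : R) < 4^-1 by rewrite invr_gt0.
have pc : continuous psi.
  have H eps' s' : continuous (fun y => tent eps' (s' - y)).
    move=> y; apply: (@continuous_comp _ _ _ (fun y => s' - y) (tent eps')); last exact: tent_cont.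
    by apply: cvgB; [exact: cvg_cst|exact: cvg_id].
  by move=> y; apply: cvgB; exact: H.
have i1 := ig_refl s (tent_ig eps); have i2 := ig_refl 2^-1 (tent_ig 4^-1).
have pi : ig psi := igB i1 i2.
have d1 : derive1 (prim psi) = psi.
  by apply/funext => x; rewrite derive1E; have [_ ->] := dv_prim x pc pi.
split => //; split.
- by move=> x; have [] := dv_prim x pc pi.
- by rewrite d1.
pose a := Num.min eps 4^-1.
have [ae a4] : a <= eps /\ a <= 4^-1 by rewrite !ge_min !lexx orbT.
have a0 : 0 < a by rewrite lt_min e0.
exists a, (1 - a); split => //; first by rewrite gtrBl.
have pl r : r <= a -> psi r = 0.
  move=> ra; rewrite /psi !tent_out ?subrr//.
    by apply: le_trans (ler_norm _); move: ra a4; lra.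
  by apply: le_trans (ler_norm _); move: ra ae s1; lra.
have pr r : 1 - a <= r -> psi r = 0.
  move=> ra; rewrite /psi !tent_out ?subrr//.
    by rewrite -normrN; apply: le_trans (ler_norm _); move: ra a4; lra.
  by rewrite -normrN; apply: le_trans (ler_norm _); move: ra ae s2; lra.
move=> x; rewrite negb_and -!ltNge => xab.
rewrite (prim_halfline x pi).
have -> : Int (fun r => psi r * (r <= 0)%R%:R) = 0.
  rewrite -[RHS](@Int0 R); apply: Int_ext => r; case: (leP r 0) => r0; last by rewrite mulr0.
  by rewrite pl ?mul0r// (le_trans r0)// ltW.
rewrite subr0; case/orP: xab => xa.
  rewrite -[RHS](@Int0 R); apply: Int_ext => r; case: (leP r x) => r0; last by rewrite mulr0.
  by rewrite pl ?mul0r// (le_trans r0)// ltW.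
transitivity (Int psi).
  apply: Int_ext => r; case: (leP r x) => r0; first by rewrite mulr1.
  by rewrite pr ?mul0r// ltW// (lt_trans xa).
by rewrite (IntB i1 i2) (Int_refl _ (tent_ig eps)) (Int_refl _ (tent_ig 4^-1)) !Int_tent// subrr.
Qed.

(** Testing with the primitives of [tent_test] shows that the mollifications of [D] take the same
    value [c] at all points away from the ends; as [eps] tends to 0 they converge to [D] in L1. *)
Lemma du_bois_reymond D : ig D -> (forall phi, test_function phi ->
    Int (fun x => D x * derive1 phi x) = 0) ->
  exists c, aeq (onI D) (onI (fun=> c)).
Proof.
move=> Di D0; have e4 : (0 : R) < 4^-1 by rewrite invr_gt0.
pose c := Int (fun y => D y * tent 4^-1 (2^-1 - y)); exists c.
have Dt eps s : 0 < eps -> ig (fun y => D y * tent eps (s - y)).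
  move=> e0; apply: (@ig_bounded _ _ (expR 1 / eps)) => //.
    exact: mf_refl (mf_cont (@tent_cont eps)).
  move=> x; apply: le_trans (tent_bound e0 _) _; rewrite ler_piMr ?divr_ge0 ?expR_ge0 ?(ltW e0)//.
  by apply: ew_le1; rewrite invr_ge0 ltW.
have convc eps s : 0 < eps -> 2 * eps <= s -> s <= 1 - 2 * eps -> conv (tent eps) D s = c.
  move=> e0 s1 s2; have [tp dp] := tent_test e0 s1 s2.
  have := D0 _ tp; rewrite dp => h.
  have i1 := Dt _ s e0; have i2 := Dt _ 2^-1 e4.
  have h2 : Int (fun y => D y * tent eps (s - y)) - c = 0.
    rewrite -h /c -(IntB i1 i2); apply: Int_ext => y; ring.
  have -> : conv (tent eps) D s = Int (fun y => D y * tent eps (s - y)).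
    rewrite -(Int_refl s i1); apply: Int_ext => y.
    by rewrite mulrC; congr (_ * tent _ _); ring.
  by apply/eqP; rewrite -subr_eq0 h2.
have w0D : wi 0 D by apply: ig_ext Di => x; rewrite /ew mul0r oppr0 expR0 mulr1.
pose X d x := `|D x - c| * ((d <= x) && (x <= 1 - d))%R%:R.
have Xi d : ig (X d).
  have i0 : ig (fun x : R => ((d <= x) && (x <= 1 - d))%R%:R : R).
    have := @ig_continuous R (fun=> 1) d (1 - d) (@cst_continuous _ _ _).
    by apply: ig_ext => x; rewrite mul1r.
  apply: (ig_dom _ _ (igD (ig_abs Di) (igZ `|c| i0))).
    by apply: mfM; [apply: mf_abs; apply: mfB; [exact: ig_mf|exact: mf_cst]|exact: ig_mf i0].
  move=> x; rewrite /X normrM normr_id; case: (_ && _); rewrite ?normr1 ?normr0 ?mulr1 ?mulr0 ?addr0//.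
  exact: ler_normB.
have X0 d : 0 < d -> Int (X d) = 0.
  move=> d0; apply/le_anti/andP; split; last by apply: Int_ge0 => x; rewrite mulr_ge0.
  apply/ler_addgt0Pl => eta eta0; rewrite addr0.
  have [E E0 EP] := approx_identity (lexx 0) w0D eta0 (expR_ge0 1).
  pose eps := Num.min E d / 2.
  have m0 : 0 < Num.min E d by rewrite lt_min E0.
  have e0 : 0 < eps by rewrite divr_gt0.
  have [mE md] : Num.min E d <= E /\ Num.min E d <= d by rewrite !ge_min !lexx orbT.
  have eE : eps < E by rewrite ltr_pdivrMr//; move: mE E0; lra.
  have ed : 2 * eps <= d by rewrite /eps mulrC divfK ?pnatr_eq0.
  have := EP eps (tent eps) e0 eE (mf_cont (@tent_cont eps)) (tent_bound e0).
  rewrite Int_tent//; apply: le_trans.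
  apply: Int_le => //.
    apply: (wi_abs (w := 0)); apply: wiB; last exact: wiZ.
    apply: (@conv_wi R 0 eps^-1) => //; first by rewrite invr_gt0.
    split; first exact: mf_cont (@tent_cont eps).
    by exists (expR 1 / eps); exact: tent_bound.
  move=> x; rewrite /X /ew mul0r oppr0 expR0 mulr1.
  case: (boolP (_ && _)) => [/andP[x1 x2]|_]; last by rewrite mulr0.
  rewrite mulr1 (convc eps x)//; [by rewrite mul1r distrC|exact: le_trans ed x1|].
  by apply: le_trans x2 _; rewrite lerD2l lerN2.
pose Y x := `|D x - c| * ((0 < x) && (x < 1))%R%:R.
have Ym : mf Y.
  apply: mfM; first by apply: mf_abs; apply: mfB; [exact: ig_mf|exact: mf_cst].
  rewrite (_ : (fun x => _) = fun x : R => (0 < x)%R%:R * (x < 1)%R%:R).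
    by apply: mfM; apply: mf_lt; (exact: mf_cst || exact: mf_id).
  by apply/funext => x; case: (0 < x); case: (x < 1); rewrite ?mulr1 ?mulr0.
(* The open unit interval is exhausted by the intervals [[d, 1 - d]] on which [D = c] almost
   everywhere is already known. *)
have Y0 : Int Y = 0.
  have cv : Int (X k.+1%:R^-1) @[k --> \oo] --> Int Y.
    apply: (@Int_dominated R (fun k => X k.+1%:R^-1) Y (X 0)).
    - by move=> k; exact: ig_mf.
    - exact: Ym.
    - move=> x; apply: cvg_near_cst.
      case: (boolP ((0 < x) && (x < 1))) => [/andP[x0 x1]|x01].
        have x1' : 0 < 1 - x by rewrite subr_gt0.
        near=> k; rewrite /X /Y x0 x1; congr (_ * _).
        have -> : k.+1%:R^-1 <= x by apply/ltW; near: k; exact: near_infty_natSinv_lt (PosNum x0).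
        suff -> : x <= 1 - k.+1%:R^-1 by [].
        have : k.+1%:R^-1 <= 1 - x by apply/ltW; near: k; exact: near_infty_natSinv_lt (PosNum x1').
        by rewrite lerBrDr addrC -lerBrDr.
      apply: nearW => k; rewrite /X /Y (negPf x01) mulr0.
      have k0 : 0 < k.+1%:R^-1 :> R by rewrite invr_gt0.
      rewrite (_ : _ && _ = false) ?mulr0//; apply/negbTE; move: x01; apply: contra.
      case/andP => h1 h2; rewrite (lt_le_trans k0 h1)/=.
      by apply: le_lt_trans h2 _; rewrite gtrBl.
    - exact: Xi.
    - move=> k x; rewrite /X normrM normr_id ler_wpM2l//.
      have k0 : 0 < k.+1%:R^-1 :> R by rewrite invr_gt0.
      case: (boolP (_ && _)) => [/andP[h1 h2]|_]; last by rewrite normr0.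
      rewrite normr1 (le_trans (ltW k0) h1) subr0 (_ : x <= 1)//.
      by apply: le_trans h2 _; rewrite gerBl ltW.
  rewrite (_ : (fun k => _) = fun=> 0) in cv; last by apply/funext => k; apply: X0; rewrite invr_gt0.
  by apply/esym; exact: (cvg_unique (@norm_hausdorff _ R^o) (cvg_cst (0 : R)) cv).
have Yi : ig Y.
  apply: (ig_dom Ym _ (Xi 0)) => x; rewrite /X /Y normrM normr_id ler_wpM2l// subr0.
  case: (boolP (_ && _)) => [/andP[/ltW -> /ltW ->]|_]; first by rewrite normr1.
  by rewrite normr0.
have Ya : aeq Y (fun=> 0).
  apply: Int_abs0 => //; rewrite -[RHS]Y0; apply: Int_ext => x.
  by rewrite ger0_norm// mulr_ge0.
apply: filterS3 Ya (aeneq 0) (aeneq 1) => x; rewrite /Y /onI => Yx x0 x1.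
case: (boolP (_ && _)) Yx => [|]; last first.
  move=> h _; rewrite (_ : (0 <= x) && (x <= 1) = false) ?mulr0//.
  apply/negbTE; move: h; apply: contra; case/andP => a1 a2.
  by rewrite !lt_neqAle a1 a2 eq_sym x0 x1.
move=> _; rewrite mulr1 => /normr0P; rewrite subr_eq0 => /eqP ->//.
Unshelve. all: by end_near.
Qed.

(** The difference of [a] and the primitive of [b] has weak derivative 0, so it is constant by
    [du_bois_reymond]. *)
Lemma prim_wderiv a b : ig (onI a) -> ig (onI b) -> wderiv a b ->
  exists c, aeq (onI a) (onI (fun x => c + prim (onI b) x)).
Proof.
move=> ai bi ab.
have w1 : wi 0 (onI b) by apply: ig_ext bi => x; rewrite /ew mul0r oppr0 expR0 mulr1.
pose P := onI (prim (onI b)).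
have Pi : ig P.
  have i0 : ig (fun x : R => ((0 <= x) && (x <= 1))%R%:R : R).
    have := @ig_continuous R (fun=> 1) 0 1 (@cst_continuous _ _ _).
    by apply: ig_ext => x; rewrite mul1r.
  apply: (ig_dom _ _ (igZ (wnorm 0 (onI b)) i0)).
    by apply: mfM; [exact: wi_mf (wi_prim (lexx 0) ltr01 w1)|exact: ig_mf i0].
  move=> x; rewrite /P /onI normrM [`|_%:R|]ger0_norm// ler_wpM2r//.
  apply: le_trans (prim_bound x (lexx 0) w1) _.
  by rewrite /ew oppr0 mul0r oppr0 expR0 mul1r.
have PP : aeq (onI (prim (onI b))) (onI (fun x => 0 + prim (onI b) x)).
  by apply: filterS (aeneq 0) => x _; rewrite /onI add0r.
have Pb := wderiv_prim Pi bi PP.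
have Di := igB ai Pi.
have [|c cP] := du_bois_reymond Di.
  move=> phi tphi; have i1 := (ig_test tphi ai).2; have i2 := (ig_test tphi Pi).2.
  transitivity (Int (fun x => onI a x * derive1 phi x - P x * derive1 phi x)).
    by apply: Int_ext => x; rewrite mulrBl.
  by rewrite (IntB i1 i2) (ab _ tphi) (Pb _ tphi) subrr.
exists c; apply: filterS cP => x; rewrite /P /onI.
case: (_ && _); rewrite ?mulr1 ?mulr0// => <-; ring.
Qed.

End WeakDerivative.

(** * Complex Gaussian kernels *)

Import Normc.
Local Open Scope complex_scope.

Section ComplexCalculus.
Variable R : realType.
Local Notation C := R[i].
Local Notation re := (@complex.Re R).
Local Notation im := (@complex.Im R).
Implicit Types (z w : C) (F G : R -> C).

Lemma reD z w : re (z + w) = re z + re w. Proof. by case: z; case: w. Qed.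
Lemma imD z w : im (z + w) = im z + im w. Proof. by case: z; case: w. Qed.
Lemma reN z : re (- z) = - re z. Proof. by case: z. Qed.
Lemma imN z : im (- z) = - im z. Proof. by case: z. Qed.
Lemma reM z w : re (z * w) = re z * re w - im z * im w.
Proof. by case: z; case: w. Qed.
Lemma imM z w : im (z * w) = re z * im w + im z * re w.
Proof. by case: z; case: w. Qed.
Lemma reR (x : R) : re x%:C = x. Proof. by []. Qed.
Lemma imR (x : R) : im x%:C = 0. Proof. by []. Qed.
Definition reimE := (reD, imD, reN, imN, reM, imM, reR, imR).

Lemma complexP z w : re z = re w -> im z = im w -> z = w.
Proof. by case: z w => [a b] [c d] /= -> ->. Qed.

Lemma normc_ge0 z : 0 <= normc z.
Proof. by case: z => a b; rewrite /= sqrtr_ge0. Qed.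

Lemma re_le z : `|re z| <= normc z.
Proof.
case: z => a b /=; rewrite -sqrtr_sqr ler_wsqrtr// lerDl sqr_ge0//.
Qed.

Lemma im_le z : `|im z| <= normc z.
Proof.
case: z => a b /=; rewrite -sqrtr_sqr ler_wsqrtr// lerDr sqr_ge0//.
Qed.

Lemma normc_le z : normc z <= `|re z| + `|im z|.
Proof.
case: z => a b /=; rewrite -[leRHS]ger0_norm ?addr_ge0// -sqrtr_sqr ler_wsqrtr//.
rewrite sqrrD !real_normK ?num_real// -addrA [_ *+ 2 + _]addrC addrA lerDl.
by rewrite mulrn_wge0// mulr_ge0.
Qed.

Lemma normcR (x : R) : normc x%:C = `|x|.
Proof. by rewrite /= expr0n /= addr0 sqrtr_sqr. Qed.

Lemma normcX2 z : normc (z ^+ 2) = normc z ^+ 2.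
Proof. by rewrite !expr2 normcM. Qed.

Definition cexp z : C := (expR (re z) * cos (im z)) +i* (expR (re z) * sin (im z)).

Lemma cexpD z w : cexp (z + w) = cexp z * cexp w.
Proof.
by apply: complexP; rewrite ?(reM, imM) /cexp /= reD imD expRD ?cosD ?sinD; ring.
Qed.

Lemma normc_cexp z : normc (cexp z) = expR (re z).
Proof.
rewrite /cexp /= !exprMn -mulrDr cos2Dsin2 mulr1 sqrtr_sqr ger0_norm// expR_ge0.
Qed.

Lemma abs_sin_le (x : R) : `|sin x| <= `|x|.
Proof.
have P (y : R) : 0 <= y -> `|sin y| <= y.
  move=> y0; have [y1|y1] := leP y 0.
    have -> : y = 0 by lra.
    by rewrite sin0 normr0.
  have [c _ H] := @MVT R sin cos 0 y y1 (fun x _ => is_derive_sin x)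
    (continuous_subspaceT (@continuous_sin R)).
  rewrite sin0 !subr0 in H; rewrite H normrM (ger0_norm y0).
  by rewrite ler_piMl// ler_norml cos_geN1 cos_le1.
have [x0|x0] := leP 0 x; first by rewrite (ger0_norm x0); exact: P.
by rewrite (ltr0_norm x0) -normrN -sinN; apply: P; lra.
Qed.

Lemma abs_cos1_le (x : R) : `|cos x - 1| <= x ^+ 2.
Proof.
have -> : cos x - 1 = - (2 * sin (x / 2) ^+ 2).
  rewrite [in LHS](_ : x = x / 2 + x / 2); last by field.
  rewrite cosD; have := cos2Dsin2 (x / 2).
  set c := cos _; set s := sin _; rewrite -!expr2 => h.
  have -> : c ^+ 2 = 1 - s ^+ 2 by lra.
  ring.
rewrite normrN normrM ger0_norm// normrX.
have := abs_sin_le (x / 2).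
move=> /(fun h => @lerXn2r R 2 _ _ (normr_ge0 _) (normr_ge0 _) h).
rewrite -!normrX [in X in _ <= X -> _]ger0_norm ?sqr_ge0// expr_div_n.
have := sqr_ge0 x; lra.
Qed.

Lemma abs_sinx_le (x : R) : `|sin x - x| <= x ^+ 2 * expR `|x|.
Proof.
have P (y : R) : 0 <= y -> `|sin y - y| <= y ^+ 2 * expR y.
  move=> y0; have [y1|y1] := leP y 0.
    have -> : y = 0 by lra.
    by rewrite sin0 subr0 normr0 expr0n /= mul0r.
  have D (z : R) : dv (fun x => sin x - x) z (cos z - 1).
    by apply: dvB; [exact: is_derive_sin|exact: dv_id].
  have [c /andP[c0 cy] H] := @MVT R (fun x => sin x - x) (fun x => cos x - 1) 0 y y1
    (fun x _ => D x) (continuous_subspaceT (dv_cont D)).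
  have c0' : 0 < c by move: c0.
  have cy' : c < y by move: cy.
  rewrite /= sin0 !subr0 in H; rewrite H normrM (ger0_norm y0).
  apply: (@le_trans _ _ (c ^+ 2 * y)).
    by rewrite ler_wpM2r// abs_cos1_le.
  have E := expR_ge1Dx y.
  have : c ^+ 2 <= y ^+ 2 by rewrite lerXn2r ?nnegrE ?ltW.
  have := sqr_ge0 y; nra.
have [x0|x0] := leP 0 x; first by rewrite (ger0_norm x0); exact: P.
rewrite (ltr0_norm x0) -normrN opprB addrC -sqrrN.
have -> : - sin x + x = sin (- x) - (- x) by rewrite sinN; ring.
by apply: P; lra.
Qed.

Lemma abs_expB1_le (y : R) : `|expR y - 1| <= `|y| * expR `|y|.
Proof.
have [y0|y0] := leP 0 y.
  rewrite (ger0_norm y0) ger0_norm; last first.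
    by rewrite subr_ge0 -expR0 ler_expR.
  have := expR_ge1Dx (- y); rewrite expRN => h.
  have e0 := expR_gt0 y.
  have : (1 + - y) * expR y <= 1.
    rewrite -[leRHS](mulVf (lt0r_neq0 e0)) ler_wpM2r//; exact: ltW.
  lra.
have e1 : expR y <= 1 by rewrite -expR0 ler_expR ltW.
rewrite ler0_norm ?subr_le0// ltr0_norm//.
have := expR_ge1Dx y; have := expR_ge1Dx (- y) => h1 h2.
nra.
Qed.

Lemma abs_exp1_le (x : R) : `|expR x - 1 - x| <= x ^+ 2 * expR `|x|.
Proof.
have P (y t : R) : 0 < t -> `|(expR (y * t) - 1 - y * t)| <= (y * t) ^+ 2 * expR (`|y| * t).
  move=> t0.
  have D2 (z : R) : dv (fun x => expR (y * x) - 1 - y * x) z ((expR (y * z) - 1) * y).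
    have dl : dv (fun x => y * x) z y.
      by apply: dv_eq (dvM (dv_cst y z) (dv_id z)) _; ring.
    by apply: dv_eq (dvB (dvB (dv_exp dl) (dv_cst 1 z)) dl) _; ring.
  have [c /andP[c0 ct] H] := @MVT R _ _ 0 t t0
    (fun x _ => D2 x) (continuous_subspaceT (dv_cont D2)).
  have c0' : 0 < c by move: c0.
  have ct' : c < t by move: ct.
  rewrite /= !mulr0 expR0 !subr0 subrr subr0 in H; rewrite H !normrM (gtr0_norm t0).
  apply: (@le_trans _ _ ((`|y * c| * expR `|y * c|) * `|y| * t)).
    by rewrite ler_wpM2r ?(ltW t0)// ler_wpM2r// abs_expB1_le.
  rewrite normrM (gtr0_norm c0') exprMn -(real_normK (num_real y)).
  have E : expR (`|y| * c) <= expR (`|y| * t) by rewrite ler_expR ler_wpM2l// ltW.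
  have e0 := expR_gt0 (`|y| * c).
  have -> : `|y| * c * expR (`|y| * c) * `|y| * t = (`|y| ^+ 2 * t) * (c * expR (`|y| * c)) by ring.
  have -> : `|y| ^+ 2 * t ^+ 2 * expR (`|y| * t) = (`|y| ^+ 2 * t) * (t * expR (`|y| * t)) by ring.
  rewrite ler_wpM2l ?mulr_ge0 ?sqr_ge0 ?(ltW t0)//.
  by apply: ler_pM => //; exact: ltW.
by have := P x 1 ltr01; rewrite !mulr1.
Qed.

Lemma cexp_taylor z : normc (cexp z - 1 - z) <= 4 * normc z ^+ 2 * expR (normc z).
Proof.
have := re_le z; have := im_le z; set N := normc z => bN aN.
apply: le_trans (normc_le _) _.
have N0 : 0 <= N by exact: normc_ge0.
move: bN aN; case: z @N N0 => a b N N0 /= bN aN.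
have sq (x : R) : `|x| <= N -> x ^+ 2 <= N ^+ 2.
  by move=> xN; rewrite -(real_normK (num_real x)) lerXn2r// nnegrE.
have ex (x : R) : `|x| <= N -> expR `|x| <= expR N by rewrite ler_expR.
have e1 : 1 <= expR N by rewrite -expR0 ler_expR.
have eN := expR_ge0 N.
have h1 : `|expR a * cos b - 1 - a| <= 2 * N ^+ 2 * expR N.
  have -> : expR a * cos b - 1 - a = (expR a - 1 - a) * cos b + (1 + a) * (cos b - 1) by ring.
  apply: le_trans (ler_normD _ _) _; rewrite !normrM.
  have -> : 2 * N ^+ 2 * expR N = (N ^+ 2 * expR N) * 1 + expR N * N ^+ 2 by ring.
  apply: lerD; apply: ler_pM => //.
  - by apply: le_trans (abs_exp1_le a) _; apply: ler_pM; rewrite ?sqr_ge0 ?expR_ge0 ?sq ?ex.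
  - by rewrite ler_norml cos_geN1 cos_le1.
  - apply: le_trans (ler_normD _ _) _; rewrite normr1.
    by apply: le_trans (expR_ge1Dx _) _; exact: ex.
  - by apply: le_trans (abs_cos1_le b) _; exact: sq.
have h2 : `|expR a * sin b - b| <= 2 * N ^+ 2 * expR N.
  have -> : expR a * sin b - b = (expR a - 1) * sin b + (sin b - b) by ring.
  apply: le_trans (ler_normD _ _) _; rewrite normrM.
  have -> : 2 * N ^+ 2 * expR N = (N * expR N) * N + N ^+ 2 * expR N by ring.
  apply: lerD.
    apply: ler_pM => //; last by apply: le_trans (abs_sin_le b) _.
    by apply: le_trans (abs_expB1_le a) _; apply: ler_pM; rewrite ?expR_ge0 ?ex.
  by apply: le_trans (abs_sinx_le b) _; apply: ler_pM; rewrite ?sqr_ge0 ?expR_ge0 ?sq ?ex.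
apply: (@le_trans _ _ (`|expR a * cos b - 1 - a| + `|expR a * sin b - b|)); last by lra.
rewrite le_eqVlt; apply/orP; left; apply/eqP.
by congr (`|_| + `|_|); rewrite /=; ring.
Qed.

Definition cdv F (x : R) (d : C) := dv (re \o F) x (re d) /\ dv (im \o F) x (im d).

Lemma cdv_eq F x d d' : cdv F x d -> d = d' -> cdv F x d'. Proof. by move=> H <-. Qed.

Lemma cdv_cst (c : C) x : cdv (fun=> c) x 0.
Proof. by split; exact: dv_cst. Qed.

Lemma cdv_id x : cdv (fun t => t%:C) x 1.
Proof. by split; [exact: dv_id|exact: dv_cst]. Qed.

Lemma cdvD F G x d e : cdv F x d -> cdv G x e -> cdv (fun t => F t + G t) x (d + e).
Proof.
move=> [F1 F2] [G1 G2]; split.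
- rewrite reD (_ : _ \o _ = fun t => (re \o F) t + (re \o G) t); first exact: dvD.
  by apply/funext => t; rewrite /= reD.
- rewrite imD (_ : _ \o _ = fun t => (im \o F) t + (im \o G) t); first exact: dvD.
  by apply/funext => t; rewrite /= imD.
Qed.

Lemma cdvM F G x d e : cdv F x d -> cdv G x e ->
  cdv (fun t => F t * G t) x (F x * e + G x * d).
Proof.
move=> [F1 F2] [G1 G2]; split.
- rewrite (_ : _ \o _ = fun t => (re \o F) t * (re \o G) t - (im \o F) t * (im \o G) t).
    by apply: dv_eq (dvB (dvM F1 G1) (dvM F2 G2)) _; rewrite !reimE /=; ring.
  by apply/funext => t; rewrite /= reM.
- rewrite (_ : _ \o _ = fun t => (re \o F) t * (im \o G) t + (im \o F) t * (re \o G) t).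
    by apply: dv_eq (dvD (dvM F1 G2) (dvM F2 G1)) _; rewrite !reimE /=; ring.
  by apply/funext => t; rewrite /= imM.
Qed.

Lemma cdvN F x d : cdv F x d -> cdv (fun t => - F t) x (- d).
Proof.
move=> dF; have := cdvM (cdv_cst (-1) x) dF; rewrite mulr0 addr0 mulN1r.
by congr cdv; apply/funext => t; rewrite mulN1r.
Qed.

Lemma cdv_exp F x d : cdv F x d -> cdv (fun t => cexp (F t)) x (cexp (F x) * d).
Proof.
move=> [F1 F2]; split.
- apply: dv_eq (dvM (dv_exp F1) (dv_cos F2)) _; rewrite reM /cexp /=; ring.
- apply: dv_eq (dvM (dv_exp F1) (dv_sin F2)) _; rewrite imM /cexp /=; ring.
Qed.

Lemma cdv_cont F f : (forall x, cdv F x (f x)) -> continuous (re \o F) /\ continuous (im \o F).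
Proof.
move=> dF; split.
- by apply: (@dv_cont _ _ (re \o f)) => x; exact: (dF x).1.
- by apply: (@dv_cont _ _ (im \o f)) => x; exact: (dF x).2.
Qed.

Definition cmf2 (F : R -> R -> C) := mf2 (fun x y => re (F x y)) /\ mf2 (fun x y => im (F x y)).

Lemma cmf2_real (f : R -> R -> R) : mf2 f -> cmf2 (fun x y => (f x y)%:C).
Proof. by move=> mf; split => //; exact: (@mf2_1 R (fun=> 0) (mf_cst _)). Qed.

Lemma cmf2_cst (c : C) : cmf2 (fun _ _ => c).
Proof.
split; [exact: (@mf2_1 R (fun=> re c) (mf_cst _))|exact: (@mf2_1 R (fun=> im c) (mf_cst _))].
Qed.

Lemma mf2_ext (F G : R -> R -> R) : (forall x y, F x y = G x y) -> mf2 F -> mf2 G.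
Proof. by move=> FG; congr mf2; apply/funext => x; apply/funext => y. Qed.

Lemma cmf2D (F G : R -> R -> C) : cmf2 F -> cmf2 G -> cmf2 (fun x y => F x y + G x y).
Proof.
move=> [F1 F2] [G1 G2]; split.
- by apply: mf2_ext (mf2D F1 G1) => x y; rewrite reD.
- by apply: mf2_ext (mf2D F2 G2) => x y; rewrite imD.
Qed.

Lemma cmf2M (F G : R -> R -> C) : cmf2 F -> cmf2 G -> cmf2 (fun x y => F x y * G x y).
Proof.
move=> [F1 F2] [G1 G2]; split.
- by apply: mf2_ext (mf2B (mf2M F1 G1) (mf2M F2 G2)) => x y; rewrite reM.
- by apply: mf2_ext (mf2D (mf2M F1 G2) (mf2M F2 G1)) => x y; rewrite imM.
Qed.

Lemma cmf2_exp (F : R -> R -> C) : cmf2 F -> cmf2 (fun x y => cexp (F x y)).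
Proof.
move=> [F1 F2]; split; apply: mf2M.
- by apply: mf2_comp F1; exact: measurable_expR.
- by apply: mf2_comp F2; apply: mf_cont; exact: continuous_cos.
- by apply: mf2_comp F1; exact: measurable_expR.
- by apply: mf2_comp F2; apply: mf_cont; exact: continuous_sin.
Qed.

Definition cmf F := mf (re \o F) /\ mf (im \o F).

Lemma cmf2_cmf (F : R -> C) : cmf2 (fun _ y => F y) -> cmf F.
Proof.
have mp : measurable_fun [set: measurableTypeR R]
   (fun y : measurableTypeR R => (0 : measurableTypeR R, y)).
  by apply: measurable_fun_pair => //; exact: measurable_cst.
move=> [F1 F2]; split.
- exact: (measurableT_comp F1 mp).
- exact: (measurableT_comp F2 mp).
Qed.

Definition cig F := ig (re \o F) /\ ig (im \o F).
Definition cInt F : C := (Int (re \o F)) +i* (Int (im \o F)).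

Lemma cIntZ (c : C) F : cig F -> cInt (fun x => c * F x) = c * cInt F.
Proof.
move=> [F1 F2]; apply: complexP; rewrite /= ?(reM, imM) /=.
- rewrite -!IntZ// -IntB; [|exact: igZ|exact: igZ].
  by apply: Int_ext => x; rewrite /= reM.
- rewrite -!IntZ// -IntD; [|exact: igZ|exact: igZ].
  by apply: Int_ext => x; rewrite /= imM.
Qed.

Lemma cig_dom F (g : R -> R) : cmf F -> (forall x, normc (F x) <= g x) -> ig g -> cig F.
Proof.
move=> [F1 F2] Fg gi; split.
- by apply: (ig_dom F1 _ gi) => x; apply: le_trans (Fg x); exact: re_le.
- by apply: (ig_dom F2 _ gi) => x; apply: le_trans (Fg x); exact: im_le.
Qed.

(** Limits at infinity are not examined: averaging [f] over unit intervals keeps its integral and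
    produces [k (x + 1) - k x], whose integral is 0 by translation invariance. *)
Lemma Int_deriv0 (k f : R -> R) : (forall x, dv k x (f x)) -> continuous f -> ig f ->
  ig k -> Int f = 0.
Proof.
move=> dk cf fi ki.
have ci : ig (chi (1:R)).
  apply: ig_ext (ig_prim_continuous (f := fun=> 1) 1 _) => [r|]; first by rewrite mul1r.
  by move=> x; exact: cvg_cst.
have H := ig2_conv (ig_refl 0 ci) fi.
have C1 : Int (chi (1:R)) = 1.
  have c1 : continuous (fun _ : R => 1 : R) by move=> x; exact: cvg_cst.
  have := prim_FTC 1 (@dv_id R) c1.
  rewrite subr0 => E; rewrite -[RHS]E; apply: Int_ext => r.
  by rewrite mul1r.
have E1 : Int (fun s => Int (fun r => chi 1 (0 - r) * f (s - r))) = Int f.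
  transitivity (Int (chi (1:R)) * Int f); last by rewrite C1 mul1r.
  rewrite (ig2_swap H) -(Int_refl 0 ci) mulrC -IntZ; last exact: ig_refl.
  apply: Int_ext => r; rewrite IntZ; last exact: (ig_shift (- r) fi).
  rewrite (Int_shift (- r) fi); exact: mulrC.
rewrite -E1 -[RHS](subrr (Int k)) -{1}(Int_shift 1 ki) -IntB//; last exact: (ig_shift 1 ki).
apply: Int_ext => x.
have dkx (t : R) : dv (fun t => k (x + t)) t (f (x + t)).
  apply: dv_eq (dv_comp (dk (x + t)) (dvD (dv_cst x t) (dv_id t))) _; ring.
have cfx : continuous (fun t => f (x + t)).
  move=> t; apply: continuous_comp; last exact: cf.
  by apply: cvgD; [exact: cvg_cst|exact: cvg_id].
rewrite -[X in _ - k X](addr0 x) -(prim_FTC 1 dkx cfx) /prim.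
rewrite -[RHS](Int_refl 0); last exact: ig_prim_continuous.
apply: Int_ext => r; rewrite (_ : x - r = x + (0 - r)); last by ring.
exact: mulrC.
Qed.

End ComplexCalculus.

(** * Gaussian integrals with complex parameters and heat kernels at complex times *)

Section ComplexGaussian.
Variable R : realType.
Local Notation C := R[i].
Local Notation re := (@complex.Re R).
Local Notation im := (@complex.Im R).
Implicit Types (a b c z w al be : C) (x y t r l m A B : R).

(** The open sector of half-angle pi/4; within the right half plane the condition says that [z^2]
    has positive real part. *)
Definition cone z : Prop := `|im z| < re z.

Lemma quad_exp m K y : 0 < m -> - (m ^+ 2 * y ^+ 2) + K * `|y| <= K ^+ 2 / (4 * m ^+ 2).
Proof.
move=> m0; have m2 : 0 < 4 * m ^+ 2 by rewrite mulr_gt0// exprn_gt0.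
rewrite ler_pdivlMr// -(real_normK (num_real y)); set u := `|y|.
have := sqr_ge0 (2 * m ^+ 2 * u - K); nra.
Qed.

Lemma re_le_normc z : re z <= normc z.
Proof. exact: le_trans (ler_norm _) (re_le z). Qed.

Lemma gexp_re m A B al be y : 0 < m -> m <= re al - `|im al| ->
  normc al <= A -> normc be <= B ->
  re (- (al * y%:C + be) ^+ 2) <= - (m ^+ 2 * y ^+ 2) + 2 * A * B * `|y| + B ^+ 2.
Proof.
move=> m0 mal alA beB.
have h1 : m ^+ 2 <= re (al ^+ 2).
  rewrite expr2 reM; have h := real_normK (num_real (im al)).
  have i0 := normr_ge0 (im al); nra.
have n1 := normc_ge0 al; have n2 := normc_ge0 be.
have h2 : `|re (al * be)| <= A * B.
  apply: le_trans (re_le _) _; rewrite normcM; exact: ler_pM.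
have h3 : `|re (be ^+ 2)| <= B ^+ 2.
  apply: le_trans (re_le _) _; rewrite normcX2.
  by rewrite lerXn2r// nnegrE// (le_trans n2).
have E : re (- (al * y%:C + be) ^+ 2) =
   - (re (al ^+ 2) * y ^+ 2) - 2 * re (al * be) * y - re (be ^+ 2).
  by case: al {mal alA h1 n1 h2} => p q; case: be {beB n2 h3} => s t; rewrite /= ; ring.
rewrite E.
have h4 : - (re (al * be) * y) <= A * B * `|y|.
  apply: le_trans (ler_norm _) _; rewrite normrN normrM ler_wpM2r//.
have h5 : - re (be ^+ 2) <= B ^+ 2.
  by apply: le_trans h3; rewrite -normrN ler_norm.
have h6 : m ^+ 2 * y ^+ 2 <= re (al ^+ 2) * y ^+ 2 by rewrite ler_wpM2r// sqr_ge0.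
lra.
Qed.

(** The Gaussian rate [m^2] beats all linear terms in the exponent by completing the square
    ([quad_exp]). The factor [(1 + |y|) ^+ 2] makes room for polynomial prefactors of degree 2. *)
Lemma gexp_bound m A B l al be y : 0 < m -> m <= re al - `|im al| ->
  normc al <= A -> normc be <= B ->
  (1 + `|y|) ^+ 2 * normc (cexp (- (al * y%:C + be) ^+ 2)) <=
  expR (B ^+ 2 + (2 * A * B + 2 + l) ^+ 2 / (4 * m ^+ 2)) * ew l y.
Proof.
move=> m0 mal alA beB; rewrite normc_cexp.
have H := gexp_re y m0 mal alA beB.
have E1 : (1 + `|y|) ^+ 2 <= expR (2 * `|y|).
  have -> : 2 * `|y| = `|y| + `|y| by ring.
  by rewrite expRD -expr2 lerXn2r ?nnegrE ?expR_ge0 ?addr_ge0// expR_ge1Dx.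
apply: (@le_trans _ _ (expR (2 * `|y|) * expR (- (m ^+ 2 * y ^+ 2) + 2 * A * B * `|y| + B ^+ 2))).
  by apply: ler_pM; rewrite ?sqr_ge0 ?expR_ge0// ler_expR.
rewrite /ew -!expRD ler_expR.
have := quad_exp (2 * A * B + 2 + l) y m0; lra.
Qed.

Lemma normc2 : normc (2 : C) = 2.
Proof.
have -> : (2 : C) = (2 : R)%:C by apply: complexP => /=; ring.
by rewrite normcR ger0_norm.
Qed.

Let sqp : R := Num.sqrt pi.

Lemma sqp_gt0 : 0 < sqp. Proof. by rewrite sqrtr_gt0 pi_gt0. Qed.

Lemma normc1B (a : C) t : 0 <= t -> t <= 1 -> normc (1 + t%:C * (a - 1)) <= 2 + normc a.
Proof.
move=> t0 t1; apply: le_trans (le_normcD _ _) _; rewrite normcM normcR ger0_norm//.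
have h := le_normcD a (-1); have n0 := normc_ge0 (a - 1).
rewrite normcN normc1 in h; rewrite normc1; nra.
Qed.

Lemma chi1_le0 t : t <= 0 -> chi 1 t = 0.
Proof. by move=> t0; rewrite /chi t0 (le_trans t0 ler01) subrr. Qed.

Lemma chi1_gt1 t : 1 < t -> chi 1 t = 0.
Proof.
move=> t1; rewrite /chi (_ : (t <= 1) = false); last by apply/negbTE; rewrite -ltNge.
rewrite (_ : (t <= 0) = false) ?subrr//; apply/negbTE; rewrite -ltNge.
exact: lt_trans t1.
Qed.

Definition cder (F : R -> C) := forall x, exists d, cdv F x d.

Lemma cder_cst c : cder (fun=> c). Proof. by move=> x; exists 0; exact: cdv_cst. Qed.
Lemma cder_id : cder (fun t => t%:C). Proof. by move=> x; exists 1; exact: cdv_id. Qed.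
Lemma cderD (F G : R -> C) : cder F -> cder G -> cder (fun x => F x + G x).
Proof.
by move=> dF dG x; case: (dF x) (dG x) => d ? [e ?]; exists (d + e); exact: cdvD.
Qed.
Lemma cderN (F : R -> C) : cder F -> cder (fun x => - F x).
Proof. by move=> dF x; case: (dF x) => d ?; exists (- d); exact: cdvN. Qed.
Lemma cderM (F G : R -> C) : cder F -> cder G -> cder (fun x => F x * G x).
Proof.
move=> dF dG x; case: (dF x) (dG x) => d ? [e ?].
by exists (F x * e + G x * d); exact: cdvM.
Qed.
Lemma cder_exp (F : R -> C) : cder F -> cder (fun x => cexp (F x)).
Proof. by move=> dF x; case: (dF x) => d ?; exists (cexp (F x) * d); exact: cdv_exp. Qed.
Lemma cder_cont (F : R -> C) : cder F -> continuous (re \o F) /\ continuous (im \o F).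
Proof. by move=> /choice[f df]; exact: cdv_cont df. Qed.

Section Master.
Variables a b : C.
Hypothesis ca : cone a.

(** A deformation in place of Cauchy's theorem: [ze t y] moves from [y] at [t = 0] to [a y + b] at
    [t = 1], with slope [al t] in the cone by convexity. The [t]-derivative of [H] and the
    [y]-derivative of [K] are the same function [Fd], so the integral of [H] over [y] does not
    depend on [t]. *)
Let al (t : R) : C := 1 + t%:C * (a - 1).
Let ze (t y : R) : C := al t * y%:C + t%:C * b.
Let zd (y : R) : C := (a - 1) * y%:C + b.
Let H (t y : R) : C := al t * cexp (- (ze t y) ^+ 2).
Let K (t y : R) : C := zd y * cexp (- (ze t y) ^+ 2).
Let Fd (t y : R) : C := ((a - 1) - 2 * ze t y * al t * zd y) * cexp (- (ze t y) ^+ 2).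

Let dH t y : cdv (fun t => H t y) t (Fd t y).
Proof.
have d1 : cdv al t (a - 1).
  apply: cdv_eq (cdvD (cdv_cst 1 t) (cdvM (cdv_id t) (cdv_cst (a - 1) t))) _; ring.
have d2 : cdv (fun t => ze t y) t (zd y).
  apply: cdv_eq (cdvD (cdvM d1 (cdv_cst y%:C t)) (cdvM (cdv_id t) (cdv_cst b t))) _.
  rewrite /zd; ring.
have d3 : cdv (fun t => - (ze t y) ^+ 2) t (- (ze t y * zd y + ze t y * zd y)).
  by apply: cdvN; exact: cdvM.
apply: cdv_eq (cdvM d1 (cdv_exp d3)) _; rewrite /Fd; ring.
Qed.

Let dK t y : cdv (fun y => K t y) y (Fd t y).
Proof.
have d1 : cdv zd y (a - 1).
  apply: cdv_eq (cdvD (cdvM (cdv_cst (a - 1) y) (cdv_id y)) (cdv_cst b y)) _; ring.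
have d2 : cdv (fun y => ze t y) y (al t).
  apply: cdv_eq (cdvD (cdvM (cdv_cst (al t) y) (cdv_id y)) (cdv_cst (t%:C * b) y)) _; ring.
have d3 : cdv (fun y => - (ze t y) ^+ 2) y (- (ze t y * al t + ze t y * al t)).
  by apply: cdvN; exact: cdvM.
apply: cdv_eq (cdvM d1 (cdv_exp d3)) _; rewrite /Fd; ring.
Qed.

Let m : R := Num.min 1 (re a - `|im a|).
Let m0 : 0 < m. Proof. by rewrite lt_min ltr01 subr_gt0. Qed.
Let m_al t : 0 <= t -> t <= 1 -> m <= re (al t) - `|im (al t)|.
Proof.
move=> t0 t1.
have -> : re (al t) = 1 - t + t * re a by rewrite /al; case: (a) => p q /=; ring.
have -> : im (al t) = t * im a by rewrite /al; case: (a) => p q /=; ring.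
rewrite normrM (ger0_norm t0).
have h1 : m <= 1 by rewrite ge_min lexx.
have h2 : m <= re a - `|im a| by rewrite ge_min lexx orbT.
nra.
Qed.

Let A := 2 + normc a.
Let B := normc b.
Let be_le t : 0 <= t -> t <= 1 -> normc (t%:C * b) <= B.
Proof.
by move=> t0 t1; rewrite normcM normcR (ger0_norm t0) ler_piMl// normc_ge0.
Qed.

Let D := normc (a - 1) + B.
(** Chosen so that the polynomial prefactors of [H], [K] and [Fd] are at most [C0 * (1 + |y|) ^+ 2]
    for all [0 <= t <= 1]. *)
Let C0 := A + D + normc (a - 1) + 2 * (A + B) * A * D.
Let M := expR (B ^+ 2 + (2 * A * B + 2 + 1) ^+ 2 / (4 * m ^+ 2)).

Let A0 : 0 <= A. Proof. by rewrite addr_ge0// normc_ge0. Qed.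
Let B0 : 0 <= B. Proof. exact: normc_ge0. Qed.
Let D0 : 0 <= D. Proof. by rewrite addr_ge0// normc_ge0. Qed.

Let ABD : 0 <= 2 * (A + B) * A * D.
Proof.
by apply: mulr_ge0 => //; apply: mulr_ge0 => //; apply: mulr_ge0 => //; apply: addr_ge0.
Qed.

Let C00 : 0 <= C0.
Proof. by rewrite addr_ge0// addr_ge0 ?normc_ge0// addr_ge0. Qed.

Let bnd t y (p : C) : 0 <= t -> t <= 1 -> normc p <= C0 * (1 + `|y|) ^+ 2 ->
  normc (p * cexp (- (ze t y) ^+ 2)) <= C0 * M * ew 1 y.
Proof.
move=> t0 t1 pC; rewrite normcM.
have := gexp_bound 1 y m0 (m_al t0 t1) (normc1B a t0 t1) (be_le t0 t1).
rewrite -/A -/M => h.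
apply: (@le_trans _ _ (C0 * ((1 + `|y|) ^+ 2 * normc (cexp (- ze t y ^+ 2))))).
  by rewrite mulrA ler_wpM2r// normc_ge0.
by rewrite -mulrA ler_wpM2l.
Qed.

Let y1 y : 1 <= (1 + `|y|) ^+ 2.
Proof. by rewrite exprn_ege1// lerDl. Qed.

Let y2 y : 1 + `|y| <= (1 + `|y|) ^+ 2.
Proof. by rewrite expr2 ler_peMl// ?addr_ge0// lerDl. Qed.

Let zd_le y : normc (zd y) <= D * (1 + `|y|).
Proof.
apply: le_trans (le_normcD _ _) _; rewrite normcM normcR -/B.
have h := normc_ge0 (a - 1); have h' := normr_ge0 y.
have := mulr_ge0 B0 h'; rewrite /D; lra.
Qed.

Let ze_le t y : 0 <= t -> t <= 1 -> normc (ze t y) <= (A + B) * (1 + `|y|).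
Proof.
move=> t0 t1; apply: le_trans (le_normcD _ _) _; rewrite normcM normcR.
have h := normc1B a t0 t1; have h' := normr_ge0 y; have h2 := be_le t0 t1.
have h3 := ler_wpM2r h' h; rewrite -/A in h3 h.
have := mulr_ge0 B0 h'; rewrite -/(al t) in h h3; have := A0; lra.
Qed.

Let H_le t y : 0 <= t -> t <= 1 -> normc (H t y) <= C0 * M * ew 1 y.
Proof.
move=> t0 t1; apply: bnd => //.
apply: (@le_trans _ _ (A * 1)); first by rewrite mulr1; exact: normc1B.
apply: ler_pM => //; have := ABD; have := D0; have := normc_ge0 (a - 1).
by rewrite /C0; lra.
Qed.

Let K_le t y : 0 <= t -> t <= 1 -> normc (K t y) <= C0 * M * ew 1 y.
Proof.
move=> t0 t1; apply: bnd => //; apply: le_trans (zd_le y) _.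
apply: ler_pM => //.
have := A0; have := normc_ge0 (a - 1); have := ABD.
rewrite /C0; lra.
Qed.

Let Fd_le t y : 0 <= t -> t <= 1 -> normc (Fd t y) <= C0 * M * ew 1 y.
Proof.
move=> t0 t1; apply: bnd => //; apply: le_trans (le_normcD _ _) _; rewrite normcN.
have n1 := normc_ge0 (a - 1).
have h1 : normc (2 * ze t y * al t * zd y) <= 2 * ((A + B) * (1 + `|y|)) * A * (D * (1 + `|y|)).
  rewrite !normcM; rewrite normc2.
  apply: ler_pM; rewrite ?mulr_ge0 ?normc_ge0//.
  apply: ler_pM; rewrite ?mulr_ge0 ?normc_ge0//.
  - by rewrite ler_wpM2l// ze_le.
  - exact: normc1B.
have h2 : normc (a - 1) <= normc (a - 1) * (1 + `|y|) ^+ 2 by rewrite ler_peMr.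
have h3 : 0 <= (A + D) * (1 + `|y|) ^+ 2 by rewrite mulr_ge0 ?sqr_ge0// addr_ge0.
rewrite /C0; lra.
Qed.

Let cmze (t : R) : cmf2 (fun _ y => ze t y).
Proof.
apply: cmf2D; last exact: cmf2_cst.
apply: cmf2M; first exact: cmf2_cst.
exact: cmf2_real (@mf2_snd R).
Qed.

Let cmze2 : cmf2 (fun y t => ze t y).
Proof.
have ct : cmf2 (fun _ t : R => t%:C) := cmf2_real (@mf2_snd R).
apply: cmf2D; last by apply: cmf2M => //; exact: cmf2_cst.
apply: cmf2M; last exact: cmf2_real (@mf2_fst R).
by apply: cmf2D; [exact: cmf2_cst|apply: cmf2M => //; exact: cmf2_cst].
Qed.

Let cmexp (F : R -> R -> C) : cmf2 F -> cmf2 (fun x y => cexp (- (F x y) ^+ 2)).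
Proof.
move=> mF; apply: cmf2_exp.
have := cmf2M (cmf2_cst (-1)) (cmf2M mF mF).
by congr cmf2; apply/funext => x; apply/funext => y; rewrite mulN1r expr2.
Qed.

Let cmH t : cmf (H t).
Proof.
by apply: cmf2_cmf; apply: cmf2M; [exact: cmf2_cst|exact: cmexp (cmze t)].
Qed.

Let cmzd : cmf2 (fun y _ => zd y).
Proof.
apply: cmf2D; last exact: cmf2_cst.
by apply: cmf2M; [exact: cmf2_cst|exact: cmf2_real (@mf2_fst R)].
Qed.

Let cmFd2 : cmf2 (fun y t => Fd t y).
Proof.
apply: cmf2M; last exact: cmexp cmze2.
have ct : cmf2 (fun _ t : R => al t).
  apply: cmf2D; first exact: cmf2_cst.
  by apply: cmf2M; [exact: cmf2_real (@mf2_snd R)|exact: cmf2_cst].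
have := cmf2D (cmf2_cst (a - 1)) (cmf2M (cmf2_cst (-1)) (cmf2M (cmf2M (cmf2M (cmf2_cst 2) cmze2) ct) cmzd)).
by congr cmf2; apply/funext => y; apply/funext => t; rewrite mulN1r.
Qed.

Let cigH t : 0 <= t -> t <= 1 -> cig (H t).
Proof.
move=> t0 t1; apply: (cig_dom (cmH t) _ (igZ (C0 * M) (ig_ew (@ltr01 R)))) => y.
exact: H_le.
Qed.

(** Stated for a real component [p], to be taken as real and as imaginary part. Fubini reduces the
    difference of the two integrals to integrals of the [y]-derivative of [K], which vanish by
    [Int_deriv0]. *)
Let step (p : C -> R) (F : R -> R -> R) :
  (forall z, `|p z| <= normc z) ->
  (forall t y, F t y = p (Fd t y)) ->
  (forall t y, dv (fun t => p (H t y)) t (F t y)) ->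
  (forall t y, dv (fun y => p (K t y)) y (F t y)) ->
  (forall y, continuous (fun t => F t y)) -> (forall t, continuous (F t)) ->
  mf2 (fun y t => F t y) -> (forall t, ig (fun y => p (H t y)) \/ ~ (0 <= t <= 1)) ->
  (forall t, mf (fun y => p (K t y))) ->
  Int (fun y => p (H 1 y)) = Int (fun y => p (H 0 y)).
Proof.
move=> pn FE dHp dKp cFt cFy mF iH mK.
have i1 : ig (fun y => p (H 1 y)) by case: (iH 1) => // -[]; rewrite ler01 lexx.
have i0 : ig (fun y => p (H 0 y)) by case: (iH 0) => // -[]; rewrite ler01 lexx.
have ci : ig (chi (1:R)).
  have c1 : continuous (fun _ : R => 1 : R) by move=> x; exact: cvg_cst.
  by apply: ig_ext (ig_prim_continuous (f := fun=> 1) 1 c1) => r; rewrite mul1r.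
have dom t y : 0 <= t -> t <= 1 -> `|F t y| <= C0 * M * ew 1 y.
  by move=> t0 t1; rewrite FE; apply: le_trans (pn _) (Fd_le _ _ _).
have I2 : ig2 (fun y t => F t y * chi 1 t).
  apply: (ig2_dom _ _ (ig2_tensor (igZ (C0 * M) (ig_ew (@ltr01 R))) (ig_abs ci))).
    apply: mf2M => //; exact: mf2_2 (mf_chi 1).
  move=> y t; rewrite normrM.
  have [t0|t0] := ltP 0 t; last by rewrite chi1_le0// normr0 !mulr0.
  have [t1|t1] := leP t 1; last first.
    by rewrite chi1_gt1// normr0 !mulr0.
  by rewrite ler_wpM2r// dom// ltW.
apply/eqP; rewrite -subr_eq0 -IntB//; apply/eqP.
transitivity (Int (fun y => Int (fun t => F t y * chi 1 t))).
  apply: Int_ext => y; rewrite -[RHS]/(prim (fun t => F t y) 1).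
  by rewrite (prim_FTC 1 (fun t => dHp t y) (cFt y)).
rewrite (ig2_swap I2) -[RHS](Int0 R); apply: Int_ext => t.
have [t0|t0] := ltP 0 t; last first.
  rewrite chi1_le0// -[RHS](Int0 R).
  by apply: Int_ext => y; rewrite mulr0.
have [t1|t1] := leP t 1; last first.
  rewrite chi1_gt1// -[RHS](Int0 R).
  by apply: Int_ext => y; rewrite mulr0.
have Fi : ig (F t).
  apply: (ig_dom (mf_cont (cFy t)) _ (igZ (C0 * M) (ig_ew (@ltr01 R)))) => y.
  by rewrite dom// ltW.
have Ki : ig (fun y => p (K t y)).
  apply: (ig_dom (mK t) _ (igZ (C0 * M) (ig_ew (@ltr01 R)))) => y.
  by apply: le_trans (pn _) (K_le _ (ltW t0) t1).
transitivity (chi 1 t * Int (F t)); last by rewrite (Int_deriv0 (dKp t) (cFy t) Fi Ki) mulr0.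
by rewrite -IntZ//; apply: Int_ext => y; rewrite mulrC.
Qed.

Let cdze_y t : cder (ze t).
Proof.
by apply: cderD; [apply: cderM; [exact: cder_cst|exact: cder_id]|exact: cder_cst].
Qed.

Let cdzd : cder zd.
Proof.
by apply: cderD; [apply: cderM; [exact: cder_cst|exact: cder_id]|exact: cder_cst].
Qed.

Let cdal : cder al.
Proof.
by apply: cderD; [exact: cder_cst|apply: cderM; [exact: cder_id|exact: cder_cst]].
Qed.

Let cdze_t y : cder (fun t => ze t y).
Proof.
apply: cderD; last by apply: cderM; [exact: cder_id|exact: cder_cst].
by apply: cderM; [exact: cdal|exact: cder_cst].
Qed.

Let cdFd_y t : cder (Fd t).
Proof.
apply: cderM; last by apply/cder_exp/cderN/cderM.
apply: cderD; first exact: cder_cst.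
apply: cderN; apply: cderM => //; apply: cderM; last exact: cder_cst.
by apply: cderM => //; exact: cder_cst.
Qed.

Let cdFd_t y : cder (fun t => Fd t y).
Proof.
apply: cderM; last by apply/cder_exp/cderN/cderM.
apply: cderD; first exact: cder_cst.
apply: cderN; apply: cderM; last exact: cder_cst.
by apply: cderM => //; apply: cderM => //; exact: cder_cst.
Qed.

Let cmK t : cmf (K t).
Proof.
apply: cmf2_cmf; apply: cmf2M; last exact: cmexp (cmze t).
apply: cmf2D; last exact: cmf2_cst.
by apply: cmf2M; [exact: cmf2_cst|exact: cmf2_real (@mf2_snd R)].
Qed.

Let iHor (p : C -> R) t : (cig (H t) -> ig (fun y => p (H t y))) ->
  ig (fun y => p (H t y)) \/ ~ (0 <= t <= 1).
Proof.
move=> cp; case: (pselect (0 <= t <= 1)) => [/andP[t0 t1]|]; [left|by right].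
by apply: cp; exact: cigH.
Qed.

Lemma gauss_cig : cig (fun y => a * cexp (- (a * y%:C + b) ^+ 2)).
Proof.
have := cigH ler01 (lexx 1); congr cig; apply/funext => y.
by rewrite /H /ze /al !rmorph1 !mul1r addrCA subrr addr0.
Qed.

Lemma gauss_cInt : cInt (fun y => a * cexp (- (a * y%:C + b) ^+ 2)) = sqp%:C.
Proof.
have -> : (fun y => a * cexp (- (a * y%:C + b) ^+ 2)) = H 1.
  apply/funext => y.
  by rewrite /H /ze /al !rmorph1 !mul1r addrCA subrr addr0.
have -> : cInt (H 1) = cInt (H 0).
  apply: complexP.
  - apply: (step (p := re) (F := fun t y => re (Fd t y))) => //.
    + exact: re_le.
    + by move=> t y; exact: (dH t y).1.
    + by move=> t y; exact: (dK t y).1.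
    + by move=> y; exact: (cder_cont (cdFd_t y)).1.
    + by move=> t; exact: (cder_cont (cdFd_y t)).1.
    + exact: cmFd2.1.
    + by move=> t; apply: iHor => -[].
    + by move=> t; exact: (cmK t).1.
  - apply: (step (p := im) (F := fun t y => im (Fd t y))) => //.
    + exact: im_le.
    + by move=> t y; exact: (dH t y).2.
    + by move=> t y; exact: (dK t y).2.
    + by move=> y; exact: (cder_cont (cdFd_t y)).2.
    + by move=> t; exact: (cder_cont (cdFd_y t)).2.
    + exact: cmFd2.2.
    + by move=> t; apply: iHor => -[].
    + by move=> t; exact: (cmK t).2.
have E y : H 0 y = (gauss_fun y)%:C.
  rewrite /H /ze /al !rmorph0 !mul0r !addr0 !mul1r /gauss_fun.
  have -> : - (y%:C) ^+ 2 = (- y ^+ 2)%:C by rewrite rmorphN rmorphXn.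
  by apply: complexP; rewrite /cexp /= ?cos0 ?sin0 ?mulr1 ?mulr0.
apply: complexP => /=.
- rewrite /sqp -[RHS]/(fine (Num.sqrt pi)%:E) -integralT_gauss.
  by congr fine; apply: eq_integral => y _; rewrite /= E.
- by rewrite -[RHS](Int0 R); apply: Int_ext => y; rewrite /= E.
Qed.

End Master.

(** Gaussian of mass 1, parametrised by the root [a] so that no branch has to be chosen before
    [ga]. *)
Definition gk (a : C) (r : R) : C := a * cexp (- (a * r%:C) ^+ 2) / sqp%:C.

Let nsq : sqp%:C != 0 :> C.
Proof. by rewrite fmorph_eq0 gt_eqF ?sqp_gt0. Qed.

Lemma gkE a r : gk a r = sqp^-1%:C * (a * cexp (- (a * r%:C + 0) ^+ 2)).
Proof. by rewrite /gk addr0 mulrC fmorphV. Qed.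

Lemma gk_even a r : gk a (- r) = gk a r.
Proof. by rewrite /gk rmorphN mulrN sqrrN. Qed.

Lemma cexp_bound al be l : cone al -> exists2 M, 0 <= M & forall y,
  (1 + `|y|) ^+ 2 * normc (cexp (- (al * y%:C + be) ^+ 2)) <= M * ew l y.
Proof.
move=> ca; have m0 : 0 < re al - `|im al| by rewrite subr_gt0.
exists (expR (normc be ^+ 2 + (2 * normc al * normc be + 2 + l) ^+ 2 /
  (4 * (re al - `|im al|) ^+ 2))); first exact: expR_ge0.
by move=> y; exact: gexp_bound.
Qed.

Lemma gk_bound a l : cone a -> exists2 M, 0 <= M & forall r, normc (gk a r) <= M * ew l r.
Proof.
move=> ca; have [M M0 H] := cexp_bound 0 l ca.
have s0 : 0 <= sqp^-1 by rewrite invr_ge0 ltW// sqp_gt0.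
exists (sqp^-1 * (normc a * M)); first by rewrite !mulr_ge0// normc_ge0.
move=> r; rewrite gkE !normcM normcR (ger0_norm s0) -!mulrA ler_wpM2l//.
rewrite ler_wpM2l ?normc_ge0//; apply: le_trans (H r).
rewrite ler_peMl ?normc_ge0//.
by rewrite exprn_ege1// lerDl.
Qed.

Lemma gk_cmf a : cmf (gk a).
Proof.
have [d1 d2] : continuous (re \o gk a) /\ continuous (im \o gk a).
  apply: cder_cont; rewrite /gk; apply: cderM; last exact: cder_cst.
  apply: cderM; first exact: cder_cst.
  by apply/cder_exp/cderN/cderM; apply: cderM; (exact: cder_cst || exact: cder_id).
by split; exact: mf_cont.
Qed.

Lemma gk_kern_re a l : cone a -> kern l (re \o gk a).
Proof.
move=> ca; have [M M0 H] := gk_bound l ca; split; first exact: (gk_cmf a).1.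
by exists M => r; apply: le_trans (H r); exact: re_le.
Qed.

Lemma gk_kern_im a l : cone a -> kern l (im \o gk a).
Proof.
move=> ca; have [M M0 H] := gk_bound l ca; split; first exact: (gk_cmf a).2.
by exists M => r; apply: le_trans (H r); exact: im_le.
Qed.

Lemma gk_mass a : cone a -> cInt (gk a) = 1.
Proof.
move=> ca; have := cIntZ sqp^-1%:C (gauss_cig 0 ca).
rewrite (gauss_cInt 0 ca) -rmorphM mulVf ?gt_eqF ?sqp_gt0// rmorph1 => <-.
by congr cInt; apply/funext => r; rewrite gkE.
Qed.

(** Completing the square in [r]: what depends on [r] is a Gaussian with complex centre, whose
    integral is given by [gauss_cInt]. This is why that integral allows a complex shift. *)
Lemma gk_conv_point a b al x r : cone al -> al ^+ 2 = a ^+ 2 + b ^+ 2 ->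
  gk a r * gk b (x - r) =
  (sqp^-1%:C * gk (a * b / al) x) * (al * cexp (- (al * r%:C + - (b ^+ 2 * x%:C / al)) ^+ 2)).
Proof.
move=> ca E; have al0 : al != 0.
  apply/eqP => al0; move: ca; rewrite al0 /cone /= normr0 ltxx//.
rewrite /gk fmorphV; set S := sqp%:C^-1.
have X : - (a * r%:C) ^+ 2 + - (b * (x - r)%:C) ^+ 2 =
    - (a * b / al * x%:C) ^+ 2 + - (al * r%:C + - (b ^+ 2 * x%:C / al)) ^+ 2.
  rewrite rmorphB.
  have -> : - (a * b / al * x%:C) ^+ 2 + - (al * r%:C + - (b ^+ 2 * x%:C / al)) ^+ 2 =
    - ((a ^+ 2 + b ^+ 2) / al ^+ 2 * b ^+ 2 * x%:C ^+ 2) - al ^+ 2 * r%:C ^+ 2 +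
    2 * b ^+ 2 * x%:C * r%:C by field.
  rewrite -E divff ?expf_neq0// E; ring.
have := congr1 (@cexp R) X; rewrite !cexpD => X'.
transitivity (a * b * S * S * (cexp (- (a * r%:C) ^+ 2) * cexp (- (b * (x - r)%:C) ^+ 2))).
  ring.
rewrite X'; field; exact: al0.
Qed.

Lemma gk_conv a b al x : cone a -> cone b -> cone al -> al ^+ 2 = a ^+ 2 + b ^+ 2 ->
  conv (re \o gk a) (re \o gk b) x - conv (im \o gk a) (im \o gk b) x = re (gk (a * b / al) x) /\
  conv (re \o gk a) (im \o gk b) x + conv (im \o gk a) (re \o gk b) x = im (gk (a * b / al) x).
Proof.
move=> ca cb cal E.
set be := - (b ^+ 2 * x%:C / al).
have G := cIntZ (sqp^-1%:C * gk (a * b / al) x) (gauss_cig be cal).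
rewrite (gauss_cInt be cal) in G.
have G2 : sqp^-1%:C * gk (a * b / al) x * sqp%:C = gk (a * b / al) x.
  by rewrite fmorphV; field.
rewrite G2 in G.
have kw (g : R -> R) : kern 2 g -> wi 1 g.
  move=> kg; have := kern_wi (ltr_nat _ 0 2) kg.
  move=> /(wi_le _); apply. by rewrite oppr0 ler01.
have two : (1 : R) <= 2 by rewrite ler1n.
have ii (g h : R -> R) : kern 2 g -> kern 2 h -> ig (fun r => g r * h (x - r)).
  by move=> kg kh; exact: (conv_ig x ler01 two kg (kw _ kh)).
have ra := gk_kern_re 2 ca; have ia := gk_kern_im 2 ca.
have rb := gk_kern_re 2 cb; have ib := gk_kern_im 2 cb.
have H r : gk a r * gk b (x - r) = _ := gk_conv_point x r cal E.
split.
- rewrite -G /conv -IntB; [|exact: ii|exact: ii].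
  by apply: Int_ext => r; rewrite /= -H reM.
- rewrite -G /conv -IntD; [|exact: ii|exact: ii].
  by apply: Int_ext => r; rewrite /= -H imM.
Qed.

(* The parameter a with a^2 = 1/(4z), so that gk (ga z) is the heat kernel at time z. *)
Definition ga (z : C) : C := sqrtc (4 * z)^-1.

Lemma cone_gt0 z : cone z -> 0 < re z.
Proof. by apply: le_lt_trans. Qed.

Lemma cone_neq0 z : cone z -> z != 0.
Proof.
by move=> /cone_gt0 zg; apply/eqP => z0; move: zg; rewrite z0 ltxx.
Qed.

Lemma coneD z w : cone z -> cone w -> cone (z + w).
Proof.
rewrite /cone reD imD => cz cw; apply: le_lt_trans (ler_normD _ _) _; exact: ltrD.
Qed.

Lemma coneV z : cone z -> cone z^-1.
Proof.
move=> cz; have z0 := cone_neq0 cz; have r0 := cone_gt0 cz.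
move: cz r0 z0; case: z => p q; rewrite /cone /= => qp p0 z0.
have d0 : 0 < p ^+ 2 + q ^+ 2 by rewrite ltr_pwDl ?sqr_ge0// exprn_gt0.
by rewrite normrN normrM [`|_^-1|]gtr0_norm ?invr_gt0// ltr_pM2r ?invr_gt0.
Qed.

Lemma coneZ (x : R) z : 0 < x -> cone z -> cone (x%:C * z).
Proof.
move=> x0; case: z => p q; rewrite /cone /= !mul0r subr0 addr0 => h.
by rewrite normrM gtr0_norm// ltr_pM2l.
Qed.

Lemma cone4 z : cone z -> cone (4 * z)^-1.
Proof.
move=> cz; apply: coneV; have -> : (4 : C) = (4 : R)%:C by apply: complexP => /=; ring.
exact: coneZ.
Qed.

(** Square roots of elements of [cone] with nonnegative real part have argument below pi/8 in
    modulus, and the tangent of pi/8 is less than 1/2. With this bound three arguments still add up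
    to less than pi/2, as used in [re_cone2_prod3]. *)
Definition cone2 z := 0 < re z /\ 2 * `|im z| <= re z.

Lemma cone2_sqr s : 0 <= re s -> cone (s ^+ 2) -> cone2 s.
Proof.
case: s => p q; rewrite /cone2 /cone /= => p0.
have -> : p * q + q * p = 2 * (p * q) by ring.
rewrite normrM (ger0_norm (ler0n _ 2)) normrM (ger0_norm p0) => h.
have qq := real_normK (num_real q); have q0 := normr_ge0 q.
have p1 : 0 < p.
  rewrite lt_neqAle p0 andbT eq_sym; apply/eqP => p00.
  by move: h; rewrite p00; have := sqr_ge0 q; nra.
split => //; nra.
Qed.

Lemma ga2 z : (ga z) ^+ 2 = (4 * z)^-1.
Proof. exact: sqr_sqrtc. Qed.

Lemma ga_cone2 z : cone z -> cone2 (ga z).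
Proof.
move=> cz; apply: cone2_sqr; last by rewrite ga2; exact: cone4.
by rewrite /ga /sqrtc; case: ((4 * z)^-1) => p q; rewrite sqrtr_ge0.
Qed.

Lemma cone2_cone z : cone2 z -> cone z.
Proof. by rewrite /cone => -[z0 zz]; have := normr_ge0 (im z); lra. Qed.

Lemma ga_cone z : cone z -> cone (ga z).
Proof. by move=> /ga_cone2/cone2_cone. Qed.

Lemma cone2V z : cone2 z -> cone2 z^-1.
Proof.
case: z => p q [/= p0 pq]; rewrite /cone2 /=.
have d0 : 0 < p ^+ 2 + q ^+ 2 by rewrite ltr_pwDl ?sqr_ge0// exprn_gt0.
rewrite normrN normrM [`|_^-1|]gtr0_norm ?invr_gt0// divr_gt0//; split => //.
by rewrite mulrA ler_pM2r ?invr_gt0.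
Qed.

Lemma re_cone2_prod3 z1 z2 z3 : cone2 z1 -> cone2 z2 -> cone2 z3 -> 0 < re (z1 * z2 * z3).
Proof.
case: z1 z2 z3 => [p1 q1] [p2 q2] [p3 q3] [/= a1 b1] [/= a2 b2] [/= a3 b3].
have q12 : 4 * `|q1 * q2| <= p1 * p2.
  rewrite normrM (_ : 4 * (`|q1| * `|q2|) = (2 * `|q1|) * (2 * `|q2|)); last by ring.
  by apply: ler_pM; rewrite ?mulr_ge0.
have q13 : 4 * `|q1 * q3| <= p1 * p3.
  rewrite normrM (_ : 4 * (`|q1| * `|q3|) = (2 * `|q1|) * (2 * `|q3|)); last by ring.
  by apply: ler_pM; rewrite ?mulr_ge0.
have q23 : 4 * `|q2 * q3| <= p2 * p3.
  rewrite normrM (_ : 4 * (`|q2| * `|q3|) = (2 * `|q2|) * (2 * `|q3|)); last by ring.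
  by apply: ler_pM; rewrite ?mulr_ge0.
have h1 : q1 * q2 * p3 <= p1 * p2 * p3 / 4.
  rewrite [leRHS]mulrAC ler_pM2r// ler_pdivlMr//; have := ler_norm (q1 * q2); lra.
have h2 : q1 * q3 * p2 <= p1 * p3 * p2 / 4.
  rewrite [leRHS]mulrAC ler_pM2r// ler_pdivlMr//; have := ler_norm (q1 * q3); lra.
have h3 : q2 * q3 * p1 <= p2 * p3 * p1 / 4.
  rewrite [leRHS]mulrAC ler_pM2r// ler_pdivlMr//; have := ler_norm (q2 * q3); lra.
have ppp : 0 < p1 * p2 * p3 by rewrite !mulr_gt0.
lra.
Qed.

(** Choosing the root as [ga z * ga w / ga (z + w)] makes the second identity immediate; that it is
    the root in the right half plane is [re_cone2_prod3]. *)
Lemma ga_sum z w : cone z -> cone w -> exists2 al, cone al &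
  al ^+ 2 = ga z ^+ 2 + ga w ^+ 2 /\ ga z * ga w / al = ga (z + w).
Proof.
move=> cz cw; have czw := coneD cz cw.
have n0 (u : C) : cone u -> ga u != 0 by move=> /ga_cone/cone_neq0.
have E : (ga z * ga w / ga (z + w)) ^+ 2 = ga z ^+ 2 + ga w ^+ 2.
  rewrite expr_div_n exprMn !ga2; field.
  by rewrite cone_neq0// cone_neq0// cone_neq0.
exists (ga z * ga w / ga (z + w)).
  have r2 : cone ((ga z * ga w / ga (z + w)) ^+ 2).
    by rewrite E !ga2; apply: coneD; exact: cone4.
  apply: cone2_cone; apply: cone2_sqr => //; apply/ltW.
  by apply: re_cone2_prod3; [exact: ga_cone2|exact: ga_cone2|exact/cone2V/ga_cone2].
split => //; field; by rewrite !n0.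
Qed.

Lemma normc_cone z : cone z -> normc z <= 2 * re z.
Proof.
rewrite /cone => cz; apply: le_trans (normc_le z) _.
have := cone_gt0 cz => r0; rewrite (gtr0_norm r0); lra.
Qed.

(* The heat kernel at complex time z lives at scale sqrt |z|. *)
Lemma heat_bound z r : cone z ->
  normc (gk (ga z) r) <= expR 2 / Num.sqrt (normc z) * ew 1 (r / Num.sqrt (normc z)).
Proof.
move=> cz; have z0 : 0 < normc z.
  by apply: lt_le_trans (re_le_normc z); exact: cone_gt0.
set eps := Num.sqrt (normc z); have e0 : 0 < eps by rewrite sqrtr_gt0.
have e2 : eps ^+ 2 = normc z by rewrite sqr_sqrtr// ltW.
have na : normc (ga z) <= eps^-1.
  rewrite -(@ler_pXn2r _ 2)// ?nnegrE ?normc_ge0 ?invr_ge0 ?(ltW e0)//.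
  rewrite -normcX2 ga2 normcV normcM exprVn e2.
  have -> : (4 : C) = 2 * 2 by ring.
  rewrite !normcM normc2 lef_pV2 ?posrE ?mulr_gt0//; lra.
have s1 : sqp^-1 <= 1.
  rewrite invf_le1 ?sqp_gt0// -sqrtr1 ler_wsqrtr//.
  by apply: le_trans (pi_ge2 R); rewrite ler1n.
have s0 : 0 <= sqp^-1 by rewrite invr_ge0 ltW// sqp_gt0.
rewrite gkE !normcM normcR (ger0_norm s0).
apply: (@le_trans _ _ (1 * (eps^-1 * normc (cexp (- (ga z * r%:C + 0) ^+ 2))))).
  apply: ler_pM => //; first by rewrite mulr_ge0 ?normc_ge0.
  by rewrite ler_wpM2r ?normc_ge0.
rewrite mul1r mulrAC [leRHS]mulrC ler_wpM2l ?invr_ge0 ?(ltW e0)//.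
rewrite normc_cexp /ew -expRD ler_expR addr0 exprMn ga2.
have cz4 := cone4 cz.
have -> : re (- ((4 * z)^-1 * r%:C ^+ 2)) = - (re (4 * z)^-1 * r ^+ 2).
  by case: ((4 * z)^-1) => p q /=; ring.
have h : (8 * eps ^+ 2)^-1 <= re (4 * z)^-1.
  have h1 := normc_cone cz4.
  have h2 : normc (4 * z)^-1 = (4 * eps ^+ 2)^-1.
    rewrite normcV normcM e2; have -> : (4 : C) = 2 * 2 by ring.
    by rewrite normcM normc2; congr (_ * _)^-1; ring.
  rewrite h2 in h1.
  have -> : (8 * eps ^+ 2)^-1 = (4 * eps ^+ 2)^-1 / 2 by field; rewrite gt_eqF.
  lra.
have h3 := ler_wpM2r (sqr_ge0 r) h.
set u := r / eps.
have ru : (8 * eps ^+ 2)^-1 * r ^+ 2 = u ^+ 2 / 8.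
  by rewrite /u; field; rewrite gt_eqF.
rewrite ru in h3.
(* Completing the square gives [u ^+ 2 / 8 >= |u| - 2], the origin of the constant [expR 2]. *)
have := sqr_ge0 (`|u| - 4); rewrite -(real_normK (num_real u)) in h3 *; lra.
Qed.

Lemma ga_real t : 0 < t -> ga t%:C = (2 * Num.sqrt t)^-1%:C.
Proof.
move=> t0; have st : 0 < Num.sqrt t by rewrite sqrtr_gt0.
have -> : ga t%:C = sqrtc ((4 * t)^-1)%:C.
  rewrite /ga fmorphV rmorphM; congr (sqrtc (_ * _)^-1).
  by apply: complexP => /=; ring.
rewrite sqrtc_sqrtr; last by rewrite lecR invr_ge0 mulr_ge0// ltW.
congr (_%:C) => /=; rewrite sqrtrV ?mulr_ge0 ?(ltW t0)//; congr (_^-1).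
rewrite sqrtrM//; congr (_ * _).
have -> : (4 : R) = 2 ^+ 2 by ring.
by rewrite sqrtr_sqr ger0_norm.
Qed.

Lemma gk_real (p r : R) : gk p%:C r = (p * expR (- (p * r) ^+ 2) / sqp)%:C.
Proof.
rewrite /gk; have -> : - (p%:C * r%:C) ^+ 2 = (- (p * r) ^+ 2)%:C.
  by rewrite rmorphN rmorphXn rmorphM.
have -> : cexp (- (p * r) ^+ 2)%:C = (expR (- (p * r) ^+ 2))%:C.
  by apply: complexP; rewrite /cexp /= ?cos0 ?sin0 ?mulr1 ?mulr0.
by rewrite !rmorphM fmorphV.
Qed.

Lemma cone_real t : 0 < t -> cone t%:C.
Proof. by move=> t0; rewrite /cone /= normr0. Qed.

Lemma heat_real_im t r : 0 < t -> im (gk (ga t%:C) r) = 0.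
Proof. by move=> t0; rewrite ga_real// gk_real. Qed.

(** Since [g' = - 2 p^2 r g], the derivative of [r g] is [g - 2 p^2 r^2 g]. Its integral is 0, so
    the second moment is [1 / (2 p^2) = 2 t]. *)
Lemma heat_second_moment t : 0 < t -> Int (fun r => r ^+ 2 * re (gk (ga t%:C) r)) = 2 * t.
Proof.
move=> t0; have ct := ga_cone (cone_real t0).
set g := fun r => re (gk (ga t%:C) r).
have m1 := gk_mass ct; move: m1 => /(congr1 re) /= m1.
pose p := (2 * Num.sqrt t)^-1.
have st : 0 < Num.sqrt t by rewrite sqrtr_gt0.
have p0 : 0 < p by rewrite invr_gt0 mulr_gt0.
have pt : p ^+ 2 = (4 * t)^-1.
  rewrite /p exprVn exprMn sqr_sqrtr ?(ltW t0)//; congr (_ * _)^-1; ring.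
have gE r : g r = p * expR (- (p * r) ^+ 2) / sqp by rewrite /g ga_real// gk_real.
have dg r : dv g r (- (2 * p ^+ 2 * r) * g r).
  have d1 : dv (fun r => p * r) r p.
    by apply: dv_eq (dvM (dv_cst p r) (dv_id r)) _; ring.
  have d2 := dvM (dvM (dv_cst p r) (dv_exp (dvN (dvM d1 d1)))) (dv_cst sqp^-1 r).
  have -> : g = fun r => p * expR (- (p * r * (p * r))) * sqp^-1.
    by apply/funext => x; rewrite gE expr2.
  apply: dv_eq d2 _; ring.
pose k r := r * g r; pose f r := g r - 2 * p ^+ 2 * (r ^+ 2 * g r).
have dk r : dv k r (f r).
  by apply: dv_eq (dvM (dv_id r) (dg r)) _; rewrite /f; ring.
have kg : kern 3 g := gk_kern_re 3 ct.
have [M M0 gM] := kernP kg.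
have gm := kern_mf kg.
have ab r : `|r| <= expR `|r|.
  by have := expR_ge1Dx `|r|; lra.
have ik : ig k.
  apply: (ig_dom _ _ (igZ M (ig_ew (@ltr01 R)))); first by apply: mfM => //; exact: mf_id.
  move=> r; rewrite normrM; apply: (@le_trans _ _ (expR `|r| * (M * ew 3 r))).
    by apply: ler_pM.
  rewrite mulrCA ler_wpM2l// /ew -expRD ler_expR; have := normr_ge0 r; lra.
have i2 : ig (fun r => r ^+ 2 * g r).
  apply: (ig_dom _ _ (igZ M (ig_ew (@ltr01 R)))).
    by apply: mfM => //; apply: (mfM (f := fun r => r) (g := fun r => r)); exact: mf_id.
  move=> r; rewrite normrM normrX; apply: (@le_trans _ _ (expR `|r| ^+ 2 * (M * ew 3 r))).
    by apply: ler_pM => //; rewrite lerXn2r// nnegrE expR_ge0.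
  rewrite mulrCA ler_wpM2l// /ew expr2 -!expRD ler_expR; have := normr_ge0 r; lra.
have ig' : ig g := kern_ig (ltr0n _ 3) kg.
have fi : ig f by apply: igB => //; exact: igZ.
have cg : continuous g := dv_cont dg.
have cf : continuous f.
  move=> r; apply: cvgB; first exact: cg.
  apply: cvgM; first exact: cvg_cst.
  by apply: cvgM; [apply: cvgM; exact: cvg_id|exact: cg].
have := Int_deriv0 dk cf fi ik.
rewrite IntB//; last exact: igZ.
rewrite IntZ// -/g.
have -> : Int g = 1 by [].
rewrite pt; set X := Int _ => /eqP; rewrite subr_eq0 => /eqP h.
have := congr1 (fun u => 2 * t * u) h; rewrite mulr1 => ->.
by field; rewrite gt_eqF.
Qed.

End ComplexGaussian.

(** * Complex differentiability of the heat kernel in time *)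

Section HeatKernelDerivative.
#[local] Hint Extern 0 (is_true (0 <= normc _)) => (exact: normc_ge0) : core.
Variable R : realType.
Local Notation C := R[i].
Local Notation re := (@complex.Re R).
Local Notation im := (@complex.Im R).
Local Notation sqp := (Num.sqrt pi : R).
Implicit Types (a c h k z : C) (r l : R).

(** The derivative of [gk a r] with respect to [a]. *)
Definition gk' (a : C) (r : R) : C :=
  (1 - 2 * a ^+ 2 * r%:C ^+ 2) * cexp (- (a * r%:C) ^+ 2) / sqp%:C.

Let nsq : sqp%:C != 0 :> C.
Proof. by rewrite fmorph_eq0 gt_eqF ?sqp_gt0. Qed.

Lemma gk'_even a r : gk' a (- r) = gk' a r.
Proof. by rewrite /gk' rmorphN mulrN !sqrrN. Qed.

Lemma gk'_cmf a : cmf (gk' a).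
Proof.
have [d1 d2] : continuous (re \o gk' a) /\ continuous (im \o gk' a).
  apply: cder_cont; rewrite /gk'; apply: cderM; last exact: cder_cst.
  apply: cderM.
    apply: cderD; first exact: cder_cst.
    apply/cderN/cderM; first exact: cder_cst.
    by apply: cderM; exact: cder_id.
  by apply/cder_exp/cderN/cderM; apply: cderM; (exact: cder_cst || exact: cder_id).
by split; exact: mf_cont.
Qed.

Lemma normcRM (x : R) z : 0 <= x -> normc (x%:C * z) = x * normc z.
Proof. by move=> x0; rewrite normcM normcR ger0_norm. Qed.

Lemma normc_cexp_gauss a r : normc (cexp (- (a * r%:C) ^+ 2)) = expR (- (re (a ^+ 2) * r ^+ 2)).
Proof.
rewrite normc_cexp exprMn; congr expR.
by case: (a ^+ 2) => p q /=; ring.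
Qed.

Lemma normc_r2 r : normc (r%:C ^+ 2) = r ^+ 2.
Proof. by rewrite normcX2 normcR real_normK// num_real. Qed.

Lemma poly_gauss (A l r : R) : 0 < A ->
  expR (4 * `|r|) * expR (- (A / 2 * r ^+ 2)) <= expR ((4 + l) ^+ 2 / (2 * A)) * ew l r.
Proof.
move=> A0; rewrite /ew -!expRD ler_expR.
have A2 : 0 < A / 2 by rewrite divr_gt0.
have := @quad_exp R (Num.sqrt (A / 2)) (4 + l) r.
rewrite sqrtr_gt0 => /(_ A2); rewrite sqr_sqrtr ?(ltW A2)//.
have -> : 4 * (A / 2) = 2 * A by field.
lra.
Qed.

Lemma r2_exp r : r ^+ 2 <= expR (4 * `|r|).
Proof.
rewrite -(real_normK (num_real r)).
have h : `|r| <= expR `|r| by have := expR_ge1Dx `|r|; lra.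
apply: (@le_trans _ _ (expR `|r| ^+ 2)); first by rewrite lerXn2r// nnegrE expR_ge0.
by rewrite expr2 -expRD ler_expR; have := normr_ge0 r; lra.
Qed.

Lemma r4_exp r : r ^+ 2 * r ^+ 2 <= expR (4 * `|r|).
Proof.
rewrite -(real_normK (num_real r)).
have h : `|r| <= expR `|r| by have := expR_ge1Dx `|r|; lra.
have h2 : `|r| ^+ 2 <= expR `|r| ^+ 2 by rewrite lerXn2r// nnegrE expR_ge0.
apply: (@le_trans _ _ (expR `|r| ^+ 2 * expR `|r| ^+ 2)).
  by apply: ler_pM => //; exact: exprn_ge0.
by rewrite expr2 -!expRD ler_expR; have := normr_ge0 r; lra.
Qed.

(** Perturbing [a] multiplies the Gaussian by [cexp eps] with [eps] quadratic in [r]. For small [k]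
    this costs at most half of the Gaussian decay; the other half absorbs the powers up to [r^4] in
    the remainder and leaves [ew l r]. *)
Lemma gk_taylor a l : cone a -> 0 < re (a ^+ 2) -> exists2 M, 0 <= M &
  exists2 k0, 0 < k0 & forall k r, normc k <= k0 ->
    normc (gk (a + k) r - gk a r - k * gk' a r) <= M * normc k ^+ 2 * ew l r.
Proof.
move=> ca; set A := re (a ^+ 2) => A0.
have na : 0 < normc a by apply: lt_le_trans (re_le_normc a); exact: cone_gt0.
set n := normc a in na *.
set X := expR ((4 + l) ^+ 2 / (2 * A)).
have X0 : 0 <= X by exact: expR_ge0.
exists (sqp^-1 * (72 * n ^+ 3 + 4 * n) * X).
  by rewrite !mulr_ge0 ?addr_ge0 ?mulr_ge0 ?invr_ge0 ?exprn_ge0 ?(ltW na)// ltW// sqp_gt0.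
(* The first bound gives [|a + k| <= 2 n], the second [3 n |k| <= A / 2] and hence
   [|eps| <= A / 2 * r ^+ 2]. *)
exists (Num.min n (A / (6 * n))); first by rewrite lt_min na divr_gt0// mulr_gt0.
move=> k r; rewrite le_min => /andP[kn kA].
have n3 : 0 < 6 * n by rewrite mulr_gt0.
rewrite ler_pdivlMr// in kA.
have k0 := normc_ge0 k.
set eps := - (k * (2 * a + k)) * r%:C ^+ 2.
have E1 : cexp (- ((a + k) * r%:C) ^+ 2) = cexp (- (a * r%:C) ^+ 2) * cexp eps.
  by rewrite -cexpD; congr cexp; rewrite /eps; ring.
have E : gk (a + k) r - gk a r - k * gk' a r =
   sqp^-1%:C * cexp (- (a * r%:C) ^+ 2) *
   ((a + k) * (cexp eps - 1 - eps) - k ^+ 2 * (2 * a + (a + k)) * r%:C ^+ 2).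
  rewrite /gk /gk' E1 fmorphV /eps; field; exact: nsq.
have nak : normc (a + k) <= 2 * n by apply: le_trans (le_normcD _ _) _; rewrite -/n; lra.
have n2ak : normc (2 * a + k) <= 3 * n.
  by apply: le_trans (le_normcD _ _) _; rewrite normcM normc2 -/n; lra.
have r20 := sqr_ge0 r.
have neps : normc eps <= normc k * (3 * n) * r ^+ 2.
  rewrite /eps normcM normcN normcM normc_r2 ler_wpM2r// ler_wpM2l//.
have nepsA : normc eps <= A / 2 * r ^+ 2.
  apply: le_trans neps _; rewrite ler_wpM2r//; lra.
have T := cexp_taylor eps.
have e1 : normc ((a + k) * (cexp eps - 1 - eps)) <=
    72 * n ^+ 3 * normc k ^+ 2 * (expR (4 * `|r|) * expR (A / 2 * r ^+ 2)).
  rewrite normcM.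
  have T2 : 4 * normc eps ^+ 2 * expR (normc eps) <=
     4 * (normc k * (3 * n) * r ^+ 2) ^+ 2 * expR (A / 2 * r ^+ 2).
    apply: ler_pM; rewrite ?expR_ge0 ?ler_expR//.
      by rewrite mulr_ge0// sqr_ge0.
    by rewrite ler_wpM2l// lerXn2r// nnegrE (le_trans (normc_ge0 eps)).
  apply: (@le_trans _ _ ((2 * n) * (4 * (normc k * (3 * n) * r ^+ 2) ^+ 2 * expR (A / 2 * r ^+ 2)))).
    by apply: ler_pM; rewrite ?normc_ge0//; apply: le_trans T T2.
  have -> : 2 * n * (4 * (normc k * (3 * n) * r ^+ 2) ^+ 2 * expR (A / 2 * r ^+ 2)) =
    72 * n ^+ 3 * normc k ^+ 2 * ((r ^+ 2 * r ^+ 2) * expR (A / 2 * r ^+ 2)) by ring.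
  rewrite ler_wpM2l ?mulr_ge0 ?exprn_ge0 ?(ltW na)//.
  by rewrite ler_wpM2r ?expR_ge0// r4_exp.
have e2 : normc (k ^+ 2 * (2 * a + (a + k)) * r%:C ^+ 2) <=
    4 * n * normc k ^+ 2 * (expR (4 * `|r|) * expR (A / 2 * r ^+ 2)).
  rewrite normcM normc_r2 normcM normcX2.
  have h1 : normc (2 * a + (a + k)) <= 4 * n.
    by apply: le_trans (le_normcD _ _) _; rewrite normcM normc2 -/n; lra.
  have h2 : r ^+ 2 <= expR (4 * `|r|) * expR (A / 2 * r ^+ 2).
    rewrite -[leLHS]mulr1; apply: ler_pM => //; first exact: r2_exp.
    by rewrite -expR0 ler_expR mulr_ge0// divr_ge0// ltW.
  apply: ler_pM => //; first by rewrite mulr_ge0 ?exprn_ge0 ?normc_ge0.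
  by rewrite mulrC ler_wpM2r ?exprn_ge0.
have e3 := le_normcD ((a + k) * (cexp eps - 1 - eps)) (- (k ^+ 2 * (2 * a + (a + k)) * r%:C ^+ 2)).
rewrite normcN in e3.
have s0 : 0 <= sqp^-1 by rewrite invr_ge0 ltW// sqp_gt0.
rewrite E normcM normcRM// normc_cexp_gauss -/A.
have P := poly_gauss l r A0; rewrite -/X in P.
set Y := expR (4 * `|r|) in e1 e2 P *.
have Z : expR (- (A * r ^+ 2)) * expR (A / 2 * r ^+ 2) = expR (- (A / 2 * r ^+ 2)).
  by rewrite -expRD; congr expR; field.
have e4 : normc ((a + k) * (cexp eps - 1 - eps) - k ^+ 2 * (2 * a + (a + k)) * r%:C ^+ 2) <=
   (72 * n ^+ 3 + 4 * n) * normc k ^+ 2 * (Y * expR (A / 2 * r ^+ 2)).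
  apply: le_trans e3 _; lra.
apply: (@le_trans _ _ (sqp^-1 * expR (- (A * r ^+ 2)) *
   ((72 * n ^+ 3 + 4 * n) * normc k ^+ 2 * (Y * expR (A / 2 * r ^+ 2))))).
  by rewrite ler_wpM2l// mulr_ge0// expR_ge0.
have -> : sqp^-1 * expR (- (A * r ^+ 2)) *
   ((72 * n ^+ 3 + 4 * n) * normc k ^+ 2 * (Y * expR (A / 2 * r ^+ 2))) =
  sqp^-1 * (72 * n ^+ 3 + 4 * n) * normc k ^+ 2 * (Y * (expR (- (A * r ^+ 2)) * expR (A / 2 * r ^+ 2))).
  by ring.
rewrite Z; have -> : sqp^-1 * (72 * n ^+ 3 + 4 * n) * X * normc k ^+ 2 * ew l r =
  sqp^-1 * (72 * n ^+ 3 + 4 * n) * normc k ^+ 2 * (X * ew l r) by ring.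
rewrite ler_wpM2l// !mulr_ge0 ?exprn_ge0// addr_ge0// ?mulr_ge0 ?exprn_ge0 ?(ltW na)//.
Qed.

Lemma gk'_bound a l : cone a -> 0 < re (a ^+ 2) -> exists2 M, 0 <= M &
  forall r, normc (gk' a r) <= M * ew l r.
Proof.
move=> ca; set A := re (a ^+ 2) => A0.
set X := expR ((4 + l) ^+ 2 / (2 * A)).
have X0 : 0 <= X by exact: expR_ge0.
have s0 : 0 <= sqp^-1 by rewrite invr_ge0 ltW// sqp_gt0.
set n := normc a; have n0 : 0 <= n by exact: normc_ge0.
exists ((1 + 2 * n ^+ 2) * X * sqp^-1).
  by rewrite !mulr_ge0// addr_ge0// mulr_ge0// exprn_ge0.
move=> r; rewrite /gk' !normcM normcV normcR ger0_norm ?sqrtr_ge0//.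
have r20 := sqr_ge0 r.
have e1 : normc (1 - 2 * a ^+ 2 * r%:C ^+ 2) <= (1 + 2 * n ^+ 2) * expR (4 * `|r|).
  apply: le_trans (le_normcD _ _) _; rewrite normcN normc1.
  rewrite (normcM (2 * a ^+ 2)) (normcM 2) normc2 normcX2 normc_r2 -/n.
  have h1 : 1 <= expR (4 * `|r|) by rewrite -expR0 ler_expR mulr_ge0.
  have h2 := r2_exp r; rewrite [leRHS]mulrDl mul1r lerD//.
  by rewrite ler_wpM2l// mulr_ge0// exprn_ge0.
have P := poly_gauss l r A0; rewrite -/X in P.
have e2 : normc (cexp (- (a * r%:C) ^+ 2)) <= expR (- (A / 2 * r ^+ 2)).
  rewrite normc_cexp_gauss -/A ler_expR; have := mulr_ge0 (ltW A0) r20; lra.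
have -> : (1 + 2 * n ^+ 2) * X / sqp * ew l r = (1 + 2 * n ^+ 2) * (X * ew l r) / sqp by ring.
rewrite ler_wpM2r//.
apply: (@le_trans _ _ ((1 + 2 * n ^+ 2) * expR (4 * `|r|) * expR (- (A / 2 * r ^+ 2)))).
  by apply: ler_pM; rewrite ?normc_ge0.
by rewrite -mulrA ler_wpM2l// addr_ge0// mulr_ge0// exprn_ge0.
Qed.

(** The equation [ga z ^+ 2 = (4 z)^-1] is differentiated implicitly: the difference of squares is
    divided by [c + a], of modulus at least [re a] because both roots lie in the right half plane.
    The derivative found is [- 2 ga^3]. *)
Lemma ga_taylor z : cone z -> exists2 M, 0 <= M & exists2 eta, 0 < eta &
  forall h, normc h < eta -> cone (z + h) /\
    normc (ga (z + h) - ga z) <= M * normc h /\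
    normc (ga (z + h) - ga z + 2 * ga z ^+ 3 * h) <= M * normc h ^+ 2.
Proof.
move=> cz; set a := ga z.
have z0 : 0 < normc z by apply: lt_le_trans (re_le_normc z); exact: cone_gt0.
have [ra ra2] := ga_cone2 cz; rewrite -/a in ra ra2.
have na : 0 < normc a by apply: lt_le_trans (re_le_normc a).
have d0 : 0 < re z - `|im z| by rewrite subr_gt0.
set n := normc a in na *.
set M1 := 8 * n ^+ 4 / re a; have M10 : 0 <= M1.
  by apply: divr_ge0; [apply: mulr_ge0 => //; exact/exprn_ge0/ltW | exact: ltW].
set M2 := (32 * n ^+ 6 + M1 ^+ 2) / (2 * n).
have M20 : 0 <= M2.
  apply: divr_ge0; last by rewrite mulr_ge0// ltW.
  by rewrite addr_ge0 ?sqr_ge0// mulr_ge0//; exact/exprn_ge0/ltW.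
exists (M1 + M2); first by rewrite addr_ge0.
(* The first bound keeps [z + h] away from 0, the second keeps it in the cone. *)
exists (Num.min (normc z / 2) ((re z - `|im z|) / 2)).
  by rewrite lt_min !divr_gt0.
move=> h; rewrite lt_min => /andP[h1 h2].
have nh := normc_ge0 h.
have czh : cone (z + h).
  rewrite /cone reD imD; have i1 := im_le h; have i2 := re_le h.
  have i3 := ler_normD (im z) (im h); have i4 : - `|re h| <= re h by rewrite lerNl -normrN ler_norm.
  lra.
split => //; set c := ga (z + h); set k := c - a.
have zn0 := cone_neq0 cz; have zhn0 := cone_neq0 czh.
have a2 : a ^+ 2 = (4 * z)^-1 := ga2 z.
have c2 : c ^+ 2 = (4 * (z + h))^-1 := ga2 (z + h).
have Eca : k * (c + a) = - 4 * h * a ^+ 2 * c ^+ 2.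
  have -> : k * (c + a) = c ^+ 2 - a ^+ 2 by rewrite /k; ring.
  rewrite a2 c2; field; by rewrite zn0 zhn0.
have [rc _] := ga_cone2 czh; rewrite -/c in rc.
have nca : re a <= normc (c + a).
  by apply: le_trans (re_le_normc _); rewrite reD lerDr ltW.
have normc4 : normc (4 : C) = 4.
  have -> : (4 : C) = 2 * 2 by ring.
  by rewrite normcM normc2; ring.
have nc2 : normc c ^+ 2 <= 2 * n ^+ 2.
  rewrite /n -!normcX2 a2 c2 !normcV !normcM normc4.
  have nz : normc z <= normc (z + h) + normc h.
    have -> : z = (z + h) + - h by ring.
    by apply: le_trans (le_normcD _ _) _; rewrite normcN (_ : z + h + - h + h = z + h)//; ring.
  have nzh : 0 < normc (z + h) by lra.
  have -> : 2 * (4 * normc z)^-1 = (2 * normc z)^-1.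
    by field; rewrite gt_eqF.
  rewrite lef_pV2 ?posrE ?mulr_gt0//; lra.
have nk : normc k <= M1 * normc h.
  have := congr1 (@normc R) Eca.
  rewrite (normcM k) (normcM _ (c ^+ 2)) (normcM _ (a ^+ 2)) (normcM _ h) normcN normc4 !normcX2 -/n => H.
  rewrite /M1 mulrAC ler_pdivlMr//.
  apply: (@le_trans _ _ (normc k * normc (c + a))).
    by rewrite ler_wpM2l ?normc_ge0.
  rewrite H.
  have -> : 8 * n ^+ 4 * normc h = 4 * normc h * n ^+ 2 * (2 * n ^+ 2) by ring.
  by rewrite ler_wpM2l// mulr_ge0 ?sqr_ge0// mulr_ge0.
split; first by apply: le_trans nk _; rewrite ler_wpM2r// lerDl.
have E2 : k + 2 * a ^+ 3 * h = (16 * h ^+ 2 * a ^+ 4 * c ^+ 2 - k ^+ 2) / (2 * a).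
  have an0 : a != 0 by apply/eqP => a00; move: ra; rewrite a00 ltxx.
  have E3 : k * (2 * a) = - 4 * h * a ^+ 2 * c ^+ 2 - k ^+ 2.
    by rewrite -Eca /k; ring.
  have c2E : a ^+ 2 = c ^+ 2 + 4 * h * a ^+ 2 * c ^+ 2.
    have H : c ^+ 2 - a ^+ 2 = - 4 * h * a ^+ 2 * c ^+ 2 by rewrite -Eca /k; ring.
    have -> : 4 * h * a ^+ 2 * c ^+ 2 = - (- 4 * h * a ^+ 2 * c ^+ 2) by ring.
    rewrite -H; ring.
  apply: (canRL (mulfK _)); first by rewrite mulf_neq0// pnatr_eq0.
  rewrite mulrDl E3.
  have -> : 2 * a ^+ 3 * h * (2 * a) = 4 * h * a ^+ 2 * (c ^+ 2 + 4 * h * a ^+ 2 * c ^+ 2).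
    by rewrite -c2E; ring.
  ring.
rewrite E2 normcM normcV (normcM 2 a) normc2 -/n [leRHS]mulrDl.
have i1 : normc (16 * h ^+ 2 * a ^+ 4 * c ^+ 2 - k ^+ 2) <= (32 * n ^+ 6 + M1 ^+ 2) * normc h ^+ 2.
  apply: le_trans (le_normcD _ _) _; rewrite normcN (normcX2 k) [leRHS]mulrDl lerD//.
    have -> : 16 * h ^+ 2 * a ^+ 4 * c ^+ 2 = 4 * 4 * h ^+ 2 * (a ^+ 2 * a ^+ 2) * c ^+ 2 by ring.
    rewrite (normcM _ (c ^+ 2)) (normcM _ (a ^+ 2 * _)) (normcM (a ^+ 2)) (normcM _ (h ^+ 2)).
    rewrite (normcM 4) normc4 !normcX2 -/n.
    have -> : 32 * n ^+ 6 * normc h ^+ 2 = 4 * 4 * normc h ^+ 2 * (n ^+ 2 * n ^+ 2) * (2 * n ^+ 2) by ring.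
    by rewrite ler_wpM2l// !mulr_ge0// ltW.
  by rewrite -exprMn lerXn2r// nnegrE ?(le_trans (normc_ge0 k) nk)// normc_ge0.
have i2 : 0 <= M1 * normc h ^+ 2 by rewrite mulr_ge0// exprn_ge0.
apply: (@le_trans _ _ (M2 * normc h ^+ 2)); last by lra.
by rewrite /M2 [leRHS]mulrAC; apply: ler_wpM2r i1; rewrite invr_ge0 mulr_ge0// ltW.
Qed.

Lemma heat_diff z l : cone z -> exists2 M, 0 <= M & exists2 eta, 0 < eta &
  forall h, normc h < eta -> cone (z + h) /\ forall r,
    normc (gk (ga (z + h)) r - gk (ga z) r - h * (- (2 * ga z ^+ 3) * gk' (ga z) r))
      <= M * normc h ^+ 2 * ew l r.
Proof.
move=> cz; have ca := ga_cone cz.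
have A0 : 0 < re (ga z ^+ 2) by rewrite ga2; exact/cone_gt0/cone4.
have [M1 M10 [k0 k00 H1]] := gk_taylor l ca A0.
have [M2 M20 H2] := gk'_bound l ca A0.
have [M3 M30 [eta eta0 H3]] := ga_taylor cz.
exists (M1 * M3 ^+ 2 + M3 * M2); first by rewrite addr_ge0 ?mulr_ge0 ?exprn_ge0.
exists (Num.min eta (k0 / (M3 + 1))); first by rewrite lt_min eta0 divr_gt0// ltr_wpDl.
move=> h; rewrite lt_min ltr_pdivlMr ?ltr_wpDl// => /andP[/H3 [czh [nk nk2]] hk].
split => // r; set k := ga (z + h) - ga z in nk nk2.
have nh := normc_ge0 h.
have kk0 : normc k <= k0 by lra.
have := H1 k r kk0; have -> : ga z + k = ga (z + h) by rewrite /k addrC subrK.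
move=> e1.
have -> : gk (ga (z + h)) r - gk (ga z) r - h * (- (2 * ga z ^+ 3) * gk' (ga z) r) =
  (gk (ga (z + h)) r - gk (ga z) r - k * gk' (ga z) r) +
  (k + 2 * ga z ^+ 3 * h) * gk' (ga z) r by ring.
apply: le_trans (le_normcD _ _) _; rewrite normcM.
have e2 : M1 * normc k ^+ 2 * ew l r <= M1 * (M3 * normc h) ^+ 2 * ew l r.
  by rewrite ler_wpM2r// ler_wpM2l// lerXn2r// nnegrE ?normc_ge0// mulr_ge0.
have e3 : normc (k + 2 * ga z ^+ 3 * h) * normc (gk' (ga z) r) <=
   (M3 * normc h ^+ 2) * (M2 * ew l r).
  by apply: ler_pM; rewrite ?normc_ge0.
rewrite exprMn in e2; lra.
Qed.

End HeatKernelDerivative.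

Local Opaque ext rop wt om Cop.

(** * The heat semigroup *)

Section KernelConvolution.
Variable R : realType.
Implicit Types (g h : R -> R) (l : R).

(** The common rate [l] passes to the convolution by the triangle inequality; the surplus rate 1 of
    [g] is spent on integrating over [r]. *)
Lemma kern_conv l g h : 0 <= l -> kern (l + 1) g -> kern l h -> kern l (conv g h).
Proof.
move=> l0 kg kh; have [C C0 gC] := kernP kg; have [D D0 hD] := kernP kh.
have l1 : 0 < l + 1 by exact: ltr_wpDl l0 ltr01.
have CD : 0 <= C * D by exact: mulr_ge0.
have dom s r : `|g r * h (s - r)| <= C * D * ew l s * ew 1 r.
  rewrite normrM; apply: le_trans (ler_pM (normr_ge0 _) (normr_ge0 _) (gC r) (hD (s - r))) _.
  have -> : C * ew (l + 1) r * (D * ew l (s - r)) = C * D * (ew l r * ew l (s - r)) * ew 1 r.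
    by rewrite ewDw; ring.
  apply: ler_wpM2r => //; apply: ler_wpM2l => //.
  have -> : ew l s = ew l (r + (s - r)) by congr (ew l _); ring.
  exact: ew_sub.
split.
  have hi : wi (l + 1) h.
    apply: (ig_dom _ _ (igZ D (ig_ew l1))); first exact: mfM (kern_mf kh) (mf_ew _).
    move=> x; rewrite normrM [`|ew _ _|]ger0_norm//.
    apply: ler_wpM2r => //; apply: le_trans (hD x) _; rewrite ler_piMr//; exact: ew_le1.
  have ll : l + 1 <= l + 1 by [].
  have H : ig2 (fun s r => g r * h (s - r) * ew 1 s).
    have i0 : ig (fun s : R => C * D * ew 1 s) by apply: igZ; exact: ig_ew.
    apply: (ig2_dom _ _ (ig2_tensor i0 (ig_ew (@ltr01 R)))).
      apply: mf2M; last exact: mf2_1 (mf_ew 1).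
      apply: mf2M; first exact: mf2_2 (kern_mf kg).
      apply: mf2_comp (kern_mf kh) _; exact: (mf2B (@mf2_fst R) (@mf2_snd R)).
    move=> s r; rewrite normrM [`|ew _ _|]ger0_norm//.
    apply: le_trans (ler_wpM2r (ew_ge0 1 s) (dom s r)) _.
    have -> : C * D * ew l s * ew 1 r * ew 1 s = C * D * ew 1 s * ew 1 r * ew l s by ring.
    rewrite ler_piMr//; last exact: ew_le1.
    by do 2 apply: mulr_ge0 => //.
  have := mfM (ig_mf (ig2_Int H)) (mf_ew (-1)).
  congr mf; apply/funext => s.
  have -> : Int (fun r => g r * h (s - r) * ew 1 s) = ew 1 s * conv g h s.
    rewrite -IntZ; first by apply: Int_ext => r; rewrite mulrC.
    apply: (ig_dom _ (dom s) (igZ _ (ig_ew ltr01))).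
    by apply: mfM; [exact: kern_mf kg|exact: mf_refl (kern_mf kh)].
  by rewrite mulrAC ew_inv mul1r.
exists (C * D * Int (ew 1)) => s.
have i1 : ig (fun r => C * D * ew l s * ew 1 r) by apply: igZ; exact: ig_ew.
have i2 : ig (fun r => g r * h (s - r)).
  apply: (ig_dom _ (dom s) i1).
  by apply: mfM; [exact: kern_mf kg|exact: mf_refl (kern_mf kh)].
apply: le_trans (Int_abs i2) _; apply: le_trans (Int_le (ig_abs i2) i1 (dom s)) _.
by rewrite (IntZ _ (ig_ew ltr01)) mulrAC.
Qed.

Lemma conv_even g h : (forall r, g (- r) = g r) -> (forall r, h (- r) = h r) ->
  ig (fun r => 0 * g r) -> (forall s, ig (fun r => g r * h (s - r))) ->
  forall s, conv g h (- s) = conv g h s.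
Proof.
move=> ge he _ gi s; rewrite /conv -(Int_refl 0 (gi (- s))).
apply: Int_ext => r; rewrite sub0r ge -he; congr (_ * h _); ring.
Qed.

End KernelConvolution.

(** * Complex data and kernels as pairs of real ones *)

Section ComplexNetwork.
Variables (R : realType) (n : nat).
Local Notation C := R[i].
Local Notation re := (@complex.Re R).
Local Notation im := (@complex.Im R).
Local Notation mu := (@lebesgue_measure R).
Variables (bar : 'I_n -> 'I_n) (tau : 'I_n -> R) (kap : 'M[R]_n).
Hypotheses (barK : involutive bar) (tau_gt0 : forall e, 0 < tau e).
Hypothesis tau_bar : forall e, tau (bar e) = tau e.
Implicit Types (u v F : 'I_n -> R -> C) (a b : C) (e f : 'I_n) (s h : R).
Implicit Types (g k : R -> C).

Local Notation data := (data tau).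
Local Notation compat := (compat bar tau).
Local Notation cut := (cut tau).
Local Notation cutnorm := (cutnorm tau).
Local Notation wt := (wt tau kap).
Local Notation rop := (rop bar tau kap).
Local Notation ekern := (ekern tau kap).
Local Notation lin a u b v := (fun e s => a * u e s + b * v e s).

Definition rev v e s : R := re (v e s).
Definition imv v e s : R := im (v e s).
Definition crop g v e s : C :=
  (rop (re \o g) (rev v) e s - rop (im \o g) (imv v) e s) +i*
  (rop (re \o g) (imv v) e s + rop (im \o g) (rev v) e s).
Definition cekern g := ekern (re \o g) /\ ekern (im \o g).
Definition cdat v := [/\ data (rev v), data (imv v), compat (rev v) & compat (imv v)].
Definition csz v : R := cutnorm (rev v) + cutnorm (imv v).
Definition cae u v := forall e, \forall s \ae mu, 0 <= s -> s <= tau e -> u e s = v e s.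

Lemma cae_cut u v e : cae u v -> aeq (cut (rev u) e) (cut (rev v) e) /\
  aeq (cut (imv u) e) (cut (imv v) e).
Proof.
move=> uv; split; apply: filterS (uv e) => s; rewrite /raw_cut /rev /imv;
by case: (boolP (_ && _)) => [/andP[s0 s1] ->|_ _]; rewrite ?mulr0.
Qed.

Lemma cae_trans u v w : cae u v -> cae v w -> cae u w.
Proof. by move=> uv vw e; apply: filterS2 (uv e) (vw e) => s h1 h2 s0 s1; rewrite h1 ?h2. Qed.

Lemma cae_sym u v : cae u v -> cae v u.
Proof. by move=> uv e; apply: filterS (uv e) => s h1 s0 s1; rewrite h1. Qed.

Lemma csz_ge0 v : 0 <= csz v.
Proof. by apply: addr_ge0; exact: cutnorm_ge0. Qed.

Lemma csz_cae u v : cdat u -> cdat v -> cae u v -> csz u = csz v.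
Proof.
move=> [ur ui _ _] [vr vi _ _] uv; congr (_ + _).
- by apply: cutnorm_aeq => // e; exact: (cae_cut e uv).1.
- by apply: cutnorm_aeq => // e; exact: (cae_cut e uv).2.
Qed.

Definition clin a u b v e s : C := a * u e s + b * v e s.

Lemma rev_clin a u b v : rev (clin a u b v) =
  lin 1 (lin (re a) (rev u) (- im a) (imv u)) 1 (lin (re b) (rev v) (- im b) (imv v)).
Proof.
by apply/funext => e; apply/funext => s; rewrite /rev /imv /clin reD !reM; ring.
Qed.

Lemma imv_clin a u b v : imv (clin a u b v) =
  lin 1 (lin (re a) (imv u) (im a) (rev u)) 1 (lin (re b) (imv v) (im b) (rev v)).
Proof.
by apply/funext => e; apply/funext => s; rewrite /rev /imv /clin imD !imM; ring.
Qed.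

Lemma cdat_clin a u b v : cdat u -> cdat v -> cdat (clin a u b v).
Proof.
move=> [ur ui cr ci] [vr vi dr di]; split.
- rewrite rev_clin; exact (data_lin 1 1 (data_lin _ _ ur ui) (data_lin _ _ vr vi)).
- rewrite imv_clin; exact (data_lin 1 1 (data_lin _ _ ui ur) (data_lin _ _ vi vr)).
- rewrite rev_clin; exact (compat_lin 1 1 (compat_lin _ _ cr ci) (compat_lin _ _ dr di)).
- rewrite imv_clin; exact (compat_lin 1 1 (compat_lin _ _ ci cr) (compat_lin _ _ di dr)).
Qed.

Lemma cutnorm_linB (u1 u2 : 'I_n -> R -> R) : data u1 -> data u2 ->
  cutnorm (lin 1 u1 (-1) u2) <= cutnorm u1 + cutnorm u2.
Proof.
by move=> d1 d2; have := cutnorm_lin 1 (-1) d1 d2; rewrite normrN normr1 !mul1r.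
Qed.

Lemma cutnorm_linD (u1 u2 : 'I_n -> R -> R) : data u1 -> data u2 ->
  cutnorm (lin 1 u1 1 u2) <= cutnorm u1 + cutnorm u2.
Proof.
by move=> d1 d2; have := cutnorm_lin 1 1 d1 d2; rewrite normr1 !mul1r.
Qed.

Lemma rev_crop g v : rev (crop g v) =
  lin 1 (rop (re \o g) (rev v)) (-1) (rop (im \o g) (imv v)).
Proof.
apply/funext => e; apply/funext => s.
exact (esym (congr2 +%R (mul1r _) (mulN1r _))).
Qed.

Lemma imv_crop g v : imv (crop g v) =
  lin 1 (rop (re \o g) (imv v)) 1 (rop (im \o g) (rev v)).
Proof.
apply/funext => e; apply/funext => s.
exact (esym (congr2 +%R (mul1r _) (mul1r _))).
Qed.

Lemma crop_cdat g v : cekern g -> cdat v -> cdat (crop g v).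
Proof.
move=> [gr gi] [vr vi cr ci].
have d1 := rop_data barK tau_gt0 gr vr; have d2 := rop_data barK tau_gt0 gi vi.
have d3 := rop_data barK tau_gt0 gr vi; have d4 := rop_data barK tau_gt0 gi vr.
have c1 := rop_compat barK tau_gt0 tau_bar gr vr cr.
have c2 := rop_compat barK tau_gt0 tau_bar gi vi ci.
have c3 := rop_compat barK tau_gt0 tau_bar gr vi ci.
have c4 := rop_compat barK tau_gt0 tau_bar gi vr cr.
have E1 := rev_crop g v; have E2 := imv_crop g v.
split.
- rewrite E1; exact (data_lin 1 (-1) d1 d2).
- rewrite E2; exact (data_lin 1 1 d3 d4).
- rewrite E1; exact (compat_lin 1 (-1) c1 c2).
- rewrite E2; exact (compat_lin 1 1 c3 c4).
Qed.

Lemma rop_lin4 (g : R -> R) (x1 x2 x3 x4 : R) (u1 u2 u3 u4 : 'I_n -> R -> R) e s : ekern g ->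
  data u1 -> data u2 -> data u3 -> data u4 ->
  compat u1 -> compat u2 -> compat u3 -> compat u4 ->
  rop g (lin 1 (lin x1 u1 x2 u2) 1 (lin x3 u3 x4 u4)) e s =
  x1 * rop g u1 e s + x2 * rop g u2 e s + (x3 * rop g u3 e s + x4 * rop g u4 e s).
Proof.
move=> eg d1 d2 d3 d4 c1 c2 c3 c4.
have E := rop_lin barK tau_gt0 tau_bar 1 1 e s eg (data_lin x1 x2 d1 d2)
  (compat_lin x1 x2 c1 c2) (data_lin x3 x4 d3 d4) (compat_lin x3 x4 c3 c4).
have E1 := rop_lin barK tau_gt0 tau_bar x1 x2 e s eg d1 c1 d2 c2.
have E2 := rop_lin barK tau_gt0 tau_bar x3 x4 e s eg d3 c3 d4 c4.
exact (etrans E (congr2 +%R (etrans (mul1r _) E1) (etrans (mul1r _) E2))).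
Qed.

Lemma crop_lin_alg a b (p1 p2 p3 p4 q1 q2 q3 q4 : R) :
  ((re a * p1 + - im a * p2 + (re b * p3 + - im b * p4)) -
   (re a * q2 + im a * q1 + (re b * q4 + im b * q3))) +i*
  ((re a * p2 + im a * p1 + (re b * p4 + im b * p3)) +
   (re a * q1 + - im a * q2 + (re b * q3 + - im b * q4))) =
  a * ((p1 - q2) +i* (p2 + q1)) + b * ((p3 - q4) +i* (p4 + q3)).
Proof. by apply: complexP; rewrite ?reD ?imD ?reM ?imM /=; ring. Qed.

Lemma congrC (p q p' q' : R) : p = p' -> q = q' -> p +i* q = p' +i* q'.
Proof. by move=> -> ->. Qed.

Lemma comp_alg1 (x1 x2 x3 x4 : R) : x1 - x2 - (x3 + x4) = x1 + -1 * x4 - (x2 + 1 * x3).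
Proof. by ring. Qed.

Lemma comp_alg2 (x1 x2 x3 x4 : R) : x1 + x2 + (x3 - x4) = x1 + -1 * x4 + (x2 + 1 * x3).
Proof. by ring. Qed.

Lemma crop_lin g a u b v e s : cekern g -> cdat u -> cdat v ->
  crop g (clin a u b v) e s = a * crop g u e s + b * crop g v e s.
Proof.
move=> [gr gi] [ur ui cr ci] [vr vi dr di].
have e1 := rop_lin4 (re a) (- im a) (re b) (- im b) e s gr ur ui vr vi cr ci dr di.
have e2 := rop_lin4 (re a) (im a) (re b) (im b) e s gi ui ur vi vr ci cr di dr.
have e3 := rop_lin4 (re a) (im a) (re b) (im b) e s gr ui ur vi vr ci cr di dr.
have e4 := rop_lin4 (re a) (- im a) (re b) (- im b) e s gi ur ui vr vi cr ci dr di.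
rewrite {1}/crop rev_clin imv_clin.
exact (etrans (congrC (congr2 (fun x y => x - y) e1 e2) (congr2 +%R e3 e4))
  (crop_lin_alg a b _ _ _ _ _ _ _ _)).
Qed.

Lemma crop_ae g u v e s : cekern g -> cdat u -> cdat v -> cae u v ->
  crop g u e s = crop g v e s.
Proof.
move=> [gr gi] [ur ui cr ci] [vr vi dr di] uv.
have hr f := (cae_cut f uv).1; have hi f := (cae_cut f uv).2.
have e1 := rop_aeq barK tau_gt0 tau_bar e s gr ur cr vr dr hr.
have e2 := rop_aeq barK tau_gt0 tau_bar e s gi ui ci vi di hi.
have e3 := rop_aeq barK tau_gt0 tau_bar e s gr ui ci vi di hi.
have e4 := rop_aeq barK tau_gt0 tau_bar e s gi ur cr vr dr hr.
exact (congrC (congr2 (fun x y => x - y) e1 e2) (congr2 +%R e3 e4)).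
Qed.

Let wt0 : 0 < wt := wt_gt0 kap tau_gt0.
Let wt1 : wt < wt + 1. Proof. by rewrite ltrDl. Qed.

Lemma crop_comp g k q v e s : cekern g -> cekern k -> cekern q -> cdat v ->
  kern (wt + 1 + 1) (re \o g) -> kern (wt + 1 + 1) (im \o g) ->
  (forall x, conv (re \o g) (re \o k) x - conv (im \o g) (im \o k) x = re (q x) /\
     conv (re \o g) (im \o k) x + conv (im \o g) (re \o k) x = im (q x)) ->
  crop g (crop k v) e s = crop q v e s.
Proof.
move=> [gr gi] [kr ki] [qr qi] [vr vi cr ci] gr2 gi2 qE.
have w10 : 0 <= wt + 1 by apply: ltW; exact: lt_trans wt0 wt1.
have ec (g1 k1 : R -> R) : ekern g1 -> kern (wt + 1 + 1) g1 -> ekern k1 -> ekern (conv g1 k1).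
  move=> [h1 h2] h3 [h4 h5]; split; first exact: kern_conv w10 h3 h4.
  apply: conv_even h2 h5 _ _.
    by apply: igZ; apply: kern_ig h1; exact: lt_trans wt0 wt1.
  move=> t; apply: (@conv_ig R (wt + 1 / 2) (wt + 1)).
  - by apply: addr_ge0; [exact: ltW|].
  - by rewrite lerD2l; lra.
  - exact: h1.
  - have h4' : kern (wt + 1) k1 := h4.
    have lw : wt + 1 / 2 < wt + 1 by rewrite ltrD2l; lra.
    have := kern_wi lw h4'; apply: wi_le.
    by apply: (@le_trans _ _ 0); rewrite ?oppr_le0; apply: addr_ge0 => //; exact: ltW.
have A (g1 k1 : R -> R) (w : 'I_n -> R -> R) : ekern g1 -> ekern k1 -> data w -> compat w ->
    rop g1 (rop k1 w) e s = rop (conv g1 k1) w e s.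
  by move=> h1 h2 h3 h4; exact (ropA barK tau_gt0 tau_bar e s h1 h2 h3 h4).
have E1 := rev_crop k v; have E2 := imv_crop k v.
have d1 := rop_data barK tau_gt0 kr vr; have d2 := rop_data barK tau_gt0 ki vi.
have d3 := rop_data barK tau_gt0 kr vi; have d4 := rop_data barK tau_gt0 ki vr.
have c1 := rop_compat barK tau_gt0 tau_bar kr vr cr.
have c2 := rop_compat barK tau_gt0 tau_bar ki vi ci.
have c3 := rop_compat barK tau_gt0 tau_bar kr vi ci.
have c4 := rop_compat barK tau_gt0 tau_bar ki vr cr.
have L (g1 : R -> R) : ekern g1 ->
    rop g1 (rev (crop k v)) e s = rop g1 (rop (re \o k) (rev v)) e s - rop g1 (rop (im \o k) (imv v)) e s /\
    rop g1 (imv (crop k v)) e s = rop g1 (rop (re \o k) (imv v)) e s + rop g1 (rop (im \o k) (rev v)) e s.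
  move=> eg; rewrite E1 E2; split.
    exact (etrans (rop_lin barK tau_gt0 tau_bar 1 (-1) e s eg d1 c1 d2 c2)
      (congr2 +%R (mul1r _) (mulN1r _))).
  exact (etrans (rop_lin barK tau_gt0 tau_bar 1 1 e s eg d3 c3 d4 c4)
    (congr2 +%R (mul1r _) (mul1r _))).
have K (g1 g2 q1 : R -> R) (x : R) (w : 'I_n -> R -> R) : ekern g1 -> ekern g2 -> data w ->
    (forall r, g1 r + x * g2 r = q1 r) ->
    rop g1 w e s + x * rop g2 w e s = rop q1 w e s.
  move=> h1 h2 h3 h; have := rop_kerD barK tau_gt0 1 x e s h1 h2 h3.
  rewrite mul1r => <-; congr (rop _ w e s); apply/funext => r; rewrite mul1r; exact: h.
have [L1 L2] := L _ gr; have [L3 L4] := L _ gi.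
have k1 := ec _ _ gr gr2 kr; have k2 := ec _ _ gi gi2 ki.
have k3 := ec _ _ gr gr2 ki; have k4 := ec _ _ gi gi2 kr.
have Q1 r : conv (re \o g) (re \o k) r + -1 * conv (im \o g) (im \o k) r = (re \o q) r.
  by rewrite mulN1r (qE r).1.
have Q2 r : conv (re \o g) (im \o k) r + 1 * conv (im \o g) (re \o k) r = (im \o q) r.
  by rewrite mul1r (qE r).2.
pose sub := fun x y : R => x - y.
have M1 := etrans L1 (congr2 sub (A _ _ _ gr kr vr cr) (A _ _ _ gr ki vi ci)).
have M4 := etrans L4 (congr2 +%R (A _ _ _ gi kr vi ci) (A _ _ _ gi ki vr cr)).
have M2 := etrans L2 (congr2 +%R (A _ _ _ gr kr vi ci) (A _ _ _ gr ki vr cr)).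
have M3 := etrans L3 (congr2 sub (A _ _ _ gi kr vr cr) (A _ _ _ gi ki vi ci)).
have N1 := etrans (congr2 sub M1 M4) (comp_alg1 _ _ _ _).
have N2 := etrans (congr2 +%R M2 M3) (comp_alg2 _ _ _ _).
have O1 := congr2 sub (K _ _ _ _ _ k1 k2 vr Q1) (K _ _ _ _ _ k3 k4 vi Q2).
have O2 := congr2 +%R (K _ _ _ _ _ k1 k2 vi Q1) (K _ _ _ _ _ k3 k4 vr Q2).
exact (congrC (etrans N1 O1) (etrans N2 O2)).
Qed.

Lemma bound_alg (c x y p q : R) :
  c * x * p + c * y * q + (c * x * q + c * y * p) = c * (x + y) * (p + q).
Proof. by ring. Qed.

Definition kw (g : R -> R) := wnorm (- wt) g.

Lemma crop_bound g v : cekern g -> cdat v ->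
  csz (crop g v) <= Cop tau kap * (kw (re \o g) + kw (im \o g)) * csz v.
Proof.
move=> [gr gi] [vr vi cr ci].
have b1 := rop_bound barK tau_gt0 tau_bar gr vr cr.
have b2 := rop_bound barK tau_gt0 tau_bar gi vi ci.
have b3 := rop_bound barK tau_gt0 tau_bar gr vi ci.
have b4 := rop_bound barK tau_gt0 tau_bar gi vr cr.
have d1 := rop_data barK tau_gt0 gr vr; have d2 := rop_data barK tau_gt0 gi vi.
have d3 := rop_data barK tau_gt0 gr vi; have d4 := rop_data barK tau_gt0 gi vr.
have E1 := rev_crop g v; have E2 := imv_crop g v.
have h1 := cutnorm_linB d1 d2; have h2 := cutnorm_linD d3 d4.
rewrite {1}/csz E1 E2.
apply: le_trans (lerD h1 h2) _.
apply: le_trans (lerD (lerD b1 b2) (lerD b3 b4)) _.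
by rewrite /csz -(bound_alg (Cop tau kap) _ _ _ _); exact: lexx.
Qed.

Lemma kw_le (g : R -> R) (M : R) : mf g -> (forall r, `|g r| <= M * ew (wt + 1) r) ->
  kw g <= 2 * M.
Proof.
move=> gm gM; have i1 := igZ M (ig_ew (@ltr01 R)).
have dom r : `|g r| * ew (- wt) r <= M * ew 1 r.
  apply: le_trans (ler_wpM2r (ew_ge0 _ _) (gM r)) _.
  by rewrite -mulrA -ewDw (_ : wt + 1 - wt = 1)//; ring.
have gi : ig (fun r => `|g r| * ew (- wt) r).
  apply: (ig_dom _ _ i1); first exact: mfM (mf_abs gm) (mf_ew _).
  by move=> r; rewrite ger0_norm ?dom// mulr_ge0.
apply: le_trans (Int_le gi i1 dom) _; rewrite (IntZ _ (ig_ew ltr01)) (Int_ew_eq ltr01).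
by rewrite divr1 mulrC.
Qed.

Lemma crop_kernel_bound g v (M : R) : cekern g -> cdat v ->
  (forall r, normc (g r) <= M * ew (wt + 1) r) ->
  csz (crop g v) <= 4 * Cop tau kap * M * csz v.
Proof.
move=> eg dv gM; apply: le_trans (crop_bound eg dv) _.
have h1 : kw (re \o g) <= 2 * M.
  apply: kw_le; first exact: kern_mf eg.1.1.
  by move=> r; exact: le_trans (re_le _) (gM r).
have h2 : kw (im \o g) <= 2 * M.
  apply: kw_le; first exact: kern_mf eg.2.1.
  by move=> r; exact: le_trans (im_le _) (gM r).
apply: ler_wpM2r; first exact: csz_ge0.
have -> : 4 * Cop tau kap * M = Cop tau kap * (2 * M + 2 * M) by ring.
by apply: ler_wpM2l; [exact: Cop_ge0|exact: lerD].
Qed.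

Lemma cekern_lin a g b k : cekern g -> cekern k -> cekern (fun r => a * g r + b * k r).
Proof.
move=> [gr gi] [kr ki]; split.
- have := ekern_lin 1 1 (ekern_lin (re a) (- im a) gr gi) (ekern_lin (re b) (- im b) kr ki).
  by congr raw_ekern; apply/funext => r; rewrite /= reD !reM; ring.
- have := ekern_lin 1 1 (ekern_lin (re a) (im a) gi gr) (ekern_lin (re b) (im b) ki kr).
  by congr raw_ekern; apply/funext => r; rewrite /= imD !imM; ring.
Qed.

Lemma crop_kerlin_alg a b (p1 p2 p3 p4 q1 q2 q3 q4 : R) :
  ((re a * p1 + - im a * p2 + (re b * p3 + - im b * p4)) -
   (re a * q2 + im a * q1 + (re b * q4 + im b * q3))) +i*
  ((re a * q1 + - im a * q2 + (re b * q3 + - im b * q4)) +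
   (re a * p2 + im a * p1 + (re b * p4 + im b * p3))) =
  a * ((p1 - q2) +i* (q1 + p2)) + b * ((p3 - q4) +i* (q3 + p4)).
Proof. by apply: complexP; rewrite ?reD ?imD ?reM ?imM /=; ring. Qed.

Lemma crop_kerlin a g b k v e s : cekern g -> cekern k -> cdat v ->
  crop (fun r => a * g r + b * k r) v e s = a * crop g v e s + b * crop k v e s.
Proof.
move=> [gr gi] [kr ki] [vr vi _ _].
have K (x1 x2 x3 x4 : R) (g1 g2 g3 g4 q : R -> R) (w : 'I_n -> R -> R) :
    ekern g1 -> ekern g2 -> ekern g3 -> ekern g4 -> data w ->
    (forall r, x1 * g1 r + x2 * g2 r + (x3 * g3 r + x4 * g4 r) = q r) ->
    rop q w e s = x1 * rop g1 w e s + x2 * rop g2 w e s + (x3 * rop g3 w e s + x4 * rop g4 w e s).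
  move=> h1 h2 h3 h4 dw hq.
  have e1 := rop_kerD barK tau_gt0 x1 x2 e s h1 h2 dw.
  have e2 := rop_kerD barK tau_gt0 x3 x4 e s h3 h4 dw.
  have e3 := rop_kerD barK tau_gt0 1 1 e s (ekern_lin x1 x2 h1 h2) (ekern_lin x3 x4 h3 h4) dw.
  rewrite -e1 -e2; rewrite !mul1r in e3; rewrite -e3.
  by congr (rop _ w e s); apply/funext => r; rewrite !mul1r hq.
have R1 r : re a * (re \o g) r + - im a * (im \o g) r + (re b * (re \o k) r + - im b * (im \o k) r) =
    (re \o (fun r => a * g r + b * k r)) r by rewrite /= reD !reM; ring.
have R2 r : re a * (im \o g) r + im a * (re \o g) r + (re b * (im \o k) r + im b * (re \o k) r) =
    (im \o (fun r => a * g r + b * k r)) r by rewrite /= imD !imM; ring.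
have e1 := K _ _ _ _ _ _ _ _ _ _ gr gi kr ki vr R1.
have e2 := K _ _ _ _ _ _ _ _ _ _ gi gr ki kr vi R2.
have e3 := K _ _ _ _ _ _ _ _ _ _ gr gi kr ki vi R1.
have e4 := K _ _ _ _ _ _ _ _ _ _ gi gr ki kr vr R2.
exact (etrans (congrC (congr2 (fun x y => x - y) e1 e2) (congr2 +%R e3 e4))
  (crop_kerlin_alg a b _ _ _ _ _ _ _ _)).
Qed.

Lemma re_sub a b : re (1 * a + -1 * b) = re a - re b.
Proof. by rewrite reD !reM /=; ring. Qed.

Lemma im_sub a b : im (1 * a + -1 * b) = im a - im b.
Proof. by rewrite imD !imM /=; ring. Qed.

Lemma re_quot (x : R) a b (c : C) :
  re (x%:C * (1 * a + -1 * b) + -1 * c) = x * (1 * re a + -1 * re b) + -1 * re c.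
Proof. by rewrite reD !reM re_sub /=; ring. Qed.

Lemma im_quot (x : R) a b (c : C) :
  im (x%:C * (1 * a + -1 * b) + -1 * c) = x * (1 * im a + -1 * im b) + -1 * im c.
Proof. by rewrite imD !imM im_sub /=; ring. Qed.

Lemma approx_alg1 (p q r : R) : p - q - r = 1 * (1 * p + -1 * r) + -1 * q.
Proof. by ring. Qed.

Lemma approx_alg2 (p q r : R) : p + q - r = 1 * (1 * p + -1 * r) + 1 * q.
Proof. by ring. Qed.

Lemma crop_approx v (eta B : R) : cdat v -> 0 < eta -> 0 <= B ->
  exists2 e0, 0 < e0 & forall eps g, 0 < eps -> eps < e0 -> cekern g -> cInt g = 1 ->
    (forall r, normc (g r) <= B / eps * ew eps^-1 r) ->
    csz (clin 1 (crop g v) (-1) v) <= eta.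
Proof.
move=> dv eta0 B0; have [vr vi cr ci] := dv.
(* Four real operators occur: the real part of [g] has mass 1 and approximates the identity on both
   parts of [v], while the imaginary part has mass 0 and its operators tend to 0. *)
have e4 : 0 < eta / 4 by rewrite divr_gt0.
have [E1 E10 P1] := rop_approx kap barK tau_gt0 vr e4 B0.
have [E2 E20 P2] := rop_approx kap barK tau_gt0 vi e4 B0.
exists (Num.min E1 E2); first by rewrite lt_min E10.
move=> eps g eps0; rewrite lt_min => /andP[h1 h2] eg g1 gB.
have [gr gi] := eg.
have [Gr Gi] : Int (re \o g) = 1 /\ Int (im \o g) = 0 by case: g1.
have rB r : `|(re \o g) r| <= B / eps * ew eps^-1 r by exact: le_trans (re_le _) (gB r).
have iB r : `|(im \o g) r| <= B / eps * ew eps^-1 r by exact: le_trans (im_le _) (gB r).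
have q1 := P1 eps _ eps0 h1 (kern_mf gr.1) rB.
have q2 := P2 eps _ eps0 h2 (kern_mf gi.1) iB.
have q3 := P2 eps _ eps0 h2 (kern_mf gr.1) rB.
have q4 := P1 eps _ eps0 h1 (kern_mf gi.1) iB.
rewrite ?Gr ?Gi in q1 q2 q3 q4.
have d1 := rop_data barK tau_gt0 gr vr; have d2 := rop_data barK tau_gt0 gi vi.
have d3 := rop_data barK tau_gt0 gr vi; have d4 := rop_data barK tau_gt0 gi vr.
pose u1 := lin 1 (rop (re \o g) (rev v)) (-1) (rev v).
pose u3 := lin 1 (rop (re \o g) (imv v)) (-1) (imv v).
have D1 : data u1 := data_lin 1 (-1) d1 vr.
have D3 : data u3 := data_lin 1 (-1) d3 vi.
have N1 : cutnorm u1 <= eta / 4.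
  apply: le_trans q1; rewrite le_eqVlt; apply/orP; left; apply/eqP; congr raw_cutnorm.
  by apply/funext => e; apply/funext => s; rewrite /u1 mul1r mulN1r mul1r.
have N3 : cutnorm u3 <= eta / 4.
  apply: le_trans q3; rewrite le_eqVlt; apply/orP; left; apply/eqP; congr raw_cutnorm.
  by apply/funext => e; apply/funext => s; rewrite /u3 mul1r mulN1r mul1r.
have N2 : cutnorm (rop (im \o g) (imv v)) <= eta / 4.
  apply: le_trans q2; rewrite le_eqVlt; apply/orP; left; apply/eqP; congr raw_cutnorm.
  by apply/funext => e; apply/funext => s; rewrite mul0r subr0.
have N4 : cutnorm (rop (im \o g) (rev v)) <= eta / 4.
  apply: le_trans q4; rewrite le_eqVlt; apply/orP; left; apply/eqP; congr raw_cutnorm.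
  by apply/funext => e; apply/funext => s; rewrite mul0r subr0.
have F1 : rev (clin 1 (crop g v) (-1) v) = lin 1 u1 (-1) (rop (im \o g) (imv v)).
  apply/funext => e; apply/funext => s.
  exact (etrans (re_sub (crop g v e s) (v e s)) (approx_alg1 (rop (re \o g) (rev v) e s)
    (rop (im \o g) (imv v) e s) (rev v e s))).
have F2 : imv (clin 1 (crop g v) (-1) v) = lin 1 u3 1 (rop (im \o g) (rev v)).
  apply/funext => e; apply/funext => s.
  exact (etrans (im_sub (crop g v e s) (v e s)) (approx_alg2 (rop (re \o g) (imv v) e s)
    (rop (im \o g) (rev v) e s) (imv v e s))).
rewrite /csz F1 F2.
have b1 := cutnorm_linB D1 d2; have b2 := cutnorm_linD D3 d4.
apply: le_trans (lerD b1 b2) _.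
apply: le_trans (lerD (lerD N1 N2) (lerD N3 N4)) _.
by rewrite le_eqVlt; apply/orP; left; apply/eqP; field.
Qed.

Lemma crop_real g v e s : cekern g -> cdat v -> (forall r, im (g r) = 0) ->
  crop g v e s = rop (re \o g) (rev v) e s +i* rop (re \o g) (imv v) e s.
Proof.
move=> [gr gi] [vr vi _ _] g0.
have Z (w : 'I_n -> R -> R) : data w -> rop (im \o g) w e s = 0.
  move=> dw; have := rop_kerD barK tau_gt0 0 0 e s gr gi dw; rewrite !mul0r addr0 => h.
  rewrite -[RHS]h; congr (rop _ w e s); apply/funext => r.
  by rewrite !mul0r addr0 /= g0.
exact (congrC
  (etrans (congr1 (fun x => rop (re \o g) (rev v) e s - x) (Z _ vi)) (subr0 _))
  (etrans (congr1 (fun x => rop (re \o g) (imv v) e s + x) (Z _ vr)) (addr0 _))).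
Qed.

Definition cgen (G : R -> R -> C) v F := forall eta : R, 0 < eta -> exists2 h0 : R, 0 < h0 &
  forall h, 0 < h -> h < h0 ->
    csz (clin (h^-1)%:C (clin 1 (crop (G h) v) (-1) v) (-1) F) <= eta.

(** At real times the kernels are real, so the real and imaginary parts of the data evolve
    separately and the real results apply to each. *)
Lemma cgen_nsol (G : R -> R -> C) (B : R) v F : 0 <= B ->
  heat_family (fun h => re \o G h) B -> (forall h, 0 < h -> forall r, im (G h r) = 0) ->
  (forall h, 0 < h -> cekern (G h)) -> cdat v -> cdat F ->
  cgen G v F <-> nsol bar tau kap (rev v) (rev F) /\ nsol bar tau kap (imv v) (imv F).
Proof.
move=> B0 hG G0 eG dv dF; have [vr vi cr ci] := dv; have [Fr Fi Cr Ci] := dF.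
pose Q := fun h => quot bar tau kap (fun h => re \o G h) h.
have E h : 0 < h -> rev (clin (h^-1)%:C (clin 1 (crop (G h) v) (-1) v) (-1) F) = Q h (rev v) (rev F) /\
    imv (clin (h^-1)%:C (clin 1 (crop (G h) v) (-1) v) (-1) F) = Q h (imv v) (imv F).
  move=> h0; split; apply/funext => e; apply/funext => s.
    exact (etrans (re_quot h^-1 (crop (G h) v e s) (v e s) (F e s)) (congr1 (fun p => h^-1 * (1 * p + -1 * rev v e s) + -1 * rev F e s)
      (congr1 re (crop_real e s (eG h h0) dv (G0 h h0))))).
  exact (etrans (im_quot h^-1 (crop (G h) v e s) (v e s) (F e s)) (congr1 (fun p => h^-1 * (1 * p + -1 * imv v e s) + -1 * imv F e s)
    (congr1 im (crop_real e s (eG h h0) dv (G0 h h0))))).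
have S h : 0 < h -> csz (clin (h^-1)%:C (clin 1 (crop (G h) v) (-1) v) (-1) F) =
    cutnorm (Q h (rev v) (rev F)) + cutnorm (Q h (imv v) (imv F)).
  by move=> h0; have [e1 e2] := E h h0; rewrite /csz e1 e2.
split=> [gen|[s1 s2] eta eta0].
  split; apply: (gen_nsol barK tau_gt0 tau_bar B0 hG) => // eta eta0;
    have [h0 h00 hP] := gen _ eta0; exists h0 => // h hh hh0; have := hP h hh hh0;
    rewrite (S h hh); apply: le_trans.
  - by rewrite lerDl cutnorm_ge0.
  - by rewrite lerDr cutnorm_ge0.
have g1 := nsol_gen barK tau_gt0 tau_bar B0 hG vr cr Fr Cr s1.
have g2 := nsol_gen barK tau_gt0 tau_bar B0 hG vi ci Fi Ci s2.
have e2 : 0 < eta / 2 by rewrite divr_gt0.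
have [h1 h10 H1] := g1 _ e2; have [h2 h20 H2] := g2 _ e2.
exists (Num.min h1 h2); first by rewrite lt_min h10.
move=> h h0; rewrite lt_min => /andP[a1 a2]; rewrite (S h h0) (splitr eta).
by apply: lerD; [exact: H1|exact: H2].
Qed.

End ComplexNetwork.

Local Notation raw_csz := csz.

Local Open Scope quotient_scope.

(** * Elements of L1 and their representatives *)

Section L1Element.
Variable R : realType.
Local Notation C := R[i].
Local Notation re := (@complex.Re R).
Local Notation im := (@complex.Im R).
Local Notation mu := (@lebesgue_measure R).

Lemma integrable_onI (f : R -> R) :
  mu.-integrable (@unitI R) (EFin \o f) <-> ig (onI f).
Proof.
have E : (EFin \o f) \_ (@unitI R) = EFin \o onI f.
  apply/funext => x; rewrite /= patchE mem_setE in_itv/= /onI.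
  by case: (_ && _); rewrite ?mulr1 ?mulr0.
split=> [/(integrable_mkcond _ (@measurable_unitI R))|h]; first by rewrite E.
by apply/(integrable_mkcond _ (@measurable_unitI R)); rewrite E.
Qed.

Lemma cintegrable_onI (f : R -> C) :
  cintegrable f <-> ig (onI (re \o f)) /\ ig (onI (im \o f)).
Proof.
split=> [[h1 h2]|[h1 h2]]; first by split; apply/integrable_onI.
by split; exact/integrable_onI.
Qed.

Lemma Rintegral_onI (f : R -> R) : \int[mu]_(x in @unitI R) f x = Int (onI f).
Proof.
rewrite Rintegral_mkcond; apply: Int_ext => x.
by rewrite patchE mem_setE in_itv/= /onI; case: (_ && _); rewrite ?mulr1 ?mulr0.
Qed.

Definition toL1 (f : R -> C) : L1 R :=
  if pselect (cintegrable f) is left H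
  then \pi_(L1 R) (@MkL1fun R f (mem_set H)) else 0.

Lemma repr_toL1 f : cintegrable f ->
  \forall x \ae mu, unitI x -> repr (toL1 f) x = f x.
Proof.
move=> fi; rewrite /toL1; case: pselect => [H|//].
exact: (repr_piL1 (@MkL1fun R f (mem_set H))).
Qed.

Lemma L1_repr_eq (u v : L1 R) :
  (\forall x \ae mu, unitI x -> repr u x = repr v x) -> u = v.
Proof. by move=> h; rewrite -[u]reprK -[v]reprK; apply/L1_eqP. Qed.

Lemma L1_repr_lin (a b : C) (u v : L1 R) :
  \forall x \ae mu, unitI x -> repr (a *: u + b *: v) x = a * repr u x + b * repr v x.
Proof.
have -> : a *: u + b *: v = \pi_(L1 R) (a *: repr u + b *: repr v : L1fun R).
  by rewrite L1_piD !L1_piZ !reprK.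
by have := repr_piL1 (a *: repr u + b *: repr v); apply: filterS => x h Ix; rewrite h.
Qed.

Lemma repr_cintegrable (u : L1 R) : cintegrable (repr u).
Proof. exact: L1fun_cintegrable. Qed.

End L1Element.

(** * Vectors in L1 as data on a network *)

Section SemigroupOnL1.
Variables (R : realType) (m : nat) (sigma : 'I_m -> R).
Hypothesis sigma_gt0 : forall i, 0 < sigma i.
Variables (K00 K01 K10 K11 : 'M[R]_m).
Local Notation C := R[i].
Local Notation re := (@complex.Re R).
Local Notation im := (@complex.Im R).
Local Notation mu := (@lebesgue_measure R).
Local Notation X := (L1vec R m).
Local Notation n := (m + m)%N.
Implicit Types (i j : 'I_m) (e f : 'I_n) (s t x : R) (u v w : X).

Definition speed i : R := Num.sqrt (sigma i).
Local Notation c := speed.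

Lemma speed_gt0 i : 0 < c i. Proof. by rewrite sqrtr_gt0. Qed.
Local Hint Resolve speed_gt0 : core.
Lemma speed_neq0 i : c i != 0. Proof. by rewrite gt_eqF. Qed.

(* The two endpoints of the i-th component are numbered lshift m i (at x = 0)
   and rshift m i (at x = 1). *)
Definition idx e : 'I_m := match fintype.split e with inl i => i | inr i => i end.
Definition nbar e : 'I_n :=
  match fintype.split e with inl i => rshift m i | inr i => lshift m i end.
Definition ntau e : R := (c (idx e))^-1.
Definition npt e s : R :=
  match fintype.split e with inl i => c i * s | inr i => 1 - c i * s end.
(** A derivative along the edge is the speed times the derivative in [x], hence the factors [c i];
    an edge starting at [x = 1] is run backwards, hence the signs in the lower blocks. *)
Definition nkap : 'M[R]_n := block_mx
  (\matrix_(i, j) (c i * K00 i j)) (\matrix_(i, j) (c i * K01 i j))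
  (\matrix_(i, j) (- (c i * K10 i j))) (\matrix_(i, j) (- (c i * K11 i j))).

Lemma split_l i : fintype.split (lshift m i) = inl i :> 'I_m + 'I_m.
Proof. by rewrite (fintype.unsplitK (inl i)). Qed.
Lemma split_r i : fintype.split (rshift m i) = inr i :> 'I_m + 'I_m.
Proof. by rewrite (fintype.unsplitK (inr i)). Qed.
Lemma idx_l i : idx (lshift m i) = i. Proof. by rewrite /idx split_l. Qed.
Lemma idx_r i : idx (rshift m i) = i. Proof. by rewrite /idx split_r. Qed.
Lemma nbar_l i : nbar (lshift m i) = rshift m i. Proof. by rewrite /nbar split_l. Qed.
Lemma nbar_r i : nbar (rshift m i) = lshift m i. Proof. by rewrite /nbar split_r. Qed.
Lemma npt_l i s : npt (lshift m i) s = c i * s. Proof. by rewrite /npt split_l. Qed.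
Lemma npt_r i s : npt (rshift m i) s = 1 - c i * s. Proof. by rewrite /npt split_r. Qed.

Lemma endpointP (P : 'I_n -> Prop) :
  (forall i, P (lshift m i)) -> (forall i, P (rshift m i)) -> forall e, P e.
Proof. by move=> hl hr e; rewrite -[e](fintype.splitK); case: (fintype.split e). Qed.

Lemma nbarK : involutive nbar.
Proof. by apply: endpointP => i; rewrite ?nbar_l ?nbar_r ?nbar_l. Qed.

Lemma ntau_gt0 e : 0 < ntau e. Proof. by rewrite invr_gt0. Qed.

Lemma idx_bar e : idx (nbar e) = idx e.
Proof. by move: e; apply: endpointP => i; rewrite ?nbar_l ?nbar_r ?idx_l ?idx_r. Qed.

Lemma ntau_bar e : ntau (nbar e) = ntau e. Proof. by rewrite /ntau idx_bar. Qed.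

Lemma npt_bar e s : npt (nbar e) s = npt e (ntau e - s).
Proof.
move: e; apply: endpointP => i; rewrite ?nbar_l ?nbar_r ?npt_l ?npt_r /ntau ?idx_l ?idx_r.
  by rewrite mulrBr divff// speed_neq0.
by rewrite mulrBr divff ?speed_neq0//; ring.
Qed.

Definition nslope e : R := match fintype.split e with inl i => c i | inr i => - c i end.
Definition norg e : R := match fintype.split e with inl i => 0 | inr i => 1 end.

Lemma npt_affine e s : npt e s = nslope e * s + norg e.
Proof. by rewrite /npt /nslope /norg; case: (fintype.split e) => i; ring. Qed.

Lemma nslope_neq0 e : nslope e != 0.
Proof. by rewrite /nslope; case: (fintype.split e) => i; rewrite ?oppr_eq0 speed_neq0. Qed.

Lemma nslope_norm e : `|nslope e|^-1 = ntau e.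
Proof.
rewrite /ntau /nslope /idx; case: (fintype.split e) => i; rewrite ?normrN gtr0_norm//.
Qed.

Lemma npt_in e s : (0 <= npt e s) && (npt e s <= 1) = (0 <= s) && (s <= ntau e).
Proof.
move: e; apply: endpointP => i; rewrite ?npt_l ?npt_r /ntau ?idx_l ?idx_r.
  by rewrite pmulr_rge0// -[in RHS](mulr1 (c i)^-1) ler_pdivlMl.
by rewrite subr_ge0 gerBl pmulr_rge0// andbC -[in RHS](mulr1 (c i)^-1) ler_pdivlMl.
Qed.

Local Notation cdat := (cdat nbar ntau).
Local Notation cae := (cae ntau).
Local Notation csz := (csz ntau).
Local Notation cut := (cut ntau).

(* Parametrisation at speed sqrt sigma_i, which turns sigma_i u'' into u'',
   of the components from both endpoints. *)
Definition Vf (U : 'I_m -> R -> C) e s : C := U (idx e) (npt e s).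
Definition Vc u := Vf (fun i => repr (u i)).

Lemma cut_Vf (p : C -> R) (U : 'I_m -> R -> C) e s :
  cut (fun e s => p (Vf U e s)) e s = onI (p \o U (idx e)) (nslope e * s + norg e).
Proof. by rewrite /raw_cut /onI -npt_affine npt_in. Qed.

Lemma Vf_cdat U : (forall i, cintegrable (U i)) -> cdat (Vf U).
Proof.
move=> Ui; split.
- move=> e; apply: (ig_ext (fun s => esym (cut_Vf re U e s))).
  exact: ig_affine (nslope_neq0 e) ((cintegrable_onI _).1 (Ui (idx e))).1.
- move=> e; apply: (ig_ext (fun s => esym (cut_Vf im U e s))).
  exact: ig_affine (nslope_neq0 e) ((cintegrable_onI _).1 (Ui (idx e))).2.
- by move=> e s _ _; rewrite /rev /Vf idx_bar npt_bar.
- by move=> e s _ _; rewrite /imv /Vf idx_bar npt_bar.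
Qed.

Lemma Vc_cdat u : cdat (Vc u).
Proof. by apply: Vf_cdat => i; exact: repr_cintegrable. Qed.

Lemma unitIE x : unitI x <-> (0 <= x) && (x <= 1).
Proof. by rewrite /unitI /= in_itv. Qed.

Lemma Vf_cae U W : (forall i, \forall x \ae mu, unitI x -> U i x = W i x) ->
  cae (Vf U) (Vf W).
Proof.
move=> UW e; have := ae_affine (norg e) (nslope_neq0 e) (UW (idx e)).
apply: filterS => s h s0 s1; rewrite /Vf npt_affine; apply: h.
by apply/unitIE; rewrite -npt_affine npt_in s0.
Qed.

Lemma cae_Vf U W : cae (Vf U) (Vf W) ->
  forall i, \forall x \ae mu, unitI x -> U i x = W i x.
Proof.
move=> UW i; have ci : (c i)^-1 != 0 by rewrite invr_eq0 speed_neq0.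
have := ae_affine 0 ci (UW (lshift m i)); apply: filterS => x h /unitIE Ix.
have E : npt (lshift m i) ((c i)^-1 * x + 0) = x.
  by rewrite npt_l addr0 mulrA divff ?mul1r// speed_neq0.
have := npt_in (lshift m i) ((c i)^-1 * x + 0); rewrite E Ix => /esym/andP[s0 s1].
by have := h s0 s1; rewrite /Vf E idx_l.
Qed.

Lemma Vc_inj u v : cae (Vc u) (Vc v) -> u = v.
Proof. by move=> uv; apply/ffunP => i; apply: L1_repr_eq; exact: (cae_Vf uv). Qed.

(** Only the copies starting at [x = 0] are read; for compatible data the reversed copies carry the
    same information, which [Vc_Lv] exploits. *)
Definition Lv (v : 'I_n -> R -> C) : X :=
  [ffun i => toL1 (fun x => v (lshift m i) ((c i)^-1 * x))].

Lemma Lv_cintegrable (V : 'I_n -> R -> C) i : cdat V -> cintegrable (fun x => V (lshift m i) ((c i)^-1 * x)).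
Proof.
move=> [vr vi _ _]; have ci : (c i)^-1 != 0 by rewrite invr_eq0 speed_neq0.
have E (p : C -> R) x : cut (fun e s => p (V e s)) (lshift m i) ((c i)^-1 * x + 0) =
    onI (p \o (fun x => V (lshift m i) ((c i)^-1 * x))) x.
  rewrite /raw_cut /onI /= addr0 -npt_in npt_l mulrA divff ?mul1r// speed_neq0//.
apply/cintegrable_onI; split.
- by apply: (ig_ext (E re)); exact: ig_affine ci (vr _).
- by apply: (ig_ext (E im)); exact: ig_affine ci (vi _).
Qed.

Lemma Vc_Lv (V : 'I_n -> R -> C) : cdat V -> cae (Vc (Lv V)) V.
Proof.
move=> dv; pose U i x := V (lshift m i) ((c i)^-1 * x).
apply: (@cae_trans _ _ _ _ (Vf U)).
  apply: Vf_cae => i; rewrite /Lv /L1vec_comp ffunE.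
  exact: repr_toL1 (Lv_cintegrable i dv).
apply: endpointP => i; apply: filterS (@aeneq R 0) => s _ s0 s1; rewrite /Vf /U.
  by rewrite idx_l npt_l mulrA mulVf ?mul1r// speed_neq0.
rewrite idx_r npt_r mulrBr mulr1 mulrA mulVf ?mul1r ?speed_neq0//.
have [_ _ cr ci] := dv; have t0 : ntau (rshift m i) = ntau (lshift m i).
  by rewrite /ntau idx_l idx_r.
rewrite t0 in s1; have E1 := cr (lshift m i) s s0 s1; have E2 := ci (lshift m i) s s0 s1.
have te : ntau (lshift m i) = (c i)^-1 by rewrite /ntau idx_l.
rewrite nbar_l te in E1 E2.
by apply: complexP; [exact: esym E1|exact: esym E2].
Qed.

Lemma Vc_lin (a b : C) u v : cae (Vc (a *: u + b *: v)) (clin a (Vc u) b (Vc v)).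
Proof.
have := @Vf_cae (fun i => repr ((a *: u + b *: v) i)) (fun i x => a * repr (u i) x + b * repr (v i) x).
apply=> i; rewrite /L1vec_comp !ffunE; exact: L1_repr_lin.
Qed.

Definition nrm u : R := \sum_i Int (onI (@normc R \o repr (u i))).

Lemma nrmE u : `|u| = (nrm u)%:C.
Proof.
rewrite -[LHS]/(L1vec_norm u) /L1vec_norm /nrm rmorph_sum; apply: eq_bigr => i _.
by rewrite -[LHS]/(L1_norm (u i)) /L1_norm Rintegral_onI.
Qed.

Lemma onI_normc_ig i u : ig (onI (@normc R \o repr (u i))).
Proof. by apply/integrable_onI; exact: cintegrable_normc (repr_cintegrable _). Qed.

Lemma onI_Int_ge0 i u : 0 <= Int (onI (@normc R \o repr (u i))).
Proof. by apply: Int_ge0 => x; rewrite mulr_ge0//= normc_ge0. Qed.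

Lemma nrm_ge0 u : 0 <= nrm u.
Proof. by apply: sumr_ge0 => i _; exact: onI_Int_ge0. Qed.

Lemma Int_cut_Vf (p : C -> R) (U : 'I_m -> R -> C) e : ig (onI (p \o U (idx e))) ->
  Int (fun s => `|cut (fun e s => p (Vf U e s)) e s|) =
  ntau e * Int (fun x => `|onI (p \o U (idx e)) x|).
Proof.
move=> i1; rewrite -nslope_norm -(Int_affine (norg e) (nslope_neq0 e) (ig_abs i1)).
by apply: Int_ext => s; rewrite cut_Vf.
Qed.

Lemma Int_onI_part (p : C -> R) i u : (forall z, `|p z| <= normc z) ->
  ig (onI (p \o repr (u i))) ->
  Int (fun x => `|onI (p \o repr (u i)) x|) <= Int (onI (@normc R \o repr (u i))).
Proof.
move=> pn i1; apply: Int_le; [exact: ig_abs|exact: onI_normc_ig|].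
by move=> x; rewrite /onI normrM [`|_%:R|]ger0_norm// ler_wpM2r//=.
Qed.

(** Together with [nrm_csz] this makes the norm of the vector and the size of its network data
    equivalent, so that bounds and limits pass in both directions. *)
Lemma csz_nrm : exists2 Q, 0 <= Q & forall u, csz (Vc u) <= Q * nrm u.
Proof.
exists (\sum_e 2 * ntau e).
  by apply: sumr_ge0 => e _; rewrite mulr_ge0// ltW// ntau_gt0.
move=> u; rewrite mulr_suml /raw_csz /raw_cutnorm -big_split; apply: ler_sum => e _ /=.
have [ir ii] := (cintegrable_onI _).1 (repr_cintegrable (u (idx e))).
have e1 := @Int_cut_Vf re (fun i => repr (u i)) e ir.
have e2 := @Int_cut_Vf im (fun i => repr (u i)) e ii.
apply: (@le_trans _ _ (ntau e * Int (fun x => `|onI (re \o repr (u (idx e))) x|) +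
   ntau e * Int (fun x => `|onI (im \o repr (u (idx e))) x|))).
  by rewrite -e1 -e2.
rewrite -mulrDr.
have h1 := Int_onI_part (@re_le R) ir; have h2 := Int_onI_part (@im_le R) ii.
have h3 : Int (onI (@normc R \o repr (u (idx e)))) <= nrm u.
  rewrite /nrm (bigD1 (idx e))//= lerDl; apply: sumr_ge0 => i _; exact: onI_Int_ge0.
have -> : 2 * ntau e * nrm u = ntau e * (nrm u + nrm u) by ring.
rewrite ler_wpM2l ?(ltW (ntau_gt0 e))//; apply: lerD; [exact: le_trans h1 h3|exact: le_trans h2 h3].
Qed.

Lemma nrm_csz : exists2 Q, 0 <= Q & forall u, nrm u <= Q * csz (Vc u).
Proof.
exists (\sum_i c i); first by apply: sumr_ge0 => i _; exact/ltW.
move=> u; rewrite mulr_suml; apply: ler_sum => i _.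
have [ir ii] := (cintegrable_onI _).1 (repr_cintegrable (u i)).
have h1 : Int (onI (@normc R \o repr (u i))) <=
    Int (fun x => `|onI (re \o repr (u i)) x|) + Int (fun x => `|onI (im \o repr (u i)) x|).
  rewrite -IntD; [|exact: ig_abs ir|exact: ig_abs ii].
  apply: Int_le; [exact: onI_normc_ig|exact: igD (ig_abs ir) (ig_abs ii)|].
  move=> x; rewrite /onI !normrM [`|_%:R|]ger0_norm// -mulrDl ler_wpM2r//=.
  exact: normc_le.
apply: le_trans h1 _.
have ir' : ig (onI (re \o (fun i => repr (u i)) (idx (lshift m i)))) by rewrite idx_l.
have ii' : ig (onI (im \o (fun i => repr (u i)) (idx (lshift m i)))) by rewrite idx_l.
have e1 := @Int_cut_Vf re (fun i => repr (u i)) (lshift m i) ir'.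
have e2 := @Int_cut_Vf im (fun i => repr (u i)) (lshift m i) ii'.
have te : ntau (lshift m i) = (c i)^-1 by rewrite /ntau idx_l.
rewrite idx_l te in e1 e2.
have ci0 := ltW (speed_gt0 i).
have f1 : Int (fun x => `|onI (re \o repr (u i)) x|) <= c i * cutnorm ntau (rev (Vc u)).
  rewrite -[leLHS]mul1r -(divff (speed_neq0 i)) -mulrA -e1 ler_wpM2l//.
  rewrite /raw_cutnorm (bigD1 (lshift m i))//= lerDl; apply: sumr_ge0 => e _.
  by apply: Int_ge0 => x; exact: normr_ge0.
have f2 : Int (fun x => `|onI (im \o repr (u i)) x|) <= c i * cutnorm ntau (imv (Vc u)).
  rewrite -[leLHS]mul1r -(divff (speed_neq0 i)) -mulrA -e2 ler_wpM2l//.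
  rewrite /raw_cutnorm (bigD1 (lshift m i))//= lerDl; apply: sumr_ge0 => e _.
  by apply: Int_ge0 => x; exact: normr_ge0.
by rewrite mulrDr; exact: lerD.
Qed.

End SemigroupOnL1.

Local Notation raw_nkap := nkap.
Local Notation raw_ntau := ntau.

Section ComplexNorm.
Variable R : realType.
Local Notation C := R[i].
Local Notation re := (@complex.Re R).

Lemma normCE (z : C) : `|z| = (normc z)%:C.
Proof. by case: z. Qed.

Lemma gt0_realC (e : C) : 0 < e -> e = (re e)%:C /\ 0 < re e.
Proof. by case: e => a b; rewrite ltcE /= => /andP[/eqP -> ?]. Qed.

(** For [|t| < pi / 4], [sin |t| = cos (pi / 2 - |t|) < cos |t|], the cosine being strictly
    decreasing on [[0, pi]]. *)
Lemma sector_cone (d : R) z : d <= pi / 4 -> sector d z -> cone z.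
Proof.
move=> dp [r [t [r0 td ->]]]; rewrite /cone /= normrM gtr0_norm// ltr_pM2l//.
have tp : `|t| < pi / 4 by exact: lt_le_trans td dp.
have p0 := pi_gt0 R.
have t0 := normr_ge0 t.
have -> : cos t = cos `|t| by case: (ger0P t) => _; rewrite ?cosN.
have -> : `|sin t| = sin `|t|.
  have s0 : 0 <= sin `|t| by apply: sin_ge0_pi; rewrite t0/=; apply: ltW; apply: lt_trans tp _; lra.
  by rewrite -(ger0_norm s0); case: (ger0P t) => _; rewrite ?sinN ?normrN.
rewrite -cosBpihalf -cosN opprB ltr_cos ?in_itv/=; move: tp t0 p0; move: `|t| (pi : R) => x p; last 2 first.
- by move=> *; apply/andP; split; lra.
- by move=> *; apply/andP; split; lra.
by move=> *; lra.
Qed.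

Lemma lmod_alg1 (V : lmodType C) (a : C) (x y z : V) :
  a *: (1 *: x + -1 *: y) + -1 *: z = a *: (x - y) - z.
Proof. by rewrite scale1r !scaleN1r. Qed.

Lemma lmod_alg2 (V : lmodType C) (h : C) (x y z : V) :
  1 *: (1 *: x + -1 *: y) + 1 *: (- h *: z + 0 *: z) = x - y - h *: z.
Proof. by rewrite !scale1r scaleN1r scale0r addr0 scaleNr. Qed.

End ComplexNorm.

(** * The analytic semigroup and its generator *)

Section HeatSemigroup.
Variables (R : realType) (m : nat) (sigma : 'I_m -> R).
Hypothesis sigma_gt0 : forall i, 0 < sigma i.
Variables (K00 K01 K10 K11 : 'M[R]_m).
Local Notation C := R[i].
Local Notation re := (@complex.Re R).
Local Notation im := (@complex.Im R).
Local Notation X := (L1vec R m).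
Local Notation n := (m + m)%N.
Implicit Types (u v : X) (z w : C) (g : R -> C).

Local Notation nbar := (@nbar m).
Local Notation ntau := (ntau sigma).
Local Notation nkap := (nkap sigma K00 K01 K10 K11).
Local Notation cdat := (cdat nbar ntau).
Local Notation cae := (cae ntau).
Local Notation csz := (csz ntau).
Local Notation crop := (crop nbar ntau nkap).
Local Notation cekern := (cekern ntau nkap).
Local Notation wt := (wt ntau nkap).
Local Notation Vc := (Vc sigma).
Local Notation Lv := (Lv sigma).

Let bK := @nbarK m.
Let t0 := ntau_gt0 sigma_gt0.
Let tb := ntau_bar sigma.

Lemma cae_eq (V W : 'I_n -> R -> C) : (forall e s, V e s = W e s) -> cae V W.
Proof. by move=> VW e; apply: filterS (@aeneq R 0) => s _ _ _; exact: VW. Qed.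

Lemma cae_clin (a b : C) (V V' W W' : 'I_n -> R -> C) : cae V V' -> cae W W' ->
  cae (clin a V b W) (clin a V' b W').
Proof.
move=> h1 h2 e; apply: filterS2 (h1 e) (h2 e) => s e1 e2 s0 s1.
by rewrite /clin (e1 s0 s1) (e2 s0 s1).
Qed.

Definition Lop g u : X := Lv (crop g (Vc u)).

Lemma Vc_Lop g u : cekern g -> cae (Vc (Lop g u)) (crop g (Vc u)).
Proof.
move=> eg; exact (Vc_Lv sigma_gt0 (crop_cdat bK t0 tb eg (Vc_cdat sigma_gt0 u))).
Qed.

Lemma Lop_lin g (a b : C) u v : cekern g ->
  Lop g (a *: u + b *: v) = a *: Lop g u + b *: Lop g v.
Proof.
move=> eg; apply: (Vc_inj sigma_gt0).
have du := Vc_cdat sigma_gt0 u; have dv := Vc_cdat sigma_gt0 v.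
apply: cae_trans (Vc_Lop _ eg) _.
apply: (@cae_trans _ _ _ _ (clin a (crop g (Vc u)) b (crop g (Vc v)))).
  apply: cae_eq => e s.
  apply: etrans (crop_ae bK t0 tb e s eg (Vc_cdat sigma_gt0 _) (cdat_clin a b du dv) (Vc_lin sigma_gt0 a b u v)) _.
  exact (crop_lin bK t0 tb a b e s eg du dv).
apply: cae_sym; apply: cae_trans (Vc_lin sigma_gt0 a b _ _) _.
by apply: cae_clin; exact: Vc_Lop.
Qed.

Lemma Lop_bound : exists2 Q, 0 <= Q & forall g (M : R) u, cekern g ->
  (forall r, normc (g r) <= M * ew (wt + 1) r) -> nrm (Lop g u) <= Q * M * nrm u.
Proof.
have [Q1 Q10 H1] := csz_nrm sigma_gt0; have [Q2 Q20 H2] := nrm_csz sigma_gt0.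
have C0 := Cop_ge0 ntau nkap.
have C4 : 0 <= 4 * Cop ntau nkap := mulr_ge0 (ler0n _ 4) C0.
exists (Q2 * (4 * Cop ntau nkap) * Q1); first exact: mulr_ge0 (mulr_ge0 Q20 C4) Q10.
move=> g M u eg gM; have du := Vc_cdat sigma_gt0 u.
have M0 : 0 <= M.
  have := le_trans (normc_ge0 _) (gM 0); rewrite pmulr_lge0//; exact: ew_gt0.
apply: le_trans (H2 _) _.
rewrite (csz_cae (Vc_cdat sigma_gt0 _) (crop_cdat bK t0 tb eg du) (Vc_Lop _ eg)).
have h := crop_kernel_bound bK t0 tb eg du gM.
have -> : Q2 * (4 * Cop ntau nkap) * Q1 * M * nrm u =
  Q2 * (4 * Cop ntau nkap * M * (Q1 * nrm u)) by ring.
apply: ler_wpM2l => //; apply: le_trans h _; apply: ler_wpM2l (H1 u).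
exact: mulr_ge0 C4 M0.
Qed.

Lemma Lop_comp g k q u : cekern g -> cekern k -> cekern q ->
  kern (wt + 1 + 1) (re \o g) -> kern (wt + 1 + 1) (im \o g) ->
  (forall x, conv (re \o g) (re \o k) x - conv (im \o g) (im \o k) x = re (q x) /\
     conv (re \o g) (im \o k) x + conv (im \o g) (re \o k) x = im (q x)) ->
  Lop g (Lop k u) = Lop q u.
Proof.
move=> eg ek eq kr ki h; apply: (Vc_inj sigma_gt0).
have du := Vc_cdat sigma_gt0 u.
apply: cae_trans (Vc_Lop _ eg) _; apply: cae_sym; apply: cae_trans (Vc_Lop _ eq) _.
apply: cae_eq => e s; apply: esym.
apply: etrans (crop_ae bK t0 tb e s eg (Vc_cdat sigma_gt0 _) (crop_cdat bK t0 tb ek du) (Vc_Lop u ek)) _.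
exact (crop_comp bK t0 tb e s eg ek eq du kr ki h).
Qed.

Lemma cekern_bound g (M : R) : cmf g -> (forall r, g (- r) = g r) ->
  (forall r, normc (g r) <= M * ew (wt + 1) r) -> cekern g.
Proof.
move=> [gr gi] ge gM; split; split.
- by split => //; exists M => r; exact: le_trans (re_le _) (gM r).
- by move=> r; rewrite /= ge.
- by split => //; exists M => r; exact: le_trans (im_le _) (gM r).
- by move=> r; rewrite /= ge.
Qed.

Local Opaque Lop.
Definition hk z := gk (ga z).

Lemma hk_kern l z : cone z -> kern l (re \o hk z) /\ kern l (im \o hk z).
Proof. by move=> /ga_cone cz; split; [exact: gk_kern_re|exact: gk_kern_im]. Qed.

Lemma hk_cekern z : cone z -> cekern (hk z).
Proof.
move=> cz; have [h1 h2] := hk_kern (wt + 1) cz.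
by split; split => // r; rewrite /= /hk gk_even.
Qed.

(** The identity outside the cone is a convention; it gives the required value at [z = 0], which
    does not belong to the cone. *)
Definition Tz z u : X := if `[< cone z >] then Lop (hk z) u else u.

Lemma Tz_cone z u : cone z -> Tz z u = Lop (hk z) u.
Proof. by move=> cz; rewrite /Tz asboolT. Qed.

Lemma Tz_linear z : linear (Tz z).
Proof.
move=> a u v; rewrite /Tz; case: asboolP => // cz.
by have := Lop_lin a 1 u v (hk_cekern cz); rewrite !scale1r.
Qed.
HB.instance Definition _ z := GRing.isLinear.Build C X X *:%R (Tz z) (Tz_linear z).

(** The proof of [cekern g] is an argument so that a linear structure, available for such kernels,
    can be attached. *)
Definition Lopl g of cekern g := Lop g.
Lemma Lopl_linear g (eg : cekern g) : linear (Lopl eg).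
Proof. by move=> a u v; have := Lop_lin a 1 u v eg; rewrite !scale1r. Qed.
HB.instance Definition _ g (eg : cekern g) :=
  GRing.isLinear.Build C X X *:%R (Lopl eg) (Lopl_linear eg).

Definition heat_op z : {linear X -> X} := Tz z.

Lemma bounded_continuous (f : {linear X -> X}) (M : R) :
  (forall u, nrm (f u) <= M * nrm u) -> continuous f.
Proof.
move=> fM; apply: bounded_linear_continuous; apply/linear_boundedP.
exists M%:C; split; first by rewrite complex_real.
move=> r Mr u; rewrite !nrmE; apply: (@le_trans _ _ (M%:C * (nrm u)%:C)).
  by rewrite -rmorphM lecR.
by apply: ler_wpM2r; [rewrite lecR nrm_ge0|exact: ltW].
Qed.

Lemma Lopl_continuous g (eg : cekern g) (M : R) :
  (forall r, normc (g r) <= M * ew (wt + 1) r) -> continuous (Lopl eg).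
Proof.
move=> gM; have [Q Q0 H] := Lop_bound.
by apply: (@bounded_continuous _ (Q * M)) => u; exact: H.
Qed.

Lemma Tz_continuous z : cone z -> continuous (Tz z).
Proof.
move=> cz; have [Q Q0 H] := Lop_bound.
have [M M0 gM] := gk_bound (wt + 1) (ga_cone cz).
apply: (@bounded_continuous (heat_op z) (Q * M)) => u.
by rewrite /heat_op /= Tz_cone//; apply: H => //; exact: hk_cekern.
Qed.

Lemma Tz_add z w u : cone z -> cone w -> Tz (z + w) u = Tz z (Tz w u).
Proof.
move=> cz cw; have [kr ki] := hk_kern (wt + 1 + 1) cz.
have [al cal [al2 alE]] := ga_sum cz cw.
have conv_hk x : conv (re \o hk z) (re \o hk w) x - conv (im \o hk z) (im \o hk w) x = re (hk (z + w) x) /\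
    conv (re \o hk z) (im \o hk w) x + conv (im \o hk z) (re \o hk w) x = im (hk (z + w) x).
  by rewrite {5 10}/hk -alE; exact: gk_conv (ga_cone cz) (ga_cone cw) cal al2.
have E := Lop_comp u (hk_cekern cz) (hk_cekern cw) (hk_cekern (coneD cz cw)) kr ki conv_hk.
exact (etrans (Tz_cone u (coneD cz cw)) (esym (etrans (congr1 (Tz z) (Tz_cone u cw))
  (etrans (Tz_cone _ cz) E)))).
Qed.

(** Chain rule: [- (2 * ga z ^+ 3)] is the derivative of [ga], and [gk'] that of [gk] in its
    parameter. *)
Definition hk' z r := - (2 * ga z ^+ 3) * gk' (ga z) r.

Lemma hk'_bound z : cone z -> exists2 M, 0 <= M &
  forall r, normc (hk' z r) <= M * ew (wt + 1) r.
Proof.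
move=> cz; have A0 : 0 < re (ga z ^+ 2) by rewrite ga2; exact/cone_gt0/cone4.
have [M M0 H] := gk'_bound (wt + 1) (ga_cone cz) A0.
exists (normc (- (2 * ga z ^+ 3)) * M); first by rewrite mulr_ge0// normc_ge0.
by move=> r; rewrite /hk' normcM -mulrA ler_wpM2l// normc_ge0.
Qed.

Lemma hk'_cekern z : cone z -> cekern (hk' z).
Proof.
move=> cz; have [M M0 H] := hk'_bound cz; apply: cekern_bound H.
  have [d1 d2] := gk'_cmf (ga z); set cc := - (2 * ga z ^+ 3); split.
    rewrite (_ : re \o hk' z = fun r => re cc * re (gk' (ga z) r) - im cc * im (gk' (ga z) r)).
      exact: mfB (mfM (mf_cst (re cc)) d1) (mfM (mf_cst (im cc)) d2).
    by apply/funext => r; exact: reM.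
  rewrite (_ : im \o hk' z = fun r => re cc * im (gk' (ga z) r) + im cc * re (gk' (ga z) r)).
    exact: mfD (mfM (mf_cst (re cc)) d2) (mfM (mf_cst (im cc)) d1).
  by apply/funext => r; exact: imM.
by move=> r; rewrite /hk' gk'_even.
Qed.

Lemma Lop_ker a g b k u : cekern g -> cekern k ->
  Lop (fun r => a * g r + b * k r) u = a *: Lop g u + b *: Lop k u.
Proof.
move=> eg ek; apply: (Vc_inj sigma_gt0); have du := Vc_cdat sigma_gt0 u.
apply: cae_trans (Vc_Lop _ (cekern_lin a b eg ek)) _.
apply: (@cae_trans _ _ _ _ (clin a (crop g (Vc u)) b (crop k (Vc u)))).
  apply: cae_eq => e s; exact (crop_kerlin bK t0 a b e s eg ek du).
apply: cae_sym; apply: cae_trans (Vc_lin sigma_gt0 a b _ _) _.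
by apply: cae_clin; exact: Vc_Lop.
Qed.

Lemma near0_complex (P : C -> Prop) (d : R) : 0 < d ->
  (forall h, normc h < d -> P h) -> \forall h \near (0 : C^o), P h.
Proof.
move=> d0 H; apply/nbhs_normP; exists d%:C => /=; first by rewrite ltcR.
by move=> h /=; rewrite sub0r normrN normCE ltcR; exact: H.
Qed.

(** The remainder is itself the operator of a kernel, the second-order remainder of [heat_diff], so
    [Lop_bound] yields an estimate of order [|h|^2] in operator norm. *)
Lemma Tz_holomorphic z : cone z -> op_holomorphic_at heat_op z.
Proof.
move=> cz; have eg' := hk'_cekern cz; have [M' M0' H'] := hk'_bound cz.
exists (Lopl eg'); first exact: Lopl_continuous H'.
move=> e /gt0_realC[-> e0]; set e' := re e in e0 *.
have [Q Q0 HQ] := Lop_bound.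
have [M M0 [eta eta0 H]] := heat_diff (wt + 1) cz.
have c0 : 0 < Q * M + 1 by rewrite ltr_wpDl// mulr_ge0.
apply: (@near0_complex _ (Num.min eta (e' / (Q * M + 1)))); first by rewrite lt_min eta0 divr_gt0.
move=> h; rewrite lt_min => /andP[/H [czh hb] he] u.
(* The term with coefficient 0 only completes the remainder to a combination of two binary
   combinations of kernels. *)
have eD := cekern_lin 1 1 (cekern_lin 1 (-1) (hk_cekern czh) (hk_cekern cz)) (cekern_lin (- h) 0 eg' eg').
have E : heat_op (z + h) u - heat_op z u - h *: Lopl eg' u =
    Lop (fun r => 1 * (1 * hk (z + h) r + -1 * hk z r) + 1 * (- h * hk' z r + 0 * hk' z r)) u.
  rewrite (Lop_ker 1 1 _ (cekern_lin 1 (-1) (hk_cekern czh) (hk_cekern cz)) (cekern_lin (- h) 0 eg' eg')).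
  rewrite (Lop_ker _ _ _ (hk_cekern czh) (hk_cekern cz)) (Lop_ker _ _ _ eg' eg').
  apply: esym; apply: etrans (lmod_alg2 h _ _ _) _.
  exact (congr2 (fun x y => x - y - h *: Lop (hk' z) u) (esym (Tz_cone u czh)) (esym (Tz_cone u cz))).
rewrite E !nrmE normCE -!rmorphM lecR.
have := HQ _ (M * normc h ^+ 2) u eD.
have nh := normc_ge0 h; have nu := nrm_ge0 u.
move=> HD; apply: le_trans (HD _) _.
  move=> r; have := hb r; rewrite /hk' /hk; congr (_ <= _); congr normc; ring.
apply: ler_wpM2r => //; rewrite expr2 !mulrA ler_wpM2r//.
move: he; rewrite ltr_pdivlMr// => /ltW; apply: le_trans.
by rewrite mulrC ler_wpM2l// lerDl.
Qed.

Lemma hk_cInt z : cone z -> cInt (hk z) = 1.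
Proof. by move=> cz; exact: gk_mass (ga_cone cz). Qed.

Lemma csz_Vc_clin (a b : C) u v (V W : 'I_n -> R -> C) : cdat V -> cdat W ->
  cae (Vc u) V -> cae (Vc v) W ->
  csz (Vc (a *: u + b *: v)) = csz (clin a V b W).
Proof.
move=> dV dW uV vW; apply: csz_cae; [exact: Vc_cdat|exact: cdat_clin|].
exact: cae_trans (Vc_lin sigma_gt0 a b u v) (cae_clin a b uV vW).
Qed.

Lemma cae_refl (V : 'I_n -> R -> C) : cae V V.
Proof. exact: cae_eq. Qed.

(** Throughout the cone the kernel at time [z] has scale [sqrt |z|] with the same constant [expR 2]
    from [heat_bound], so [crop_approx] gives convergence uniformly in the argument of [z]. *)
Lemma Tz_small u (eta : R) : 0 < eta -> exists2 d, 0 < d &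
  forall z, cone z -> normc z < d -> nrm (Tz z u - u) <= eta.
Proof.
move=> eta0; have [Q Q0 HQ] := nrm_csz sigma_gt0.
have Q1 : 0 < Q + 1 by rewrite ltr_wpDl.
have du := Vc_cdat sigma_gt0 u.
have [E E0 EP] := crop_approx nkap bK t0 du (divr_gt0 eta0 Q1) (expR_ge0 2).
exists (E ^+ 2); first by rewrite exprn_gt0.
move=> z cz zE; have eg := hk_cekern cz.
have z0 : 0 < normc z by apply: lt_le_trans (re_le_normc z); exact: cone_gt0.
have s0 : 0 < Num.sqrt (normc z) by rewrite sqrtr_gt0.
have sE : Num.sqrt (normc z) < E.
  rewrite -(ltr_pXn2r (n := 2))// ?nnegrE ?(ltW s0) ?(ltW E0)//.
  by rewrite sqr_sqrtr ?(ltW z0).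
have bd r : normc (hk z r) <= expR 2 / Num.sqrt (normc z) * ew (Num.sqrt (normc z))^-1 r.
  apply: le_trans (heat_bound r cz) _; rewrite /ew normrM [`|_^-1|]ger0_norm ?invr_ge0 ?(ltW s0)//.
  by rewrite mul1r (mulrC `|r|).
have := EP _ _ s0 sE eg (hk_cInt cz) bd.
have -> : csz (clin 1 (crop (hk z) (Vc u)) (-1) (Vc u)) = csz (Vc (Tz z u - u)).
  rewrite -(csz_Vc_clin 1 (-1) (crop_cdat bK t0 tb eg du) du (Vc_Lop u eg) (cae_refl _)).
  by rewrite scale1r scaleN1r Tz_cone.
move=> h; apply: le_trans (HQ _) _; apply: le_trans (ler_wpM2l Q0 h) _.
by rewrite mulrCA ler_piMr ?(ltW eta0)// ler_pdivrMr// mul1r lerDl.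
Qed.

Lemma heat_analytic : analytic_semigroup (pi / 4) heat_op.
Proof.
have sc := @sector_cone R _ _ (lexx (pi / 4)).
split.
- by move=> z /sc cz; exact: Tz_continuous.
- move=> u; rewrite /heat_op /= /Tz asboolF//.
  by rewrite /cone /= normr0 ltxx.
- by move=> z w /sc cz /sc cw u; exact: Tz_add.
- by move=> z /sc cz; exact: Tz_holomorphic.
move=> d' /andP[_ d'p] u; apply/cvgrPdist_le => e /gt0_realC[-> e0].
have [d d0 dP] := Tz_small u e0.
apply: (near0_complex d0) => z zd sz; have cz := sector_cone (ltW d'p) sz.
by rewrite distrC nrmE lecR; exact: dP.
Qed.

Lemma heat_generator u f : generator heat_op (u, f) <->
  cgen nbar ntau nkap (fun h => hk h%:C) (Vc u) (Vc f).
Proof.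
have du := Vc_cdat sigma_gt0 u; have df := Vc_cdat sigma_gt0 f.
have [Q1 Q10 H1] := csz_nrm sigma_gt0; have [Q2 Q20 H2] := nrm_csz sigma_gt0.
pose D (h : R) := (h%:C)^-1 *: (heat_op h%:C u - u) - f.
have E h : 0 < h -> csz (clin (h^-1)%:C (clin 1 (crop (hk h%:C) (Vc u)) (-1) (Vc u)) (-1) (Vc f)) =
    csz (Vc (D h)).
  move=> h0; have cz := cone_real h0; have eg := hk_cekern cz.
  have dc := crop_cdat bK t0 tb eg du.
  have c1 := cae_trans (Vc_lin sigma_gt0 1 (-1) (Lop (hk h%:C) u) u)
    (cae_clin 1 (-1) (Vc_Lop u eg) (cae_refl (Vc u))).
  have e1 := csz_Vc_clin (h^-1)%:C (-1) (cdat_clin 1 (-1) dc du) df c1 (cae_refl (Vc f)).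
  have e2 : (h^-1)%:C *: (1 *: Lop (hk h%:C) u + -1 *: u) + -1 *: f = D h.
    apply: etrans (lmod_alg1 (h^-1)%:C _ _ _) _; rewrite /D fmorphV.
    exact (congr1 (fun x => (h%:C)^-1 *: (x - u) - f) (esym (Tz_cone u cz))).
  exact (etrans (esym e1) (congr1 (fun x : X => csz (Vc x)) e2)).
split=> [/cvgrPdist_le gen eta eta0|gen].
  have Q1' : 0 < Q1 + 1 by rewrite ltr_wpDl.
  have e0 : 0 < (eta / (Q1 + 1))%:C by rewrite ltcR divr_gt0.
  have [d /= d0 dP] := gen _ e0.
  exists d => // h h0 hd; rewrite (E h h0); apply: le_trans (H1 _) _.
  have := dP h; rewrite /= sub0r normrN gtr0_norm// => /(_ hd h0).
  rewrite distrC nrmE lecR -/(D h) => hD.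
  apply: le_trans (ler_wpM2l Q10 hD) _.
  by rewrite mulrCA ler_piMr ?(ltW eta0)// ler_pdivrMr// mul1r lerDl.
apply/cvgrPdist_le => e /gt0_realC[-> e0].
have Q2' : 0 < Q2 + 1 by rewrite ltr_wpDl.
have [h0 h00 hP] := gen _ (divr_gt0 e0 Q2').
exists h0 => //= h; rewrite /= sub0r normrN => hh hp; rewrite gtr0_norm// in hh.
rewrite distrC nrmE lecR -/(D h); apply: le_trans (H2 _) _; rewrite -(E h hp).
apply: le_trans (ler_wpM2l Q20 (hP h hp hh)) _.
by rewrite mulrCA ler_piMr ?(ltW e0)// ler_pdivrMr// mul1r lerDl.
Qed.

Lemma heat_kernels : heat_family (fun h => re \o hk h%:C) (expR 2).
Proof.
move=> h h0; have cz := cone_real h0; split.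
- by move=> l; exact: (hk_kern l cz).1.
- by move=> r; exact: (congr1 re (gk_even (ga h%:C) r)).
- move=> r; have nh : normc h%:C = h by rewrite normcR gtr0_norm.
  have s0 : 0 < Num.sqrt h by rewrite sqrtr_gt0.
  apply: le_trans (re_le _) _; apply: le_trans (heat_bound r cz) _; rewrite nh.
  by rewrite /ew normrM [`|_^-1|]ger0_norm ?invr_ge0 ?(ltW s0)// mul1r (mulrC `|r|).
- by have := hk_cInt cz => -[].
- exact: heat_second_moment.
Qed.

Lemma heat_generator_nsol u f : generator heat_op (u, f) <->
  nsol nbar ntau nkap (rev (Vc u)) (rev (Vc f)) /\
  nsol nbar ntau nkap (imv (Vc u)) (imv (Vc f)).
Proof.
apply: (iff_trans (heat_generator u f)).
apply: (cgen_nsol bK t0 tb (expR_ge0 2) heat_kernels) => //.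
- by move=> h h0 r; exact: heat_real_im.
- by move=> h h0; apply: hk_cekern; exact: cone_real.
- exact: Vc_cdat.
- exact: Vc_cdat.
Qed.

End HeatSemigroup.

(** * Identification of the generator *)

Section Traces.
Variable R : realType.
Local Notation C := R[i].
Local Notation re := (@complex.Re R).
Local Notation im := (@complex.Im R).
Local Notation mu := (@lebesgue_measure R).
Local Notation I := (@unitI R).
Implicit Types (h : R -> R) (x y : R).

Lemma wi0 h : ig h -> wi 0 h.
Proof. by apply: ig_ext => x; rewrite /ew mul0r oppr0 expR0 mulr1. Qed.

Lemma prim_within h : ig h -> {within I, continuous (prim h)}.
Proof.
move=> hi; have h1 : mu.-integrable `[0, 1] (EFin \o h) by exact: integrableS hi.
apply: subspace_eq_continuous (parameterized_integral_continuous ler01 h1) => x.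
rewrite inE /= in_itv/= => /andP[x0 _].
by apply: esym; exact: prim_itv x0 (ig_mf hi).
Qed.

Lemma within_affine (a b : R) h : {within I, continuous h} ->
  {within I, continuous (fun x => a + b * x + h x)}.
Proof.
move=> hc; apply: (within_continuousD (f := fun x : R => a + b * x)) hc.
apply: continuous_subspaceT => x; apply: cvgD; first exact: cvg_cst.
by apply: cvgM; [exact: cvg_cst|exact: cvg_id].
Qed.

Lemma trace_of (u : L1 R) (gr gi : R -> R) x : unitI x ->
  {within I, continuous gr} -> {within I, continuous gi} ->
  (\forall y \ae mu, unitI y -> repr u y = gr y +i* gi y) ->
  trace u x (gr x +i* gi x).
Proof.
move=> Ix rc ic ug; exists (fun y => gr y +i* gi y : R[i]^o); split => //.
apply/subspace_continuousP => y Iy.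
apply/cvgrPdist_lt => e /gt0_realC[-> e0].
have e2 : 0 < re e / 2 by rewrite divr_gt0.
have /subspace_continuousP/(_ y Iy)/cvgrPdist_lt/(_ _ e2) H1 := rc.
have /subspace_continuousP/(_ y Iy)/cvgrPdist_lt/(_ _ e2) H2 := ic.
apply: filterS2 H1 H2 => t h1 h2; rewrite normCE ltcR.
apply: le_lt_trans (normc_le _) _ => /=; rewrite (splitr (re e)).
exact: ltrD.
Qed.

Lemma ae_itv_absurd (P : R -> Prop) (a b : R) : a < b ->
  (\forall y \ae mu, P y) -> (forall y, a <= y -> y <= b -> ~ P y) -> False.
Proof.
move=> ab [N [mN N0 NP]] nP.
have : (mu `[a, b] <= mu N)%E.
  apply: le_measure; rewrite ?inE//.
  by move=> y /=; rewrite in_itv/= => /andP[y1 y2]; apply: NP; exact: nP.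
by rewrite N0 lebesgue_measure_itv/= lte_fin ab -EFinB lee_fin subr_le0 leNgt ab.
Qed.

(** Continuous representatives agree almost everywhere on the interval; if they differed at an end
    point, they would differ on a one-sided interval of positive measure. *)
Lemma trace_unique (u : L1 R) x (a b : C) : (x == 0) || (x == 1) ->
  trace u x a -> trace u x b -> a = b.
Proof.
move=> x01 [g1 [c1 e1 <-]] [g2 [c2 e2 <-]]; apply: contrapT => /eqP ne.
have Ix : I x by apply/unitIE; case/orP: x01 => /eqP ->; rewrite lexx ler01.
have d0 : 0 < `|g1 x - g2 x| / 2 by rewrite divr_gt0// normr_gt0 subr_eq0.
have /subspace_continuousP/(_ x Ix)/cvgrPdist_lt/(_ _ d0) H1 := c1.
have /subspace_continuousP/(_ x Ix)/cvgrPdist_lt/(_ _ d0) H2 := c2.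
have [d /= dp dP] : exists2 d : R, 0 < d & forall y, `|x - y| < d -> I y -> g1 y <> g2 y.
  have [d dp dP] := filterI H1 H2; exists d => // y xy Iy E.
  have [h1 h2] := dP y xy Iy.
  have := ler_normB (g1 x - g1 y) (g2 x - g2 y).
  have -> : g1 x - g1 y - (g2 x - g2 y) = g1 x - g2 x by rewrite E; ring.
  move=> /le_lt_trans /(_ (ltrD h1 h2)).
  by rewrite -splitr ltxx.
have ee : \forall y \ae mu, I y -> g1 y = g2 y.
  by apply: filterS2 e1 e2 => y h1 h2 Iy; rewrite -h1// h2.
(* Halving the minimum keeps the interval inside [[0, 1]] and strictly within the radius [d]. *)
pose t := Num.min d 1 / 2.
have m0 : 0 < Num.min d 1 by rewrite lt_min dp ltr01.
have t0 : 0 < t by rewrite divr_gt0.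
have [td t1] : t < d /\ t < 1.
  by apply/andP; rewrite -lt_min /t ltr_pdivrMr// ltr_pMr// ltr1n.
case/orP: x01 => /eqP x0; rewrite x0 in dP.
  apply: (ae_itv_absurd t0 ee) => y y0 yt /(_ _) E.
  apply: (dP y); last apply: E.
  - by rewrite sub0r normrN ger0_norm//; exact: le_lt_trans yt td.
  - by apply/unitIE; rewrite y0 (le_trans yt)// ltW.
  - by apply/unitIE; rewrite y0 (le_trans yt)// ltW.
have t1' : 1 - t < 1 by rewrite gtrBl.
apply: (ae_itv_absurd t1' ee) => y y0 yt /(_ _) E.
have Iy : I y by apply/unitIE; rewrite yt andbT; apply: le_trans y0; rewrite subr_ge0 ltW.
apply: (dP y _ Iy (E Iy)).
rewrite ger0_norm ?subr_ge0//; apply: le_lt_trans td; lra.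
Qed.

(** Test functions are real, so the two parts of the defining identity separate. *)
Lemma wderiv_complex (u v : L1 R) : weak_derivative u v <->
  wderiv (re \o repr u) (re \o repr v) /\ wderiv (im \o repr u) (im \o repr v).
Proof.
have E1 (p : C -> R) (w : L1 R) (phi : R -> R) : (forall z (r : R), p (z * r%:C) = p z * r) ->
   \int[mu]_(x in I) p (repr w x * (phi x)%:C) = Int (fun x => onI (p \o repr w) x * phi x).
  move=> pM; rewrite Rintegral_onI; apply: Int_ext => x.
  by rewrite /onI pM /= mulrAC.
have rM z (r : R) : re (z * r%:C) = re z * r by case: z => a b /=; ring.
have iM z (r : R) : im (z * r%:C) = im z * r by case: z => a b /=; ring.
have E (w : L1 R) (phi : R -> R) : cintegral (fun x => repr w x * (phi x)%:C) =
    Int (fun x => onI (re \o repr w) x * phi x) +i* Int (fun x => onI (im \o repr w) x * phi x).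
  by rewrite /cintegral (E1 re)// (E1 im).
split=> [H|[H1 H2] phi tphi]; last by rewrite !E H1// H2.
by split=> phi /H; rewrite !E => -[].
Qed.

End Traces.

(** * From the network back to the unit interval *)

Section StrongForm.
Variables (R : realType) (m : nat) (sigma : 'I_m -> R).
Hypothesis sigma_gt0 : forall i, 0 < sigma i.
Variables (K00 K01 K10 K11 : 'M[R]_m).
Local Notation n := (m + m)%N.
Implicit Types (U F : 'I_m -> R -> R) (i j : 'I_m) (s x : R) (p q : 'I_m -> R).

Local Notation c := (speed sigma).
Local Notation nbar := (@nbar m).
Local Notation ntau := (ntau sigma).
Local Notation nkap := (nkap sigma K00 K01 K10 K11).
Local Notation nsol := (nsol nbar ntau nkap).
Local Notation ext := (ext nbar ntau nkap).
Local Notation data := (data ntau).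
Local Notation compat := (compat nbar ntau).

Let bK := @nbarK m.
Let t0 := ntau_gt0 sigma_gt0.
Let tb := ntau_bar sigma.
Let c0 i : 0 < c i := speed_gt0 sigma_gt0 i.
Let cn0 i : c i != 0 := speed_neq0 sigma_gt0 i.

Definition net U (e : 'I_n) s := U (idx e) (npt sigma e s).
Definition pr1 F i := prim (onI (fun x => (sigma i)^-1 * F i x)).
Definition pr2 F i := prim (pr1 F i).

(** [nsol] in the original variable: [p] and [q] are value and slope at 0, and the two systems are
    the boundary conditions at 0 and at 1, with the values at 1 expressed by the twofold
    primitive. *)
Definition strong U F := exists p q,
  [/\ forall i, aeq (onI (U i)) (onI (fun x => p i + q i * x + pr2 F i x)),
      forall i, q i = \sum_j K00 i j * p j + \sum_j K01 i j * (p j + q j + pr2 F j 1) &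
      forall i, q i + pr1 F i 1 =
        \sum_j K10 i j * p j + \sum_j K11 i j * (p j + q j + pr2 F j 1)].

Lemma prim_scale (h : R -> R) (a : R) s : 0 < a -> (forall t, ig (fun r => h r * chi t r)) ->
  prim h (a * s) = prim (fun r => a * h (a * r)) s.
Proof.
move=> a0 hi; have an0 : a != 0 by rewrite gt_eqF.
have i1 := ig_affine 0 an0 (hi (a * s)).
have h1 := Int_affine 0 an0 (hi (a * s)); rewrite (gtr0_norm a0) in h1.
have E r : a * h (a * r) * chi s r = a * (h (a * r + 0) * chi (a * s) (a * r + 0)).
  have -> : chi (a * s) (a * r + 0) = chi s r.
    by rewrite addr0 /chi ler_pM2l//; congr (_ - _%:R); rewrite pmulr_rle0.
  by rewrite addr0 mulrA.
by rewrite /prim (Int_ext E) (IntZ _ i1) h1 mulrA divff// mul1r.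
Qed.

Lemma prim_local (h k : R -> R) s (t : R) : 0 <= s -> s <= t ->
  (forall r, 0 <= r -> r <= t -> h r = k r) -> prim h s = prim k s.
Proof.
move=> s0 st hk; apply: Int_ext => r; rewrite /chi.
case: (leP r 0) => r0; first by rewrite (le_trans r0 s0) subrr !mulr0.
case: (leP r s) => rs; last by rewrite subr0 !mulr0.
by rewrite (hk r (ltW r0) (le_trans rs st)).
Qed.

Lemma net_data U : (forall i, ig (onI (U i))) -> data (net U).
Proof.
move=> Ui e; have := ig_affine (norg R e) (nslope_neq0 sigma_gt0 e) (Ui (idx e)).
apply: ig_ext => s; rewrite /raw_cut /onI -npt_affine npt_in//.
Qed.

Lemma net_compat U : compat (net U).
Proof. by move=> e s _ _; rewrite /net idx_bar npt_bar. Qed.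

Lemma speed_sqr i : c i * c i = sigma i.
Proof. by rewrite -expr2 sqr_sqrtr// ltW. Qed.

Section Primitives.
Variable F : 'I_m -> R -> R.
Hypothesis Fi : forall i, ig (onI (F i)).

Let tl i : ntau (lshift m i) = (c i)^-1. Proof. by rewrite /raw_ntau idx_l. Qed.

Let fi i : ig (onI (fun x => (sigma i)^-1 * F i x)).
Proof. by have := igZ (sigma i)^-1 (Fi i); apply: ig_ext => x; rewrite /onI mulrA. Qed.

Let Fd := net_data Fi.

Lemma ext_in (e : 'I_n) s : 0 <= s -> s <= ntau e -> ext (net F) e s = net F e s.
Proof.
move=> s0 st; have := cut_ext nbar nkap t0 (net F) e s.
by rewrite /raw_cut s0 st !mulr1.
Qed.

(** Change of variables [x = c i * s]; the square of the speed cancels [(sigma i)^-1], which leaves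
    one factor [c i]. *)
Lemma prim_ext1 i s : 0 <= s -> s <= ntau (lshift m i) ->
  prim (ext (net F) (lshift m i)) s = c i * pr1 F i (c i * s).
Proof.
move=> s0 st; have H := fi i.
have a1 : ig (fun r => c i * onI (fun x => (sigma i)^-1 * F i x) (c i * r)).
  apply: igZ; have := ig_affine 0 (cn0 i) H; apply: ig_ext => r; by rewrite addr0.
rewrite /pr1 (prim_scale s (c0 i) (fun t => ig_prim t (lexx 0) (wi0 H))).
rewrite -(primZ (c i) s (lexx 0) (wi0 a1)).
apply: (prim_local s0 st) => r r0 rt; rewrite ext_in// /net idx_l npt_l /onI.
have -> : (0 <= c i * r) && (c i * r <= 1).
  by rewrite -npt_l npt_in// r0.
rewrite mulr1 !mulrA speed_sqr divff ?mul1r// gt_eqF//.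
Qed.

Lemma pr1_wi i : wi 1 (pr1 F i).
Proof. exact: wi_prim (lexx 0) ltr01 (wi0 (fi i)). Qed.

Lemma prim_ext2 i s : 0 <= s -> s <= ntau (lshift m i) ->
  prim (prim (ext (net F) (lshift m i))) s = pr2 F i (c i * s).
Proof.
move=> s0 st; rewrite /pr2 (prim_scale s (c0 i) (fun t => ig_prim t ler01 (pr1_wi i))).
by apply: (prim_local s0 st) => r r0 rt; exact: prim_ext1.
Qed.

Lemma prim_ext_tau i : prim (ext (net F) (lshift m i)) (ntau (lshift m i)) = c i * pr1 F i 1 /\
  prim (prim (ext (net F) (lshift m i))) (ntau (lshift m i)) = pr2 F i 1.
Proof.
have e0 := ltW (t0 (lshift m i)); have E : c i * ntau (lshift m i) = 1 by rewrite tl divff.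
by rewrite (prim_ext1 e0 (lexx _)) (prim_ext2 e0 (lexx _)) E.
Qed.

Lemma nkap_sum (e : 'I_n) (b : 'I_n -> R) :
  \sum_f nkap e f * b f = \sum_j nkap e (lshift m j) * b (lshift m j) +
    \sum_j nkap e (rshift m j) * b (rshift m j).
Proof. by rewrite big_split_ord. Qed.

Lemma nkap_l i (b : 'I_n -> R) : \sum_f nkap (lshift m i) f * b f =
  c i * (\sum_j K00 i j * b (lshift m j) + \sum_j K01 i j * b (rshift m j)).
Proof.
rewrite nkap_sum mulrDr !mulr_sumr; congr (_ + _); apply: eq_bigr => j _.
  by rewrite /raw_nkap block_mxEul mxE mulrA.
by rewrite /raw_nkap block_mxEur mxE mulrA.
Qed.

Lemma nkap_r i (b : 'I_n -> R) : \sum_f nkap (rshift m i) f * b f =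
  - (c i * (\sum_j K10 i j * b (lshift m j) + \sum_j K11 i j * b (rshift m j))).
Proof.
rewrite nkap_sum mulrDr opprD !mulr_sumr -!sumrN; congr (_ + _); apply: eq_bigr => j _.
  by rewrite /raw_nkap block_mxEdl mxE mulNr mulrA.
by rewrite /raw_nkap block_mxEdr mxE mulNr mulrA.
Qed.

Lemma nsol_strong U : nsol (net U) (net F) -> strong U F.
Proof.
move=> [b [d [vW dk bb dd]]].
exists (fun i => b (lshift m i)), (fun i => (c i)^-1 * d (lshift m i)).
have br j : b (rshift m j) = b (lshift m j) + (c j)^-1 * d (lshift m j) + pr2 F j 1.
  have := bb (lshift m j); rewrite nbar_l => ->.
  by rewrite (prim_ext_tau j).2 tl (mulrC (d _)).
split => i.
- have ci : (c i)^-1 != 0 by rewrite invr_eq0.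
  have := ae_affine 0 ci (vW (lshift m i)); apply: filterS => x; rewrite addr0.
  set s := (c i)^-1 * x; have cs : c i * s = x by rewrite /s mulrA divff ?mul1r.
  rewrite /raw_cut /net -npt_in// idx_l npt_l cs /onI.
  case: (boolP (_ && _)) => [x01|_]; last by rewrite !mulr0.
  rewrite !mulr1 => ->; rewrite /affp.
  have /andP[s0 st] : (0 <= s) && (s <= ntau (lshift m i)) by rewrite -npt_in// npt_l cs.
  by rewrite (prim_ext2 s0 st) cs /s; ring.
- apply: (mulfI (cn0 i)); rewrite mulrA divff// mul1r dk nkap_l.
  by congr (_ * (_ + _)); apply: eq_bigr => j _; rewrite br.
- apply: (mulfI (cn0 i)); apply: oppr_inj.
  transitivity (d (rshift m i)).
    have := dd (lshift m i); rewrite nbar_l => ->; rewrite (prim_ext_tau i).1.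
    by rewrite mulrDr mulrA divff// mul1r opprD.
  rewrite dk nkap_r; congr (- (_ * (_ + _))); apply: eq_bigr => j _; by rewrite br.
Qed.

Lemma strong_nsol U : strong U F -> nsol (net U) (net F).
Proof.
move=> [p [q [UW E0 E1]]].
(* At a right end the value is that at [x = 1], and the slope is taken along the reversed edge,
   hence its sign. *)
pose b (e : 'I_n) := match fintype.split e with inl i => p i | inr i => p i + q i + pr2 F i 1 end.
pose d (e : 'I_n) := match fintype.split e with inl i => c i * q i | inr i => - (c i * (q i + pr1 F i 1)) end.
have bl i : b (lshift m i) = p i by rewrite /b split_l.
have br i : b (rshift m i) = p i + q i + pr2 F i 1 by rewrite /b split_r.
have dl i : d (lshift m i) = c i * q i by rewrite /d split_l.
have dr i : d (rshift m i) = - (c i * (q i + pr1 F i 1)) by rewrite /d split_r.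
have wtp : 0 <= wt ntau nkap := ltW (wt_gt0 nkap t0).
have Fw := ext_wiwt nkap bK t0 Fd.
have Fc := ext_symC nkap bK t0 tb (net_compat F).
have Fs := ext_symS nkap bK t0 Fd.
have bbl i : b (rshift m i) = b (lshift m i) + d (lshift m i) * ntau (lshift m i) +
    prim (prim (ext (net F) (lshift m i))) (ntau (lshift m i)).
  by rewrite (prim_ext_tau i).2 bl br dl tl mulrAC divff// mul1r.
have ddl i : d (rshift m i) = - d (lshift m i) - prim (ext (net F) (lshift m i)) (ntau (lshift m i)).
  by rewrite (prim_ext_tau i).1 dl dr mulrDr opprD.
have P1 i : prim (ext (net F) (rshift m i)) (ntau (lshift m i)) =
    prim (ext (net F) (lshift m i)) (ntau (lshift m i)).
  have -> : ext (net F) (rshift m i) = fun r => ext (net F) (lshift m i) (ntau (lshift m i) - r).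
    by apply/funext => r; rewrite -Fc nbar_l.
  by rewrite (prim_refl _ _ wtp (Fw (lshift m i))) subrr prim0 subr0.
have P2 i := prim2_symC (lshift m i) (ntau (lshift m i)) wtp Fw Fc.
have bb e : b (nbar e) = b e + d e * ntau e + prim (prim (ext (net F) e)) (ntau e).
  move: e; apply: endpointP => i; first by rewrite nbar_l bbl.
  have tr : ntau (rshift m i) = ntau (lshift m i) by rewrite -nbar_l tb.
  have := P2 i; rewrite nbar_l nbar_r tr => ->.
  by rewrite subrr prim0 bbl ddl; ring.
have dd e : d (nbar e) = - d e - prim (ext (net F) e) (ntau e).
  move: e; apply: endpointP => i; first by rewrite nbar_l ddl.
  have tr : ntau (rshift m i) = ntau (lshift m i) by rewrite -nbar_l tb.
  by rewrite nbar_r tr P1 ddl; ring.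
(* Consistency under reversal lets the formula on the right-hand copies be deduced from that on the
   left-hand ones. *)
have [_ /(_ (conj bb dd)) sW] := affp_symC b d wtp Fw Fc.
have al i s : 0 <= s -> s <= ntau (lshift m i) ->
    affp b d (ext (net F)) (lshift m i) s = p i + q i * (c i * s) + pr2 F i (c i * s).
  by move=> s0 st; rewrite /affp (prim_ext2 s0 st) bl dl; ring.
exists b, d; split.
- apply: endpointP => i.
    have := ae_affine 0 (cn0 i) (UW i); apply: filterS => s; rewrite addr0 => h.
    rewrite /raw_cut; case: (boolP (_ && _)) => [/andP[s0 st]|_]; last by rewrite !mulr0.
    rewrite !mulr1 al// /net idx_l npt_l; move: h; rewrite /onI.
    have -> : (0 <= c i * s) && (c i * s <= 1) by rewrite -npt_l npt_in// s0.
    by rewrite !mulr1.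
  have tr : ntau (rshift m i) = ntau (lshift m i) by rewrite -nbar_l tb.
  have cn : - c i != 0 by rewrite oppr_eq0.
  have := ae_affine 1 cn (UW i); apply: filterS => s.
  have -> : - c i * s + 1 = 1 - c i * s by ring.
  move=> h; rewrite /raw_cut; case: (boolP (_ && _)) => [/andP[s0 st]|_]; last by rewrite !mulr0.
  rewrite !mulr1 /net idx_r npt_r.
  have := sW (lshift m i) s; rewrite nbar_l => ->.
  have s0' : 0 <= ntau (lshift m i) - s by rewrite subr_ge0 -tr.
  have st' : ntau (lshift m i) - s <= ntau (lshift m i) by rewrite gerBl.
  rewrite (al i _ s0' st') mulrBr tl divff//.
  move: h; rewrite /onI.
  have -> : (0 <= 1 - c i * s) && (1 - c i * s <= 1) by rewrite -npt_r npt_in// s0.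
  by rewrite !mulr1.
- apply: endpointP => i.
    rewrite nkap_l dl; congr (_ * _); rewrite E0; congr (_ + _); apply: eq_bigr => j _; by rewrite ?bl ?br.
  rewrite nkap_r dr; congr (- (_ * _)); rewrite E1; congr (_ + _); apply: eq_bigr => j _; by rewrite ?bl ?br.
- exact: bb.
- exact: dd.
Qed.

End Primitives.

End StrongForm.

(** * Comparison with the operator on its domain *)

Section Operator.
Variables (R : realType) (m : nat) (sigma : 'I_m -> R).
Hypothesis sigma_gt0 : forall i, 0 < sigma i.
Variables (K00 K01 K10 K11 : 'M[R]_m).
Local Notation C := R[i].
Local Notation re := (@complex.Re R).
Local Notation im := (@complex.Im R).
Local Notation mu := (@lebesgue_measure R).
Local Notation X := (L1vec R m).
Local Notation I := (@unitI R).
Implicit Types (a b h : R -> R) (u v f : X) (i j : 'I_m) (x : R).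

Lemma onI_ae a b : (\forall x \ae mu, I x -> a x = b x) <-> aeq (onI a) (onI b).
Proof.
split; apply: filterS => x H.
  rewrite /onI; case: (boolP (_ && _)) => [x01|_]; last by rewrite !mulr0.
  by rewrite H//; apply/unitIE.
by move=> /unitIE Ix; move: H; rewrite /onI Ix !mulr1.
Qed.

Lemma onI_in a x : 0 <= x -> x <= 1 -> onI a x = a x.
Proof. by move=> x0 x1; rewrite /onI x0 x1 mulr1. Qed.

Lemma ig_onI_prim (c : R) h : ig h -> ig (onI (fun x => c + prim h x)).
Proof.
move=> hi; have i0 : ig (fun x : R => ((0 <= x) && (x <= 1))%R%:R : R).
  have := @ig_continuous R (fun=> 1) 0 1 (@cst_continuous _ _ _).
  by apply: ig_ext => x; rewrite mul1r.
apply: (ig_dom _ _ (igZ (`|c| + wnorm 0 h) i0)).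
  apply: mfM; last exact: ig_mf i0.
  by apply: mfD; [exact: mf_cst|exact: wi_mf (wi_prim (lexx 0) ltr01 (wi0 hi))].
move=> x; rewrite /onI normrM [`|_%:R|]ger0_norm// ler_wpM2r//.
apply: le_trans (ler_normD _ _) _; rewrite lerD2l.
apply: le_trans (prim_bound x (lexx 0) (wi0 hi)) _.
by rewrite /ew oppr0 mul0r oppr0 expR0 mul1r.
Qed.

Lemma prim_onI_prim (q : R) h x : ig h -> 0 <= x -> x <= 1 ->
  prim (onI (fun y => q + prim h y)) x = q * x + prim (prim h) x.
Proof.
move=> hi x0 x1; have Pi := wi_prim (lexx 0) ltr01 (wi0 hi).
transitivity (prim (fun y => q + prim h y) x).
  by apply: (prim_local x0 x1) => r r0 r1; rewrite onI_in.
by rewrite (primD x ler01 (wi_cst q ltr01) Pi) prim_cst.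
Qed.

Lemma wderiv2_prim a a' a'' : ig (onI a) -> ig (onI a') -> ig (onI a'') ->
  wderiv a a' -> wderiv a' a'' -> exists p q,
  aeq (onI a) (onI (fun x => p + q * x + prim (prim (onI a'')) x)) /\
  aeq (onI a') (onI (fun x => q + prim (onI a'') x)).
Proof.
move=> i0 i1 i2 w1 w2; have [p pP] := prim_wderiv i0 i1 w1.
have [q qP] := prim_wderiv i1 i2 w2; exists p, q; split => //.
have E : prim (onI a') = prim (onI (fun x => q + prim (onI a'') x)).
  by apply: prim_aeq_fun qP; [exact: ig_mf|exact: ig_mf (ig_onI_prim q i2)].
apply: filterS pP => x ->; rewrite /onI; case: (boolP (_ && _)) => [/andP[x0 x1]|_]; last by rewrite !mulr0.
by rewrite E (prim_onI_prim q i2 x0 x1) addrA.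
Qed.

Lemma prim2_wderiv a a' a'' p q : ig (onI a) -> ig (onI a') -> ig (onI a'') ->
  aeq (onI a) (onI (fun x => p + q * x + prim (prim (onI a'')) x)) ->
  aeq (onI a') (onI (fun x => q + prim (onI a'') x)) ->
  wderiv a a' /\ wderiv a' a''.
Proof.
move=> i0 i1 i2 h0 h1; split; last exact: wderiv_prim i1 i2 h1.
apply: (wderiv_prim (c := p) i0 i1).
have E : prim (onI a') = prim (onI (fun x => q + prim (onI a'') x)).
  by apply: prim_aeq_fun h1; [exact: ig_mf|exact: ig_mf (ig_onI_prim q i2)].
apply: filterS h0 => x ->; rewrite /onI; case: (boolP (_ && _)) => [/andP[x0 x1]|_]; last by rewrite !mulr0.
by rewrite E (prim_onI_prim q i2 x0 x1) addrA.
Qed.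

Local Notation part p u := (fun i x => p (repr (u i) x)).

Lemma part_ig u i : ig (onI (part re u i)) /\ ig (onI (part im u i)).
Proof. exact: (cintegrable_onI _).1 (repr_cintegrable (u i)). Qed.

Lemma diagD_ae u i : \forall x \ae mu, I x ->
  repr (diagD sigma u i) x = (sigma i)%:C * repr (u i) x.
Proof.
have -> : diagD sigma u i = (sigma i)%:C *: u i + 0 *: u i.
  by rewrite /diagD /L1vec_comp ffunE scale0r addr0.
by apply: filterS (L1_repr_lin (sigma i)%:C 0 (u i) (u i)) => x h Ix; rewrite h// mul0r addr0.
Qed.

Lemma diagD_part u i :
  aeq (onI (fun x => (sigma i)^-1 * re (repr (diagD sigma u i) x))) (onI (part re u i)) /\
  aeq (onI (fun x => (sigma i)^-1 * im (repr (diagD sigma u i) x))) (onI (part im u i)).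
Proof.
have sn : sigma i != 0 by rewrite gt_eqF.
split; apply/onI_ae; apply: filterS (diagD_ae u i) => x h Ix; rewrite (h Ix).
  by rewrite reM /= mul0r subr0 mulrA mulVf// mul1r.
by rewrite imM /= mul0r addr0 mulrA mulVf// mul1r.
Qed.

Lemma sum_real_re (k : 'I_m -> R) (z : 'I_m -> C) :
  re (\sum_j (k j)%:C * z j) = \sum_j k j * re (z j).
Proof.
rewrite (big_morph re (id1 := 0) (op1 := +%R)) //; last by move=> x y; exact: reD.
by apply: eq_bigr => j _; rewrite reM /= mul0r subr0.
Qed.

Lemma sum_real_im (k : 'I_m -> R) (z : 'I_m -> C) :
  im (\sum_j (k j)%:C * z j) = \sum_j k j * im (z j).
Proof.
rewrite (big_morph im (id1 := 0) (op1 := +%R)) //; last by move=> x y; exact: imD.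
by apply: eq_bigr => j _; rewrite imM /= mul0r addr0.
Qed.

Lemma complex_mxE (K : 'M[R]_m) (z : 'cV[C]_m) i :
  (complex_mx K *m z) i 0 = \sum_j (K i j)%:C * z j 0.
Proof. by rewrite mxE; apply: eq_bigr => j _; rewrite mxE. Qed.

Lemma I01 : I 0 /\ I 1.
Proof. by split; apply/unitIE; rewrite ?lexx ler01. Qed.

Lemma prim2_within (p q : R) h : ig h ->
  {within I, continuous (fun x => p + q * x + prim (prim h) x)}.
Proof.
move=> hi; apply: within_affine.
have Hi : ig (onI (fun x => 0 + prim h x)) := ig_onI_prim 0 hi.
apply: subspace_eq_continuous (prim_within Hi) => x; rewrite inE => /unitIE/andP[x0 x1].
by apply: (etrans (prim_onI_prim 0 hi x0 x1)); rewrite mul0r add0r.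
Qed.

Lemma prim1_within (q : R) h : ig h -> {within I, continuous (fun x => q + prim h x)}.
Proof.
move=> hi; have := within_affine (a := q) (b := 0) (prim_within hi).
apply: subspace_eq_continuous => x _.
by apply: (congr1 (fun y => y + prim h x)); rewrite mul0r addr0.
Qed.

(** The weak derivatives provide the constants for each part of each component; [trace_unique]
    identifies the traces in the boundary condition with the resulting formulas at 0 and 1. *)
Lemma A0_strong u f : A0_Phi sigma K00 K01 K10 K11 (u, f) ->
  strong sigma K00 K01 K10 K11 (part re u) (part re f) /\
  strong sigma K00 K01 K10 K11 (part im u) (part im f).
Proof.
move=> [u' [u'' [[w1 w2] [u0 [u1 [du0 [du1 [tu0 tu1 tdu0 tdu1 bc]]]]]] /= fE]].
have H i : exists pq : (R * R) * (R * R), [/\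
    aeq (onI (part re u i)) (onI (fun x => pq.1.1 + pq.1.2 * x + prim (prim (onI (part re u'' i))) x)),
    aeq (onI (part im u i)) (onI (fun x => pq.2.1 + pq.2.2 * x + prim (prim (onI (part im u'' i))) x)),
    aeq (onI (part re u' i)) (onI (fun x => pq.1.2 + prim (onI (part re u'' i)) x)) &
    aeq (onI (part im u' i)) (onI (fun x => pq.2.2 + prim (onI (part im u'' i)) x))].
  have [w1r w1i] := (wderiv_complex _ _).1 (w1 i); have [w2r w2i] := (wderiv_complex _ _).1 (w2 i).
  have [r0 m0] := part_ig u i; have [r1 m1] := part_ig u' i; have [r2 m2] := part_ig u'' i.
  have [p [q [e1 e2]]] := wderiv2_prim r0 r1 r2 w1r w2r.
  have [p' [q' [e3 e4]]] := wderiv2_prim m0 m1 m2 w1i w2i.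
  exists ((p, q), (p', q')); split; [exact: e1|exact: e3|exact: e2|exact: e4].
have [pq pqP] := choice H.
have D i := diagD_part u'' i.
have [I0 I1] := I01.
have Fr i : pr1 sigma (part re f) i = prim (onI (part re u'' i)).
  apply: prim_aeq_fun (ig_mf (part_ig u'' i).1) _; last by rewrite fE; exact: (D i).1.
  have := igZ (sigma i)^-1 (part_ig f i).1 => /ig_mf; congr mf.
  by apply/funext => x; rewrite /onI mulrA.
have Fi i : pr1 sigma (part im f) i = prim (onI (part im u'' i)).
  apply: prim_aeq_fun (ig_mf (part_ig u'' i).2) _; last by rewrite fE; exact: (D i).2.
  have := igZ (sigma i)^-1 (part_ig f i).2 => /ig_mf; congr mf.
  by apply/funext => x; rewrite /onI mulrA.
have tr i x : I x -> trace (u i) x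
    (((pq i).1.1 + (pq i).1.2 * x + pr2 sigma (part re f) i x) +i*
     ((pq i).2.1 + (pq i).2.2 * x + pr2 sigma (part im f) i x)).
  move=> Ix; rewrite /pr2 Fr Fi; have [e1 e2 _ _] := pqP i.
  apply: (trace_of (gr := fun x => _) (gi := fun x => _) Ix).
  - exact: prim2_within (part_ig u'' i).1.
  - exact: prim2_within (part_ig u'' i).2.
  by apply: filterS2 ((onI_ae _ _).2 e1) ((onI_ae _ _).2 e2) => y h1 h2 Iy; apply: complexP; [exact: h1|exact: h2].
have tr' i x : I x -> trace (u' i) x
    (((pq i).1.2 + pr1 sigma (part re f) i x) +i* ((pq i).2.2 + pr1 sigma (part im f) i x)).
  move=> Ix; rewrite Fr Fi; have [_ _ e1 e2] := pqP i.
  apply: (trace_of (gr := fun x => _) (gi := fun x => _) Ix).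
  - exact: prim1_within (part_ig u'' i).1.
  - exact: prim1_within (part_ig u'' i).2.
  by apply: filterS2 ((onI_ae _ _).2 e1) ((onI_ae _ _).2 e2) => y h1 h2 Iy; apply: complexP; [exact: h1|exact: h2].
have z0 : ((0 : R) == 0) || ((0 : R) == 1) by rewrite eqxx.
have z1 : ((1 : R) == 0) || ((1 : R) == 1) by rewrite eqxx orbT.
have u0E i := trace_unique z0 (tu0 i) (tr i 0 I0).
have u1E i := trace_unique z1 (tu1 i) (tr i 1 I1).
have d0E i := trace_unique z0 (tdu0 i) (tr' i 0 I0).
have d1E i := trace_unique z1 (tdu1 i) (tr' i 1 I1).
have [b0 b1] : du0 = complex_mx K00 *m u0 + complex_mx K01 *m u1 /\
    du1 = complex_mx K10 *m u0 + complex_mx K11 *m u1 by case: bc.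
have B0 i : du0 i 0 = \sum_j (K00 i j)%:C * u0 j 0 + \sum_j (K01 i j)%:C * u1 j 0.
  by rewrite b0 mxE !complex_mxE.
have B1 i : du1 i 0 = \sum_j (K10 i j)%:C * u0 j 0 + \sum_j (K11 i j)%:C * u1 j 0.
  by rewrite b1 mxE !complex_mxE.
split.
- exists (fun i => (pq i).1.1), (fun i => (pq i).1.2); split => i.
  + by have [e1 _ _ _] := pqP i; rewrite /pr2 Fr.
  + have := congr1 re (B0 i); rewrite reD !sum_real_re d0E /= /pr1 prim0 addr0 => ->.
    by congr (_ + _); apply: eq_bigr => j _; rewrite ?u0E ?u1E /= ?mulr1// mulr0 addr0 /pr2 prim0 addr0.
  + have := congr1 re (B1 i); rewrite reD !sum_real_re d1E /= => ->.
    by congr (_ + _); apply: eq_bigr => j _; rewrite ?u0E ?u1E /= ?mulr1// mulr0 addr0 /pr2 prim0 addr0.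
- exists (fun i => (pq i).2.1), (fun i => (pq i).2.2); split => i.
  + by have [_ e1 _ _] := pqP i; rewrite /pr2 Fi.
  + have := congr1 im (B0 i); rewrite imD !sum_real_im d0E /= /pr1 prim0 addr0 => ->.
    by congr (_ + _); apply: eq_bigr => j _; rewrite ?u0E ?u1E /= ?mulr1// mulr0 addr0 /pr2 prim0 addr0.
  + have := congr1 im (B1 i); rewrite imD !sum_real_im d1E /= => ->.
    by congr (_ + _); apply: eq_bigr => j _; rewrite ?u0E ?u1E /= ?mulr1// mulr0 addr0 /pr2 prim0 addr0.
Qed.

(** The derivatives are supplied explicitly: [u''] is [f] divided by [sigma], and [u'] is the class
    of [g1], the primitive of [u''] whose value at 0 has parts [q] and [q']. *)
Lemma strong_A0 u f :
  strong sigma K00 K01 K10 K11 (part re u) (part re f) ->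
  strong sigma K00 K01 K10 K11 (part im u) (part im f) ->
  A0_Phi sigma K00 K01 K10 K11 (u, f).
Proof.
move=> [p [q [e1 e2 e3]]] [p' [q' [e1' e2' e3']]].
pose W := pr1 sigma (part re f); pose W' := pr1 sigma (part im f).
have sn i : sigma i != 0 by rewrite gt_eqF.
have gi i : ig (onI (fun x => (sigma i)^-1 * re (repr (f i) x))).
  by have := igZ (sigma i)^-1 (part_ig f i).1; apply: ig_ext => x; rewrite /onI mulrA.
have gi' i : ig (onI (fun x => (sigma i)^-1 * im (repr (f i) x))).
  by have := igZ (sigma i)^-1 (part_ig f i).2; apply: ig_ext => x; rewrite /onI mulrA.
pose u'' : X := [ffun i => (sigma i)^-1%:C *: f i].
pose g1 i x : C := (q i + W i x) +i* (q' i + W' i x).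
have g1i i : cintegrable (g1 i).
  apply/cintegrable_onI; split.
    exact: ig_onI_prim (gi i).
  exact: ig_onI_prim (gi' i).
pose u' : X := [ffun i => toL1 (g1 i)].
have fE : f = diagD sigma u''.
  apply/ffunP => i; rewrite /diagD !ffunE /L1vec_comp ffunE scalerA -rmorphM divff//.
  by rewrite scale1r.
have [Dr Di] : (forall i, aeq (onI (fun x => (sigma i)^-1 * re (repr (f i) x))) (onI (part re u'' i))) /\
    (forall i, aeq (onI (fun x => (sigma i)^-1 * im (repr (f i) x))) (onI (part im u'' i))).
  by split => i; rewrite fE; have [] := diagD_part u'' i.
have Wr i : W i = prim (onI (part re u'' i)).
  by apply: prim_aeq_fun (Dr i); [exact: ig_mf|exact: ig_mf (part_ig u'' i).1].
have Wi i : W' i = prim (onI (part im u'' i)).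
  by apply: prim_aeq_fun (Di i); [exact: ig_mf|exact: ig_mf (part_ig u'' i).2].
have u'r i : aeq (onI (part re u' i)) (onI (fun x => q i + W i x)).
  apply/onI_ae; have := repr_toL1 (g1i i); apply: filterS => x h Ix.
  by rewrite /u' /L1vec_comp ffunE h.
have u'i i : aeq (onI (part im u' i)) (onI (fun x => q' i + W' i x)).
  apply/onI_ae; have := repr_toL1 (g1i i); apply: filterS => x h Ix.
  by rewrite /u' /L1vec_comp ffunE h.
have E1 i : aeq (onI (part re u i)) (onI (fun x => p i + q i * x + prim (prim (onI (part re u'' i))) x)).
  by rewrite -Wr; exact: e1.
have E1' i : aeq (onI (part im u i)) (onI (fun x => p' i + q' i * x + prim (prim (onI (part im u'' i))) x)).
  by rewrite -Wi; exact: e1'.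
have E2 i : aeq (onI (part re u' i)) (onI (fun x => q i + prim (onI (part re u'' i)) x)).
  by rewrite -Wr; exact: u'r.
have E2' i : aeq (onI (part im u' i)) (onI (fun x => q' i + prim (onI (part im u'' i)) x)).
  by rewrite -Wi; exact: u'i.
have wr i := prim2_wderiv (part_ig u i).1 (part_ig u' i).1 (part_ig u'' i).1 (E1 i) (E2 i).
have wi i := prim2_wderiv (part_ig u i).2 (part_ig u' i).2 (part_ig u'' i).2 (E1' i) (E2' i).
have [I0 I1] := I01.
have tr i x : I x -> trace (u i) x
    ((p i + q i * x + pr2 sigma (part re f) i x) +i* (p' i + q' i * x + pr2 sigma (part im f) i x)).
  move=> Ix; rewrite /pr2 -/(W i) -/(W' i) Wr Wi.
  apply: (trace_of (gr := fun x => _) (gi := fun x => _) Ix).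
  - exact: prim2_within (part_ig u'' i).1.
  - exact: prim2_within (part_ig u'' i).2.
  by apply: filterS2 ((onI_ae _ _).2 (E1 i)) ((onI_ae _ _).2 (E1' i)) => y h1 h2 Iy;
    apply: complexP; [exact: h1|exact: h2].
have tr' i x : I x -> trace (u' i) x ((q i + W i x) +i* (q' i + W' i x)).
  move=> Ix; rewrite Wr Wi.
  apply: (trace_of (gr := fun x => _) (gi := fun x => _) Ix).
  - exact: prim1_within (part_ig u'' i).1.
  - exact: prim1_within (part_ig u'' i).2.
  by apply: filterS2 ((onI_ae _ _).2 (E2 i)) ((onI_ae _ _).2 (E2' i)) => y h1 h2 Iy;
    apply: complexP; [exact: h1|exact: h2].
exists u', u''; split; last exact: fE.
  by split => i; apply/wderiv_complex; split; [exact: (wr i).1|exact: (wi i).1|exact: (wr i).2|exact: (wi i).2].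
pose v0 : 'cV[C]_m := \col_i (p i +i* p' i).
pose v1 : 'cV[C]_m := \col_i ((p i + q i + pr2 sigma (part re f) i 1) +i*
  (p' i + q' i + pr2 sigma (part im f) i 1)).
pose dv0 : 'cV[C]_m := \col_i (q i +i* q' i).
pose dv1 : 'cV[C]_m := \col_i ((q i + W i 1) +i* (q' i + W' i 1)).
exists v0, v1, dv0, dv1; split.
- move=> i; have := tr i 0 I0; rewrite /v0 mxE !mulr0 !addr0 /pr2 !prim0 !addr0; exact.
- by move=> i; have := tr i 1 I1; rewrite /v1 mxE !mulr1.
- by move=> i; have := tr' i 0 I0; rewrite /dv0 mxE /W /W' /pr1 !prim0 !addr0.
- by move=> i; have := tr' i 1 I1; rewrite /dv1 mxE.
rewrite /Phi; congr pair; apply/matrixP => i j; rewrite ord1 [RHS]mxE !complex_mxE !mxE.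
  apply: complexP; rewrite ?reD ?imD ?sum_real_re ?sum_real_im /=.
    by rewrite e2; congr (_ + _); apply: eq_bigr => k _; rewrite mxE.
  by rewrite e2'; congr (_ + _); apply: eq_bigr => k _; rewrite mxE.
apply: complexP; rewrite ?reD ?imD ?sum_real_re ?sum_real_im /=.
  by rewrite e3; congr (_ + _); apply: eq_bigr => k _; rewrite mxE.
by rewrite e3'; congr (_ + _); apply: eq_bigr => k _; rewrite mxE.
Qed.

End Operator.

Local Close Scope complex_scope.
Local Close Scope quotient_scope.

Theorem theorem2p4 (R : realType) (m : nat) (sigma : 'I_m -> R)
    (sigma_gt0 : forall i, 0 < sigma i) (K00 K01 K10 K11 : 'M[R]_m) :
  generates_analytic_semigroup (A0_Phi sigma K00 K01 K10 K11).
Proof.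
exists (pi / 4), (heat_op sigma_gt0 K00 K01 K10 K11).
have p0 := pi_gt0 R; split; [lra|lra|exact: heat_analytic|].
apply/seteqP; split=> -[u f] /=.
- move=> /heat_generator_nsol[h1 h2]; apply: (strong_A0 sigma_gt0).
  + exact: (nsol_strong sigma_gt0 (fun i => (part_ig f i).1) h1).
  + exact: (nsol_strong sigma_gt0 (fun i => (part_ig f i).2) h2).
- move=> /(A0_strong sigma_gt0)[h1 h2]; apply/heat_generator_nsol; split.
  + exact: (strong_nsol sigma_gt0 (fun i => (part_ig f i).1) h1).
  + exact: (strong_nsol sigma_gt0 (fun i => (part_ig f i).2) h2).
Qed.
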